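(* The following problem is ExpTime-complete: given an $\mathcal{ALC}$ TBox $\mathcal{T}_1$, a Horn-$\mathcal{ALC}$ TBox $\mathcal{T}_2$ and signatures $\Sigma_1,\Sigma_2$, decide whether $\mathcal{T}_1$ $(\Sigma_1,\Sigma_2)$-rCQ entails $\mathcal{T}_2$.
   Context: $\mathcal{ALC}$ TBoxes are finite sets of inclusions $C\sqsubseteq D$ between $\mathcal{ALC}$ concepts (built from concept names, $\top$, $\neg$, $\sqcap$, $\exists R.C$); a TBox is Horn-$\mathcal{ALC}$ if no $\neg C$ occurs negatively and no $\exists R.\neg C$ occurs positively. An ABox is a finite set of assertions $A(a)$, $R(a,b)$; a $\Sigma_1$-ABox uses only names in $\Sigma_1$. Interpretations satisfy $a^{\mathcal{I}}=a$. A CQ $\exists\vec y\,\varphi(\vec x,\vec y)$ is a conjunction of atoms $A(z)$, $R(z,z')$; it is rooted (rCQ) if every quantified variable is connected, in the undirected graph with edges $\{u,v\}$ for atoms $R(u,v)$, to some answer variable. $(\mathcal{T},\mathcal{A})\models q(\vec a)$ means all models satisfy $q(\vec a)$. $\mathcal{T}_1$ $(\Sigma_1,\Sigma_2)$-rCQ entails $\mathcal{T}_2$ if for every $\Sigma_1$-ABox $\mathcal{A}$ consistent with both $\mathcal{T}_1$ and $\mathcal{T}_2$, every rCQ $q(\vec x)$ over names in $\Sigma_2$ and every tuple $\vec a$ from $\mathsf{ind}(\mathcal{A})$, $(\mathcal{T}_2,\mathcal{A})\models q(\vec a)$ implies $(\mathcal{T}_1,\mathcal{A})\models q(\vec a)$.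 *)

(* Defs.v *)
From mathcomp Require Import all_boot.
From Stdlib Require List.

Set Implicit Arguments.
Unset Strict Implicit.
Unset Printing Implicit Defensive.

(** * Syntax of ALC *)

(* Concept, role and individual names are finite binary words, so that a name
   is its own representation as part of the input of a Turing machine. *)
Definition name := seq bool.

Inductive concept :=
| CName of name
| CTop
| CNot of concept
| CAnd of concept & concept
| CEx of name & concept.

Record inclusion := Incl { lhs : concept; rhs : concept }.

Definition tbox := seq inclusion.

(* (concept names, role names) *)
Definition signature := (seq name * seq name)%type.

Inductive assertion :=
| AConcept of name & name
| ARole of name & name & name.

Definition abox := seq assertion.

Definition ind_assertion (x : assertion) : seq name :=
  match x with AConcept _ a => [:: a] | ARole _ a b => [:: a; b] end.

Definition ind (A : abox) : seq name := flatten (map ind_assertion A).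

Definition assertion_over (S : signature) (x : assertion) : bool :=
  match x with AConcept A _ => A \in S.1 | ARole R _ _ => R \in S.2 end.

Definition abox_over (S : signature) (A : abox) : bool :=
  all (assertion_over S) A.

(** * Polarity and Horn-ALC *)

(* [occurs s D C]: the concept [D] occurs in [C], positively if [s = true] and
   negatively if [s = false]. *)
Fixpoint occurs (s : bool) (D C : concept) : Prop :=
  (s = true /\ D = C) \/
  match C with
  | CName _ | CTop => False
  | CNot C1 => occurs (~~ s) D C1
  | CAnd C1 C2 => occurs s D C1 \/ occurs s D C2
  | CEx _ C1 => occurs s D C1
  end.

Definition occurs_in_tbox (s : bool) (D : concept) (T : tbox) : Prop :=
  exists2 i : inclusion, List.In i T &
    occurs (~~ s) D (lhs i) \/ occurs s D (rhs i).

Definition horn (T : tbox) : Prop :=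
  (forall C, ~ occurs_in_tbox false (CNot C) T) /\
  (forall R C, ~ occurs_in_tbox true (CEx R (CNot C)) T).

(** * Semantics *)

(* Interpretations satisfy a^I = a: the individual names are themselves
   elements of the domain, which is their disjoint union with an arbitrary
   type of anonymous elements. *)
Record interp := Interp {
  anon : Type;
  conc_int : name -> name + anon -> Prop;
  role_int : name -> name + anon -> name + anon -> Prop
}.

Definition dom (I : interp) : Type := (name + anon I)%type.

Definition indiv (I : interp) (a : name) : dom I := inl a.

Fixpoint ext (I : interp) (C : concept) (d : dom I) : Prop :=
  match C with
  | CName A => conc_int A d
  | CTop => True
  | CNot C1 => ~ ext C1 d
  | CAnd C1 C2 => ext C1 d /\ ext C2 d
  | CEx R C1 => exists2 e : dom I, role_int R d e & ext C1 e
  end.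

Definition sat_inclusion (I : interp) (i : inclusion) : Prop :=
  forall d : dom I, ext (lhs i) d -> ext (rhs i) d.

Definition sat_assertion (I : interp) (x : assertion) : Prop :=
  match x with
  | AConcept A a => conc_int A (indiv I a)
  | ARole R a b => role_int R (indiv I a) (indiv I b)
  end.

Definition model (T : tbox) (A : abox) (I : interp) : Prop :=
  (forall i, List.In i T -> sat_inclusion I i) /\
  (forall x, List.In x A -> sat_assertion I x).

Definition consistent (T : tbox) (A : abox) : Prop := exists I, model T A I.

(** * Conjunctive queries *)

Definition var := nat.

Inductive atom :=
| QConcept of name & var
| QRole of name & var & var.

Definition atom_vars (t : atom) : seq var :=
  match t with QConcept _ z => [:: z] | QRole _ z z' => [:: z; z'] end.

Definition atom_over (S : signature) (t : atom) : bool :=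
  match t with QConcept A _ => A \in S.1 | QRole R _ _ => R \in S.2 end.

Record query := Query {
  answer_vars : seq var;
  quant_vars : seq var;
  atoms : seq atom
}.

Definition is_CQ (q : query) : bool :=
  uniq (answer_vars q ++ quant_vars q) &&
  all (fun t => all (mem (answer_vars q ++ quant_vars q)) (atom_vars t))
      (atoms q).

Definition query_over (S : signature) (q : query) : bool :=
  all (atom_over S) (atoms q).

Definition query_edge (q : query) : rel var := fun u v =>
  has (fun t => match t with
                | QConcept _ _ => false
                | QRole _ z z' => ((u, v) == (z, z')) || ((u, v) == (z', z))
                end) (atoms q).

Definition rooted (q : query) : Prop :=
  forall y, y \in quant_vars q ->
  exists x, exists p,
    [/\ x \in answer_vars q, path (query_edge q) x p & last x p = y].

Definition is_rCQ (q : query) : Prop := is_CQ q /\ rooted q.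

Definition sat_atom (I : interp) (h : var -> dom I) (t : atom) : Prop :=
  match t with
  | QConcept A z => conc_int A (h z)
  | QRole R z z' => role_int R (h z) (h z')
  end.

Definition sat_query (I : interp) (q : query) (a : seq name) : Prop :=
  exists h : var -> dom I,
    map h (answer_vars q) = map (indiv I) a /\
    (forall t, List.In t (atoms q) -> sat_atom h t).

Definition certain_answer (T : tbox) (A : abox) (q : query) (a : seq name) :=
  forall I, model T A I -> sat_query I q a.

Definition rCQ_entails (S1 S2 : signature) (T1 T2 : tbox) : Prop :=
  forall A : abox, abox_over S1 A -> consistent T1 A -> consistent T2 A ->
  forall q : query, is_rCQ q -> query_over S2 q ->
  forall a : seq name,
    size a = size (answer_vars q) -> {subset a <= ind A} ->
    certain_answer T2 A q a -> certain_answer T1 A q a.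

(** * Binary encoding of problem instances *)

Definition enc_seq (X : Type) (e : X -> seq bool) (s : seq X) : seq bool :=
  foldr (fun x w => true :: e x ++ w) [:: false] s.

Definition enc_name : name -> seq bool := enc_seq (fun b => [:: b]).

Fixpoint enc_concept (C : concept) : seq bool :=
  match C with
  | CName A => [:: false; false] ++ enc_name A
  | CTop => [:: false; true; false]
  | CNot C1 => [:: false; true; true] ++ enc_concept C1
  | CAnd C1 C2 => [:: true; false] ++ enc_concept C1 ++ enc_concept C2
  | CEx R C1 => [:: true; true] ++ enc_name R ++ enc_concept C1
  end.

Definition enc_inclusion (i : inclusion) : seq bool :=
  enc_concept (lhs i) ++ enc_concept (rhs i).

Definition enc_tbox : tbox -> seq bool := enc_seq enc_inclusion.

Definition enc_signature (S : signature) : seq bool :=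
  enc_seq enc_name S.1 ++ enc_seq enc_name S.2.

Definition enc_instance (T1 T2 : tbox) (S1 S2 : signature) : seq bool :=
  enc_tbox T1 ++ enc_tbox T2 ++ enc_signature S1 ++ enc_signature S2.

Definition prefix_code (X : Type) (e : X -> seq bool) : Prop :=
  forall x y s t, e x ++ s = e y ++ t -> x = y /\ s = t.

Lemma enc_seq_prefix (X : Type) (e : X -> seq bool) :
  prefix_code e -> prefix_code (enc_seq e).
Proof.
move=> pe; elim=> [|x xs IH] [|y ys] s t //=; first by case.
case; rewrite -!catA => /pe[-> /IH[-> ->]]; by [].
Qed.

Lemma enc_name_prefix : prefix_code enc_name.
Proof. by apply: enc_seq_prefix => x y s t [-> ->]. Qed.

Lemma enc_concept_prefix : prefix_code enc_concept.
Proof.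
elim=> [A||C IH|C IHC D IHD|R C IH] [B||C'|C' D'|R' C'] s t //=; case;
  rewrite -?catA.
- by move=> /enc_name_prefix[-> ->].
- by move=> ->.
- by move=> /IH[-> ->].
- by move=> /IHC[-> /IHD[-> ->]].
- by move=> /enc_name_prefix[-> /IH[-> ->]].
Qed.

Lemma enc_tbox_prefix : prefix_code enc_tbox.
Proof.
apply: enc_seq_prefix => -[C D] [C' D'] s t; rewrite /enc_inclusion /= -!catA.
by move=> /enc_concept_prefix[-> /enc_concept_prefix[-> ->]].
Qed.

Lemma enc_signature_prefix : prefix_code enc_signature.
Proof.
move=> [A R] [A' R'] s t; rewrite /enc_signature /= -!catA.
have pn := enc_seq_prefix enc_name_prefix.
by move=> /pn[-> /pn[-> ->]].
Qed.

Lemma enc_instance_inj T1 T2 S1 S2 T1' T2' S1' S2' :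
  enc_instance T1 T2 S1 S2 = enc_instance T1' T2' S1' S2' ->
  [/\ T1 = T1', T2 = T2', S1 = S1' & S2 = S2'].
Proof.
move=> /enc_tbox_prefix[-> /enc_tbox_prefix[-> /enc_signature_prefix[->]]].
rewrite -[enc_signature S2]cats0 -[enc_signature S2']cats0.
by move=> /enc_signature_prefix[->].
Qed.

(** * Deterministic multi-tape Turing machines *)

(* Tape symbols: [None] is the blank, [Some (inl b)] an input/output bit and
   [Some (inr g)] an auxiliary work symbol. *)
Definition symbol (G : finType) : finType := option (bool + G)%type.

Definition bit (G : finType) (b : bool) : symbol G := Some (inl b).

Inductive move := MoveLeft | MoveStay | MoveRight.

(* A tape is infinite in both directions.  [tape_right] starts with the scanned
   cell, [tape_left] lists the cells to its left, nearest first; all the cells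
   that are not listed are blank. *)
Record tape (G : finType) := Tape {
  tape_left : seq (symbol G);
  tape_right : seq (symbol G)
}.

Definition scan (G : finType) (t : tape G) : symbol G :=
  head None (tape_right t).

Definition tape_write (G : finType) (c : symbol G) (t : tape G) : tape G :=
  Tape (tape_left t) (c :: behead (tape_right t)).

Definition tape_move (G : finType) (m : move) (t : tape G) : tape G :=
  match m with
  | MoveLeft => Tape (behead (tape_left t))
                     (head None (tape_left t) :: tape_right t)
  | MoveStay => t
  | MoveRight => Tape (scan t :: tape_left t) (behead (tape_right t))
  end.

Record machine := Machine {
  extra_tapes : nat;
  work : finType;
  state : finType;
  start : state;
  halting : pred state;
  accepting : pred state;
  delta : state -> {ffun 'I_extra_tapes.+1 -> symbol work} ->
          state * ('I_extra_tapes.+1 -> symbol work * move)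
}.

Record config (M : machine) := Config {
  cstate : state M;
  ctape : 'I_(extra_tapes M).+1 -> tape (work M)
}.

Definition init (M : machine) (w : seq bool) : config M :=
  Config (start M)
    (fun i => Tape [::] (if i == ord0 then map (@bit (work M)) w else [::])).

Definition step (M : machine) (c : config M) : config M :=
  if halting (cstate c) then c else
  let r := delta (cstate c) [ffun i => scan (ctape c i)] in
  Config r.1 (fun i => tape_move (r.2 i).2 (tape_write (r.2 i).1 (ctape c i))).

Definition run (M : machine) (w : seq bool) (n : nat) : config M :=
  iter n (@step M) (init M w).

(* The output word is read on the first tape, from the head rightwards up to
   the first blank. *)
Definition outputs (M : machine) (c : config M) (w : seq bool) : Prop :=
  exists2 r, tape_right (ctape c ord0) = map (@bit (work M)) w ++ r &
             head None r = None.

(** * Complexity classes *)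

Definition language := seq bool -> Prop.

Definition decides_in (M : machine) (L : language) (T : nat -> nat) : Prop :=
  forall w, let c := run M w (T (size w)) in
  halting (cstate c) /\ (accepting (cstate c) <-> L w).

Definition computes_in (M : machine) (f : seq bool -> seq bool)
    (T : nat -> nat) : Prop :=
  forall w, let c := run M w (T (size w)) in
  halting (cstate c) /\ outputs c (f w).

Definition in_ExpTime (L : language) : Prop :=
  exists M k, decides_in M L (fun n => 2 ^ (n ^ k + k)).

Definition polytime (f : seq bool -> seq bool) : Prop :=
  exists M k, computes_in M f (fun n => n ^ k + k).

Definition polytime_reducible (L L' : language) : Prop :=
  exists2 f, polytime f & forall w, L w <-> L' (f w).

Definition ExpTime_hard (L : language) : Prop :=
  forall L', in_ExpTime L' -> polytime_reducible L' L.

Definition ExpTime_complete (L : language) : Prop :=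
  in_ExpTime L /\ ExpTime_hard L.

(* Main.v *)
(* Membership.  A Horn TBox [T2] is an EL TBox with disjointness, so it has a
   canonical model, and if rCQ entailment fails then it fails for a tree-shaped
   query, that is, for a concept of the form "the names entailed up to depth
   [m]", at one individual.  An individual matters only through its [T1]-type
   [t], the set [s] of subconcepts that the ABox forces on it and the set [u]
   whose consequences it has to violate, and the triples [(t, s, u)] realised in
   tree-shaped ABoxes form a least fixed point.  Sets of subconcepts are numbers
   below [2 ^ (n + 2)], subconcepts are positions of the input word, and least
   fixed points of first-order formulas over an exponentially large initial
   segment of the numbers are computable in exponential time.

   Hardness.  Relative to its heads, a Turing machine is a cellular automaton in
   which every cell depends on its neighbours and on cell 0.  The TBox [T1]
   unfolds a root into a tree of pairs (elapsed time, position), held in binary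
   counters, with one branch per cell that the current one depends on; the labels
   of the cells are then forced from the leaves up to the root, where an accepting
   label is contradictory.  Hence [T1] entails "root implies goal" on all ABoxes
   over the signature {root} iff no ABox with a root is consistent iff the machine
   accepts. *)
Require Import Defs.
From mathcomp Require Import all_boot zify.
From Stdlib Require Import FunctionalExtensionality Classical ClassicalEpsilon.

Set Implicit Arguments.
Unset Strict Implicit.
Unset Printing Implicit Defensive.

(** * A structured tape language *)

Definition cell := option (option bool).

Record store := Store { pos : nat -> nat; arr : nat -> nat -> option bool }.

Definition look (s : store) i : cell :=
  if pos s i == 0 then None else Some (arr s i (pos s i)).

Definition goto (s : store) i v : store :=
  Store (fun j => if j == i then v else pos s j) (arr s).

Definition put (s : store) i o : store :=
  Store (pos s)
    (fun j x => if (j == i) && (x == pos s i) then o else arr s j x).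

Inductive cmd :=
| Skip
| Lt of nat
| Rt of nat
| Put of nat & option bool
| Seq of cmd & cmd
| If of nat & pred cell & cmd & cmd
| While of nat & pred cell & cmd.

Inductive exec : cmd -> store -> nat -> store -> Prop :=
| XSkip s : exec Skip s 0 s
| XLt i s : exec (Lt i) s 1 (goto s i (pos s i).-1)
| XRt i s : exec (Rt i) s 1 (goto s i (pos s i).+1)
| XPut i o s : exec (Put i o) s 1 (put s i o)
| XSeq c d s n s1 m s2 :
    exec c s n s1 -> exec d s1 m s2 -> exec (Seq c d) s (n + m) s2
| XIfT i (p : pred cell) c d s n s1 :
    p (look s i) -> exec c s n s1 -> exec (If i p c d) s n.+2 s1
| XIfF i (p : pred cell) c d s n s1 :
    ~~ p (look s i) -> exec d s n s1 -> exec (If i p c d) s n.+1 s1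
| XWhF i (p : pred cell) c s : ~~ p (look s i) -> exec (While i p c) s 1 s
| XWhT i (p : pred cell) c s n s1 m s2 :
    p (look s i) -> exec c s n s1 -> exec (While i p c) s1 m s2 ->
    exec (While i p c) s (n + m).+2 s2.

(* An instruction scans one tape; it rewrites the cell, moves the head of this
   tape and jumps to an absolute address. *)
Definition instr := (nat * (cell -> cell * move * nat))%type.

Fixpoint len (c : cmd) : nat :=
  match c with
  | Skip => 0
  | Lt _ | Rt _ | Put _ _ => 1
  | Seq c d => len c + len d
  | If _ _ c d => len c + len d + 2
  | While _ _ c => len c + 2
  end.

Definition jump a : instr := (0, fun x => (x, MoveStay, a)).

Definition branch i (p : pred cell) a b : instr :=
  (i, fun x => (x, MoveStay, if p x then a else b)).

Fixpoint code (c : cmd) (a : nat) : seq instr :=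
  match c with
  | Skip => [::]
  | Lt i => [:: (i, fun x => (x, if x is None then MoveStay else MoveLeft, a.+1))]
  | Rt i => [:: (i, fun x => (x, MoveRight, a.+1))]
  | Put i o => [:: (i, fun x => (if x is None then None else Some o, MoveStay, a.+1))]
  | Seq c d => code c a ++ code d (a + len c)
  | If i p c d => branch i p a.+1 (a + len c + 2) :: code c a.+1 ++
      jump (a + len c + len d + 2) :: code d (a + len c + 2)
  | While i p c => branch i p a.+1 (a + len c + 2) :: code c a.+1 ++ [:: jump a]
  end.

Fixpoint tapes_below (k : nat) (c : cmd) : bool :=
  match c with
  | Skip => true
  | Lt i | Rt i | Put i _ => i <= k
  | Seq c d => tapes_below k c && tapes_below k d
  | If i _ c d => [&& i <= k, tapes_below k c & tapes_below k d]
  | While i _ c => (i <= k) && tapes_below k c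
  end.

Fixpoint max_tape (c : cmd) : nat :=
  match c with
  | Skip => 0
  | Lt i | Rt i | Put i _ => i
  | Seq c d => maxn (max_tape c) (max_tape d)
  | If i _ c d => maxn i (maxn (max_tape c) (max_tape d))
  | While i _ c => maxn i (max_tape c)
  end.

Lemma tapes_below_max c k : max_tape c <= k -> tapes_below k c.
Proof. by elim: c => //=; lia. Qed.

Lemma size_code c a : size (code c a) = len c.
Proof.
elim: c a => //= [c IHc d IHd|i p c IHc d IHd|i p c IHc] a.
- by rewrite size_cat IHc IHd.
- by rewrite size_cat /= IHc IHd; lia.
- by rewrite size_cat /= IHc; lia.
Qed.

Definition sym := symbol unit.

Definition enc_cell (x : cell) : sym :=
  match x with
  | None => Some (inr tt)
  | Some None => None
  | Some (Some b) => Some (inl b)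
  end.

Arguments enc_cell : simpl never.

Definition dec_cell (x : sym) : cell :=
  match x with
  | None => Some None
  | Some (inl b) => Some (Some b)
  | Some (inr _) => None
  end.

Lemma enc_cellK : cancel enc_cell dec_cell.
Proof. by case=> [[b|]|]. Qed.

Section Machine.
Variables (K : nat) (P : seq instr).

Definition mdelta (q : 'I_(size P).+4) (sc : {ffun 'I_K.+1 -> sym}) :
    'I_(size P).+4 * ('I_K.+1 -> sym * move) :=
  if q == 0 :> nat then (inord 1, fun i => (sc i, MoveLeft))
  else if q == 1 :> nat then (inord 2, fun i => (enc_cell None, MoveStay))
  else let: (i, f) := nth (jump 0) P (q - 2) in
       let: (y, mv, a) := f (dec_cell (sc (inord i))) in
       (inord (a + 2),
        fun j => if j == inord i then (enc_cell y, mv) else (sc j, MoveStay)).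

Definition prog_machine : machine :=
  @Machine K unit ('I_(size P).+4) ord0
    (fun q => size P + 2 <= q) (fun q => q == (size P).+2 :> nat) mdelta.

Definition cell_at (f : nat -> option bool) x : cell :=
  if x == 0 then None else Some (f x).
Arguments cell_at : simpl never.
Arguments cell_at : simpl never.

Definition tape_ok p f (t : tape unit) :=
  (forall j, j < p -> nth None (tape_left t) j = enc_cell (cell_at f (p - j.+1))) /\
  (forall j, nth None (tape_right t) j = enc_cell (cell_at f (p + j))).

Lemma lookE s i : look s i = cell_at (arr s i) (pos s i).
Proof. by []. Qed.

Definition config_ok (s : store) (a : nat) (c : config prog_machine) :=
  cstate c = a + 2 :> nat /\
  forall i : 'I_K.+1, tape_ok (pos s i) (arr s i) (ctape c i).

Lemma tape_ok_scan p f t : tape_ok p f t -> scan t = enc_cell (cell_at f p).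
Proof. by case=> _ /(_ 0); rewrite addn0 => <-; rewrite nth0. Qed.

Lemma tape_ok_write p f o t : tape_ok p f t ->
  tape_ok p (fun x => if x == p then o else f x)
    (tape_write (enc_cell (if cell_at f p is None then None else Some o)) t).
Proof.
case=> Hl Hr; split=> [j jp|[|j]] /=.
- rewrite Hl // /cell_at; case: eqP => // _; case: eqP => //; lia.
- by rewrite addn0 /cell_at eqxx; case: eqP.
- rewrite nth_behead Hr /cell_at; case: eqP => // _; case: eqP => //; lia.
Qed.

Lemma tape_ok_rewrite p f t : tape_ok p f t -> tape_ok p f (tape_write (scan t) t).
Proof.
case=> Hl Hr; split=> [j jp|[|j]] /=; first exact: Hl.
- by rewrite -Hr nth0.
- by rewrite nth_behead Hr.
Qed.

Lemma tape_ok_left p f t : tape_ok p f t -> 0 < p ->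
  tape_ok p.-1 f (tape_move MoveLeft t).
Proof.
case=> Hl Hr p0; split=> [j jp|[|j]] /=.
- rewrite nth_behead Hl; last lia.
  by congr enc_cell; congr (cell_at f); lia.
- by rewrite -nth0 Hl // addn0 subn1.
- by rewrite Hr; congr enc_cell; congr (cell_at f); lia.
Qed.

Lemma tape_ok_right p f t : tape_ok p f t ->
  tape_ok p.+1 f (tape_move MoveRight t).
Proof.
case=> Hl Hr; split=> [[|j] jp|j] /=.
- by rewrite -[scan t]nth0 Hr; congr enc_cell; congr (cell_at f); lia.
- rewrite Hl //; congr enc_cell; congr (cell_at f); lia.
- by rewrite nth_behead Hr; congr enc_cell; congr (cell_at f); lia.
Qed.

Lemma step_instr s a c i f y mv b p' f' :
  config_ok s a c -> a < size P -> b <= (size P).+1 -> i <= K ->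
  nth (jump 0) P a = (i, f) -> f (look s i) = (y, mv, b) ->
  (forall t, tape_ok (pos s i) (arr s i) t ->
     tape_ok p' f' (tape_move mv (tape_write (enc_cell y) t))) ->
  config_ok
    (Store (fun j => if j == i then p' else pos s j)
           (fun j => if j == i then f' else arr s j)) b (step c).
Proof.
move=> [qa Ht] aP bP iK Pa fy Ht'.
rewrite /step /= qa.
have -> : size P + 2 <= a + 2 = false by lia.
rewrite /mdelta qa.
have -> : (a + 2 == 0) = false by lia.
have -> : (a + 2 == 1) = false by lia.
rewrite (_ : a + 2 - 2 = a); last lia.
rewrite Pa ffunE.
have ii : (inord i : 'I_K.+1) = i :> nat by rewrite inordK.
have Hs : scan (ctape c (inord i)) = enc_cell (look s i).
  by rewrite (tape_ok_scan (Ht _)) ii.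
rewrite Hs enc_cellK fy; split=> /= [|j].
  by rewrite inordK //; lia.
have -> : (j == inord i) = (j == i :> nat).
  by apply/eqP/eqP => [->|ji]; [|apply: val_inj; rewrite /= ii].
case: eqP => [ji|_] /=.
  by apply: Ht'; rewrite -ji.
by rewrite ffunE; apply: tape_ok_rewrite.
Qed.

Definition segment a (C : seq instr) :=
  exists l r, P = l ++ C ++ r /\ size l = a.

Lemma segment_nth a C k : segment a C -> k < size C ->
  nth (jump 0) P (a + k) = nth (jump 0) C k /\ a + k < size P.
Proof.
move=> [l [r [-> <-]]] kC; rewrite !size_cat nth_cat ltnNge leq_addr /=.
by rewrite addKn nth_cat kC; split=> //; lia.
Qed.

Lemma segment_catl a C D : segment a (C ++ D) -> segment a C.
Proof. by move=> [l [r [E <-]]]; exists l, (D ++ r); rewrite E -!catA. Qed.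

Lemma segment_catr a C D : segment a (C ++ D) -> segment (a + size C) D.
Proof.
by move=> [l [r [E <-]]]; exists (l ++ C), r; rewrite E size_cat -!catA.
Qed.

Lemma segment_tail a i C : segment a (i :: C) -> segment a.+1 C.
Proof. by rewrite -cat1s => /segment_catr; rewrite addn1. Qed.

Lemma segment_size a C : segment a C -> a + size C <= size P.
Proof. by move=> [l [r [-> <-]]]; rewrite !size_cat; lia. Qed.

Lemma store_ext s s' :
  pos s = pos s' -> arr s = arr s' -> s = s'.
Proof. by case: s => ? ?; case: s' => ? ? /= -> ->. Qed.

Lemma store_upd s i p' f' :
  p' = pos s i -> f' = arr s i ->
  Store (fun j => if j == i then p' else pos s j)
        (fun j => if j == i then f' else arr s j) = s.
Proof.
move=> -> ->; apply: store_ext; apply: functional_extensionality => j /=;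
by case: eqP => // ->.
Qed.

Lemma step_branch s a c i p b d :
  config_ok s a c -> segment a [:: branch i p b d] ->
  b <= (size P).+1 -> d <= (size P).+1 -> i <= K ->
  config_ok s (if p (look s i) then b else d) (step c).
Proof.
move=> H seg bP dP iK.
have [Pa aP] := segment_nth (k := 0) seg isT.
rewrite addn0 in Pa aP.
rewrite -(store_upd (erefl (pos s i)) (erefl (arr s i))).
apply: (step_instr H aP _ iK Pa) => /=; first by case: ifP.
- rewrite store_upd //.
- move=> t Ht; rewrite lookE.
  by rewrite -(tape_ok_scan Ht); apply: tape_ok_rewrite.
Qed.

Lemma step_jump s a c b :
  config_ok s a c -> segment a [:: jump b] -> b <= (size P).+1 ->
  config_ok s b (step c).
Proof.
move=> H seg bP.
have := step_branch (p := predT) H (i := 0) (b := b) (d := b).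
by apply.
Qed.

Lemma code_correct c s n s' : exec c s n s' ->
  forall a cf, segment a (code c a) -> tapes_below K c -> config_ok s a cf ->
  config_ok s' (a + len c) (iter n (@step prog_machine) cf).
Proof.
elim=> {c s n s'} /=.
- by move=> s a cf _ _; rewrite addn0.
- move=> i s a cf seg iK H.
  have [Pa aP] := segment_nth (k := 0) seg isT; rewrite addn0 in Pa aP.
  rewrite addn1.
  have -> : goto s i (pos s i).-1 =
    Store (fun j => if j == i then (pos s i).-1 else pos s j)
          (fun j => if j == i then arr s i else arr s j).
    apply: store_ext => //=; apply: functional_extensionality => j.
    by case: eqP => // ->.
  apply: (step_instr H aP _ iK Pa) => //=; first by lia.
  move=> t Ht; rewrite lookE.
  rewrite -(tape_ok_scan Ht).
  case: (posnP (pos s i)) => p0.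
    by move: Ht; rewrite p0 /cell_at /= => Ht; apply: tape_ok_rewrite.
  rewrite /cell_at gtn_eqF //; apply: tape_ok_left => //; exact: tape_ok_rewrite.
- move=> i s a cf seg iK H.
  have [Pa aP] := segment_nth (k := 0) seg isT; rewrite addn0 in Pa aP.
  rewrite addn1.
  have -> : goto s i (pos s i).+1 =
    Store (fun j => if j == i then (pos s i).+1 else pos s j)
          (fun j => if j == i then arr s i else arr s j).
    apply: store_ext => //=; apply: functional_extensionality => j.
    by case: eqP => // ->.
  apply: (step_instr H aP _ iK Pa) => //=; first by lia.
  move=> t Ht; rewrite lookE.
  rewrite -(tape_ok_scan Ht).
  apply: tape_ok_right => //; exact: tape_ok_rewrite.
- move=> i o s a cf seg iK H.
  have [Pa aP] := segment_nth (k := 0) seg isT; rewrite addn0 in Pa aP.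
  rewrite addn1.
  have -> : put s i o =
    Store (fun j => if j == i then pos s i else pos s j)
          (fun j => if j == i then (fun x => if x == pos s i then o else arr s i x)
                    else arr s j).
    apply: store_ext => //=; apply: functional_extensionality => j.
      by case: eqP => // ->.
    apply: functional_extensionality => x.
    by case: eqP => // ->; case: eqP => // ->.
  apply: (step_instr H aP _ iK Pa) => //=; first by lia.
  by move=> t; rewrite lookE; apply: tape_ok_write.
- move=> c d s n s1 m s2 _ IH1 _ IH2 a cf seg /andP[kc kd] H.
  rewrite [n + m]addnC iterD addnA; apply: IH2 => //.
    by have := segment_catr seg; rewrite size_code.
  by apply: IH1 => //; apply: segment_catl seg.
- move=> i p c d s n s1 pl _ IH a cf seg /and3P[ik kc kd] H.
  have sz := segment_size seg; rewrite /= size_cat /= !size_code in sz.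
  have H1 : config_ok s a.+1 (step cf).
    have := step_branch H (segment_catl (C := [:: _]) seg); rewrite pl.
    by apply=> //; lia.
  have seg1 := segment_tail seg.
  have H2 := IH _ _ (segment_catl seg1) kc H1.
  rewrite -[step (iter n _ cf)]iterS iterSr.
  apply: (step_jump H2); last by lia.
  have := segment_catr seg1; rewrite size_code => seg2.
  have := segment_catl (C := [:: _]) seg2.
  by congr (segment _ [:: jump _]); lia.
- move=> i p c d s n s1 pl _ IH a cf seg /and3P[ik kc kd] H.
  have sz := segment_size seg; rewrite /= size_cat /= !size_code in sz.
  have H1 : config_ok s (a + len c + 2) (step cf).
    have := step_branch H (segment_catl (C := [:: _]) seg); rewrite (negbTE pl).
    by apply=> //; lia.
  have := IH _ _ _ kd H1.
  rewrite -iterS iterSr (_ : a + len c + 2 + len d = a + (len c + len d + 2)); last lia.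
  apply; have := segment_catr (segment_tail seg); rewrite size_code.
  move=> /segment_tail; congr (segment _ _); lia.
- move=> i p c s pl a cf seg /andP[ik kc] H.
  have sz := segment_size seg; rewrite /= size_cat /= !size_code in sz.
  have := step_branch H (segment_catl (C := [:: _]) seg); rewrite (negbTE pl).
  by rewrite addnA; apply=> //; lia.
- move=> i p c s n s1 m s2 pl _ IH _ IHw a cf seg /andP[ik kc] H.
  have sz := segment_size seg; rewrite /= size_cat /= !size_code in sz.
  have H1 : config_ok s a.+1 (step cf).
    have := step_branch H (segment_catl (C := [:: _]) seg); rewrite pl.
    by apply=> //; lia.
  have seg1 := segment_tail seg.
  have H2 := IH _ _ (segment_catl seg1) kc H1.
  have H3 : config_ok s1 a (step (iter n (@step prog_machine) (step cf))).
    apply: (step_jump H2); last by lia.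
    by have := segment_catr seg1; rewrite size_code.
  have := IHw _ _ seg _ H3; rewrite ik kc => /(_ isT).
  congr (config_ok _ _ _).
  rewrite -[RHS]/(iter (n + m).+2 (@step prog_machine) cf) (_ : (n + m).+2 = m.+1 + n.+1); last lia.
  by rewrite iterD iterSr [iter n.+1 _ _]iterSr.
Qed.
End Machine.

Definition store0 (w : seq bool) : store :=
  Store (fun _ => 0)
    (fun i x => if i == 0 then nth None (map Some w) x.-1 else None).

Definition is_bit b : pred cell := fun x => x == Some (Some b).

Definition program (c : cmd) (t : nat) : seq instr :=
  rcons (code c 0) (branch t (is_bit true) (len c).+1 (len c).+2).

Definition compiled (c : cmd) (t : nat) : machine :=
  prog_machine (maxn t (max_tape c)) (program c t).

Lemma run_prelude c t w :
  config_ok (P := program c t) (store0 w) 0 (run (compiled c t) w 2).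
Proof.
rewrite /run /compiled /= /step /= /mdelta /= !addn2 ltn0 /= !inordK //=.
split=> [|i] /=; first by rewrite inordK ?size_rcons.
split=> // -[|j]; rewrite ffunE //= /cell_at /=.
case: ifP => [/eqP ->|i0] //=; last first.
  rewrite (_ : (i == 0 :> nat) = false); last by move: i0; rewrite -val_eqE.
  by case: j => [|j] //=; rewrite nth_nil.
case: j w => [|j] [|b w] //=.
- by rewrite nth_nil.
- case: (ltnP j (size w)) => jw; first by rewrite !(nth_map b).
  by rewrite !nth_default // size_map.
Qed.

Lemma iter_halting M (c : config M) k : halting (cstate c) -> iter k (@step M) c = c.
Proof. by move=> h; elim: k => //= k ->; rewrite /step h. Qed.

Lemma compiled_run c t w n s T : exec c (store0 w) n s -> n + 3 <= T ->
  let cf := run (compiled c t) w T in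
  [/\ halting (cstate cf), accepting (cstate cf) = is_bit true (look s t)
    & forall i : 'I_(maxn t (max_tape c)).+1, tape_ok (pos s i) (arr s i) (ctape cf i)].
Proof.
move=> E nT /=.
have tb : tapes_below (maxn t (max_tape c)) c by apply: tapes_below_max; lia.
have sP : size (program c t) = (len c).+1 by rewrite size_rcons size_code.
have seg : segment (program c t) 0 (code c 0).
  by exists [::], [:: branch t (is_bit true) (len c).+1 (len c).+2]; rewrite /program -cats1.
have seg2 : segment (program c t) (len c) [:: branch t (is_bit true) (len c).+1 (len c).+2].
  by exists (code c 0), [::]; rewrite /program cats0 cats1 size_code.
have H := code_correct E seg tb (run_prelude c t w).
rewrite add0n in H.
have [] := step_branch H seg2; [lia|lia|lia|move=> Hq Ht].
have -> : run (compiled c t) w T =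
    step (iter n (@step (compiled c t)) (run (compiled c t) w 2)).
  have -> : T = (T - (n + 3)) + (n.+1 + 2) by lia.
  rewrite /run iterD [iter (n.+1 + 2) _ _]iterD iter_halting //=.
  by rewrite Hq; case: ifP; lia.
split=> //=; rewrite Hq; case: ifP => _; lia.
Qed.

Lemma compiled_decides c t (L : language) T :
  (forall w, exists n s, [/\ exec c (store0 w) n s, n + 3 <= T (size w)
                           & look s t = Some (Some true) <-> L w]) ->
  decides_in (compiled c t) L T.
Proof.
move=> H w; have [n [s [E nT HL]]] := H w.
have [hh ha _] := compiled_run t E nT; split=> //.
rewrite ha -HL; split=> [/eqP //|->]; exact: eqxx.
Qed.

Lemma compiled_computes c f T :
  (forall w, exists n s, [/\ exec c (store0 w) n s, n + 3 <= T (size w), pos s 0 = 1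
     & forall x, x <= size (f w) -> arr s 0 x.+1 = nth None (map Some (f w)) x]) ->
  computes_in (compiled c 0) f T.
Proof.
move=> H w; have [n [s [E nT p0 Ha]]] := H w.
have [hh _ /(_ ord0)] := compiled_run 0 E nT; rewrite p0 => -[_ Hr].
split=> //; set cf := run _ _ _ in Hr *.
have Hn x : x <= size (f w) -> nth None (tape_right (ctape cf ord0)) x =
    nth None (map (@bit unit) (f w)) x.
  move=> xf; rewrite Hr add1n /cell_at /= Ha //.
  case: (ltnP x (size (f w))) => xs; first by rewrite !(nth_map true).
  by rewrite !nth_default // size_map.
exists (drop (size (f w)) (tape_right (ctape cf ord0))).
  rewrite -[LHS](cat_take_drop (size (f w))); congr cat.
  apply: (@eq_from_nth _ None).
    rewrite size_map size_take_min; apply/minn_idPl.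
    rewrite leqNgt; apply/negP => lt.
    have := Hn (size (tape_right (ctape cf ord0))) (ltnW lt).
    by rewrite nth_default // (nth_map true).
  move=> x; rewrite size_take_min => xs; rewrite nth_take ?Hn //; lia.
by rewrite -nth0 nth_drop addn0 Hn // nth_default // size_map.
Qed.

Definition runs c s n s' := exists2 m, m <= n & exec c s m s'.

Lemma runs_le c s n m s' : runs c s n s' -> n <= m -> runs c s m s'.
Proof. by move=> [k kn E] nm; exists k => //; lia. Qed.

Lemma runs_skip s n : runs Skip s n s.
Proof. by exists 0 => //; constructor. Qed.

Lemma runs_lt i s : runs (Lt i) s 1 (goto s i (pos s i).-1).
Proof. by exists 1 => //; constructor. Qed.

Lemma runs_rt i s : runs (Rt i) s 1 (goto s i (pos s i).+1).
Proof. by exists 1 => //; constructor. Qed.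

Lemma runs_put i o s : runs (Put i o) s 1 (put s i o).
Proof. by exists 1 => //; constructor. Qed.

Lemma runs_seq c d s n s1 m s2 :
  runs c s n s1 -> runs d s1 m s2 -> runs (Seq c d) s (n + m) s2.
Proof.
move=> [k kn E] [l lm F]; exists (k + l); first lia.
exact: XSeq E F.
Qed.

Lemma runs_if i p c d s n s1 :
  runs (if p (look s i) then c else d) s n s1 -> runs (If i p c d) s n.+2 s1.
Proof.
case: (boolP (p (look s i))) => pl [k kn E].
  by exists k.+2; [lia | exact: XIfT].
by exists k.+1; [lia | exact: XIfF].
Qed.

Definition nonzero : pred cell := isSome.

Lemma nonzero_look s i : nonzero (look s i) = (0 < pos s i).
Proof. by rewrite /look; case: (pos s i). Qed.

Definition down i c := While i nonzero (Seq c (Lt i)).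

Lemma runs_down i c (f : nat -> store) p n :
  (forall k, k <= p -> pos (f k) i = k) ->
  (forall k, k < p -> exists2 s, runs c (f k.+1) n s &
                       goto s i (pos s i).-1 = f k) ->
  runs (down i c) (f p) (p * (n + 3) + 1) (f 0).
Proof.
elim: p => [|p IH] Hp Hc.
  exists 1; first lia; apply: XWhF.
  by rewrite nonzero_look Hp.
have [s [k kn E] fp] := Hc p (ltnSn p).
have [||m mp F] := IH; first by move=> j jp; apply: Hp; lia.
  by move=> j jp; apply: Hc; lia.
exists (k + 1 + m).+2; first lia.
apply: XWhT F; first by rewrite nonzero_look Hp.
by apply: XSeq E _; rewrite -fp; constructor.
Qed.

Ltac nat_cases :=
  repeat match goal with
  | |- context [@eq_op Datatypes_nat__canonical__eqtype_Equality ?a ?b] =>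
      case: (@eqP _ a b) => ?
  end.

Ltac store_eq :=
  apply: store_ext => //=; apply: functional_extensionality => ? /=;
  nat_cases; try subst; lia.

Notation regN := 1.
Notation regF := 3.
Notation regU := 5.
Notation regW := 7.
Notation regZ := 9.
Definition regV d := 4 * d + 11.

Lemma goto_goto s i v v' : goto (goto s i v) i v' = goto s i v'.
Proof. by store_eq. Qed.

Lemma goto_id s i : goto s i (pos s i) = s.
Proof. by store_eq. Qed.

Definition add a b :=
  Seq (down a (Seq (Rt b) (Rt regZ))) (down regZ (Rt a)).

Lemma runs_add a b s : a != b -> a != regZ -> b != regZ -> pos s regZ = 0 ->
  runs (add a b) s (9 * pos s a + 2) (goto s b (pos s b + pos s a)).
Proof.
move=> /eqP ab /eqP aZ /eqP bZ Z0; set x := pos s a.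
pose f k := goto (goto (goto s a k) b (pos s b + (x - k))) regZ (x - k).
have H1 : runs (down a (Seq (Rt b) (Rt regZ))) s (x * (2 + 3) + 1) (f 0).
  have {1}-> : s = f x by rewrite /f; store_eq.
  apply: runs_down => [k kx|k kx]; first by rewrite /f /=; nat_cases; lia.
  exists (goto (goto (f k.+1) b (pos s b + (x - k))) regZ (x - k)).
    have -> : goto (goto (f k.+1) b (pos s b + (x - k))) regZ (x - k) =
        goto (goto (f k.+1) b (pos (f k.+1) b).+1) regZ
          (pos (goto (f k.+1) b (pos (f k.+1) b).+1) regZ).+1.
      by rewrite /f; store_eq.
    by apply: (runs_seq (n := 1) (m := 1)); apply: runs_rt.
  by rewrite /f; store_eq.
pose g k := goto (goto (f 0) a (x - k)) regZ k.
have H2 : runs (down regZ (Rt a)) (f 0) (x * (1 + 3) + 1) (g 0).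
  have {1}-> : f 0 = g x by rewrite /g /f; store_eq.
  apply: runs_down => [k kx|k kx]; first by rewrite /g /=; nat_cases; lia.
  exists (goto (g k.+1) a (x - k)); last by rewrite /g; store_eq.
  have -> : goto (g k.+1) a (x - k) = goto (g k.+1) a (pos (g k.+1) a).+1.
    by rewrite /g; store_eq.
  exact: runs_rt.
have -> : goto s b (pos s b + x) = g 0 by rewrite /g /f; store_eq.
apply: runs_le (runs_seq H1 H2) _; lia.
Qed.

Definition clear i := down i Skip.

Lemma runs_clear i s : runs (clear i) s (3 * pos s i + 1) (goto s i 0).
Proof.
apply: runs_le (_ : runs _ s (pos s i * (0 + 3) + 1) _) _; last lia.
rewrite -{1}(goto_id s i).
apply: (runs_down (f := fun k => goto s i k)) => [k _|k _] /=; first by rewrite eqxx.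
by exists (goto s i k.+1); [apply: runs_skip | rewrite goto_goto /= eqxx].
Qed.

(** * First-order formulas over a bounded domain *)

(* Variables are de Bruijn indices; [FRel r b args] tests whether the cell of
   the table [r] indexed by [args] contains the bit [b]. *)
Inductive form :=
| FLe of nat & nat
| FRel of nat & bool & seq nat
| FNot of form
| FAnd of form & form
| FOr of form & form
| FImp of form & form
| FEx of form
| FAll of form.

(* Bijective numeration in base [B]; it is injective on tuples of equal size. *)
Definition addr B (xs : seq nat) := foldl (fun h x => h * B + x.+1) 0 xs.

Fixpoint eval (a : nat -> nat -> option bool) B (e : seq nat) (phi : form) : bool :=
  match phi with
  | FLe i j => nth 0 e i <= nth 0 e j
  | FRel r b args => a (2 * r) (addr B [seq nth 0 e i | i <- args]) == Some b
  | FNot p => ~~ eval a B e p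
  | FAnd p q => eval a B e p && eval a B e q
  | FOr p q => eval a B e p || eval a B e q
  | FImp p q => eval a B e p ==> eval a B e q
  | FEx p => has (fun x => eval a B (x :: e) p) (iota 0 B)
  | FAll p => all (fun x => eval a B (x :: e) p) (iota 0 B)
  end.

Fixpoint closed_form d (phi : form) : bool :=
  match phi with
  | FLe i j => (i < d) && (j < d)
  | FRel _ _ args => (0 < size args) && all (fun i => i < d) args
  | FNot p => closed_form d p
  | FAnd p q | FOr p q | FImp p q => closed_form d p && closed_form d q
  | FEx p | FAll p => closed_form d.+1 p
  end.

Definition fle i j :=
  Seq (add i regU) (Seq (add j regW) (Seq (down regW (Lt regU))
   (Seq (If regU nonzero Skip (Rt regF)) (clear regU)))).

Definition addr_step t v :=
  Seq (down t (add regN regU)) (Seq (add regU t) (Seq (clear regU) (add v t))).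

Definition addr_code t vs := foldr (fun v c => Seq (addr_step t v) c) Skip vs.

Definition var_reg d i := regV (d - i.+1).

Fixpoint comp (phi : form) (d : nat) : cmd :=
  match phi with
  | FLe i j => fle (var_reg d i) (var_reg d j)
  | FRel r b args =>
      Seq (addr_code (2 * r) (map (var_reg d) args))
       (Seq (If (2 * r) (is_bit b) (Rt regF) Skip) (clear (2 * r)))
  | FNot p => Seq (comp p d) (If regF nonzero (Lt regF) (Rt regF))
  | FAnd p q => Seq (comp p d) (If regF nonzero (Seq (Lt regF) (comp q d)) Skip)
  | FOr p q => Seq (comp p d) (If regF nonzero Skip (comp q d))
  | FImp p q => Seq (comp p d)
      (If regF nonzero (Seq (Lt regF) (comp q d)) (Rt regF))
  | FEx p => Seq (add regN (regV d))
      (down (regV d) (If regF nonzero Skip (comp p d.+1)))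
  | FAll p => Seq (Rt regF) (Seq (add regN (regV d))
      (down (regV d) (If regF nonzero (Seq (Lt regF) (comp p d.+1)) Skip)))
  end.

Definition addr_cost k B := k * (60 * (B.+1 ^ k.+2)).

Fixpoint fcost (phi : form) B : nat :=
  match phi with
  | FLe _ _ => 30 * B + 30
  | FRel _ _ args => addr_cost (size args) B + 3 * B.+1 ^ (size args) + 10
  | FNot p => fcost p B + 5
  | FAnd p q | FOr p q | FImp p q => fcost p B + fcost q B + 5
  | FEx p | FAll p => B * (fcost p B + 9) + 9 * B + 9
  end.

Record ready B (s : store) (d : nat) (e : seq nat) : Prop := Ready {
  ready_size : size e = d;
  ready_env : all (fun x => x < B) e;
  ready_N : pos s regN = B;
  ready_F : pos s regF = 0;
  ready_U : pos s regU = 0;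
  ready_W : pos s regW = 0;
  ready_Z : pos s regZ = 0;
  ready_T : forall r, pos s (2 * r) = 0;
  ready_V : forall i, i < d -> pos s (var_reg d i) = (nth 0 e i).+1;
  ready_V0 : forall k, d <= k -> pos s (regV k) = 0
}.

Lemma runs_fle i j s : pos s regU = 0 -> pos s regW = 0 -> pos s regZ = 0 ->
  i != regU -> i != regW -> i != regZ -> j != regU -> j != regW -> j != regZ ->
  runs (fle i j) s (12 * pos s i + 13 * pos s j + 20)
    (goto s regF (pos s regF + (pos s i <= pos s j))).
Proof.
move=> U0 W0 Z0 iU iW iZ jU jW jZ.
set x := pos s i; set y := pos s j.
have H1 : runs (add i regU) s (9 * x + 2) (goto s regU x).
  by have := @runs_add i regU s; rewrite U0 add0n; apply.
have H2 : runs (add j regW) (goto s regU x) (9 * y + 2)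
    (goto (goto s regU x) regW y).
  have := @runs_add j regW (goto s regU x); rewrite /= W0 (negbTE jU) add0n.
  by apply.
pose f k := goto (goto s regU (x - (y - k))) regW k.
have H3 : runs (down regW (Lt regU)) (goto (goto s regU x) regW y) (y * (1 + 3) + 1) (f 0).
  have -> : goto (goto s regU x) regW y = f y by rewrite /f; store_eq.
  apply: runs_down => [//|k ky].
  exists (goto (f k.+1) regU (x - (y - k))); last by rewrite /f; store_eq.
  have -> : goto (f k.+1) regU (x - (y - k)) = goto (f k.+1) regU (pos (f k.+1) regU).-1.
    by rewrite /f; store_eq.
  exact: runs_lt.
have H4 : runs (If regU nonzero Skip (Rt regF)) (f 0) 3
    (goto (f 0) regF (pos s regF + (x <= y))).
  apply: runs_if; rewrite nonzero_look /= subn0.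
  case: (leqP x y) => xy.
    have -> : (0 < x - y) = false by lia.
    have -> : goto (f 0) regF (pos s regF + 1) = goto (f 0) regF (pos (f 0) regF).+1.
      by rewrite /f; store_eq.
    exact: runs_rt.
  rewrite subn_gt0 xy addn0.
  have -> : goto (f 0) regF (pos s regF) = f 0 by rewrite /f; store_eq.
  exact: runs_skip.
have H5 := runs_clear regU (goto (f 0) regF (pos s regF + (x <= y))).
have <- : goto (goto (f 0) regF (pos s regF + (x <= y))) regU 0 =
    goto s regF (pos s regF + (x <= y)) by rewrite /f; store_eq.
apply: runs_le (runs_seq H1 (runs_seq H2 (runs_seq H3 (runs_seq H4 H5)))) _.
rewrite /=; lia.
Qed.

Lemma runs_addr_step t v s B :
  pos s regN = B -> pos s regU = 0 -> pos s regZ = 0 ->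
  t != regN -> t != regU -> t != regZ -> v != regU -> v != regZ -> v != t ->
  runs (addr_step t v) s
    (pos s t * (9 * B + 5) + 12 * (pos s t * B) + 9 * pos s v + 10)
    (goto s t (pos s t * B + pos s v)).
Proof.
move=> N0 U0 Z0 tN tU tZ vU vZ vt.
have Nt : (regN == t) = false by rewrite eq_sym; exact: negbTE.
have Ut : (regU == t) = false by rewrite eq_sym; exact: negbTE.
have Zt : (regZ == t) = false by rewrite eq_sym; exact: negbTE.
set h := pos s t.
pose f k := goto (goto s regU ((h - k) * B)) t k.
have H1 : runs (down t (add regN regU)) s (h * (9 * B + 2 + 3) + 1) (f 0).
  have {1}-> : s = f h by rewrite /f; store_eq.
  apply: runs_down => [k _|k kh]; first by rewrite /f /= eqxx.
  exists (goto (f k.+1) regU ((h - k) * B)).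
    have := @runs_add regN regU (f k.+1).
    rewrite /f /= Nt Ut Zt N0 (_ : (h - k.+1) * B + B = (h - k) * B); last nia.
    by apply.
  by rewrite /f /= eqxx; store_eq.
have H2 : runs (add regU t) (f 0) (9 * (h * B) + 2) (goto (f 0) t (h * B)).
  have := @runs_add regU t (f 0); rewrite /f /= eqxx Ut Zt.
  by rewrite subn0 add0n; apply=> //; rewrite Ut.
have H3 := runs_clear regU (goto (f 0) t (h * B)).
have E3 : goto (goto (f 0) t (h * B)) regU 0 = goto s t (h * B) by rewrite /f; store_eq.
rewrite E3 /= in H3.
have H4 : runs (add v t) (goto s t (h * B)) (9 * pos s v + 2)
   (goto s t (h * B + pos s v)).
  have := @runs_add v t (goto s t (h * B)); rewrite /= eqxx Zt (negbTE vt).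
  by rewrite goto_goto; apply.
apply: runs_le (runs_seq H1 (runs_seq H2 (runs_seq H3 H4))) _.
rewrite Ut /= subn0; lia.
Qed.

Lemma foldl_addr_bound B h xs : all (fun x => x < B) xs ->
  (foldl (fun h x => h * B + x.+1) h xs).+1 <= h.+1 * B.+1 ^ size xs.
Proof.
elim: xs h => [|x xs IH] h /=; first by rewrite muln1.
move=> /andP[xB H]; apply: leq_trans (IH _ H) _.
rewrite expnS mulnA leq_mul2r; apply/orP; right; nia.
Qed.

Lemma addr_bound B xs : all (fun x => x < B) xs -> addr B xs < B.+1 ^ size xs.
Proof. by move=> H; have := foldl_addr_bound 0 H; rewrite mul1n. Qed.

Lemma runs_addr_code t vs xs s B H :
  pos s regN = B -> pos s regU = 0 -> pos s regZ = 0 ->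
  t != regN -> t != regU -> t != regZ ->
  all (fun v => [&& v != regU, v != regZ & v != t]) vs ->
  [seq pos s v | v <- vs] = [seq x.+1 | x <- xs] -> all (fun x => x < B) xs ->
  (pos s t).+1 * B.+1 ^ size xs <= H ->
  runs (addr_code t vs) s (size vs * (60 * (H * B.+1)))
    (goto s t (foldl (fun h x => h * B + x.+1) (pos s t) xs)).
Proof.
move=> N0 U0 Z0 tN tU tZ.
elim: vs xs s N0 U0 Z0 => [|v vs IH] [|x xs] s N0 U0 Z0 //=.
  by rewrite goto_id => *; apply: runs_skip.
move=> /andP[/and3P[vU vZ vt] Hvs] [vx Evs] /andP[xB Hxs] HH.
have S1 := @runs_addr_step t v s B N0 U0 Z0 tN tU tZ vU vZ vt.
rewrite vx in S1.
have eN : (regN == t) = false by rewrite eq_sym; exact: negbTE.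
have eU : (regU == t) = false by rewrite eq_sym; exact: negbTE.
have eZ : (regZ == t) = false by rewrite eq_sym; exact: negbTE.
have hB : (pos s t * B + x.+1).+1 <= (pos s t).+1 * B.+1 by nia.
have := IH xs (goto s t (pos s t * B + x.+1)); rewrite /= eN eU eZ eqxx goto_goto.
move=> /(_ N0 U0 Z0 Hvs _ Hxs _)[|| ].
- rewrite -Evs; apply/eq_in_map => u uvs /=.
  by move/allP: Hvs => /(_ _ uvs)/and3P[_ _ /negbTE ->].
- apply: leq_trans HH; rewrite expnS mulnA leq_mul2r; apply/orP; right; lia.
move=> m Hm E.
apply: runs_le (runs_seq S1 (_ : runs _ _ m _)) _; first by exists m.
have HB : (pos s t).+1 * B.+1 <= H.
  apply: leq_trans HH; rewrite expnS mulnA; apply: leq_pmulr.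
  by rewrite expn_gt0.
rewrite mulSn leq_add //; nia.
Qed.

Lemma var_reg_neq d i : [/\ var_reg d i != regN, var_reg d i != regF,
  var_reg d i != regU, var_reg d i != regW & var_reg d i != regZ].
Proof. by rewrite /var_reg /regV; split; lia. Qed.

Lemma ready_arg B s d e args : ready B s d e -> all (fun i => i < d) args ->
  [seq pos s v | v <- map (var_reg d) args] =
  [seq x.+1 | x <- [seq nth 0 e i | i <- args]].
Proof.
move=> R /allP ad; rewrite -!map_comp; apply/eq_in_map => i /ad id /=.
exact: (ready_V R).
Qed.

Lemma ready_lt B s d e args : ready B s d e -> all (fun i => i < d) args ->
  all (fun x => x < B) [seq nth 0 e i | i <- args].
Proof.
move=> R /allP ad; apply/allP => _ /mapP[i /ad id ->].
by apply: (allP (ready_env R)); apply: mem_nth; rewrite (ready_size R).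
Qed.

Lemma runs_addr B s d e t args : ready B s d e -> all (fun i => i < d) args ->
  odd t = false -> pos s t = 0 ->
  runs (addr_code t (map (var_reg d) args)) s (addr_cost (size args) B)
    (goto s t (addr B [seq nth 0 e i | i <- args])).
Proof.
move=> R ad ot t0.
have := @runs_addr_code t (map (var_reg d) args) [seq nth 0 e i | i <- args] s B
   (B.+1 ^ size args) (ready_N R) (ready_U R) (ready_Z R).
rewrite t0 !size_map mul1n => /(_ _ _ _ _ (ready_arg R ad) (ready_lt R ad) (leqnn _)) H.
have {}H := H _ _ _ _.
apply: runs_le (H _ _ _ _) _; try by apply/eqP => E; rewrite E in ot.
  apply/allP => _ /mapP[i _ ->]; have [_ _ -> _ ->] := var_reg_neq d i.
  by apply/eqP => E; rewrite -E /var_reg /regV in ot; lia.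
rewrite /addr_cost leq_mul2l; apply/orP; right.
by rewrite leq_mul2l /= -expnSr leq_pexp2l.
Qed.

Lemma addr_gt0 B xs : 0 < size xs -> 0 < addr B xs.
Proof.
by case/lastP: xs => // xs x _; rewrite /addr -cats1 foldl_cat /=; lia.
Qed.

Lemma goto_F0 B s d e : ready B s d e -> goto s regF 0 = s.
Proof. by move=> R; have F0 := ready_F R; store_eq. Qed.

Lemma has_iotaS (p : pred nat) k B : k < B ->
  has p (iota k (B - k)) = p k || has p (iota k.+1 (B - k.+1)).
Proof. by move=> kB; rewrite (_ : B - k = (B - k.+1).+1) //; lia. Qed.

Lemma all_iotaS (p : pred nat) k B : k < B ->
  all p (iota k (B - k)) = p k && all p (iota k.+1 (B - k.+1)).
Proof. by move=> kB; rewrite (_ : B - k = (B - k.+1).+1) //; lia. Qed.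

Lemma ready_push B s d e k : ready B s d e -> k < B ->
  ready B (goto s (regV d) k.+1) d.+1 (k :: e).
Proof.
move=> R kB; split=> /=; rewrite ?(ready_size R) ?(ready_env R) ?kB //.
1-5: by case: eqP => [|_]; [rewrite /regV; lia | case: R].
- by move=> r; case: eqP => [|_]; [rewrite /regV; lia | case: R].
- move=> [|i] id; rewrite /var_reg ?subn1 /=; first by rewrite eqxx.
  rewrite (_ : d.+1 - i.+2 = d - i.+1); last lia.
  case: eqP => [|_]; first by rewrite /regV; lia.
  by apply: (ready_V R).
- move=> i di; case: eqP => [|_]; first by rewrite /regV; lia.
  by apply: (ready_V0 R); lia.
Qed.

Lemma comp_correct B phi : forall d s e, closed_form d phi -> ready B s d e ->
  runs (comp phi d) s (fcost phi B) (goto s regF (eval (arr s) B e phi)).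
Proof.
have F1 s b : pos (goto s regF b) regF = b by [].
elim: phi => [i j|r b args|p IH|p IHp q IHq|p IHp q IHq|p IHp q IHq|p IH|p IH]
  d s e /=.
- move=> /andP[id jd] R.
  have [_ _ iU iW iZ] := var_reg_neq d i; have [_ _ jU jW jZ] := var_reg_neq d j.
  have := runs_fle (ready_U R) (ready_W R) (ready_Z R) iU iW iZ jU jW jZ.
  rewrite (ready_F R) !(ready_V R) //= ltnS => H; apply: runs_le H _.
  have := allP (ready_env R) (nth 0 e i); have := allP (ready_env R) (nth 0 e j).
  rewrite !mem_nth ?(ready_size R) // => /(_ isT) ? /(_ isT) ?; lia.
- move=> /andP[a0 ad] R; set h := addr _ _.
  have h0 : 0 < h by apply: addr_gt0; rewrite size_map.
  have r2 : odd (2 * r) = false by rewrite oddM.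
  have H1 := runs_addr R ad r2 (ready_T R r); rewrite -/h in H1.
  set v : bool := _ == _.
  have hF : (regF == 2 * r) = false by lia.
  have H2 : runs (If (2 * r) (is_bit b) (Rt regF) Skip) (goto s (2 * r) h) 3
     (goto (goto s (2 * r) h) regF v).
    apply: runs_if.
    have -> : is_bit b (look (goto s (2 * r) h) (2 * r)) = v.
      by rewrite /look /= eqxx gtn_eqF.
    case: v => /=.
      have := runs_rt regF (goto s (2 * r) h); rewrite /= hF (ready_F R); by [].
    have -> : goto (goto s (2 * r) h) regF 0 = goto s (2 * r) h.
      by have := ready_F R => F0; store_eq.
    exact: runs_skip.
  have H3 := runs_clear (2 * r) (goto (goto s (2 * r) h) regF v).
  have E3 : goto (goto (goto s (2 * r) h) regF v) (2 * r) 0 = goto s regF v.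
    by have := ready_T R r => T0; store_eq.
  rewrite E3 in H3; apply: runs_le (runs_seq H1 (runs_seq H2 H3)) _.
  have hb : h < B.+1 ^ size args.
    by have := addr_bound (ready_lt R ad); rewrite size_map.
  by rewrite /= eq_sym hF eqxx; lia.
- move=> cp R; apply: runs_le (runs_seq (IH _ _ _ cp R) (runs_if (n := 1) _)) _; last lia.
  rewrite nonzero_look F1; set v := eval _ _ _ _.
  have -> : goto s regF (~~ v) = goto (goto s regF v) regF (~~ v) by rewrite goto_goto.
  case: v => /=; [have := runs_lt regF (goto s regF 1)|have := runs_rt regF (goto s regF 0)]; exact.
- move=> /andP[cp cq] R.
  apply: runs_le (runs_seq (IHp _ _ _ cp R) (runs_if (n := fcost q B + 1) _)) _; last lia.
  rewrite nonzero_look F1; case: (eval _ _ _ p) => /=; last exact: runs_skip.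
  rewrite addnC; apply: runs_seq (runs_lt _ _) _.
  by rewrite /= goto_goto (goto_F0 R); apply: IHq.
- move=> /andP[cp cq] R.
  apply: runs_le (runs_seq (IHp _ _ _ cp R) (runs_if (n := fcost q B) _)) _; last lia.
  rewrite nonzero_look F1; case: (eval _ _ _ p) => /=; first exact: runs_skip.
  by rewrite (goto_F0 R); apply: IHq.
- move=> /andP[cp cq] R.
  apply: runs_le (runs_seq (IHp _ _ _ cp R) (runs_if (n := fcost q B + 1) _)) _; last lia.
  rewrite nonzero_look F1; case: (eval _ _ _ p) => /=.
    rewrite addnC; apply: runs_seq (runs_lt _ _) _.
    by rewrite /= goto_goto (goto_F0 R); apply: IHq.
  have := runs_rt regF (goto s regF 0); rewrite goto_goto /= => H.
  by apply: runs_le H _; lia.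
- move=> cp R; pose g := fun x => eval (arr s) B (x :: e) p.
  have VN : (regN == regV d) = false by rewrite /regV; lia.
  have VF : (regF == regV d) = false by rewrite /regV; lia.
  have VF' : (regV d == regF) = false by rewrite /regV; lia.
  have H1 : runs (add regN (regV d)) s (9 * B + 2) (goto s (regV d) B).
    have := @runs_add regN (regV d) s; rewrite (ready_N R) (ready_V0 R) //.
    by apply; rewrite ?(ready_Z R) // /regV; lia.
  pose f k := goto (goto s (regV d) k) regF (has g (iota k (B - k))).
  have H2 : runs (down (regV d) (If regF nonzero Skip (comp p d.+1)))
     (f B) (B * (fcost p B + 2 + 3) + 1) (f 0).
    apply: (runs_down (n := fcost p B + 2)) => [k _|k kB].
      by rewrite /f /= VF' eqxx.
    exists (goto (goto s (regV d) k.+1) regF (has g (iota k (B - k)))).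
      apply: (@runs_le _ _ (fcost p B).+2); last lia.
      apply: runs_if; rewrite nonzero_look /f /= (has_iotaS _ kB).
      case: (has g (iota k.+1 _)); rewrite ?orbT ?orbF /=; first exact: runs_skip.
      have Rk := ready_push R kB.
      by rewrite (goto_F0 Rk); apply: IH cp Rk.
    by rewrite /= VF' eqxx /f; store_eq.
  have fB : f B = goto s (regV d) B by rewrite /f subnn; have := ready_F R => F0; store_eq.
  have f0 : f 0 = goto s regF (has g (iota 0 B)).
    by rewrite /f subn0; have := ready_V0 R (leqnn d) => F0; store_eq.
  rewrite fB f0 in H2; apply: runs_le (runs_seq H1 H2) _; lia.
- move=> cp R; pose g := fun x => eval (arr s) B (x :: e) p.
  have VN : (regN == regV d) = false by rewrite /regV; lia.
  have VF : (regF == regV d) = false by rewrite /regV; lia.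
  have VF' : (regV d == regF) = false by rewrite /regV; lia.
  have H0 := runs_rt regF s; rewrite (ready_F R) in H0.
  have H1 : runs (add regN (regV d)) (goto s regF 1) (9 * B + 2) (goto (goto s regF 1) (regV d) B).
    have := @runs_add regN (regV d) (goto s regF 1); rewrite /= VF' (ready_N R) (ready_V0 R) //.
    by apply; rewrite ?(ready_Z R) // /regV; lia.
  pose f k := goto (goto s (regV d) k) regF (all g (iota k (B - k))).
  have H2 : runs (down (regV d) (If regF nonzero (Seq (Lt regF) (comp p d.+1)) Skip))
     (f B) (B * (fcost p B + 3 + 3) + 1) (f 0).
    apply: (runs_down (n := fcost p B + 3)) => [k _|k kB].
      by rewrite /f /= VF' eqxx.
    exists (goto (goto s (regV d) k.+1) regF (all g (iota k (B - k)))).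
      apply: (@runs_le _ _ (fcost p B + 1).+2); last lia.
      apply: runs_if; rewrite nonzero_look /f /= (all_iotaS _ kB).
      case: (all g (iota k.+1 _)); rewrite ?andbT ?andbF /=; last exact: runs_skip.
      have Rk := ready_push R kB.
      rewrite addnC; apply: runs_seq (runs_lt _ _) _.
      by rewrite /= goto_goto (goto_F0 Rk); apply: IH cp Rk.
    by rewrite /= VF' eqxx /f; store_eq.
  have fB : f B = goto (goto s regF 1) (regV d) B by rewrite /f subnn; store_eq.
  have f0 : f 0 = goto s regF (all g (iota 0 B)).
    by rewrite /f subn0; have := ready_V0 R (leqnn d) => F0; store_eq.
  rewrite fB f0 in H2; apply: runs_le (runs_seq H0 (runs_seq H1 H2)) _; lia.
Qed.

(** * Least fixed points *)

Definition interpretation := nat -> bool -> seq nat -> Prop.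

Fixpoint holds (J : interpretation) B (e : seq nat) (phi : form) : Prop :=
  match phi with
  | FLe i j => nth 0 e i <= nth 0 e j
  | FRel r b args => J r b [seq nth 0 e i | i <- args]
  | FNot p => ~ holds J B e p
  | FAnd p q => holds J B e p /\ holds J B e q
  | FOr p q => holds J B e p \/ holds J B e q
  | FImp p q => holds J B e p -> holds J B e q
  | FEx p => exists x, x < B /\ holds J B (x :: e) p
  | FAll p => forall x, x < B -> holds J B (x :: e) p
  end.

Definition reads (a : nat -> nat -> option bool) B : interpretation :=
  fun r b args => a (2 * r) (addr B args) = Some b.

Lemma evalP a B e phi : reflect (holds (reads a B) B e phi) (eval a B e phi).
Proof.
elim: phi e => /= [i j|r b args|p IH|p IHp q IHq|p IHp q IHq|p IHp q IHq|p IH|p IH] e.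
- exact: idP.
- exact: eqP.
- apply: (iffP negP) => H /IH; exact: H.
- by apply: (iffP andP) => -[/IHp ? /IHq ?].
- by apply: (iffP orP) => -[/IHp|/IHq] ?; [left|right|left|right].
- by apply: (iffP implyP) => H /IHp /H /IHq.
- apply: (iffP hasP) => [[x]|[x [xB /IH ?]]].
    by rewrite mem_iota add0n => /andP[_ xB] /IH ?; exists x.
  by exists x; rewrite ?mem_iota.
- apply: (iffP allP) => H x xB.
    by apply/IH/H; rewrite mem_iota.
  by apply/IH/H; rewrite mem_iota in xB; lia.
Qed.

Fixpoint tables_in (p : pred nat) (phi : form) : bool :=
  match phi with
  | FLe _ _ => true
  | FRel r _ _ => p r
  | FNot q => tables_in p q
  | FAnd q q' | FOr q q' | FImp q q' => tables_in p q && tables_in p q'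
  | FEx q | FAll q => tables_in p q
  end.

Lemma holds_ext (p : pred nat) J J' B e phi : tables_in p phi ->
  (forall r b args, p r -> J r b args <-> J' r b args) ->
  holds J B e phi <-> holds J' B e phi.
Proof.
move=> tp H; elim: phi e tp => /=.
- by [].
- by move=> r b args e pr; apply: H.
- by move=> q IH e /(IH e) ->.
- by move=> q IH q' IH' e /andP[/(IH e) -> /(IH' e) ->].
- by move=> q IH q' IH' e /andP[/(IH e) -> /(IH' e) ->].
- by move=> q IH q' IH' e /andP[/(IH e) -> /(IH' e) ->].
- move=> q IH e tp; split=> -[x [xB Hx]]; exists x; split=> //; exact/(IH (x :: e)).
- move=> q IH e tp; split=> Hx x xB; exact/(IH (x :: e))/Hx.
Qed.

(* In [phi] the table [r] only occurs with arity [k] and the bit [true], and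
   all its occurrences have the sign [sg]. *)
Fixpoint signed (r k : nat) (sg : bool) (phi : form) : bool :=
  match phi with
  | FLe _ _ => true
  | FRel r' b args => (r' == r) ==> [&& sg, b & size args == k]
  | FNot q => signed r k (~~ sg) q
  | FAnd q q' | FOr q q' => signed r k sg q && signed r k sg q'
  | FImp q q' => signed r k (~~ sg) q && signed r k sg q'
  | FEx q | FAll q => signed r k sg q
  end.

Definition in_box B k (e : seq nat) := (size e == k) && all (fun x => x < B) e.

Lemma holds_mono r k J J' B :
  (forall r' b args, r' != r -> J r' b args <-> J' r' b args) ->
  (forall args, in_box B k args -> J r true args -> J' r true args) ->
  forall phi d e sg, closed_form d phi -> size e = d -> all (fun x => x < B) e ->
  signed r k sg phi ->
  if sg then holds J B e phi -> holds J' B e phi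
  else holds J' B e phi -> holds J B e phi.
Proof.
move=> H1 H2; elim=> /=.
- by move=> i j d e [].
- move=> r' b args d e sg /andP[_ ad] se eB.
  case: (eqVneq r' r) => [->|rr]; last by move=> _; case: sg; apply H1.
  move=> /= /and3P[-> -> sa]; apply: H2; rewrite /in_box size_map sa /=.
  apply/allP => _ /mapP[i /(allP ad) id ->].
  by apply: (allP eB); apply: mem_nth; rewrite se.
- by move=> q IH d e sg cq se eB /(IH d e _ cq se eB); case: sg => /= H C /H.
- move=> q IH q' IH' d e sg /andP[cq cq'] se eB /andP[/(IH d e _ cq se eB) + /(IH' d e _ cq' se eB)].
  by case: sg => A A' [/A ? /A' ?].
- move=> q IH q' IH' d e sg /andP[cq cq'] se eB /andP[/(IH d e _ cq se eB) + /(IH' d e _ cq' se eB)].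
  by case: sg => A A' [/A|/A'] ?; [left|right|left|right].
- move=> q IH q' IH' d e sg /andP[cq cq'] se eB /andP[/(IH d e _ cq se eB) + /(IH' d e _ cq' se eB)].
  by case: sg => A A' C /A /C /A'.
- move=> q IH d e sg cq se eB sq.
  have IHx x : x < B -> if sg then holds J B (x :: e) q -> holds J' B (x :: e) q
     else holds J' B (x :: e) q -> holds J B (x :: e) q.
    by move=> xB; apply: (IH d.+1) => //=; rewrite ?se ?xB.
  by case: sg {sq} IHx => IHx [x [xB Hx]]; exists x; split=> //; apply: IHx.
- move=> q IH d e sg cq se eB sq.
  have IHx x : x < B -> if sg then holds J B (x :: e) q -> holds J' B (x :: e) q
     else holds J' B (x :: e) q -> holds J B (x :: e) q.
    by move=> xB; apply: (IH d.+1) => //=; rewrite ?se ?xB.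
  by case: sg {sq} IHx => IHx Hx x xB; apply: IHx => //; apply: Hx.
Qed.

Definition aset (a : nat -> nat -> option bool) t x :=
  fun j y => if (j == t) && (y == x) then Some true else a j y.

Lemma aset_id a t x : a t x = Some true -> aset a t x = a.
Proof.
move=> H; apply: functional_extensionality => j; apply: functional_extensionality => y.
by rewrite /aset; case: eqP => //= ->; case: eqP => // ->.
Qed.

Fixpoint tuples B k (e : seq nat) : seq (seq nat) :=
  if k is k'.+1 then flatten [seq tuples B k' (x :: e) | x <- rev (iota 0 B)]
  else [:: e].

Lemma mem_tuples B k (e e' : seq nat) :
  e' \in tuples B k e = (size e' == k + size e) && (drop k e' == e)
                          && all (fun x => x < B) (take k e').
Proof.
elim: k e e' => [|k IH] e e' /=.
  rewrite inE drop0 take0 /= andbT; case: (eqVneq e' e) => [->|]; first by rewrite eqxx.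
  by rewrite andbF.
apply/flattenP/idP => [[l /mapP[x xi ->{l}]]|].
  have xB : x < B by move: xi; rewrite mem_rev mem_iota add0n.
  rewrite IH /= => /andP[/andP[/eqP se /eqP de] te].
  have {}se : size e' = k.+1 + size e by rewrite se /=; lia.
  rewrite se eqxx /=.
  have ke : k < size e' by lia.
  have := drop_nth 0 ke; rewrite de => -[xE ->]; rewrite eqxx /=.
  by rewrite (take_nth 0 ke) all_rcons te -xE xB.
move=> /andP[/andP[/eqP se /eqP de] te].
have ke : k < size e' by lia.
move: te; rewrite (take_nth 0 ke) all_rcons => /andP[xB te].
exists (tuples B k (nth 0 e' k :: e)).
  by apply/mapP; exists (nth 0 e' k) => //; rewrite mem_rev mem_iota.
rewrite IH te andbT (drop_nth 0 ke) de eqxx andbT /= se; apply/eqP; lia.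
Qed.

Lemma mem_tuples0 B k (e : seq nat) : e \in tuples B k [::] = in_box B k e.
Proof.
rewrite mem_tuples addn0 /in_box; case: eqP => //= <-.
by rewrite drop_size take_size eqxx.
Qed.

Lemma size_tuples B k e : size (tuples B k e) = B ^ k.
Proof.
elim: k e => [|k IH] e //=; rewrite size_flatten /shape -map_comp.
rewrite (eq_map (g := fun _ => B ^ k)); last by move=> x /=; rewrite IH.
have H (l : seq nat) : sumn [seq B ^ k | _ <- l] = size l * B ^ k.
  by elim: l => //= x l ->; rewrite mulSn.
by rewrite H size_rev size_iota expnS.
Qed.

Section Block.
Variables (B r k : nat) (phi : form).
Hypothesis closed : closed_form k phi.
Hypothesis pos_phi : signed r k true phi.

Definition derive1 (a : nat -> nat -> option bool) e :=
  if eval a B e phi then aset a (2 * r) (addr B e) else a.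

Definition sweep a := foldl derive1 a (tuples B k [::]).

Definition block_arr a := iter (B ^ k) sweep a.

Definition below (a a' : nat -> nat -> option bool) :=
  (forall j y, j != 2 * r -> a j y = a' j y) /\
  (forall y, a (2 * r) y = Some true -> a' (2 * r) y = Some true).

Lemma below_trans a b c : below a b -> below b c -> below a c.
Proof.
move=> [h1 h2] [g1 g2]; split=> [j y jr|y /h2 /g2 //].
by rewrite h1 // g1.
Qed.

Lemma below_derive1 a e : below a (derive1 a e).
Proof.
rewrite /derive1; case: ifP => // _; split=> [j y jr|y H]; rewrite /aset.
  by rewrite (negbTE jr).
by rewrite eqxx /=; case: ifP.
Qed.

Lemma below_foldl a l : below a (foldl derive1 a l).
Proof.
elim: l a => //= e l IH a; apply: below_trans (IH _); exact: below_derive1.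
Qed.

Lemma below_block a n : below a (iter n sweep a).
Proof.
elim: n => //= n IH; apply: below_trans IH _; exact: below_foldl.
Qed.

Lemma eval_below a a' e : in_box B k e -> below a a' ->
  eval a B e phi -> eval a' B e phi.
Proof.
move=> /andP[/eqP se eB] [h1 h2] /evalP H; apply/evalP.
apply: (holds_mono (sg := true) (r := r) (k := k) (J := reads a B) _ _ closed se eB) H => //.
- by move=> r' b args rr; rewrite /reads h1 //; lia.
- by move=> args _; apply: h2.
Qed.

Definition saturated a :=
  forall e, in_box B k e -> eval a B e phi -> a (2 * r) (addr B e) = Some true.

Lemma sweep_saturated a : saturated a -> sweep a = a.
Proof.
move=> S; rewrite /sweep.
have : {subset tuples B k [::] <= in_box B k} by move=> e; rewrite mem_tuples0.
elim: (tuples _ _ _) => //= e l IH sub.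
have -> : derive1 a e = a.
  rewrite /derive1; case: ifP => // ev; apply: aset_id; apply: S => //.
  by apply: sub; rewrite inE eqxx.
by apply: IH => x xl; apply: sub; rewrite inE xl orbT.
Qed.

Definition fact_count a :=
  count (fun e => a (2 * r) (addr B e) == Some true) (tuples B k [::]).

Lemma sweep_progress a : ~ saturated a -> fact_count a < fact_count (sweep a).
Proof.
move=> nS; have [e He] := not_all_ex_not _ _ nS.
have [eb He2] := imply_to_and _ _ He; have [ev ne] := imply_to_and _ _ He2.
have et : e \in tuples B k [::] by rewrite mem_tuples0.
have ce : sweep a (2 * r) (addr B e) = Some true.
  rewrite /sweep; case/splitPr: et => l1 l2; rewrite foldl_cat /=.
  apply: (below_foldl _ l2).2; rewrite /derive1.
  by rewrite (eval_below eb (below_foldl a l1) ev) /aset !eqxx.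
have le := below_foldl a (tuples B k [::]); rewrite -/(sweep a) in le.
rewrite /fact_count; case/splitPr: et => l1 l2; rewrite !count_cat /= ce eqxx.
have -> : (a (2 * r) (addr B e) == Some true) = false by apply/eqP.
rewrite add0n addnA addn1 addSn ltnS.
by apply: leq_add; apply: sub_count => x /eqP /le.2 ->.
Qed.

Lemma block_saturated a : saturated (block_arr a).
Proof.
have H j : saturated (iter j sweep a) \/ j <= fact_count (iter j sweep a).
  elim: j => [|j IH]; first by right.
  case: (classic (saturated (iter j sweep a))) => [S|nS].
    by left; rewrite /= sweep_saturated.
  case: IH => // IH; right; exact: leq_ltn_trans IH (sweep_progress nS).
case: (H (B ^ k)) => // full e eb _.
have : all (fun e => block_arr a (2 * r) (addr B e) == Some true) (tuples B k [::]).
  by rewrite all_count eqn_leq count_size size_tuples.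
by move=> /allP /(_ e); rewrite mem_tuples0 => /(_ eb) /eqP.
Qed.

Definition override (J : interpretation) r (X : seq nat -> Prop) : interpretation :=
  fun r' b args => if (r' == r) && b then X args else J r' b args.

Definition least (J : interpretation) (e : seq nat) : Prop :=
  forall X : seq nat -> Prop,
    (forall e', in_box B k e' -> holds (override J r X) B e' phi -> X e') -> X e.

Lemma sound_step (X : seq nat -> Prop) b a e :
  (forall j y, j != 2 * r -> b j y = a j y) ->
  (forall e', in_box B k e' -> holds (override (reads b B) r X) B e' phi -> X e') ->
  (forall e', in_box B k e' -> a (2 * r) (addr B e') = Some true -> X e') ->
  in_box B k e -> eval a B e phi -> X e.
Proof.
move=> ab cl ok eb /evalP H; apply: cl => //.
have /andP[/eqP se eB] := eb.
apply: (holds_mono (sg := true) (r := r) (k := k) (J := reads a B) _ _ closed se eB) H => //.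
- by move=> r' b' args rr; rewrite /override (negbTE rr) /= /reads ab //; lia.
- by move=> args ba H; rewrite /override eqxx /=; apply: ok.
Qed.

End Block.

Lemma addr_inj B e e' : all (fun x => x < B) e -> all (fun x => x < B) e' ->
  size e = size e' -> addr B e = addr B e' -> e = e'.
Proof.
elim/last_ind: e e' => [|e x IH] e'; first by case: e'.
case/lastP: e' => [|e' y]; first by rewrite size_rcons.
rewrite !all_rcons !size_rcons => /andP[xB eB] /andP[yB eB'] [se].
rewrite /addr -!cats1 !foldl_cat /= -/(addr B e) -/(addr B e') => E.
have [E1 E2] : addr B e = addr B e' /\ x = y.
  have Ex : x = y.
    have : (addr B e * B + x) %% B = (addr B e' * B + y) %% B by congr (_ %% _); lia.
    by rewrite !modnMDl !modn_small.
  split=> //; apply/eqP; rewrite -(eqn_pmul2r (_ : 0 < B)); last lia.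
  by apply/eqP; lia.
by rewrite (IH e') // E2.
Qed.

Lemma block_least B r k phi a e : closed_form k phi -> signed r k true phi ->
  (forall y, a (2 * r) y <> Some true) -> in_box B k e ->
  reads (block_arr B r k phi a) B r true e <->
  least B r k phi (reads (block_arr B r k phi a) B) e.
Proof.
move=> cl sg a0 eb; set b := block_arr B r k phi a; split.
- move=> be X HX.
  have Hab : forall j y, j != 2 * r -> b j y = a j y.
    move=> j y jr; have [H _] := below_block B r k phi a (B ^ k).
    by rewrite /b /block_arr -H.
  have ok0 : forall e', in_box B k e' -> a (2 * r) (addr B e') = Some true -> X e'.
    by move=> e' _ /a0.
  suff H n : forall e', in_box B k e' ->
      iter n (sweep B r k phi) a (2 * r) (addr B e') = Some true -> X e' by apply: H be.
  elim: n => [|n IH] //=.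
  set c := iter n _ _ in IH *; rewrite /sweep.
  have Hc : forall j y, j != 2 * r -> b j y = c j y.
    move=> j y jr; have [H _] := below_block B r k phi a n.
    by rewrite Hab // /c -H.
  have : {subset tuples B k [::] <= in_box B k} by move=> u; rewrite mem_tuples0.
  elim: (tuples B k [::]) c IH Hc => [|u l IHl] c IH Hc sub //=.
  have ub : in_box B k u by apply: sub; rewrite inE eqxx.
  apply: IHl => [e' e'b|j y jr|x xl]; last by apply: sub; rewrite inE xl orbT.
  + rewrite /derive1; case: ifP => [ev|_]; last exact: IH.
    rewrite /aset eqxx /=; case: eqP => [E _|_]; last exact: IH.
    have -> : e' = u.
      by move/andP: e'b => [/eqP s1 ?]; move/andP: (ub) => [/eqP s2 ?]; apply: (addr_inj (B := B)); rewrite ?s1.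
    exact (sound_step cl sg Hc HX IH ub ev).
  + by have [H _] := below_derive1 B r phi c u; rewrite Hc // H.
- move=> H; apply: (H (fun e => reads b B r true e)) => e' eb' He.
  apply: (block_saturated cl sg) => //; apply/evalP.
  move: He; apply (holds_ext (p := predT)).
    by elim: phi {cl sg b H} => //= [? -> ? ->|? -> ? ->|? -> ? ->].
  move=> r' b' args _; rewrite /override; case: eqP => //= ->.
  by case: b'.
Qed.

Definition with_arr s a := Store (pos s) a.

Lemma with_arr_id s : with_arr s (arr s) = s.
Proof. by case: s. Qed.

Definition regR d := 4 * d + 13.

Lemma ready_pos B s s' d e : pos s = pos s' -> ready B s d e -> ready B s' d e.
Proof. by move=> E [*]; split=> //; rewrite -E. Qed.

Definition derive_cmd r k phi :=
  Seq (comp phi k)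
    (If regF nonzero
      (Seq (Lt regF)
        (Seq (addr_code (2 * r) (map (var_reg k) (iota 0 k)))
          (Seq (Put (2 * r) (Some true)) (clear (2 * r))))) Skip).

Definition derive_cost k phi B :=
  fcost phi B + addr_cost k B + 3 * B.+1 ^ k + 10.

Lemma runs_derive B r k phi s e : closed_form k phi -> ready B s k e -> 0 < k ->
  runs (derive_cmd r k phi) s (derive_cost k phi B)
    (with_arr s (derive1 B r phi (arr s) e)).
Proof.
move=> cl R k0; have H1 := comp_correct cl R.
apply: runs_le (runs_seq H1 (runs_if (n := addr_cost k B + 3 * B.+1 ^ k + 6) _)) _;
  last by rewrite /derive_cost; lia.
rewrite nonzero_look /derive1; case: (eval _ _ _ _) => /=; last first.
  by rewrite (goto_F0 R) with_arr_id; apply: runs_skip.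
have nthe : [seq nth 0 e i | i <- iota 0 k] = e.
  by rewrite -(ready_size R) -/(mkseq _ _) mkseq_nth.
have ad : all (fun i => i < k) (iota 0 k) by apply/allP => i; rewrite mem_iota.
have r2 : odd (2 * r) = false by rewrite oddM.
have H2 := runs_addr R ad r2 (ready_T R r); rewrite nthe size_iota in H2.
have H3 := runs_put (2 * r) (Some true) (goto s (2 * r) (addr B e)).
set s2 := put _ _ _ in H3; have H4 := runs_clear (2 * r) s2.
have E4 : goto s2 (2 * r) 0 = with_arr s (aset (arr s) (2 * r) (addr B e)).
  apply: store_ext => //=; apply: functional_extensionality => j /=.
    by case: eqP => // ->; rewrite (ready_T R).
  by apply: functional_extensionality => x; rewrite /aset eqxx.
rewrite E4 /= eqxx in H4.
have H0 := runs_lt regF (goto s regF 1); rewrite /= goto_goto (goto_F0 R) in H0.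
apply: runs_le (runs_seq H0 (runs_seq H2 (runs_seq H3 H4))) _.
have := addr_bound (ready_env R); rewrite (ready_size R); lia.
Qed.

Fixpoint loops d k c := if k is k'.+1 then
  Seq (add regN (regV d)) (down (regV d) (loops d.+1 k' c)) else c.

Fixpoint loops_cost B k n := if k is k'.+1 then
  9 * B + 2 + (B * (loops_cost B k' n + 3) + 1) else n.

Lemma runs_loops B c n g k d s e :
  (forall s e, ready B s (d + k) e -> runs c s n (with_arr s (g (arr s) e))) ->
  ready B s d e ->
  runs (loops d k c) s (loops_cost B k n)
    (with_arr s (foldl g (arr s) (tuples B k e))).
Proof.
elim: k d s e => [|k IH] d s e Hc R /=; first by apply: Hc; rewrite addn0.
have VF' : (regV d == regF) = false by rewrite /regV; lia.
have H1 : runs (add regN (regV d)) s (9 * B + 2) (goto s (regV d) B).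
  have := @runs_add regN (regV d) s; rewrite (ready_N R) (ready_V0 R) //.
  by apply; rewrite ?(ready_Z R) // /regV; lia.
pose f j := with_arr (goto s (regV d) j) (foldl g (arr s)
   (flatten [seq tuples B k (x :: e) | x <- rev (iota j (B - j))])).
have H2 : runs (down (regV d) (loops d.+1 k c)) (f B) (B * (loops_cost B k n + 3) + 1) (f 0).
  apply: (runs_down (n := loops_cost B k n)) => [j _|j jB]; first by rewrite /f /= eqxx.
  have Rj : ready B (f j.+1) d.+1 (j :: e).
    exact: ready_pos (ready_push R jB).
  have := IH d.+1 _ _ _ Rj.
  rewrite addSnnS => /(_ Hc) H.
  eexists; first exact: H.
  rewrite /f /with_arr /=; apply: store_ext => /=.
    by apply: functional_extensionality => i; rewrite eqxx; nat_cases.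
  rewrite -foldl_cat (_ : B - j = (B - j.+1).+1); last lia.
  by rewrite rev_cons map_rcons flatten_rcons.
have fB : f B = goto s (regV d) B by rewrite /f subnn.
have f0 : f 0 = with_arr s (foldl g (arr s) (flatten [seq tuples B k (x :: e) | x <- rev (iota 0 B)])).
  rewrite /f subn0 /with_arr; apply: store_ext => //=.
  have := ready_V0 R (leqnn d) => V0.
  by apply: functional_extensionality => i; nat_cases; subst.
rewrite fB f0 in H2; exact: runs_seq H1 H2.
Qed.

Fixpoint rounds k c := if k is k'.+1 then
  Seq (add regN (regR k')) (down (regR k') (rounds k' c)) else c.

Lemma ready_round B s d e k v : ready B s d e -> ready B (goto s (regR k) v) d e.
Proof.
case=> *; split=> //= [||||| r|i id|i id]; try by rewrite /regR; case: eqP => //; lia.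
by case: eqP => [|_]; [rewrite /var_reg /regV /regR; lia|auto].
by case: eqP => [|_]; [rewrite /regV /regR; lia|auto].
Qed.

Lemma runs_rounds B c n g k s e d :
  (forall s, ready B s d e -> runs c s n (with_arr s (g (arr s)))) ->
  ready B s d e -> (forall j, j < k -> pos s (regR j) = 0) ->
  runs (rounds k c) s (loops_cost B k n) (with_arr s (iter (B ^ k) g (arr s))).
Proof.
move=> Hc; elim: k s => [|k IH] s R Z /=; first exact: Hc.
have H1 : runs (add regN (regR k)) s (9 * B + 2) (goto s (regR k) B).
  have := @runs_add regN (regR k) s; rewrite (ready_N R) Z //.
  by apply; rewrite ?(ready_Z R) // /regR; lia.
pose f j := with_arr (goto s (regR k) j) (iter ((B - j) * B ^ k) g (arr s)).
have H2 : runs (down (regR k) (rounds k c)) (f B) (B * (loops_cost B k n + 3) + 1) (f 0).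
  apply: (runs_down (n := loops_cost B k n)) => [j _|j jB]; first by rewrite /f /= eqxx.
  have Rj : ready B (f j.+1) d e.
    by apply: ready_pos (ready_round k j.+1 R).
  have Zj i : i < k -> pos (f j.+1) (regR i) = 0.
    by move=> ik; rewrite /f /=; case: eqP => [|_]; [rewrite /regR; lia|apply: Z; lia].
  eexists; first exact: IH _ Rj Zj.
  rewrite /f /with_arr /=; apply: store_ext => /=.
    by apply: functional_extensionality => i; rewrite eqxx; nat_cases.
  by rewrite -iterD; congr iter; rewrite -mulSn; congr (_ * _); lia.
have fB : f B = goto s (regR k) B by rewrite /f subnn.
have f0 : f 0 = with_arr s (iter (B ^ k.+1) g (arr s)).
  rewrite /f subn0 /with_arr expnS; apply: store_ext => //=.
  by apply: functional_extensionality => i; nat_cases; subst; rewrite ?Z.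
rewrite fB f0 in H2; exact: runs_seq H1 H2.
Qed.

Definition block := (nat * nat * form)%type.

Definition block_cmd (b : block) :=
  let: (r, k, phi) := b in rounds k (loops 0 k (derive_cmd r k phi)).

Definition block_cost (b : block) B :=
  let: (r, k, phi) := b in loops_cost B k (loops_cost B k (derive_cost k phi B)).

Definition block_run B (b : block) a :=
  let: (r, k, phi) := b in block_arr B r k phi a.

Definition idle B s := ready B s 0 [::] /\ forall j, pos s (regR j) = 0.

Lemma runs_block B r k phi s : closed_form k phi -> 0 < k -> idle B s ->
  runs (block_cmd (r, k, phi)) s (block_cost (r, k, phi) B)
    (with_arr s (block_run B (r, k, phi) (arr s))).
Proof.
move=> cl k0 [R Z] /=.
apply: (runs_rounds (g := sweep B r k phi) _ R) => [s' R'|j _]; last exact: Z.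
apply: runs_loops R' => s'' e R''.
exact: runs_derive.
Qed.

(* Every block defines a fresh table from the input (table 0), from the tables
   of the preceding blocks and, positively, from itself. *)
Fixpoint wf_blocks (seen : seq nat) (bs : seq block) : bool :=
  if bs is (r, k, phi) :: bs' then
    [&& 0 < k, closed_form k phi, signed r k true phi, r \notin seen,
        tables_in (mem (r :: seen)) phi & wf_blocks (r :: seen) bs']
  else true.

Definition blocks_run B bs a := foldl (fun a b => block_run B b a) a bs.

Definition blocks_cmd bs := foldr (fun b c => Seq (block_cmd b) c) Skip bs.

Definition blocks_cost bs B := foldr (fun b n => block_cost b B + n) 0 bs.

Lemma runs_blocks B seen bs s : wf_blocks seen bs -> idle B s ->
  runs (blocks_cmd bs) s (blocks_cost bs B) (with_arr s (blocks_run B bs (arr s))).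
Proof.
elim: bs seen s => [|[[r k] phi] bs IH] seen s /=.
  by move=> _ _; rewrite with_arr_id; apply: runs_skip.
move=> /and5P[k0 cl _ _ /andP[_ wf]] I.
have := runs_block r cl k0 I => H1.
have I2 : idle B (with_arr s (block_run B (r, k, phi) (arr s))).
  by case: I => R Z; split=> //; apply: ready_pos R.
exact: runs_seq H1 (IH _ _ wf I2).
Qed.

Lemma blocks_keep B seen bs a r y : wf_blocks seen bs -> r \in seen ->
  blocks_run B bs a (2 * r) y = a (2 * r) y.
Proof.
elim: bs seen a => [|[[r' k] phi] bs IH] seen a //=.
move=> /and5P[k0 cl _ rn /andP[_ wf]] rs.
rewrite -[LHS]/(blocks_run B bs (block_arr B r' k phi a) (2 * r) y).
rewrite (IH _ _ wf) ?inE ?rs ?orbT //.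
have [H _] := below_block B r' k phi a (B ^ k); rewrite /block_arr -H //.
by apply/eqP => E; move: rn; rewrite (_ : r' = r) ?rs //; lia.
Qed.

Lemma least_ext (p : pred nat) B r k phi J J' e : tables_in p phi ->
  (forall r b args, p r -> J r b args <-> J' r b args) ->
  least B r k phi J e -> least B r k phi J' e.
Proof.
move=> tp E H X HX; apply: H => e' be' He'; apply: HX => //.
move: He'; apply (holds_ext _ _ tp) => r' b args pr; rewrite /override.
by case: ifP => // _; apply: iff_sym; apply: E.
Qed.

Lemma blocks_least B seen bs a : wf_blocks seen bs ->
  (forall r y, r \notin seen -> a (2 * r) y <> Some true) ->
  forall r k phi, List.In (r, k, phi) bs -> forall e, in_box B k e ->
  let J := reads (blocks_run B bs a) B in J r true e <-> least B r k phi J e.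
Proof.
elim: bs seen a => [|[[r k] phi] bs IH] seen a //=.
move=> /and5P[k0 cl sg rn /andP[tp wf]] H0 r' k' phi' [E|Hin] e eb.
  case: E => <- <- <- in eb *.
  have K r1 b args : r1 \in r :: seen ->
      reads (block_arr B r k phi a) B r1 b args <->
      reads (blocks_run B bs (block_arr B r k phi a)) B r1 b args.
    by move=> r1s; rewrite /reads (blocks_keep _ _ _ wf r1s).
  rewrite -K ?inE ?eqxx // block_least //; last by move=> y; apply: H0.
  split; apply: least_ext tp _ => r1 b args r1s; first exact: K.
  by apply: iff_sym; apply: K.
apply: (IH (r :: seen)) => // r1 y; rewrite inE negb_or => /andP[r1r r1s].
have [H _] := below_block B r k phi a (B ^ k).
by rewrite /block_arr -H; [apply: H0 | lia].
Qed.

(** * Polynomial bounds *)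

Definition poly_bounded (f : nat -> nat) := exists c, forall B, 1 < B -> f B <= B ^ c.

Lemma poly_bounded_const n : poly_bounded (fun _ => n).
Proof. by exists n => B B1; apply: ltnW; apply: ltn_expl. Qed.

Lemma poly_bounded_id : poly_bounded id.
Proof. by exists 1. Qed.

Lemma poly_bounded_add f g : poly_bounded f -> poly_bounded g ->
  poly_bounded (fun B => f B + g B).
Proof.
move=> [c Hc] [d Hd]; exists (maxn c d).+1 => B B1.
have := Hc B B1; have := Hd B B1.
have : B ^ c <= B ^ maxn c d by apply: leq_pexp2l; lia.
have : B ^ d <= B ^ maxn c d by apply: leq_pexp2l; lia.
rewrite expnS; nia.
Qed.

Lemma poly_bounded_mul f g : poly_bounded f -> poly_bounded g ->
  poly_bounded (fun B => f B * g B).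
Proof.
move=> [c Hc] [d Hd]; exists (c + d) => B B1.
by rewrite expnD leq_mul ?Hc ?Hd.
Qed.

Lemma poly_bounded_exp f k : poly_bounded f -> poly_bounded (fun B => f B ^ k).
Proof.
move=> H; elim: k => [|k IH]; first exact: poly_bounded_const 1.
have [c Hc] := poly_bounded_mul H IH; exists c => B B1; rewrite expnS; exact: Hc.
Qed.

Lemma poly_bounded_succ : poly_bounded (fun B => B.+1).
Proof.
by have [c Hc] := poly_bounded_add poly_bounded_id (poly_bounded_const 1);
  exists c => B /Hc; rewrite addn1.
Qed.

Ltac poly := repeat match goal with
  | |- poly_bounded (fun _ => ?n) => exact: (poly_bounded_const n)
  | |- poly_bounded (fun B => B) => exact: poly_bounded_id
  | |- poly_bounded (fun B => B.+1) => exact: poly_bounded_succ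
  | |- poly_bounded (fun B => @?f B + @?g B) => apply: (@poly_bounded_add f g)
  | |- poly_bounded (fun B => @?f B * @?g B) => apply: (@poly_bounded_mul f g)
  | |- poly_bounded (fun B => @?f B ^ ?k) => apply: (@poly_bounded_exp f k)
  end.

Lemma poly_bounded_addr_cost k : poly_bounded (addr_cost k).
Proof. by rewrite /addr_cost; poly. Qed.

Lemma poly_bounded_fcost phi : poly_bounded (fcost phi).
Proof.
by elim: phi => * /=; poly; try assumption; exact: poly_bounded_addr_cost.
Qed.

Lemma poly_bounded_loops k n : poly_bounded n ->
  poly_bounded (fun B => loops_cost B k (n B)).
Proof. by move=> H; elim: k => //= k IH; poly. Qed.

Lemma poly_bounded_blocks bs : poly_bounded (blocks_cost bs).
Proof.
elim: bs => [|[[r k] phi] bs IH]; first exact: poly_bounded_const 0.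
apply: poly_bounded_add IH; do 2 apply: poly_bounded_loops.
rewrite /derive_cost; poly; [exact: poly_bounded_fcost | exact: poly_bounded_addr_cost].
Qed.

(** * Exponential time *)

Definition nonblank : pred cell := fun x => x != Some None.

Definition double := Seq (down regN (Seq (Rt regU) (Rt regU))) (down regU (Rt regN)).

Lemma runs_double s : pos s regU = 0 ->
  runs double s (13 * pos s regN + 2) (goto s regN (2 * pos s regN)).
Proof.
move=> U0; set x := pos s regN.
pose f k := goto (goto s regN k) regU (2 * (x - k)).
have H1 : runs (down regN (Seq (Rt regU) (Rt regU))) s (x * (2 + 3) + 1) (f 0).
  have {1}-> : s = f x by rewrite /f; store_eq.
  apply: runs_down => [//|k kx].
  exists (goto (f k.+1) regU (2 * (x - k))); last by rewrite /f; store_eq.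
  have -> : goto (f k.+1) regU (2 * (x - k)) =
      goto (goto (f k.+1) regU (pos (f k.+1) regU).+1) regU
        (pos (goto (f k.+1) regU (pos (f k.+1) regU).+1) regU).+1.
    by rewrite /f; store_eq.
  by apply: (runs_seq (n := 1) (m := 1)); apply: runs_rt.
pose g k := goto (goto s regN (2 * x - k)) regU k.
have H2 : runs (down regU (Rt regN)) (f 0) (2 * x * (1 + 3) + 1) (g 0).
  have {1}-> : f 0 = g (2 * x) by rewrite /g /f; store_eq.
  apply: runs_down => [//|k kx].
  exists (goto (g k.+1) regN (2 * x - k)); last by rewrite /g; store_eq.
  have -> : goto (g k.+1) regN (2 * x - k) = goto (g k.+1) regN (pos (g k.+1) regN).+1.
    by rewrite /g; store_eq.
  exact: runs_rt.
have -> : goto s regN (2 * x) = g 0 by rewrite /g; store_eq.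
apply: runs_le (runs_seq H1 H2) _; lia.
Qed.

Definition setup :=
  Seq (Rt regN) (Seq (Rt regN) (Seq (Rt regN) (Seq (Rt regN) (Seq (Rt 0)
    (Seq (While 0 nonblank (Seq double (Rt 0))) (clear 0)))))).

Lemma runs_setup w (n := size w) :
  runs setup (store0 w) (n * (13 * 2 ^ n.+2 + 5) + 3 * n + 10)
    (goto (store0 w) regN (2 ^ n.+2)).
Proof.
pose f j := goto (goto (store0 w) regN (2 ^ j.+2)) 0 j.+1.
have H k : k <= n -> runs (While 0 nonblank (Seq double (Rt 0))) (f (n - k))
    (k * (13 * 2 ^ n.+2 + 5) + 1) (f n).
  elim: k => [|k IH] kn.
    rewrite subn0; exists 1; first lia; apply: XWhF.
    by rewrite /look /= /nonblank nth_default ?size_map.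
  have {}IH := IH (ltnW kn).
  set j := n - k.+1; have jn : j < n by lia.
  have E : n - k = j.+1 by lia.
  rewrite E in IH; case: IH => m mk Em.
  have [m' mk' Em'] : runs (Seq double (Rt 0)) (f j) (13 * 2 ^ n.+2 + 3) (f j.+1).
    have H1 := @runs_double (f j) erefl.
    have H2 := runs_rt 0 (goto (f j) regN (2 * pos (f j) regN)).
    have E2 : goto (goto (f j) regN (2 * pos (f j) regN)) 0
        (pos (goto (f j) regN (2 * pos (f j) regN)) 0).+1 = f j.+1.
      by rewrite /f /= (expnS 2 j.+2); store_eq.
    rewrite E2 in H2; apply: runs_le (runs_seq H1 H2) _.
    rewrite /f /=; have : 2 ^ j.+2 <= 2 ^ n.+2 by apply: leq_pexp2l; lia.
    lia.
  exists (m' + m).+2; first lia.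
  apply: XWhT Em' Em; rewrite /look /= /nonblank (nth_map true) //.
have H5 := H n (leqnn n); rewrite subnn in H5.
have H6 := runs_clear 0 (f n).
have Hs : forall s, runs (Rt regN) s 1 (goto s regN (pos s regN).+1) by move=> s; apply: runs_rt.
have H1 := Hs (store0 w); have H2 := Hs _; have H3 := Hs _; have H4 := Hs _.
have H0 := runs_rt 0 (goto (store0 w) regN 4).
apply: runs_le (runs_seq H1 (runs_seq (H2 _) (runs_seq (H3 _) (runs_seq (H4 _)
  (runs_seq (m := n * (13 * 2 ^ n.+2 + 5) + 3 * n + 5) (n := 1) (s1 := f 0) _ _))))) _; last lia.
- rewrite /= !goto_goto; have := H0; rewrite /f.
  by congr (runs _ _ _ _); store_eq.
- have E6 : goto (f n) 0 0 = goto (store0 w) regN (2 ^ n.+2) by rewrite /f; store_eq.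
  rewrite E6 in H6; apply: runs_le (runs_seq H5 H6) _; rewrite /f /=; lia.
Qed.

Lemma exp_bound c n : (2 ^ n.+2) ^ c <= 2 ^ (n ^ (3 * c).+1 + (3 * c).+1).
Proof.
rewrite -expnM; apply: leq_pexp2l => //.
case: n => [|[|n]]; [lia | by rewrite exp1n; lia|].
have : c < 2 ^ c by apply: ltn_expl.
have : 2 ^ c <= n.+2 ^ (3 * c).
  have -> : n.+2 ^ (3 * c) = (n.+2 ^ 3) ^ c by rewrite -expnM.
  case: (posnP c) => [->|c0]; first by rewrite !expn0.
  by rewrite leq_exp2r // !expnS expn0; nia.
rewrite expnS; nia.
Qed.

Definition domain_size (w : seq bool) := 2 ^ (size w).+2.

Definition final_reads bs w : interpretation :=
  reads (blocks_run (domain_size w) bs (arr (store0 w))) (domain_size w).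

Lemma idle_setup w : idle (2 ^ (size w).+2) (goto (store0 w) regN (2 ^ (size w).+2)).
Proof.
split=> [|j]; last by rewrite /= /regR; case: eqP => //; lia.
split=> //= [r|i _]; [case: eqP => //; lia|].
by rewrite /regV; case: eqP => //; lia.
Qed.

Theorem definable_in_ExpTime bs phi : wf_blocks [:: 0] bs -> closed_form 0 phi ->
  in_ExpTime (fun w => holds (final_reads bs w) (domain_size w) [::] phi).
Proof.
move=> wf cl.
pose cost B := B * (13 * B + 5) + 3 * B + 10 + (blocks_cost bs B + (fcost phi B + 6)).
have [c Hc] : poly_bounded cost.
  rewrite /cost; poly; [exact: poly_bounded_blocks | exact: poly_bounded_fcost].
pose accept := If regF nonzero (Put regF (Some true)) Skip.
pose prog := Seq setup (Seq (blocks_cmd bs) (Seq (comp phi 0) accept)).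
exists (compiled prog regF), (3 * c).+1.
apply: compiled_decides => w.
set n := size w; set B := 2 ^ n.+2.
have nB : n.+2 < B by apply: ltn_expl.
set s1 := goto (store0 w) regN B.
have H1 := runs_setup w; rewrite -/n -/B -/s1 in H1.
have I1 : idle B s1 := idle_setup w.
have H2 := runs_blocks wf I1; set s2 := with_arr _ _ in H2.
have R2 : ready B s2 0 [::] by apply: ready_pos I1.1.
have H3 := comp_correct cl R2; set v := eval _ _ _ _ in H3.
pose s4 := if v then put (goto s2 regF 1) regF (Some true) else goto s2 regF 0.
have H4 : runs accept (goto s2 regF v) 3 s4.
  apply: runs_if; rewrite nonzero_look /s4; case: v {H3 s4} => /=.
    exact: runs_put.
  exact: runs_skip.
have [m mle E] := runs_seq H1 (runs_seq H2 (runs_seq H3 H4)).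
exists m, s4; split; first exact: E.
- apply: leq_trans (exp_bound c n); apply: leq_trans (Hc B _); last lia.
  rewrite /cost; apply: leq_trans (_ : _ <= n * (13 * B + 5) + 3 * n + 10 + (blocks_cost bs B + (fcost phi B + 3)) + 3) _; first by rewrite leq_add2r.
  have : n * (13 * B + 5) <= B * (13 * B + 5) by rewrite leq_mul2r; lia.
  lia.
- have -> : (look s4 regF = Some (Some true)) <-> v.
    rewrite /s4; case: v {H3 s4 H4 E} => /=; rewrite /look /=; split=> //.
  rewrite /v; split => [/evalP H|H]; last by apply/evalP; exact: H.
  exact: H.
Qed.

Lemma final_reads_input bs w b x : wf_blocks [:: 0] bs ->
  final_reads bs w 0 b [:: x] <-> nth None (map Some w) x = Some b.
Proof.
move=> wf; rewrite /final_reads /reads.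
by have -> := blocks_keep (domain_size w) (arr (store0 w)) (addr (domain_size w) [:: x]) wf (mem_head 0 [::]).
Qed.

Lemma final_reads_least bs w r k phi e : wf_blocks [:: 0] bs ->
  List.In (r, k, phi) bs -> in_box (domain_size w) k e ->
  final_reads bs w r true e <->
  least (domain_size w) r k phi (final_reads bs w) e.
Proof.
move=> wf H eb; apply: (blocks_least (seen := [:: 0])) H _ eb => // r' y.
rewrite inE => r0 /=; by case: ifP => // /eqP; lia.
Qed.

(** * Numbers as finite sets *)

Definition bit (s i : nat) : bool := odd (s %/ 2 ^ i).

Lemma bit0 i : bit 0 i = false.
Proof. by rewrite /bit div0n. Qed.

Lemma bit_small s i : s < 2 ^ i -> bit s i = false.
Proof. by move=> H; rewrite /bit divn_small. Qed.

Lemma bit_pow b i : bit (2 ^ b) i = (i == b).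
Proof.
rewrite /bit; case: (ltngtP i b) => [ib|bi|->].
- rewrite -(subnK (ltnW ib)) expnD mulnK ?expn_gt0 // oddX.
  by rewrite subn_eq0 leqNgt ib.
- by rewrite divn_small // ltn_exp2l.
- by rewrite divnn expn_gt0.
Qed.

Lemma bit_addpow s k i : s < 2 ^ k -> bit (s + 2 ^ k) i = bit s i || (i == k).
Proof.
move=> sk; rewrite /bit; case: (ltngtP i k) => [ik|ki|->].
- rewrite orbF -(subnK (ltnW ik)) expnD addnC divnMDl ?expn_gt0 //.
  by rewrite oddD oddX subn_eq0 leqNgt ik.
- rewrite orbF !divn_small //; first exact: leq_trans sk (leq_pexp2l _ (ltnW ki)).
  have : 2 ^ k.+1 <= 2 ^ i by apply: leq_pexp2l.
  by rewrite expnS; lia.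
- by rewrite orbT divnDr ?dvdnn // divnn expn_gt0 divn_small.
Qed.

Lemma comprehension (P : nat -> Prop) k :
  exists s, s < 2 ^ k /\ forall i, i < k -> bit s i <-> P i.
Proof.
elim: k => [|k [s [sk H]]]; first by exists 0.
have E : 2 ^ k.+1 = 2 ^ k + 2 ^ k by rewrite expnS; lia.
case: (classic (P k)) => Pk.
  exists (s + 2 ^ k); split; first lia.
  move=> i; rewrite ltnS leq_eqVlt bit_addpow // => /orP[/eqP->|ik].
    by rewrite eqxx orbT.
  by rewrite (ltn_eqF ik) orbF; apply: H.
exists s; split; first lia.
move=> i; rewrite ltnS leq_eqVlt => /orP[/eqP->|ik]; last exact: H.
by rewrite bit_small.
Qed.

Lemma bits_eq0 s k : s < 2 ^ k -> (forall i, i < k -> bit s i = false) -> s = 0.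
Proof.
elim: k s => [|k IH] s; first by case: s.
move=> sk H; apply: IH => [|i ik]; last by apply: H; lia.
have := H k (ltnSn k); rewrite /bit.
have : s %/ 2 ^ k < 2 by rewrite ltn_divLR ?expn_gt0 // -expnS.
case E: (s %/ 2 ^ k) => [|[|m]] // _ _.
by rewrite ltnNge; apply/negP; rewrite -divn_gt0 ?expn_gt0 // E.
Qed.

Definition EM (P : Prop) : {P} + {~ P} := excluded_middle_informative P.

Lemma bounded_max (Q : nat -> nat -> Prop) n :
  (forall i k k', k <= k' -> Q i k -> Q i k') ->
  (forall i, i < n -> exists k, Q i k) -> exists k, forall i, i < n -> Q i k.
Proof.
move=> mono; elim: n => [|n IH] H; first by exists 0.
have [k Hk] := IH (fun i h => H i (ltnW h)); have [k' Hk'] := H n (ltnSn n).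
exists (maxn k k') => i; rewrite ltnS leq_eqVlt => /orP[/eqP->|h].
  by apply: mono Hk'; lia.
by apply: mono (Hk _ h); lia.
Qed.

(** * Deciding rCQ entailment by fixed points over sets of subconcepts *)

(* The node at an identifier describes one layer of the concept that the
   identifier denotes. *)
Inductive node :=
| NName of name
| NTop
| NNot of nat
| NAnd of nat & nat
| NEx of name & nat.

Section Core.

Variables (nd : nat -> option node) (den : nat -> concept) (tok : nat).
Variables (T1 T2 : tbox) (S1 S2 : signature) (inc1 inc2 : nat -> nat -> Prop).

Local Notation B := (2 ^ tok.+1).

Definition denotes (v : node) : concept :=
  match v with
  | NName A => CName A
  | NTop => CTop
  | NNot j => CNot (den j)
  | NAnd j k => CAnd (den j) (den k)
  | NEx R j => CEx R (den j)
  end.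

Definition children (v : node) : seq nat :=
  match v with
  | NName _ | NTop => [::]
  | NNot j => [:: j]
  | NAnd j k => [:: j; k]
  | NEx _ j => [:: j]
  end.

Definition describes (T : tbox) (inc : nat -> nat -> Prop) :=
  (forall x, List.In x T -> exists i j, inc i j /\ x = Incl (den i) (den j)) /\
  (forall i j, inc i j -> [/\ nd i <> None, nd j <> None &
                            List.In (Incl (den i) (den j)) T]).

Record coherent : Prop := Coherent {
  nd_lt : forall i, nd i <> None -> i < tok;
  nd_den : forall i v, nd i = Some v -> den i = denotes v;
  nd_children : forall i v j, nd i = Some v -> j \in children v -> nd j <> None;
  inc1P : describes T1 inc1;
  inc2P : describes T2 inc2;
  sig_name : forall A, A \in S1.1 -> exists i, nd i = Some (NName A);
  sig_role : forall R, R \in S1.2 -> exists i j, nd i = Some (NEx R j) /\ nd j = Some NTop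
}.

(* [K s i]: [T2] entails that the conjunction of [s] is subsumed by [i]. *)
Definition PhiK (X : nat -> nat -> Prop) (s i : nat) : Prop :=
  bit s i \/ nd i = Some NTop \/
  (exists j k, nd i = Some (NAnd j k) /\ X s j /\ X s k) \/
  (exists a k, X s a /\ nd a = Some (NAnd i k)) \/
  (exists a j, X s a /\ nd a = Some (NAnd j i)) \/
  (exists a, X s a /\ inc2 a i) \/
  (exists a A, X s a /\ nd a = Some (NName A) /\ nd i = Some (NName A)) \/
  (exists a R b c, X s a /\ nd a = Some (NEx R b) /\ X (2 ^ b) c /\
                   nd i = Some (NEx R c)).

Definition K (s i : nat) : Prop :=
  forall X : nat -> nat -> Prop,
    (forall s i, s < B -> i < B -> PhiK X s i -> X s i) -> X s i.

Definition PhiI (X : nat -> Prop) (s : nat) : Prop :=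
  (exists i j, K s i /\ nd i = Some (NNot j) /\ K s j) \/
  (exists i R b, K s i /\ nd i = Some (NEx R b) /\ X (2 ^ b)).

Definition Incons (s : nat) : Prop :=
  forall X : nat -> Prop, (forall s, s < B -> PhiI X s -> X s) -> X s.

Definition Loc (t : nat) : Prop :=
  (forall i, nd i = Some NTop -> bit t i) /\
  (forall i j, nd i = Some (NNot j) -> bit t i <-> ~ bit t j) /\
  (forall i j k, nd i = Some (NAnd j k) -> bit t i <-> bit t j /\ bit t k) /\
  (forall i j A, nd i = Some (NName A) -> nd j = Some (NName A) -> bit t i -> bit t j) /\
  (forall i j, inc1 i j -> bit t i -> bit t j).

Definition Compat (R : name) (t t' : nat) : Prop :=
  forall i j, nd i = Some (NEx R j) -> bit t' j -> bit t i.

(* [Bad t]: no element of a model of [T1] has type [t]. *)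
Definition PhiB (X : nat -> Prop) (t : nat) : Prop :=
  ~ Loc t \/ exists i R j, nd i = Some (NEx R j) /\ bit t i /\
    forall t', t' < B -> bit t' j -> Compat R t t' -> X t'.

Definition Bad (t : nat) : Prop :=
  forall X : nat -> Prop, (forall t, t < B -> PhiB X t -> X t) -> X t.

Definition Sok (t s : nat) : Prop :=
  forall i, bit s i ->
    (exists A, nd i = Some (NName A) /\ A \in S1.1 /\ bit t i) \/
    (exists R b, nd i = Some (NEx R b) /\ R \in S1.2).

(* The identifier [tok] in [u] means that no query has to be refuted. *)
Definition Triv (t u : nat) : Prop :=
  bit u tok \/ exists i A, K u i /\ nd i = Some (NName A) /\ A \in S2.1 /\ ~ bit t i.

Definition Incl_succ (R : name) (s' s : nat) : Prop :=
  forall c i, K s' c -> nd i = Some (NEx R c) -> bit s i.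

Definition Kids (X : nat -> nat -> nat -> Prop) (o : name -> nat -> Prop) (t s : nat) : Prop :=
  (forall i R b, nd i = Some (NEx R b) -> bit s i -> exists t' s' u',
     t' < B /\ s' < B /\ u' < B /\ X t' s' u' /\ Compat R t t' /\ K s' b /\
     Incl_succ R s' s /\ o R u') /\
  (forall i R c, nd i = Some (NEx R c) -> bit t i -> exists t',
     t' < B /\ ~ Bad t' /\ bit t' c /\ Compat R t t' /\
     ((forall u', o R u') \/ exists u', u' < B /\ o R u' /\ X t' 0 u')).

Definition no_goal : name -> nat -> Prop := fun _ _ => True.

Definition goal R0 b0 : name -> nat -> Prop := fun R u' => R = R0 -> u' = 2 ^ b0.

(* [RT t s u]: some pointed model of [T1] of type [t] carries a tree-shaped
   ABox over [S1] consistent with [T2] whose root is closed under the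
   assertions [s], while the root violates a query over [S2] that follows from
   [u] and [T2]. *)
Definition PhiR (X : nat -> nat -> nat -> Prop) (t s u : nat) : Prop :=
  ~ Bad t /\ Sok t s /\ ~ Incons s /\
  ((Triv t u /\ Kids X no_goal t s) \/
   (exists i R b, K u i /\ nd i = Some (NEx R b) /\ R \in S2.2 /\ Kids X (goal R b) t s)).

Definition RT (t s u : nat) : Prop :=
  forall X : nat -> nat -> nat -> Prop,
    (forall t s u, t < B -> s < B -> u < B -> PhiR X t s u -> X t s u) -> X t s u.

Definition Final : Prop :=
  exists t s, t < B /\ s < B /\ RT t s s /\
   (s <> 0 \/ exists t0 s0 i R b, t0 < B /\ s0 < B /\ RT t0 s0 (2 ^ tok) /\
      nd i = Some (NEx R b) /\ bit s0 i /\ Compat R t0 t /\ Incl_succ R s s0).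

Hypothesis coh : coherent.

Let has_type (I : interp) (d : dom I) (t : nat) :=
  t < B /\ forall i, nd i <> None -> bit t i <-> ext (den i) d.

Lemma id_lt_B i : i <= tok -> i < B.
Proof. by move=> H; apply: leq_ltn_trans H _; apply: ltnW; apply: ltn_expl. Qed.

Lemma nd_lt_B i : nd i <> None -> i < B.
Proof. by move=> /(nd_lt coh) H; apply: id_lt_B; lia. Qed.

Lemma pow_lt_B i : i <= tok -> 2 ^ i < B.
Proof. by move=> H; rewrite ltn_exp2l. Qed.

Lemma pow_nd_lt i : nd i <> None -> 2 ^ i < B.
Proof. by move=> /(nd_lt coh) H; apply: pow_lt_B; lia. Qed.

Lemma B_gt0 : 0 < B. Proof. by rewrite expn_gt0. Qed.

Lemma bit_lt_B s i : s < B -> bit s i -> i < B.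
Proof.
move=> sB si; rewrite ltnNge; apply/negP => Bi.
move: si; rewrite bit_small //; apply: leq_trans sB _.
by apply: leq_trans (ltnW (ltn_expl B (isT : 1 < 2))) _; apply: leq_pexp2l.
Qed.

Lemma K_closed s i : s < B -> i < B -> PhiK K s i -> K s i.
Proof.
move=> sB iB H X HX; apply: (HX) => //.
have KX s0 i0 : K s0 i0 -> X s0 i0 by move=> /(_ X HX).
case: H => [|[|[[j [k [? [/KX ? /KX ?]]]]|[[a [k [/KX ? ?]]]|[[a [j [/KX ? ?]]]|[[a [/KX ? ?]]|[[a [A [/KX ? [? ?]]]]|[a [R [b [c [/KX ? [? [/KX ? ?]]]]]]]]]]]]]].
- by left.
- by right; left.
- by do 2 right; left; exists j, k.
- by do 3 right; left; exists a, k.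
- by do 4 right; left; exists a, j.
- by do 5 right; left; exists a.
- by do 6 right; left; exists a, A.
- by do 7 right; exists a, R, b, c.
Qed.

Lemma K_base s i : s < B -> bit s i -> K s i.
Proof. by move=> sB si; apply: K_closed => //; [exact: bit_lt_B si|left]. Qed.

Lemma K_pow b : nd b <> None -> K (2 ^ b) b.
Proof. by move=> H; apply: K_base; [exact: pow_nd_lt|rewrite bit_pow eqxx]. Qed.

Lemma K_sound (I : interp) (d : dom I) s i :
  (forall x, List.In x T2 -> sat_inclusion I x) ->
  (forall j, bit s j -> nd j <> None /\ ext (den j) d) ->
  K s i -> nd i <> None /\ ext (den i) d.
Proof.
move=> HT Hs /(_ (fun s i => forall d : dom I,
  (forall j, bit s j -> nd j <> None /\ ext (den j) d) -> nd i <> None /\ ext (den i) d)).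
apply=> // {s i d Hs} s i _ _ H d Hs.
have ch a v j : nd a = Some v -> j \in children v -> nd j <> None by exact: nd_children.
case: H => [/Hs //|[E|[[j [k [E [/(_ d Hs)[_ e1] /(_ d Hs)[_ e2]]]]]|[[a [k [/(_ d Hs)[_ e1] E]]]|[[a [j [/(_ d Hs)[_ e1] E]]]|[[a [/(_ d Hs)[_ e1] E]]|[[a [A [/(_ d Hs)[_ e1] [E1 E2]]]]|[a [R [b [c [/(_ d Hs)[_ e1] [E1 [H2 E2]]]]]]]]]]]]]].
- by rewrite (nd_den coh E) E.
- by rewrite (nd_den coh E) E.
- split; first by apply: ch E _; rewrite inE eqxx.
  by move: e1; rewrite (nd_den coh E) => -[].
- split; first by apply: ch E _; rewrite !inE eqxx orbT.
  by move: e1; rewrite (nd_den coh E) => -[].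
- have [_ H] := inc2P coh; have [_ ? Hin] := H _ _ E; split=> //.
  exact: (HT _ Hin d e1).
- by move: e1; rewrite (nd_den coh E1) (nd_den coh E2) E2.
- move: e1; rewrite (nd_den coh E1) => -[e re e1].
  have [_ e2] : nd c <> None /\ ext (den c) e.
    apply: H2 => j; rewrite bit_pow => /eqP ->; split=> //.
    by apply: ch E1 _; rewrite inE eqxx.
  by rewrite (nd_den coh E2) E2; split=> //; exists e.
Qed.

Lemma Incons_sound (I : interp) (d : dom I) s :
  (forall x, List.In x T2 -> sat_inclusion I x) ->
  (forall j, bit s j -> nd j <> None /\ ext (den j) d) -> ~ Incons s.
Proof.
move=> HT Hs /(_ (fun s => forall d : dom I,
  (forall j, bit s j -> nd j <> None /\ ext (den j) d) -> False)) H.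
apply: (H _ d Hs) => {s d Hs H} s _ H d Hs.
case: H => [[i [j [k1 [E k2]]]]|[i [R [b [k1 [E H]]]]]].
- have [_] := K_sound HT Hs k1; have [_] := K_sound HT Hs k2.
  by rewrite (nd_den coh E).
- have [_] := K_sound HT Hs k1; rewrite (nd_den coh E) => -[e re e1].
  apply: (H e) => j; rewrite bit_pow => /eqP ->; split=> //.
  by apply: (nd_children coh E); rewrite inE eqxx.
Qed.

Lemma Incons_closed s : s < B -> PhiI Incons s -> Incons s.
Proof.
move=> sB H X HX; apply: (HX) => //.
case: H => [H|[i [R [b [k1 [E /(_ X HX) H]]]]]]; first by left.
by right; exists i, R, b.
Qed.

Lemma Bad_closed t : t < B -> PhiB Bad t -> Bad t.
Proof.
move=> tB H X HX; apply: (HX) => //; case: H => [H|[i [R [j [E [ti H]]]]]]; first by left.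
by right; exists i, R, j; do 2 split=> //; move=> t' t'B b c; apply: H.
Qed.

Lemma good_Loc t : t < B -> ~ Bad t -> Loc t.
Proof. by move=> tB nb; apply: NNPP => nl; apply: nb; apply: Bad_closed => //; left. Qed.

Lemma good_succ t i R j : t < B -> ~ Bad t -> nd i = Some (NEx R j) -> bit t i ->
  exists t', t' < B /\ ~ Bad t' /\ bit t' j /\ Compat R t t'.
Proof.
move=> tB nb E ti; apply: NNPP => H; apply: nb; apply: Bad_closed => //.
right; exists i, R, j; do 2 split=> //; move=> t' t'B b c.
by apply: NNPP => g; apply: H; exists t'.
Qed.

Lemma type_exists (I : interp) (d : dom I) : exists t, has_type d t.
Proof.
have [t [tB H]] := comprehension (fun i => ext (den i) d) tok.+1.
by exists t; split=> // i /(nd_lt coh) ii; apply: H; lia.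
Qed.

Lemma type_compat (I : interp) (d e : dom I) R t t' :
  has_type d t -> has_type e t' -> role_int R d e -> Compat R t t'.
Proof.
move=> [_ H] [_ H'] re i j E.
have nj : nd j <> None by apply: (nd_children coh E); rewrite inE eqxx.
rewrite H' // H ?E // (nd_den coh E) => ej; by exists e.
Qed.

Lemma type_succ (I : interp) (d : dom I) R i j t :
  has_type d t -> nd i = Some (NEx R j) -> bit t i ->
  exists e t', [/\ role_int R d e, has_type e t' & bit t' j].
Proof.
move=> [_ H] E; rewrite H ?E // (nd_den coh E) => -[e re ej].
have [t' [t'B H']] := type_exists e; exists e, t'; split=> //.
by rewrite H' //; apply: (nd_children coh E); rewrite inE eqxx.
Qed.

Lemma type_good (I : interp) (d : dom I) t :
  (forall x, List.In x T1 -> sat_inclusion I x) -> has_type d t -> ~ Bad t.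
Proof.
move=> HT Ht /(_ (fun t => forall d : dom I, ~ has_type d t)) H.
apply: (H _ d Ht) => {t d Ht H} t _ H d Ht; have [tB Hb] := Ht.
case: H => [|[i [R [j [E [ti H]]]]]].
  apply; split=> [i E|]; first by rewrite Hb ?E // (nd_den coh E).
  split=> [i j E|].
    rewrite !Hb ?E //; first by rewrite (nd_den coh E).
    by apply: (nd_children coh E); rewrite inE eqxx.
  split=> [i j k E|].
    rewrite !Hb ?E //; first by rewrite (nd_den coh E).
      by apply: (nd_children coh E); rewrite !inE eqxx orbT.
    by apply: (nd_children coh E); rewrite inE eqxx.
  split=> [i j A E1 E2|i j E].
    by rewrite !Hb ?E1 ?E2 // (nd_den coh E1) (nd_den coh E2).
  have [_ H] := inc1P coh; have [? ? Hin] := H _ _ E.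
  by rewrite !Hb //; apply: (HT _ Hin d).
have [e [t' [re Ht' b]]] := type_succ Ht E ti.
exact: (H t' (proj1 Ht') b (type_compat Ht Ht' re) e Ht').
Qed.

Lemma Kids_mono (X Y : nat -> nat -> nat -> Prop) o t s :
  (forall t s u, X t s u -> Y t s u) -> Kids X o t s -> Kids Y o t s.
Proof.
move=> XY [H1 H2]; split.
- move=> i R b E si; have [t' [s' [u' [? [? [? [/XY ? ?]]]]]]] := H1 i R b E si.
  by exists t', s', u'.
- move=> i R c E ti; have [t' [? [? [? [? H]]]]] := H2 i R c E ti.
  exists t'; do 4 split=> //; case: H => [|[u' [? [? /XY ?]]]]; first by left.
  by right; exists u'.
Qed.

Lemma PhiR_mono (X Y : nat -> nat -> nat -> Prop) t s u :
  (forall t s u, X t s u -> Y t s u) -> PhiR X t s u -> PhiR Y t s u.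
Proof.
move=> XY [? [? [? H]]]; do 3 split=> //.
case: H => [[? H]|[i [R [b [? [? [? H]]]]]]].
  by left; split=> //; exact: Kids_mono H.
by right; exists i, R, b; do 3 split=> //; exact: Kids_mono H.
Qed.

Lemma RT_closed t s u : t < B -> s < B -> u < B -> PhiR RT t s u -> RT t s u.
Proof.
move=> tB sB uB H X HX; apply: (HX) => //; apply: PhiR_mono H => ? ? ?; exact.
Qed.

(** ** The query entailed by a set *)

Fixpoint cm (m u : nat) : concept :=
  foldr CAnd CTop
    [seq match nd i with
         | Some (NName A) => if EM (K u i /\ A \in S2.1) then CName A else CTop
         | Some (NEx R b) =>
             if m is m'.+1 then
               if EM (K u i /\ R \in S2.2) then CEx R (cm m' (2 ^ b)) else CTop
             else CTop
         | _ => CTop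
         end | i <- iota 0 tok].

Lemma ext_conj (I : interp) (d : dom I) (T : Type) (f : T -> concept) l :
  ext (foldr CAnd CTop (map f l)) d <-> forall x, List.In x l -> ext (f x) d.
Proof.
elim: l => /= [|x l ->]; first by split.
by split=> [[h1 h2] y [<-|] //|H]; [exact: h2 | split=> [|y ?]; apply: H; [left|right]].
Qed.

Lemma In_iota i n : List.In i (iota 0 n) <-> i < n.
Proof.
suff H a : List.In i (iota a n) <-> a <= i < a + n by rewrite H.
elim: n a => [|n IH] a /=; first by split=> // /andP[]; lia.
rewrite IH; split=> [[->|]|] ; [lia|lia|].
by case: (eqVneq a i) => [|ne]; [left|right; lia].
Qed.

Definition names_hold (I : interp) (u : nat) (d : dom I) :=
  forall i A, nd i = Some (NName A) -> K u i -> A \in S2.1 -> conc_int A d.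

Lemma ext_cm (I : interp) (d : dom I) m u :
  ext (cm m u) d <-> names_hold u d /\
   (if m is m'.+1 then forall i R b, nd i = Some (NEx R b) -> K u i -> R \in S2.2 ->
      exists2 e, role_int R d e & ext (cm m' (2 ^ b)) e else True).
Proof.
have S i v : nd i = Some v -> List.In i (iota 0 tok).
  by move=> E; apply/In_iota; apply: (nd_lt coh); rewrite E.
case: m => [|m]; rewrite ext_conj; split.
- move=> H; split=> // i A E k As; have := H i (S _ _ E); rewrite E.
  by case: EM => //= -[]; split.
- move=> [H _] i _; case E: (nd i) => [[A||j|j k|R j]|] //=.
  by case: EM => //= -[k As]; apply: H E k As.
- move=> H; split=> [i A E k As|i R b E k Rs]; have := H i (S _ _ E); rewrite E.
  + by case: EM => //= -[]; split.
  + by case: EM => //= -[]; split.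
- move=> [H H'] i _; case E: (nd i) => [[A||j|j k|R j]|] //=.
  + by case: EM => //= -[k As]; apply: H E k As.
  + by case: EM => //= -[k As]; apply: H' E k As.
Qed.

Lemma K_mono s s' i : s' < B -> (forall j, bit s j -> bit s' j) -> K s i -> K s' i.
Proof.
move=> s'B sub /(_ (fun s i => forall s', s' < B -> (forall j, bit s j -> bit s' j) -> K s' i)).
apply=> // {s s' s'B sub i} s i _ iB H s' s'B sub.
apply: K_closed => //.
case: H => [/sub|[|[[j [k [E [/(_ _ s'B sub) ? /(_ _ s'B sub) ?]]]]|[[a [k [/(_ _ s'B sub) ? ?]]]|[[a [j [/(_ _ s'B sub) ? ?]]]|[[a [/(_ _ s'B sub) ? ?]]|[[a [A [/(_ _ s'B sub) ? [? ?]]]]|[a [R [b [c [/(_ _ s'B sub) ? [E [H ?]]]]]]]]]]]]]].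
- by left.
- by right; left.
- by do 2 right; left; exists j, k.
- by do 3 right; left; exists a, k.
- by do 4 right; left; exists a, j.
- by do 5 right; left; exists a.
- by do 6 right; left; exists a, A.
- do 7 right; exists a, R, b, c; do 3 split=> //; apply: H => //.
  by apply: pow_nd_lt; apply: (nd_children coh E); rewrite inE eqxx.
Qed.

Lemma Incons_mono s s' : s' < B -> (forall j, bit s j -> bit s' j) -> Incons s -> Incons s'.
Proof.
move=> s'B sub H; apply: Incons_closed => //.
have : PhiI Incons s.
  apply: H => u uB [H|[i [R [b [k [E H]]]]]]; first by left.
  right; exists i, R, b; do 2 split=> //; apply: Incons_closed H.
  by apply: pow_nd_lt; apply: (nd_children coh E); rewrite inE eqxx.
case=> [[i [j [k1 [E k2]]]]|[i [R [b [k1 [E H1]]]]]].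
  by left; exists i, j; split; [exact: K_mono k1|split=> //; exact: K_mono k2].
by right; exists i, R, b; split=> //; exact: K_mono k1.
Qed.

Definition compr (P : nat -> Prop) : nat :=
  proj1_sig (constructive_indefinite_description _ (comprehension P tok.+1)).

Lemma compr_lt P : compr P < B.
Proof. by rewrite /compr; case: constructive_indefinite_description => ? []. Qed.

Lemma comprP P i : i <= tok -> bit (compr P) i <-> P i.
Proof. by rewrite /compr; case: constructive_indefinite_description => ? [? H] /=; exact: H. Qed.

(** ** EL concepts and the canonical model of [T2] *)

Fixpoint el (C : concept) : bool :=
  match C with
  | CName _ | CTop => true
  | CNot _ => false
  | CAnd C D => el C && el D
  | CEx _ C => el C
  end.

Fixpoint el_disjoint (C : concept) : bool :=
  match C with
  | CName _ | CTop => true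
  | CNot C => el C
  | CAnd C D => el_disjoint C && el_disjoint D
  | CEx _ C => el_disjoint C
  end.

Lemma not_occurs_el C : (forall D, ~ occurs true (CNot D) C) -> el C.
Proof.
elim: C => //= [C _ H|C IHC D IHD H|R C IH H].
- by case: (H C); left.
- by rewrite IHC ?IHD // => E HE; apply: (H E); right; [right|left].
- by apply: IH => E HE; apply: (H E); right.
Qed.

Lemma not_occurs_el_disjoint C : (forall D, ~ occurs false (CNot D) C) -> el_disjoint C.
Proof.
elim: C => //= [C _ H|C IHC D IHD H|R C IH H].
- by apply: not_occurs_el => E HE; apply: (H E); right.
- by rewrite IHC ?IHD // => E HE; apply: (H E); right; [right|left].
- by apply: IH => E HE; apply: (H E); right.
Qed.

Lemma horn_el x : horn T2 -> List.In x T2 -> el (lhs x) /\ el_disjoint (rhs x).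
Proof.
move=> [H _] xT; split.
  by apply: not_occurs_el => D HD; apply: (H D); exists x => //; left.
by apply: not_occurs_el_disjoint => D HD; apply: (H D); exists x => //; right.
Qed.

Lemma nd_nd i : nd i <> None -> exists v, nd i = Some v /\ den i = denotes v.
Proof. by case E: (nd i) => [v|] // _; exists v; split=> //; exact: nd_den. Qed.

Lemma canonical_sat (I : interp) (lab : dom I -> nat) :
  horn T2 ->
  (forall x, lab x < B /\ ~ Incons (lab x)) ->
  (forall A x, conc_int A x <-> exists i, nd i = Some (NName A) /\ K (lab x) i) ->
  (forall R x y c i, role_int R x y -> K (lab y) c -> nd i = Some (NEx R c) -> K (lab x) i) ->
  (forall i R b x, K (lab x) i -> nd i = Some (NEx R b) ->
     exists y, role_int R x y /\ K (lab y) b) ->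
  forall x, List.In x T2 -> sat_inclusion I x.
Proof.
move=> hT cons Hc Hr He.
have El : forall C i x, el C -> nd i <> None -> den i = C -> ext C x -> K (lab x) i.
  elim=> [A||C _|C IHC D IHD|R C IH] i x elC /nd_nd[v [E ->]];
    case: v E => [A'||j|j k|R' j] E //= Ev; have lB := (cons x).1; (have iB : i < B by apply: nd_lt_B; rewrite E).
  - case: Ev => <- /= /Hc[i' [E' k]]; apply: K_closed => //.
    by do 6 right; left; exists i', A'.
  - by move=> _; apply: K_closed => //; right; left.
  - case: Ev => Ej Ek; move=> [xC xD]; have /andP[eC eD] := elC.
    apply: K_closed => //; do 2 right; left; exists j, k; split=> //.
    split; [apply: (IHC _ _ _ _ Ej xC) | apply: (IHD _ _ _ _ Ek xD)] => //;
      by apply: (nd_children coh E); rewrite !inE eqxx ?orbT.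
  - case: Ev => <- Ej [y ry yC].
    apply: (Hr _ _ _ _ _ ry (IH j y elC _ Ej yC) E).
    by apply: (nd_children coh E); rewrite inE eqxx.
have Po : forall C i x, el_disjoint C -> nd i <> None -> den i = C -> K (lab x) i -> ext C x.
  elim=> [A||C _|C IHC D IHD|R C IH] i x eC /nd_nd[v [E ->]];
    case: v E => [A'||j|j k|R' j] E //= Ev k1; have lB := (cons x).1.
  - by case: Ev => <-; apply/Hc; exists i.
  - move=> xC; case: Ev => Ej; case: (cons x) => _; apply; apply: Incons_closed => //.
    left; exists i, j; do 2 split=> //; apply: (El _ _ _ eC _ Ej xC).
    by apply: (nd_children coh E); rewrite inE eqxx.
  - have /andP[eC' eD'] := eC; case: Ev => Ej Ek.
    have nj : nd j <> None by apply: (nd_children coh E); rewrite inE eqxx.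
    have nk : nd k <> None by apply: (nd_children coh E); rewrite !inE eqxx orbT.
    split; [apply: (IHC _ _ _ _ Ej) | apply: (IHD _ _ _ _ Ek)] => //;
      apply: K_closed => //; try exact: nd_lt_B.
      by do 3 right; left; exists i, k.
    by do 4 right; left; exists i, j.
  - case: Ev => <- Ej; have [y [ry ky]] := He _ _ _ _ k1 E; exists y => //.
    by apply: (IH _ _ _ _ Ej ky) => //; apply: (nd_children coh E); rewrite inE eqxx.
move=> x xT d; have [eL eR] := horn_el hT xT.
have [H _] := inc2P coh; have [i [j [ij Ex]]] := H _ xT.
have [_ H'] := inc2P coh; have [ni nj _] := H' _ _ ij.
rewrite Ex in eL eR *; move=> /= dl; apply: (Po _ _ _ eR nj erefl).
apply: K_closed; [exact: (cons d).1 | exact: nd_lt_B|].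
by do 5 right; left; exists i; split=> //; apply: (El _ _ _ eL ni erefl dl).
Qed.

Lemma all_In (T : Type) (p : pred T) l x : all p l -> List.In x l -> p x.
Proof. by elim: l => //= y l IH /andP[py pl] [<-|/(IH pl)]. Qed.

Section FromABox.
Variables (A : abox) (I1 J : interp).
Hypothesis overA : abox_over S1 A.
Hypothesis modI : model T1 A I1.
Hypothesis modJ : model T2 A J.
Hypothesis hornT2 : horn T2.

Fixpoint base (k : nat) (a : name) : nat :=
  if k is k'.+1 then compr (fun i =>
    (exists C, nd i = Some (NName C) /\ List.In (AConcept C a) A) \/
    (exists R b c, nd i = Some (NEx R b) /\ List.In (ARole R a c) A /\ K (base k' c) b))
  else 0.

Lemma base_lt k a : base k a < B.
Proof. by case: k => [|k]; [exact: B_gt0 | exact: compr_lt]. Qed.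

Lemma base_bit k a i : bit (base k.+1 a) i <->
    (exists C, nd i = Some (NName C) /\ List.In (AConcept C a) A) \/
    (exists R b c, nd i = Some (NEx R b) /\ List.In (ARole R a c) A /\ K (base k c) b).
Proof.
case: (leqP i tok) => it; first exact: comprP.
have nn v : nd i <> Some v.
  by move=> E; have : i < tok; [apply: (nd_lt coh); rewrite E | lia].
split=> [H|]; last by case=> [[C [/nn]]|[R [b [c [/nn]]]]].
by have := bit_lt_B (base_lt k.+1 a) H; rewrite /= bit_small // in H;
  apply: leq_trans (base_lt k.+1 a) _; apply: leq_pexp2l.
Qed.

Lemma base_sound k a j : bit (base k a) j -> nd j <> None /\ ext (den j) (indiv J a).
Proof.
elim: k a j => [|k IH] a j; first by rewrite bit0.
move=> /base_bit[[C [E HC]]|[R [b [c [E [HR Kb]]]]]].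
  by rewrite (nd_den coh E) E; split=> //; exact: (modJ.2 _ HC).
have [_ e1] := K_sound modJ.1 (IH c) Kb.
rewrite (nd_den coh E) E; split=> //; exists (indiv J c) => //.
exact: (modJ.2 _ HR).
Qed.

Definition bs (k : nat) (x : dom I1) : nat := if x is inl a then base k a else 0.

Lemma bs_lt k x : bs k x < B.
Proof. by case: x => [a|y]; [exact: base_lt | exact: B_gt0]. Qed.

Lemma bs_cons k x : ~ Incons (bs k x).
Proof.
case: x => [a|y]; first exact: Incons_sound modJ.1 (base_sound (a := a)).
by apply: (Incons_sound (d := indiv J [::])) modJ.1 _ => j; rewrite bit0.
Qed.

Lemma Sok_bs k x t : has_type x t -> Sok t (bs k x).
Proof.
move=> [_ Ht] i; case: x Ht => [a|y] Ht /=; last by rewrite bit0.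
case: k => [|k]; first by rewrite bit0.
move=> /base_bit[[C [E HC]]|[R [b [c [E [HR Kb]]]]]]; [left; exists C|right; exists R, b].
  split=> //; split; first by have := all_In overA HC.
  by rewrite Ht ?E // (nd_den coh E); exact: (modI.2 _ HC).
by split=> //; have := all_In overA HR.
Qed.

Lemma Kids_bs (o : name -> nat -> Prop) t k x : has_type x t ->
  (forall R e t' k', role_int R x e -> has_type e t' -> k' < k ->
     exists u', u' < B /\ o R u' /\ RT t' (bs k' e) u') ->
  (forall R e t', role_int R x e -> has_type e t' ->
     (forall u', o R u') \/ exists u', u' < B /\ o R u' /\ RT t' 0 u') ->
  Kids RT o t (bs k x).
Proof.
move=> Ht H1 H2; split.
- move=> i R b E; case: x Ht H1 H2 => [a|y] Ht H1 H2 /=; last by rewrite bit0.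
  case: k H1 => [|k] H1; first by rewrite bit0.
  move=> /base_bit[[C []]|[R' [b' [c [E' [HR Kb]]]]]]; first by rewrite E.
  move: E'; rewrite E => -[ER Eb]; subst R' b'.
  have rc : role_int R (inl a : dom I1) (inl c) by exact: (modI.2 _ HR).
  have [t' Ht'] := type_exists (inl c : dom I1).
  have [u' [u'B [ou RTu]]] := H1 R _ _ k rc Ht' (ltnSn k).
  exists t', (base k c), u'; do 2 (split; first by [exact: Ht'.1 | exact: base_lt]).
  do 2 split=> //; split; first exact: type_compat Ht Ht' rc.
  split=> //; split=> // d i' Kd Ei'.
  by apply/base_bit; right; exists R, d, c.
- move=> i R c E ti; have [e [t' [re Ht' b]]] := type_succ Ht E ti.
  exists t'; split; first exact: Ht'.1.
  split; first exact: type_good modI.1 Ht'.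
  split=> //; split; first exact: type_compat Ht Ht' re.
  case: (H2 R e t' re Ht') => [H|[u' [? [? ?]]]]; [by left|by right; exists u'].
Qed.

Lemma refute m : forall k (x : dom I1) t u, has_type x t -> u < B ->
  ~ ext (cm m u) x \/ bit u tok -> RT t (bs k x) u.
Proof.
elim/ltn_ind: m => m IHm; elim/ltn_ind=> k IHk x t u Ht uB H.
have tokB : 2 ^ tok < B by exact: pow_lt_B.
have tokb : bit (2 ^ tok) tok by rewrite bit_pow eqxx.
apply: RT_closed => //; [exact: Ht.1 | exact: bs_lt|].
split; first exact: type_good modI.1 Ht.
split; first exact: Sok_bs Ht.
split; first exact: bs_cons.
have free : Kids RT no_goal t (bs k x).
  apply: Kids_bs Ht _ _ => [R e t' k' re Ht' kk|R e t' re Ht']; last by left.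
  by exists (2 ^ tok); do 2 split=> //; apply: IHk => //; right.
case: H => [|tu]; last by left; split=> //; left.
rewrite ext_cm => H.
case: (classic (names_hold u x)) => [Hn|Hn]; last first.
  left; split=> //; right; apply: NNPP => Hc; apply: Hn => i C E k1 CS.
  apply: NNPP => nC; apply: Hc; exists i, C; do 3 split=> //.
  by rewrite Ht.2 ?E // (nd_den coh E).
right; case: m IHm IHk H => [|m] IHm IHk H; first by case: H.
apply: NNPP => Hc; apply: H; split=> // i R b E k1 RS; apply: NNPP => He.
have bB : 2 ^ b < B by apply: pow_nd_lt; apply: (nd_children coh E); rewrite inE eqxx.
apply: Hc; exists i, R, b; do 3 split=> //.
apply: Kids_bs Ht _ _ => [R' e t' k' re Ht' kk|R' e t' re Ht'].
  case: (classic (R' = R)) => [ER|nR].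
    exists (2 ^ b); do 2 split=> //; apply: (IHm m (ltnSn m)) => //.
    by left => ee; apply: He; exists e; rewrite -?ER.
  by exists (2 ^ tok); split=> //; split; [move/nR | apply: IHk => //; right].
case: (classic (R' = R)) => [ER|nR]; last by left => u' /nR.
right; exists (2 ^ b); do 2 split=> //; have := IHm m (ltnSn m) 0 e t' (2 ^ b) Ht' bB.
have -> : bs 0 e = 0 by case: e {re Ht'}.
by apply; left => ee; apply: He; exists e; rewrite -?ER.
Qed.

Lemma In_ind a : a \in ind A -> exists x, List.In x A /\ a \in ind_assertion x.
Proof.
rewrite /ind; elim: A => //= x l IH; rewrite mem_cat => /orP[ax|/IH[y [yl ay]]].
  by exists x; split=> //; left.
by exists y; split=> //; right.
Qed.

Lemma not_final_cm : ~ Final -> forall k m a, a \in ind A ->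
  ext (cm m (base k.+1 a)) (indiv I1 a).
Proof.
move=> nF k m a aA; apply: NNPP => ne; apply: nF.
set x : dom I1 := indiv I1 a.
have [t Ht] := type_exists x.
have R0 := @refute m k.+1 x t _ Ht (base_lt k.+1 a) (or_introl ne).
exists t, (base k.+1 a); do 2 (split; first by [exact: Ht.1 | exact: base_lt]).
split; first exact: R0.
case: (classic (base k.+1 a = 0)) => [s0|]; last by left.
have [[C b|R b c] [xA /=]] := In_ind aA; rewrite !inE.
  move/eqP=> ab; subst b; have [i E] := sig_name coh (all_In overA xA).
  have : bit (base k.+1 a) i by apply/base_bit; left; exists C.
  by rewrite s0 bit0.
case/orP=> /eqP ab; subst a.
  have [i [j [E Ej]]] := sig_role coh (all_In overA xA).
  have : bit (base k.+1 b) i.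
    apply/base_bit; right; exists R, j, c; do 2 split=> //.
    apply: K_closed; [exact: base_lt | by apply: nd_lt_B; rewrite Ej | by right; left].
  by rewrite s0 bit0.
right; have [i [j [E Ej]]] := sig_role coh (all_In overA xA).
set y : dom I1 := indiv I1 b.
have [t0 Ht0] := type_exists y.
have tokB : 2 ^ tok < B by exact: pow_lt_B.
exists t0, (base k.+2 b), i, R, j.
split; first exact: Ht0.1.
split; first exact: base_lt.
split.
  apply: (@refute 0 k.+2 y t0 _ Ht0 tokB).
  by right; rewrite bit_pow eqxx.
split=> //; split.
  apply/base_bit; right; exists R, j, c; do 2 split=> //.
  apply: K_closed; [exact: base_lt | by apply: nd_lt_B; rewrite Ej | by right; left].
split; first by apply: type_compat Ht0 Ht _; exact: (modI.2 _ xA).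
by move=> d i' Kd Ei'; apply/base_bit; right; exists R, d, c.
Qed.

Lemma base_mono k k' a i : k <= k' -> bit (base k a) i -> bit (base k' a) i.
Proof.
elim: k k' a i => [|k IH] [|k'] a i //; first by rewrite bit0.
rewrite ltnS => kk /base_bit[H|[R [b [c [E [H Kb]]]]]]; apply/base_bit; first by left.
right; exists R, b, c; do 2 split=> //; apply: K_mono Kb; first exact: base_lt.
by move=> j; apply: IH.
Qed.

Lemma base_stable : exists k, forall a i, bit (base k.+2 a) i -> bit (base k.+1 a) i.
Proof.
suff [k Hk] : exists k, forall a, a \in ind A -> forall i k', bit (base k' a) i -> bit (base k a) i.
  exists k => a i; case: (boolP (a \in ind A)) => aA Hb.
    by apply: base_mono (Hk a aA _ _ Hb).
  have nA x : List.In x A -> a \in ind_assertion x -> False.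
    move=> xA ax; move/negP: aA; apply; rewrite /ind; elim: A xA => //= y l IH [->|/IH H];
      by rewrite mem_cat ?ax ?H ?orbT.
  by move/base_bit: Hb => [[C [_ /nA H]]|[R [b [c [_ [/nA H _]]]]]]; case: H; rewrite /= inE eqxx.
elim: (ind A) => [|a l [k Hk]]; first by exists 0.
have [k1 Hk1] : exists k, forall i, i < tok.+1 -> forall k', bit (base k' a) i -> bit (base k a) i.
  apply: bounded_max => [i k1 k2 k12 H k' /H|i _]; first exact: base_mono.
  case: (classic (exists k', bit (base k' a) i)) => [[k' H]|H]; first by exists k'.
  by exists 0 => k' Hk'; case: H; exists k'.
exists (maxn k k1) => b; rewrite inE => /orP[/eqP->|bl] i k' Hb; last first.
  by apply: base_mono (Hk b bl _ _ Hb); lia.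
case: (leqP i tok) => it.
  by apply: base_mono (Hk1 i it _ Hb); lia.
move: Hb; rewrite bit_small //; apply: leq_trans (base_lt k' a) _.
exact: leq_pexp2l.
Qed.

Section Tree.
Variable k0 : nat.
Hypothesis stable : forall a i, bit (base k0.+2 a) i -> bit (base k0.+1 a) i.

Definition child_set (j : nat) : nat :=
  if nd j is Some (NEx R b) then if EM (Incons (2 ^ b)) then 0 else 2 ^ b else 0.

(* The anonymous element [(a, j, p)] is reached from the individual [a] by the
   existential restrictions listed, last one first, in [j :: p]. *)
Definition lab (x : name + name * nat * seq nat) : nat :=
  match x with inl a => base k0.+1 a | inr (_, j, _) => child_set j end.

Definition tr (a : name) (p : seq nat) : name + name * nat * seq nat :=
  if p is j :: p' then inr (a, j, p') else inl a.

Definition tree : interp := @Interp (name * nat * seq nat)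
  (fun C x => exists i, nd i = Some (NName C) /\ K (lab x) i)
  (fun R x y =>
     (exists a c, x = inl a /\ y = inl c /\ List.In (ARole R a c) A) \/
     (exists a j p b, y = inr (a, j, p) /\ x = tr a p /\
        nd j = Some (NEx R b) /\ K (lab x) j)).

Lemma trP x : exists a p, x = tr a p.
Proof. by case: x => [a|[[a j] p]]; [exists a, [::]|exists a, (j :: p)]. Qed.

Lemma lab_ok x : lab x < B /\ ~ Incons (lab x).
Proof.
have I0 : ~ Incons 0 := @bs_cons 0 (inl [::]).
case: x => [a|[[a j] p]] /=.
  by split; [exact: (base_lt k0.+1 _) | exact: (@bs_cons k0.+1 (inl a))].
rewrite /child_set; case E: (nd j) => [[C||i|i l|R b]|]; try by split; [exact: B_gt0|].
case: EM => nI; split=> //; first exact: B_gt0.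
by apply: pow_nd_lt; apply: (nd_children coh E); rewrite inE eqxx.
Qed.

Lemma child_setE x j R b : K (lab x) j -> nd j = Some (NEx R b) -> child_set j = 2 ^ b.
Proof.
move=> Kj E; rewrite /child_set E; case: EM => // IB; case: (lab_ok x) => xB; case.
by apply: Incons_closed => //; right; exists j, R, b.
Qed.

Lemma tree_model : model T2 A tree.
Proof.
split.
  apply: (canonical_sat (lab := lab : dom tree -> nat)) hornT2 _ _ _ _.
  - exact: lab_ok.
  - by [].
  - move=> R x y c i [[a [d [-> [-> HR]]]]|[a [j [p [b [-> [Ex [E Kj]]]]]]]] Kc Ei.
      apply: K_base; first exact: (base_lt k0.+1 _).
      by apply: stable; apply/base_bit; right; exists R, c, d.
    rewrite /= (child_setE Kj E) in Kc; apply: K_closed; first exact: (lab_ok x).1.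
      by apply: nd_lt_B; rewrite Ei.
    by do 7 right; exists j, R, b, c.
  - move=> i R b x Ki E; have [a [p Ex]] := trP x.
    exists (inr (a, i, p)); split; first by right; exists a, i, p, b.
    rewrite /= (child_setE Ki E); apply: K_pow.
    by apply: (nd_children coh E); rewrite inE eqxx.
move=> [C a|R a c] Hin /=; last by left; exists a, c.
have [i E] := sig_name coh (all_In overA Hin).
by exists i; split=> //; apply: K_base; [exact: (base_lt k0.+1 _) | apply/base_bit; left; exists C].
Qed.

Hypothesis cmI : forall m a, a \in ind A -> ext (cm m (base k0.+1 a)) (indiv I1 a).

Fixpoint good (a : name) (p : seq nat) : Prop :=
  if p is j :: p' then good a p' /\
    exists R b, [/\ nd j = Some (NEx R b), R \in S2.2 & K (lab (tr a p')) j]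
  else True.

Fixpoint gp (m : nat) (a : name) (p : seq nat) : dom I1 :=
  if p is j :: p' then
    match EM (exists e, exists R b, [/\ nd j = Some (NEx R b),
        role_int R (gp m a p') e & ext (cm (m - (size p').+1) (2 ^ b)) e]) with
    | left H => proj1_sig (constructive_indefinite_description _ H)
    | right _ => indiv I1 a
    end
  else indiv I1 a.

Lemma gp_ok m a p : a \in ind A -> good a p -> size p <= m ->
  ext (cm (m - size p) (lab (tr a p))) (gp m a p) /\
  (if p is j :: p' then forall R b, nd j = Some (NEx R b) ->
     role_int R (gp m a p') (gp m a p) else True).
Proof.
move=> aA; elim: p => [|j p IH] /=; first by rewrite subn0 => _ _; split=> //; apply: cmI.
move=> [gd [R [b [E RS Kj]]]] pm; have [IH1 _] := IH gd (ltnW pm).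
rewrite (child_setE Kj E); case: EM => [H|H]; last first.
  case: H; move: IH1; rewrite (_ : m - size p = (m - (size p).+1).+1); last lia.
  by move/ext_cm => [_ /(_ j R b E Kj RS)[e re ee]]; exists e, R, b.
case: constructive_indefinite_description => e /= [R' [b' [E' re ee]]].
move: E'; rewrite E => -[ER Eb]; subst R' b'; split=> // R1 b1 [<- _] //.
Qed.

Lemma has_In (T : Type) (p : pred T) l : has p l -> exists x, List.In x l /\ p x.
Proof.
elim: l => //= x l IH /orP[px|/IH[y [yl py]]]; first by exists x; split=> //; left.
by exists y; split=> //; right.
Qed.

Lemma tree_transfer q ans : is_rCQ q -> query_over S2 q -> {subset ans <= ind A} ->
  sat_query tree q ans -> sat_query I1 q ans.
Proof.
move=> [cq rooted_q] qS ansA [h [hans hat]].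
pose vars := answer_vars q ++ quant_vars q.
pose ok x := exists a p, [/\ h x = tr a p, a \in ind A & good a p].
have ok_ans x : x \in answer_vars q -> ok x.
  move=> xq; have xi : index x (answer_vars q) < size (answer_vars q) by rewrite index_mem.
  have sz : size ans = size (answer_vars q) by rewrite -(size_map (indiv tree)) -hans size_map.
  exists (nth [::] ans (index x (answer_vars q))), [::]; split=> //.
    have := congr1 (fun l => nth (inl [::]) l (index x (answer_vars q))) hans.
    by rewrite (nth_map 0) // (nth_map [::]) ?sz // nth_index.
  by apply: ansA; apply: mem_nth; rewrite sz.
have tr_inj a p a' p' : tr a p = tr a' p' -> a = a' /\ p = p'.
  by case: p p' => [|j p] [|j' p'] //=; [case=> -> | case=> -> -> ->].
have ok_step u v : query_edge q u v -> ok u -> ok v.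
  move=> /has_In[t [tin]]; case: t tin => [//|R z z'] tin /orP uv.
  have RS : R \in S2.2 by exact: (all_In qS tin).
  have /= rz := hat _ tin.
  have H : (ok z -> ok z') /\ (ok z' -> ok z).
    case: rz => [[a [c [ha [hc HR]]]]|[a [j [p [b [hc [ha [E Kj]]]]]]]].
      have indA x : List.In x A -> {subset ind_assertion x <= ind A}.
        rewrite /ind => + y yx; elim: A => //= x' l IH [->|/IH H];
          by rewrite mem_cat ?yx ?H ?orbT.
      have sub := indA _ HR.
      split=> _; [exists c, [::]|exists a, [::]]; split=> //; apply: sub;
        by rewrite !inE eqxx ?orbT.
    split=> [[a' [p' [e a'A gd]]]|[a' [p' [e a'A gd]]]].
      have [ea ep] := tr_inj _ _ _ _ (etrans (esym ha) e); subst a' p'.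
      exists a, (j :: p); split=> //; split=> //; exists R, b; split=> //.
      by rewrite -ha.
    have [ea ep] := tr_inj a (j :: p) _ _ (etrans (esym hc) e); subst a' p'.
    by exists a, p; split=> //; case: gd.
  by case: uv => /eqP[-> ->]; [exact: H.1 | exact: H.2].
have ok_vars x : x \in vars -> ok x.
  rewrite mem_cat => /orP[/ok_ans //|/rooted_q[y [p [yq py <-]]]].
  elim: p y {yq} py (ok_ans _ yq) => //= z p IH y /andP[yz pz] oky.
  by apply: IH => //; apply: ok_step oky.
pose dp x := if h x is inr (_, _, p) then (size p).+1 else 0.
pose m := \max_(x <- vars) dp x.
pose g (x : dom tree) : dom I1 :=
  match x with inl a => indiv I1 a | inr (a, j, p) => gp m a (j :: p) end.
have gtr a p : g (tr a p) = gp m a p by case: p.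
have dpm x a p : x \in vars -> h x = tr a p -> size p <= m.
  move=> xv E; have -> : size p = dp x by rewrite /dp E; case: (p).
  exact: leq_bigmax_seq.
have atv t z : List.In t (atoms q) -> z \in atom_vars t -> z \in vars.
  move=> tin; have /andP[_ Hall] := cq; have := all_In Hall tin => /allP H /H //.
exists (g \o h); split.
  by rewrite map_comp hans -map_comp.
move=> t tin; have := hat t tin; have atz := atv t _ tin; case: t tin atz => [C z|R z z'] tin atz /=.
  move=> [i [E Ki]]; have zv : z \in vars by apply: atz; rewrite inE eqxx.
  have [a [p [hz aA gd]]] := ok_vars z zv; rewrite hz gtr.
  have [H _] := gp_ok aA gd (dpm _ _ _ zv hz); move/ext_cm: H => [H _].
  by apply: (H i) => //; [rewrite -hz | exact: (all_In qS tin)].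
have zv : z \in vars by apply: atz; rewrite inE eqxx.
have zv' : z' \in vars by apply: atz; rewrite !inE eqxx orbT.
case=> [[a [c [-> [-> HR]]]]|[a [j [p [b [hc [ha [E Kj]]]]]]]].
  exact: (modI.2 _ HR).
have [a' [p' [hz' aA gd]]] := ok_vars z' zv'.
have [ea ep] := tr_inj a (j :: p) _ _ (etrans (esym hc) hz'); subst a' p'.
have [_ H] := gp_ok aA gd (dpm _ _ _ zv' hz').
by rewrite ha hc gtr; apply: (H R b).
Qed.
End Tree.
End FromABox.

Theorem not_final_entails : horn T2 -> ~ Final -> rCQ_entails S1 S2 T1 T2.
Proof.
move=> hT nF A overA _ [J modJ] q rq qS ans sz ansA cert I1 modI.
have [k0 stable] := base_stable overA.
have cmI m a : a \in ind A -> ext (cm m (base A k0.+1 a)) (indiv I1 a).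
  exact: (not_final_cm overA modI modJ nF).
apply: (tree_transfer overA modI modJ cmI rq qS ansA).
exact: cert (tree_model I1 overA modJ hT stable).
Qed.

(** ** From a concept to a rooted query *)

Definition qvar (p : seq bool) : var := (pickle p).+1.

Lemma qvar_inj p p' : qvar p = qvar p' -> p = p'.
Proof. by case; apply: (pcan_inj (@pickleK _)). Qed.

Fixpoint catoms (C : concept) (v : var) (p : seq bool) : seq atom :=
  match C with
  | CName A => [:: QConcept A v]
  | CTop | CNot _ => [::]
  | CAnd C D => catoms C v (true :: p) ++ catoms D v (false :: p)
  | CEx R C => QRole R v (qvar p) :: catoms C (qvar p) (true :: p)
  end.

Fixpoint qvars (C : concept) (p : seq bool) : seq var :=
  match C with
  | CName _ | CTop | CNot _ => [::]
  | CAnd C D => qvars C (true :: p) ++ qvars D (false :: p)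
  | CEx R C => qvar p :: qvars C (true :: p)
  end.

Definition concept_query (C : concept) : query :=
  Query [:: 0] (qvars C [::]) (catoms C 0 [::]).

Lemma mem_qvars C p x : x \in qvars C p -> exists l, x = qvar (l ++ p).
Proof.
elim: C p => //= [C IHC D IHD|R C IH] p.
  rewrite mem_cat => /orP[/IHC|/IHD] [l ->].
    by exists (rcons l true); rewrite cat_rcons.
  by exists (rcons l false); rewrite cat_rcons.
rewrite inE => /orP[/eqP->|/IH[l ->]]; first by exists [::].
by exists (rcons l true); rewrite cat_rcons.
Qed.

Lemma qvars_disjoint C D p x :
  x \in qvars C (true :: p) -> x \in qvars D (false :: p) -> False.
Proof.
move=> /mem_qvars[l ->] /mem_qvars[l' /qvar_inj H].
have sz : size l = size l' by have := congr1 size H; rewrite !size_cat /=; lia.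
have := congr1 (drop (size l)) H; rewrite drop_size_cat // sz drop_size_cat //.
Qed.

Lemma qvar_notin C p : qvar p \notin qvars C (true :: p).
Proof.
apply/negP => /mem_qvars[l /qvar_inj H].
by have := congr1 size H; rewrite size_cat /=; lia.
Qed.

Lemma uniq_qvars C p : uniq (qvars C p).
Proof.
elim: C p => //= [C IHC D IHD|R C IH] p; last by rewrite IH qvar_notin.
rewrite cat_uniq IHC IHD andbT /=; apply/hasPn => x xD; apply/negP => xC.
exact: qvars_disjoint xC xD.
Qed.

Lemma catoms_vars C v p t : List.In t (catoms C v p) ->
  {subset atom_vars t <= v :: qvars C p}.
Proof.
elim: C v p => //= [A|C IHC D IHD|R C IH] v p.
- by case=> // <- x; rewrite !inE.
- move=> /(@List.in_app_or _ _ _ _)[/IHC|/IHD] H x /H;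
    by rewrite !inE mem_cat => /orP[->|->]; rewrite ?orbT.
- case=> [<-|/IH H] x; first by rewrite !inE => /orP[->|->]; rewrite ?orbT.
  by move/H; rewrite !inE => /orP[->|->]; rewrite ?orbT.
Qed.

Lemma catoms_sat (I : interp) (h : var -> dom I) C v p : el C ->
  (forall t, List.In t (catoms C v p) -> sat_atom h t) -> ext C (h v).
Proof.
elim: C v p => //= [A|C IHC D IHD|R C IH] v p.
- by move=> _ /(_ (QConcept A v)); apply; left.
- move=> /andP[eC eD] H; split.
    by apply: (IHC v (true :: p)) => // t Ht; apply: H; apply: List.in_or_app; left.
  by apply: (IHD v (false :: p)) => // t Ht; apply: H; apply: List.in_or_app; right.
- move=> eC H; exists (h (qvar p)); first by apply: (H (QRole R v (qvar p))); left.
  by apply: (IH _ (true :: p)) => // t Ht; apply: H; right.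
Qed.

Lemma sat_atom_ext (I : interp) (h h' : var -> dom I) t :
  {in atom_vars t, h =1 h'} -> sat_atom h t -> sat_atom h' t.
Proof.
case: t => [A z|R z z'] /= H; first by rewrite -H ?inE ?eqxx.
by rewrite -!H ?inE ?eqxx ?orbT.
Qed.

Lemma ext_catoms (I : interp) C (h0 : var -> dom I) v p :
  v \notin qvars C p -> ext C (h0 v) ->
  exists h, (forall x, x \notin qvars C p -> h x = h0 x) /\
            forall t, List.In t (catoms C v p) -> sat_atom h t.
Proof.
elim: C h0 v p => [A||C _|C IHC D IHD|R C IH] h0 v p /=.
- by move=> _ HA; exists h0; split=> // t [<-|].
- by move=> _ _; exists h0.
- by move=> _ _; exists h0.
- rewrite mem_cat negb_or => /andP[vC vD] [eC eD].
  have [h1 [A1 H1]] := IHC _ _ _ vC eC.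
  rewrite -(A1 v vC) in eD; have [h2 [A2 H2]] := IHD _ _ _ vD eD.
  exists h2; split=> [x|t].
    by rewrite mem_cat negb_or => /andP[xC xD]; rewrite A2 // A1.
  move=> /(@List.in_app_or _ _ _ _)[Ht|/H2 //].
  apply: sat_atom_ext (H1 t Ht) => x /(catoms_vars Ht).
  rewrite inE => /orP[/eqP->|xC]; rewrite A2 //.
  by apply/negP => xD; apply: qvars_disjoint xC xD.
- rewrite inE negb_or => /andP[vp vC] [e re eC].
  pose h1 x := if x == qvar p then e else h0 x.
  have e1 : ext C (h1 (qvar p)) by rewrite /h1 eqxx.
  have [h [A H]] := IH h1 _ _ (qvar_notin C p) e1.
  exists h; split=> [x|t].
    by rewrite inE negb_or => /andP[xp xC]; rewrite A // /h1 (negbTE xp).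
  case=> [<-|/H //] /=.
  by rewrite !A ?qvar_notin // /h1 eqxx (negbTE vp).
Qed.

Lemma concept_query_sat (I : interp) C a : el C ->
  sat_query I (concept_query C) [:: a] <-> ext C (indiv I a).
Proof.
move=> eC; split=> [[h [[h0] H]]|H].
  by rewrite -h0; apply: catoms_sat H.
have n0 : 0 \notin qvars C [::] by apply/negP => /mem_qvars[].
have [h [A Hh]] := @ext_catoms I C (fun _ => indiv I a) 0 [::] n0 H.
by exists h; split=> //=; rewrite A.
Qed.

Lemma query_reach C v p (q : query) :
  (forall t, List.In t (catoms C v p) -> List.In t (atoms q)) ->
  forall y, y \in qvars C p -> exists l, path (query_edge q) v l /\ last v l = y.
Proof.
elim: C v p => //= [C IHC D IHD|R C IH] v p H y.
  rewrite mem_cat => /orP[] Hy.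
    by apply: (IHC v _ _ _ Hy) => t Ht; apply: H; apply: List.in_or_app; left.
  by apply: (IHD v _ _ _ Hy) => t Ht; apply: H; apply: List.in_or_app; right.
have e : query_edge q v (qvar p).
  have : List.In (QRole R v (qvar p)) (atoms q) by apply: H; left.
  rewrite /query_edge; elim: (atoms q) => //= t l IHl [->|/IHl ->]; last by rewrite orbT.
  by rewrite eqxx.
rewrite inE => /orP[/eqP->|Hy]; first by exists [:: qvar p]; rewrite /= e.
have [|l [pl ly]] := IH (qvar p) (true :: p) _ y Hy; first by move=> t Ht; apply: H; right.
by exists (qvar p :: l); rewrite /= e.
Qed.

Lemma In_all (T : Type) (p : pred T) l : (forall x, List.In x l -> p x) -> all p l.
Proof. by elim: l => //= x l IH H; rewrite H ?IH //; [move=> y yl; apply: H; right|left]. Qed.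

Lemma concept_query_rCQ C : is_rCQ (concept_query C).
Proof.
split.
  apply/andP; split.
    by rewrite /= uniq_qvars andbT; apply/negP => /mem_qvars[].
  apply: In_all => t Ht; apply/allP => x /(catoms_vars Ht); by [].
move=> y Hy; have [l [pl ly]] := @query_reach C 0 [::] (concept_query C) (fun t h => h) y Hy.
by exists 0, l; split=> //; rewrite inE.
Qed.

Fixpoint concept_over (S : signature) (C : concept) : bool :=
  match C with
  | CName A => A \in S.1
  | CTop => true
  | CNot C => concept_over S C
  | CAnd C D => concept_over S C && concept_over S D
  | CEx R C => (R \in S.2) && concept_over S C
  end.

Lemma concept_query_over S C : concept_over S C -> query_over S (concept_query C).
Proof.
rewrite /query_over /=; move: 0 [::]; elim: C => //= [A v p ->|C IHC D IHD v p|R C IH v p] //.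
  by move=> /andP[/IHC H /IHD H']; rewrite all_cat H H'.
by move=> /andP[-> /IH ->].
Qed.

Lemma el_over_cm m u : el (cm m u) && concept_over S2 (cm m u).
Proof.
have conj l : all (fun C => el C && concept_over S2 C) l ->
    el (foldr CAnd CTop l) && concept_over S2 (foldr CAnd CTop l).
  by elim: l => //= C l IH /andP[/andP[-> ->] /IH].
elim: m u => [|m IH] u; apply: conj; rewrite all_map; apply/allP => i _ /=;
  case: (nd i) => [[A||j|j k|R j]|] //; case: EM => //= -[_ ->] //.
Qed.

(** ** From the fixed point to a counterexample *)

Fixpoint RTn (k t s u : nat) : Prop :=
  if k is k'.+1 then t < B /\ s < B /\ u < B /\ PhiR (RTn k') t s u else False.

Lemma RTn_mono k k' t s u : k <= k' -> RTn k t s u -> RTn k' t s u.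
Proof.
elim: k k' t s u => [|k IH] [|k'] t s u //= kk [? [? [? H]]]; do 3 split=> //.
by apply: PhiR_mono H => t' s' u'; apply: IH.
Qed.

Lemma Kids_rank o t s :
  Kids (fun t s u => exists k, RTn k t s u) o t s -> exists k, Kids (RTn k) o t s.
Proof.
move=> [H1 H2].
have [k1 Hk1] : exists k, forall i, i < tok -> forall R b,
    nd i = Some (NEx R b) -> bit s i -> exists t' s' u',
     t' < B /\ s' < B /\ u' < B /\ RTn k t' s' u' /\ Compat R t t' /\ K s' b /\
     Incl_succ R s' s /\ o R u'.
  apply: bounded_max => [i k k' kk H R b E si|i _].
    have [t' [s' [u' [? [? [? [? H']]]]]]] := H R b E si.
    by exists t', s', u'; do 3 split=> //; split=> //; apply: RTn_mono kk _.
  case: (classic (exists R b, nd i = Some (NEx R b) /\ bit s i)) => [[R [b [E si]]]|N].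
    have [t' [s' [u' [? [? [? [[k Hk] H']]]]]]] := H1 i R b E si.
    exists k => R' b' E' _; move: E'; rewrite E => -[<- <-].
    by exists t', s', u'.
  by exists 0 => R b E si; case: N; exists R, b.
have [k2 Hk2] : exists k, forall i, i < tok -> forall R c,
    nd i = Some (NEx R c) -> bit t i -> exists t',
     t' < B /\ ~ Bad t' /\ bit t' c /\ Compat R t t' /\
     ((forall u', o R u') \/ exists u', u' < B /\ o R u' /\ RTn k t' 0 u').
  apply: bounded_max => [i k k' kk H R b E si|i _].
    have [t' [? [? [? [? H']]]]] := H R b E si.
    exists t'; do 4 split=> //; case: H' => [|[u' [? [? ?]]]]; first by left.
    by right; exists u'; do 2 split=> //; apply: RTn_mono kk _.
  case: (classic (exists R b, nd i = Some (NEx R b) /\ bit t i)) => [[R [b [E ti]]]|N].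
    have [t' [? [? [? [? H']]]]] := H2 i R b E ti.
    case: H' => [H'|[u' [? [? [k Hk]]]]].
      exists 0 => R' b' E' _; move: E'; rewrite E => -[<- <-].
      by exists t'; do 4 split=> //; left.
    exists k => R' b' E' _; move: E'; rewrite E => -[<- <-].
    by exists t'; do 4 split=> //; right; exists u'.
  by exists 0 => R b E ti; case: N; exists R, b.
have lt i v : nd i = Some v -> i < tok by move=> E; apply: (nd_lt coh); rewrite E.
exists (maxn k1 k2); split=> i R b E ei.
  have [t' [s' [u' [? [? [? [? H']]]]]]] := Hk1 i (lt _ _ E) R b E ei.
  exists t', s', u'; do 3 split=> //; split=> //.
  by apply: RTn_mono (leq_maxl k1 k2) _.
have [t' [? [? [? [? H']]]]] := Hk2 i (lt _ _ E) R b E ei.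
exists t'; do 4 split=> //; case: H' => [|[u' [? [? ?]]]]; first by left.
right; exists u'; do 2 split=> //.
by apply: RTn_mono (leq_maxr k1 k2) _.
Qed.

Lemma RT_rank t s u : RT t s u -> exists k, RTn k t s u.
Proof.
move=> /(_ (fun t s u => exists k, RTn k t s u)); apply.
move=> {}t {}s {}u tB sB uB [nB [Sk [nI H]]].
case: H => [[Tr /Kids_rank[k Hk]]|[i [R [b [Ki [E [RS /Kids_rank[k Hk]]]]]]]];
  exists k.+1; do 6 split=> //; first by left.
by right; exists i, R, b.
Qed.

(* [(t, s, u, k, o)]: the stage [k] and the reason [o] (the existential
   restriction refuted, if any) for which [(t, s, u)] enters [RT]. *)
Definition elt := (nat * nat * nat * nat * option nat)%type.
Definition eT (x : elt) := x.1.1.1.1.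
Definition eS (x : elt) := x.1.1.1.2.
Definition eU (x : elt) := x.1.1.2.
Definition eK (x : elt) := x.1.2.
Definition eO (x : elt) := x.2.

Definition valid (x : elt) : Prop :=
  [/\ eT x < B, eS x < B, eU x < B & ~ Bad (eT x)] /\
  [/\ Sok (eT x) (eS x), ~ Incons (eS x)
    & match eO x with
      | None => Triv (eT x) (eU x) /\ Kids (RTn (eK x)) no_goal (eT x) (eS x)
      | Some i => exists R b, [/\ K (eU x) i, nd i = Some (NEx R b), R \in S2.2
                                & Kids (RTn (eK x)) (goal R b) (eT x) (eS x)]
      end].

Lemma RTn_valid k t s u : RTn k.+1 t s u -> exists o, valid (t, s, u, k, o).
Proof.
move=> [tB [sB [uB [nB [Sk [nI H]]]]]].
case: H => [H|[i [R [b [Ki [E [RS H]]]]]]]; [exists None|exists (Some i)]; do 2 split=> //.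
by exists R, b.
Qed.

Lemma Kids_free X o t s : Kids X o t s -> Kids X no_goal t s.
Proof.
move=> [H1 H2]; split=> i R b E ei.
  have [t' [s' [u' [? [? [? [? [? [? [? ?]]]]]]]]]] := H1 i R b E ei.
  by exists t', s', u'.
by have [t' [? [? [? [? _]]]]] := H2 i R b E ei; exists t'; do 4 split=> //; left.
Qed.

Lemma valid_free t s k o : valid (t, s, 2 ^ tok, k, o) -> valid (t, s, 2 ^ tok, k, None).
Proof.
case: o => [i|//] [H [Sk nI [R [b [_ _ _ Hk]]]]]; split=> //; split=> //=.
by split; [left; rewrite /= bit_pow eqxx | exact: Kids_free Hk].
Qed.

Section Counterexample.
Variables (root : elt) (kmax : nat).
Hypothesis vroot : valid root.
Hypothesis hornT2 : horn T2.

Definition good_elt t : elt := (t, 0, 2 ^ tok, 0, None).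

Lemma Incons0 : ~ Incons 0.
Proof.
case: vroot => [[_ sB _ _] [_ nI _]] H; apply: nI; apply: Incons_mono H => // j.
by rewrite bit0.
Qed.

Lemma valid_good t : t < B -> ~ Bad t -> valid (good_elt t).
Proof.
move=> tB nb; split; split=> //=; [exact: B_gt0|exact: pow_lt_B| |exact: Incons0|].
  by move=> i; rewrite bit0.
split; first by left; rewrite bit_pow eqxx.
split=> [i R b _|i R c E ti]; first by rewrite bit0.
have [t' [? [? [? ?]]]] := good_succ tB nb E ti.
by exists t'; do 4 split=> //; left.
Qed.

Definition default := good_elt (eT root).

Lemma valid_default : valid default.
Proof. by case: vroot => [[? _ _ ?] _]; apply: valid_good. Qed.

Definition individual (x : elt) : name := nseq (pickle x) true.

Definition decode (a : name) : elt :=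
  if unpickle (size a) is Some x then if EM (valid x) then x else default else default.

Lemma decode_valid a : valid (decode a).
Proof.
rewrite /decode; case: unpickle => [x|]; last exact: valid_default.
by case: EM => //= nv; exact: valid_default.
Qed.

Lemma individualK x : valid x -> decode (individual x) = x.
Proof. by rewrite /decode /individual size_nseq pickleK; case: EM. Qed.

Definition edge (R : name) (x y : elt) : Prop :=
  Compat R (eT x) (eT y) /\
  forall i R0 b0, eO x = Some i -> nd i = Some (NEx R0 b0) -> R = R0 ->
    eU y = 2 ^ b0 /\ eK y < eK x.

Lemma abox_child x i R c : valid x -> nd i = Some (NEx R c) -> bit (eS x) i ->
  exists y, [/\ valid y, K (eS y) c, Incl_succ R (eS y) (eS x), edge R x y & eK y < eK x].
Proof.
move=> [_ [_ _ Ho]] E b; case Eo: (eO x) Ho => [j|].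
  move=> [R0 [b0 [Kj Ej RS0 [H1 _]]]].
  have [t' [s' [u' [? [? [? [RTu [cp [Kc [ii gu]]]]]]]]]] := H1 i R c E b.
  case Ek: (eK x) RTu => [|k] // RTu; have [o vy] := RTn_valid RTu.
  exists (t', s', u', k, o); split=> //.
  split=> // i' R' b'; rewrite Eo => -[<-]; rewrite Ej => -[E1 E2] ER; subst R' b'.
  by split; [exact: gu | rewrite Ek].
move=> [_ [H1 _]].
have [t' [s' [u' [? [? [? [RTu [cp [Kc [ii gu]]]]]]]]]] := H1 i R c E b.
case Ek: (eK x) RTu => [|k] // RTu; have [o vy] := RTn_valid RTu.
by exists (t', s', u', k, o); split=> //; split=> // i' R' b'; rewrite Eo.
Qed.

Definition node_model : interp := @Interp Empty_set
  (fun A x => if x is inl a then exists i, nd i = Some (NName A) /\ bit (eT (decode a)) i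
              else False)
  (fun R x y => if x is inl a then if y is inl c then edge R (decode a) (decode c)
                else False else False).

Lemma goal_unsat R b : ~ forall u', goal R b R u'.
Proof. by move=> /(_ (2 ^ b).+1 erefl); lia. Qed.

Lemma witness x i R c : valid x -> nd i = Some (NEx R c) -> bit (eT x) i ->
  exists y, [/\ valid y, bit (eT y) c & edge R x y].
Proof.
move=> [[tB sB uB nb] [Sk nI H]] E ti.
case Eo: (eO x) H => [j|]; last first.
  move=> [_ [_ H2]]; have [t' [? [? [? [? _]]]]] := H2 i R c E ti.
  by exists (good_elt t'); split=> //; [exact: valid_good | split=> //; rewrite Eo].
move=> [R0 [b0 [Kj Ej RS [_ H2]]]].
have [t' [t'B [nb' [bc [cp H]]]]] := H2 i R c E ti.
case: (classic (R = R0)) => [ER|nR]; last first.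
  exists (good_elt t'); split=> //; first exact: valid_good.
  by split=> // i' R' b'; rewrite Eo => -[<-]; rewrite Ej => -[<- _] /nR.
case: H => [|[u' [u'B [gu RTu]]]]; first by rewrite ER => /goal_unsat.
case Ek: (eK x) RTu => [|k] // RTu; have [o vy] := RTn_valid RTu.
exists (t', 0, u', k, o); split=> //; split=> //= i' R' b'.
by rewrite Eo => -[<-]; rewrite Ej => -[_ <-] _; split; [exact: gu | rewrite Ek /eK].
Qed.

Lemma node_truth C i a : nd i <> None -> den i = C ->
  ext C (indiv node_model a) <-> bit (eT (decode a)) i.
Proof.
elim: C i a => [A||C IH|C IHC D IHD|R C IH] i a /nd_nd[v [E ->]];
  case: v E => [A'||j|j k|R' j] E //= Ev;
  have va := decode_valid a; have [[tB _ _ nb] _] := va;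
  have [L1 [L2 [L3 [L4 L5]]]] := good_Loc tB nb.
- case: Ev => <-; split=> [[i' [E' b]]|b]; [exact: L4 E' E b | by exists i].
- by split=> // _; apply: L1.
- case: Ev => Ej; rewrite (L2 i j E) (IH j) //.
  by apply: (nd_children coh E); rewrite inE eqxx.
- case: Ev => Ej Ek; rewrite (L3 i j k E) (IHC j) // ?(IHD k) //;
    by apply: (nd_children coh E); rewrite !inE eqxx ?orbT.
- case: Ev => <- Ej.
  have nj : nd j <> None by apply: (nd_children coh E); rewrite inE eqxx.
  split=> [[[c|[]] [cp _] /(IH j c nj Ej) b]|b]; first exact: cp E b.
  have [y [vy by_ ey]] := witness va E b.
  by exists (indiv node_model (individual y)); [rewrite /= individualK | apply/(IH j); rewrite ?individualK].
Qed.

Lemma node_model_sat x : List.In x T1 -> sat_inclusion node_model x.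
Proof.
have [H H'] := inc1P coh => /H[i [j [ij ->]]] [a|[]] /=.
have [ni nj _] := H' _ _ ij; have [[tB _ _ nb] _] := decode_valid a.
have [_ [_ [_ [_ L5]]]] := good_Loc tB nb.
by move=> /(node_truth _ ni erefl) b; apply/(node_truth _ nj erefl); apply: L5 b.
Qed.

Definition elts : seq elt :=
  List.flat_map (fun t => List.flat_map (fun s => List.flat_map (fun u =>
  List.flat_map (fun k => List.flat_map (fun o =>
    if EM (valid (t, s, u, k, o)) then [:: (t, s, u, k, o)] else [::])
   (None :: map Some (iota 0 tok)))
   (iota 0 kmax)) (iota 0 B)) (iota 0 B)) (iota 0 B).

Lemma In_elts x : List.In x elts <-> valid x /\ eK x < kmax.
Proof.
split.
  move=> /List.in_flat_map[t [_ /List.in_flat_map[s [_ /List.in_flat_map[u [_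
    /List.in_flat_map[k [kk /List.in_flat_map[o [_]]]]]]]]]].
  by case: EM => // v [<-|//]; split=> //; apply/In_iota.
case: x => [[[[t s] u] k] o] [v kk]; have [[tB sB uB _] [_ _ Ho]] := v.
apply/List.in_flat_map; exists t; split; first exact/In_iota.
apply/List.in_flat_map; exists s; split; first exact/In_iota.
apply/List.in_flat_map; exists u; split; first exact/In_iota.
apply/List.in_flat_map; exists k; split; first exact/In_iota.
apply/List.in_flat_map; exists o; split; last by case: EM => [w|[]//]; left.
case: (o) Ho => [i /= [R [b [_ E _ _]]]|_]; last by left.
right; apply/List.in_map_iff; exists i; split=> //; apply/In_iota.
by apply: (nd_lt coh); rewrite E.
Qed.

Definition abox_of : abox :=
  List.flat_map (fun x => List.flat_map (fun i =>
    match nd i with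
    | Some (NName A) => if bit (eS x) i then [:: AConcept A (individual x)] else [::]
    | Some (NEx R _) => if bit (eS x) i then
        List.flat_map (fun y => if EM (edge R x y /\ Incl_succ R (eS y) (eS x)) then
          [:: ARole R (individual x) (individual y)] else [::]) elts else [::]
    | _ => [::]
    end) (iota 0 tok)) elts.

Lemma In_abox z : List.In z abox_of <-> exists x i, [/\ List.In x elts, bit (eS x) i &
    (exists A, nd i = Some (NName A) /\ z = AConcept A (individual x)) \/
    (exists R b y, [/\ nd i = Some (NEx R b), List.In y elts, edge R x y,
       Incl_succ R (eS y) (eS x) & z = ARole R (individual x) (individual y)])].
Proof.
split.
  move=> /List.in_flat_map[x [xe /List.in_flat_map[i [_]]]].
  case E: (nd i) => [[A||j|j k|R j]|] //; case: ifP => // b.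
    by case=> // <-; exists x, i; split=> //; left; exists A.
  move=> /List.in_flat_map[y [ye]]; case: EM => // -[ee ii] [<-|//].
  by exists x, i; split=> //; right; exists R, j, y.
move=> [x [i [xe b H]]]; apply/List.in_flat_map; exists x; split=> //.
apply/List.in_flat_map; exists i; split.
  apply/In_iota/(nd_lt coh).
  by case: H => [[A [-> _]]|[R [c [y [-> _ _ _ _]]]]].
case: H => [[A [-> ->]]|[R [c [y [-> ye ee ii ->]]]]]; rewrite b; first by left.
by apply/List.in_flat_map; exists y; split=> //; case: EM => [w|[]//]; left.
Qed.

Lemma abox_of_over : abox_over S1 abox_of.
Proof.
apply: In_all => z /In_abox[x [i [/In_elts[[_ [Sk _ _]] _] b H]]].
case: (Sk i b) => [[A [E [AS _]]]|[R [c [E RS]]]].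
  by case: H => [[A' []]|[R [c [y []]]]]; rewrite E // => -[<-] ->.
by case: H => [[A' []]|[R' [c' [y []]]]]; rewrite E // => -[<- _] _ _ _ ->.
Qed.

Lemma node_model_abox : model T1 abox_of node_model.
Proof.
split; first exact: node_model_sat.
move=> z /In_abox[x [i [/In_elts[v _] b H]]]; have [_ [Sk _ _]] := v.
case: H => [[A [E ->]]|[R [c [y [E /In_elts[vy _] ee _ ->]]]]] /=; last by rewrite !individualK.
exists i; split=> //; rewrite individualK //.
by case: (Sk i b) => [[A' [E' [_ ]]]|[R [c []]]]; rewrite ?E.
Qed.

Definition set_of (b : nat) : nat :=
  if EM (nd b <> None /\ ~ Incons (2 ^ b)) then 2 ^ b else 0.

Definition clab (x : name + nat) : nat :=
  match x with inl a => eS (decode a) | inr b => set_of b end.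

Definition canonical : interp := @Interp nat
  (fun C x => exists i, nd i = Some (NName C) /\ K (clab x) i)
  (fun R x y =>
     (exists a c, x = inl a /\ y = inl c /\ List.In (ARole R a c) abox_of) \/
     (exists i b, y = inr b /\ nd i = Some (NEx R b) /\ K (clab x) i)).

Lemma clab_ok x : clab x < B /\ ~ Incons (clab x).
Proof.
case: x => [a|b] /=; first by case: (decode_valid a) => [[_ ? _ _] [_ ? _]].
rewrite /set_of; case: EM => [[nb nI]|nn] /=; split=> //; first exact: pow_nd_lt.
  exact: B_gt0.
exact: Incons0.
Qed.

Lemma canonical_model : model T2 abox_of canonical.
Proof.
have setE (x : name + nat) i R b : K (clab x) i -> nd i = Some (NEx R b) -> set_of b = 2 ^ b.
  move=> Ki E; rewrite /set_of; case: EM => // -[]; split.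
    by apply: (nd_children coh E); rewrite inE eqxx.
  move=> Ib; have [xB []] := clab_ok x.
  by apply: Incons_closed => //; right; exists i, R, b.
split.
  apply: (canonical_sat (lab := clab : dom canonical -> nat)) hornT2 _ _ _ _.
  - exact: clab_ok.
  - by [].
  - move=> R x y c i [[a [d [-> [-> Hin]]]]|[j [b [-> [E Kj]]]]] Kc Ei.
      move: Hin => /In_abox[x' [j [/In_elts[vx _] _ [[A [_ //]]|[R' [b [y' [_ /In_elts[vy _] _ ii [ER Ea Ed]]]]]]]]].
      subst R' a d; rewrite /= !individualK // in Kc *.
      apply: K_base; first by case: vx => [[_ ? _ _] _].
      exact: ii Kc Ei.
    rewrite /= (setE _ _ _ _ Kj E) in Kc; apply: K_closed; first exact: (clab_ok x).1.
      by apply: nd_lt_B; rewrite Ei.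
    by do 7 right; exists j, R, b, c.
  - move=> i R b x Ki E; exists (inr b); split; first by right; exists i, b.
    rewrite /= (setE _ _ _ _ Ki E); apply: K_pow.
    by apply: (nd_children coh E); rewrite inE eqxx.
move=> z zA; have := zA; move=> /In_abox[x [i [/In_elts[v _] b H]]].
case: H => [[A [E Ez]]|[R [c [y [E _ _ _ Ez]]]]]; subst z => /=; last first.
  by left; exists (individual x), (individual y).
exists i; split=> //; rewrite individualK //; apply: K_base => //.
by case: v => [[_ ? _ _] _].
Qed.

Lemma assertions_sound (I : interp) : model T2 abox_of I ->
  forall x, List.In x elts -> forall i, bit (eS x) i ->
  nd i <> None /\ ext (den i) (indiv I (individual x)).
Proof.
move=> mI; suff H n x : eK x < n -> List.In x elts -> forall i, bit (eS x) i ->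
    nd i <> None /\ ext (den i) (indiv I (individual x)) by move=> x; exact: (H (eK x).+1).
elim: n x => // n IH x xn xe i b.
have /In_elts[v xk] := xe; have [[tB sB uB nb] [Sk nI Ho]] := v.
case: (Sk i b) => [[A [E [AS _]]]|[R [c [E RS]]]]; rewrite (nd_den coh E) E; split=> //=.
  apply: (mI.2 (AConcept A (individual x))); apply/In_abox; exists x, i; split=> //.
  by left; exists A.
have [y [vy Kc ii ee kk]] := abox_child v E b.
have ye : List.In y elts by apply/In_elts; split=> //; lia.
exists (indiv I (individual y)).
  apply: (mI.2 (ARole R (individual x) (individual y))); apply/In_abox; exists x, i; split=> //.
  by right; exists R, c, y.
have Hy := IH y (leq_trans kk (xn : eK x <= n)) ye.
by have [_] := K_sound mI.1 Hy Kc.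
Qed.

Lemma cm_entailed (I : interp) m u (d : dom I) :
  (forall x, List.In x T2 -> sat_inclusion I x) ->
  (forall i, K u i -> nd i <> None -> ext (den i) d) -> ext (cm m u) d.
Proof.
move=> mI; elim: m u d => [|m IH] u d H; apply/ext_cm; split=> //.
- by move=> i A E k _; have := H i k; rewrite (nd_den coh E) E; apply.
- by move=> i A E k _; have := H i k; rewrite (nd_den coh E) E; apply.
- move=> i R b E k RS; have := H i k; rewrite (nd_den coh E) E => -[] // e re eb.
  exists e => //; apply: IH => c Kc _.
  have [] := K_sound mI _ Kc (d := e) => // j; rewrite bit_pow => /eqP ->; split=> //.
  by apply: (nd_children coh E); rewrite inE eqxx.
Qed.

Lemma node_fails n a m : eK (decode a) < n -> n <= m ->
  bit (eU (decode a)) tok = false ->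
  ~ ext (cm m (eU (decode a))) (indiv node_model a).
Proof.
elim: n a m => // n IH a [//|m] xn nm ub.
have [[tB sB uB nb] [Sk nI Ho]] := decode_valid a.
have [L1 [L2 [L3 [L4 L5]]]] := good_Loc tB nb.
move/ext_cm=> [Hn Hs].
case Eo: (eO (decode a)) Ho => [j|].
  move=> [R0 [b0 [Kj Ej RS0 _]]].
  have [[c|[]] [cp He] Hc] := Hs j R0 b0 Ej Kj RS0.
  have [Ey ky] := He _ _ _ Eo Ej erefl.
  have b0t : b0 < tok by apply: (nd_lt coh); apply: (nd_children coh Ej); rewrite inE eqxx.
  have := IH c m (leq_trans ky xn) nm; rewrite Ey bit_pow gtn_eqF // => H.
  exact: H erefl Hc.
move=> [[bu|[i [A [Ki [E [AS nt]]]]]] _]; first by rewrite ub in bu.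
have [i' [E' b']] := Hn i A E Ki AS.
exact: nt (L4 _ _ _ E' E b').
Qed.
End Counterexample.

Theorem final_not_entails : horn T2 -> Final -> ~ rCQ_entails S1 S2 T1 T2.
Proof.
move=> hT [t [s [tB [sB [/RT_rank[[//|k] Rk] Hroot]]]]] ent.
have [o] := RTn_valid Rk; set x := (t, s, s, k, o) => v0.
have [eTx eSx eUx] : [/\ eT x = t, eS x = s & eU x = s] by [].
move: (x) v0 eTx eSx eUx => root v0 {x} eTx eSx eUx.
have [kmax [kk indr]] : exists kmax, eK root < kmax /\ individual root \in ind (abox_of kmax).
  have ind_intro kmax z a : List.In z (abox_of kmax) -> a \in ind_assertion z ->
      a \in ind (abox_of kmax).
    rewrite /ind => + az; elim: (abox_of kmax) => //= x' l IH [->|/IH H];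
      by rewrite mem_cat ?az ?H ?orbT.
  case: Hroot => [s0|[t0 [s0 [i [R [b [t0B [s0B [/RT_rank[[//|k0] Rk0] [E [bi [cp ii]]]]]]]]]]]].
    have [i bi] : exists i, bit s i.
      apply: NNPP => N; apply: s0; apply: (bits_eq0 sB) => i _.
      by apply/negP => bi; apply: N; exists i.
    rewrite -eSx in bi; exists (eK root).+1; split=> //.
    have re : List.In root (elts (eK root).+1) by apply/In_elts.
    have [_ [Sk _ _]] := v0.
    case: (Sk i bi) => [[A [E _]]|[R [c [E RS]]]].
      apply: (ind_intro _ (AConcept A (individual root))); last by rewrite inE.
      by apply/In_abox; exists root, i; split=> //; left; exists A.
    have [y [vy Kc ii ee ky]] := abox_child v0 E bi.
    apply: (ind_intro _ (ARole R (individual root) (individual y))); last by rewrite inE eqxx.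
    apply/In_abox; exists root, i; split=> //; right; exists R, c, y; split=> //.
    by apply/In_elts; split=> //; lia.
  have [o0 vp] := RTn_valid Rk0; have {}vp := valid_free vp.
  set parent : elt := (t0, s0, 2 ^ tok, k0, None) in vp.
  exists (maxn (eK root) k0).+1; split; first lia.
  apply: (ind_intro _ (ARole R (individual parent) (individual root))); last by rewrite !inE eqxx orbT.
  apply/In_abox; exists parent, i; split=> //.
    by apply/In_elts; split=> //; rewrite ltnS; exact: leq_maxr.
  right; exists R, b, root; rewrite /edge eTx eSx; split=> //.
  by apply/In_elts; split=> //; lia.
have utok : bit (eU root) tok = false.
  rewrite eUx -eSx; apply/negP => bt; have [_ [Sk _ _]] := v0.
  have : tok < tok; last by rewrite ltnn.
  apply: (nd_lt coh).
  by case: (Sk tok bt) => [[A [-> _]]|[R [b [-> _]]]].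
have re : List.In root (elts kmax) by apply/In_elts.
set C := cm (eK root).+1 (eU root).
have /andP[eC oC] := el_over_cm (eK root).+1 (eU root).
have indsub : {subset [:: individual root] <= ind (abox_of kmax)}.
  by move=> a; rewrite inE => /eqP ->.
have cert : certain_answer T2 (abox_of kmax) (concept_query C) [:: individual root].
  move=> I mI; apply/concept_query_sat => //; apply: cm_entailed; first exact: mI.1.
  move=> i Ki ni; rewrite eUx -eSx in Ki.
  by have [] := K_sound mI.1 (assertions_sound mI re) Ki.
have := ent (abox_of kmax) (abox_of_over kmax) (ex_intro _ _ (node_model_abox kmax v0))
  (ex_intro _ _ (canonical_model kmax v0 hT)) (concept_query C)
  (concept_query_rCQ _) (concept_query_over oC) [:: individual root] erefl indsub cert
  (node_model root) (node_model_abox kmax v0).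
move/(concept_query_sat _ _ eC); rewrite /C.
by have := @node_fails root v0 (eK root).+1 (individual root) (eK root).+1; rewrite individualK //; apply.
Qed.
End Core.

(** * Defining the fixed points over the positions of the input word *)

Notation tab r args := (FRel r true args).
Definition fbit b i := FRel 0 b [:: i].
Definition feq i j := FAnd (FLe i j) (FLe j i).
Definition fsucc i j :=
  FAnd (FNot (FLe j i)) (FAll (FOr (FLe 0 i.+1) (FLe j.+1 0))).
Definition fzero i := FAll (FLe i.+1 0).
Definition fend i :=
  FAnd (FNot (FOr (fbit true i) (fbit false i)))
    (FAll (FImp (FNot (FLe i.+1 0)) (FOr (fbit true 0) (fbit false 0)))).

(* The word [s] occurs at position [i] and ends before position [j]. *)
Fixpoint fstr i (s : seq bool) j :=
  if s is b :: s' then FAnd (fbit b i) (FEx (FAnd (fsucc i.+1 0) (fstr 0 s' j.+1)))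
  else feq i j.

Notation tNE := 1.
Notation tCE := 2.
Notation tNEQ := 3.
Notation tIT1 := 4.
Notation tIT2 := 5.
Notation tIS1 := 6.
Notation tIS2 := 7.
Notation tIS3 := 8.
Notation tIS4 := 9.
Notation tDBL := 10.
Notation tBIT := 11.
Notation tSING := 12.
Notation tID := 13.
Notation tTOP := 14.
Notation tNOT := 15.
Notation tAND := 16.
Notation tNM := 17.
Notation tRL := 18.
Notation tSN := 19.
Notation tEX := 20.
Notation tSR := 21.
Notation tC1 := 22.
Notation tC2 := 23.
Notation tR1 := 24.
Notation tR2 := 25.
Notation tINC1 := 26.
Notation tINC2 := 27.
Notation tOC := 28.
Notation tK := 29.
Notation tIC := 30.
Notation tBAD := 31.
Notation tRT := 32.

Definition fNE := FOr (fstr 0 [:: false] 1)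
  (FEx (FAnd (FOr (fstr 1 [:: true; false] 0) (fstr 1 [:: true; true] 0)) (tab tNE [:: 0; 2]))).

Definition fCE :=
  FOr (FEx (FAnd (fstr 1 [:: false; false] 0) (tab tNE [:: 0; 2])))
  (FOr (fstr 0 [:: false; true; false] 1)
  (FOr (FEx (FAnd (fstr 1 [:: false; true; true] 0) (tab tCE [:: 0; 2])))
  (FOr (FEx (FEx (FAnd (fstr 2 [:: true; false] 1) (FAnd (tab tCE [:: 1; 0]) (tab tCE [:: 0; 3])))))
       (FEx (FEx (FAnd (fstr 2 [:: true; true] 1) (FAnd (tab tNE [:: 1; 0]) (tab tCE [:: 0; 3])))))))).

Definition fNEQ_bit b :=
  FEx (FEx (FAnd (fstr 2 [:: true; b] 1) (FAnd (fstr 3 [:: true; b] 0) (tab tNEQ [:: 1; 0])))).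

Definition fNEQ := FOr (FAnd (fbit false 0) (fbit false 1)) (FOr (fNEQ_bit false) (fNEQ_bit true)).

Definition inclusion_step r := FEx (FAnd (tab r [:: 0])
  (FEx (FAnd (fstr 1 [:: true] 0) (FEx (FAnd (tab tCE [:: 1; 0]) (tab tCE [:: 0; 3])))))).

Definition name_step r := FEx (FAnd (tab r [:: 0])
  (FEx (FAnd (fstr 1 [:: true] 0) (tab tNE [:: 0; 2])))).

Definition fafter r i := FEx (FAnd (tab r [:: 0]) (fstr 0 [:: false] i.+1)).

Definition fDBL := FOr (FAnd (fzero 0) (fzero 1))
  (FEx (FEx (FEx (FAnd (tab tDBL [:: 2; 1])
    (FAnd (fsucc 2 3) (FAnd (fsucc 1 0) (fsucc 0 4))))))).

Definition fodd s h := FEx (FAnd (tab tDBL [:: h.+1; 0]) (fsucc 0 s.+1)).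

Definition fBIT := FOr (FAnd (fzero 1) (FEx (fodd 1 0)))
  (FEx (FEx (FAnd (fsucc 1 3) (FAnd (FOr (tab tDBL [:: 0; 2]) (fodd 2 0)) (tab tBIT [:: 0; 1]))))).

Definition fSING := FAll (FAnd (FImp (tab tBIT [:: 1; 0]) (feq 0 2))
                               (FImp (feq 0 2) (tab tBIT [:: 1; 0]))).

Definition fID := FEx (FAnd (tab tCE [:: 1; 0]) (FEx (FAnd (fafter tIT2 0) (FLe 1 0)))).

Definition fTOP := FOr (FAnd (tab tID [:: 0]) (FEx (fstr 1 [:: false; true; false] 0))) (fend 0).
Definition fNOT := FAnd (tab tID [:: 0]) (fstr 0 [:: false; true; true] 1).
Definition fAND := FAnd (tab tID [:: 0]) (FAnd (fstr 0 [:: true; false] 1) (tab tCE [:: 1; 2])).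
Definition fNM := FOr (FAnd (tab tID [:: 0]) (fstr 0 [:: false; false] 1))
                      (FAnd (tab tIS1 [:: 0]) (fstr 0 [:: true] 1)).
Definition fRL := FOr
  (FAnd (tab tID [:: 0]) (FAnd (fstr 0 [:: true; true] 1) (tab tNE [:: 1; 2])))
  (FAnd (tab tIS2 [:: 0]) (FAnd (fstr 0 [:: true] 1) (fend 2))).
Definition fSN := FEx (FEx (FAnd (tab tNM [:: 2; 1]) (FAnd (tab tNM [:: 3; 0]) (tab tNEQ [:: 1; 0])))).
Definition fEX := FEx (tab tRL [:: 1; 0; 2]).
Definition fSR := FEx (FEx (FAnd (FEx (tab tRL [:: 3; 2; 0]))
  (FAnd (FEx (tab tRL [:: 4; 1; 0])) (tab tNEQ [:: 1; 0])))).
Definition flisted r p := FEx (FEx (FAnd (tab r [:: 1])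
  (FAnd (fstr 1 [:: true] 0) (tab tNEQ [:: p.+2; 0])))).
Definition fC r := FEx (FAnd (tab tNM [:: 1; 0]) (flisted r 0)).
Definition fR r := FEx (FAnd (FEx (tab tRL [:: 2; 1; 0])) (flisted r 0)).
Definition fINC r := FEx (FAnd (tab r [:: 0]) (FAnd (fstr 0 [:: true] 1)
  (FAnd (tab tCE [:: 1; 2]) (FEx (tab tCE [:: 3; 0]))))).

Definition fone s := FEx (FAnd (fzero 0) (fsucc 0 s.+1)).

(* The table [tOC] relates an identifier to the sign 0 or 1 of an occurrence. *)
Definition fOC :=
  FOr (FAnd (fone 1) (FEx (tab tINC2 [:: 0; 1])))
  (FOr (FAnd (fzero 1) (FEx (tab tINC2 [:: 1; 0])))
  (FOr (FEx (FEx (FAnd (tab tNOT [:: 1; 2]) (FAnd (tab tOC [:: 1; 0])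
     (FOr (FAnd (fzero 0) (fone 3)) (FAnd (fone 0) (fzero 3)))))))
  (FOr (FEx (FEx (FAnd (FOr (tab tAND [:: 1; 2; 0]) (tab tAND [:: 1; 0; 2])) (tab tOC [:: 1; 3]))))
       (FEx (FAnd (tab tEX [:: 0; 1]) (tab tOC [:: 0; 2])))))).

Definition fK :=
  FOr (tab tBIT [:: 0; 1])
  (FOr (tab tTOP [:: 1])
  (FOr (FEx (FEx (FAnd (tab tAND [:: 3; 1; 0]) (FAnd (tab tK [:: 2; 1]) (tab tK [:: 2; 0])))))
  (FOr (FEx (FEx (FAnd (tab tK [:: 2; 1]) (tab tAND [:: 1; 3; 0]))))
  (FOr (FEx (FEx (FAnd (tab tK [:: 2; 1]) (tab tAND [:: 1; 0; 3]))))
  (FOr (FEx (FAnd (tab tK [:: 1; 0]) (tab tINC2 [:: 0; 2])))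
  (FOr (FEx (FAnd (tab tK [:: 1; 0]) (tab tSN [:: 0; 2])))
       (FEx (FEx (FEx (FEx (FAnd (tab tK [:: 4; 3]) (FAnd (tab tEX [:: 3; 2])
          (FAnd (tab tSING [:: 0; 2]) (FAnd (tab tK [:: 0; 1])
          (FAnd (tab tEX [:: 5; 1]) (tab tSR [:: 3; 5])))))))))))))))).

Definition fIC :=
  FOr (FEx (FEx (FAnd (tab tK [:: 2; 1]) (FAnd (tab tNOT [:: 1; 0]) (tab tK [:: 2; 0])))))
      (FEx (FEx (FEx (FAnd (tab tK [:: 3; 2]) (FAnd (tab tEX [:: 2; 1])
         (FAnd (tab tSING [:: 0; 1]) (tab tIC [:: 0]))))))).

Definition fiff p q := FAnd (FImp p q) (FImp q p).

Definition fLoc t :=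
  FAnd (FAll (FImp (tab tTOP [:: 0]) (tab tBIT [:: t.+1; 0])))
  (FAnd (FAll (FAll (FImp (tab tNOT [:: 1; 0])
     (fiff (tab tBIT [:: t.+2; 1]) (FNot (tab tBIT [:: t.+2; 0]))))))
  (FAnd (FAll (FAll (FAll (FImp (tab tAND [:: 2; 1; 0])
     (fiff (tab tBIT [:: t.+3; 2]) (FAnd (tab tBIT [:: t.+3; 1]) (tab tBIT [:: t.+3; 0])))))))
  (FAnd (FAll (FAll (FImp (tab tSN [:: 1; 0]) (FImp (tab tBIT [:: t.+2; 1]) (tab tBIT [:: t.+2; 0])))))
        (FAll (FAll (FImp (tab tINC1 [:: 1; 0]) (FImp (tab tBIT [:: t.+2; 1]) (tab tBIT [:: t.+2; 0])))))))).

(* Roles are referred to through identifiers [i] of existential restrictions. *)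
Definition fCompat i t t' := FAll (FAll (FImp (tab tEX [:: 1; 0]) (FImp (tab tSR [:: i.+2; 1])
  (FImp (tab tBIT [:: t'.+2; 0]) (tab tBIT [:: t.+2; 1]))))).

Definition fBAD := FOr (FNot (fLoc 0))
  (FEx (FEx (FAnd (tab tEX [:: 1; 0]) (FAnd (tab tBIT [:: 2; 1])
    (FAll (FImp (tab tBIT [:: 0; 1]) (FImp (fCompat 2 3 0) (tab tBAD [:: 0])))))))).

Definition fTok i := FEx (FAnd (fend 0) (fsucc 0 i.+1)).

Definition fSok t s := FAll (FImp (tab tBIT [:: s.+1; 0])
  (FOr (FAnd (tab tC1 [:: 0]) (tab tBIT [:: t.+1; 0])) (tab tR1 [:: 0]))).

Definition fTriv t u := FOr (FEx (FAnd (fTok 0) (tab tBIT [:: u.+1; 0])))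
  (FEx (FAnd (tab tK [:: u.+1; 0]) (FAnd (tab tC2 [:: 0]) (FNot (tab tBIT [:: t.+1; 0]))))).

Definition fIncl i s' s := FAll (FAll (FImp (tab tK [:: s'.+2; 1])
  (FImp (tab tEX [:: 0; 1]) (FImp (tab tSR [:: i.+2; 0]) (tab tBIT [:: s.+2; 0]))))).

(* [g i u]: the goal imposed on a successor by the role of [i] is [u]. *)
Definition fKids (g : nat -> nat -> form) (free : nat -> form) t s :=
  FAnd
  (FAll (FAll (FImp (tab tEX [:: 1; 0]) (FImp (tab tBIT [:: s.+2; 1])
     (FEx (FEx (FEx (FAnd (tab tRT [:: 2; 1; 0]) (FAnd (fCompat 4 t.+3.+2 2)
       (FAnd (tab tK [:: 1; 3]) (FAnd (fIncl 4 1 s.+3.+2) (g 4 0))))))))))))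
  (FAll (FAll (FImp (tab tEX [:: 1; 0]) (FImp (tab tBIT [:: t.+2; 1])
     (FEx (FAnd (FNot (tab tBAD [:: 0])) (FAnd (tab tBIT [:: 0; 1]) (FAnd (fCompat 2 t.+3 0)
       (FOr (free 2) (FEx (FEx (FAnd (fzero 0) (FAnd (g 4 1) (tab tRT [:: 2; 0; 1])))))))))))))).

Definition ftrue := FAll (FLe 0 0).

Definition fgoal i0 b0 d i u := FImp (tab tSR [:: i; i0 + d]) (tab tSING [:: u; b0 + d]).

Definition fRT :=
  FAnd (FNot (tab tBAD [:: 0])) (FAnd (fSok 0 1) (FAnd (FNot (tab tIC [:: 1]))
  (FOr (FAnd (fTriv 0 2) (fKids (fun _ _ => ftrue) (fun _ => ftrue) 0 1))
       (FEx (FEx (FAnd (tab tK [:: 4; 1]) (FAnd (tab tEX [:: 1; 0]) (FAnd (tab tR2 [:: 1])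
         (fKids (fun i u => fgoal 1 0 5 i u) (fun i => FNot (tab tSR [:: i; 4])) 2 3))))))))).

Definition all_blocks : seq block := [::
  (tNE, 2, fNE); (tCE, 2, fCE); (tNEQ, 2, fNEQ);
  (tIT1, 1, FOr (fzero 0) (inclusion_step tIT1));
  (tIT2, 1, FOr (fafter tIT1 0) (inclusion_step tIT2));
  (tIS1, 1, FOr (fafter tIT2 0) (name_step tIS1));
  (tIS2, 1, FOr (fafter tIS1 0) (name_step tIS2));
  (tIS3, 1, FOr (fafter tIS2 0) (name_step tIS3));
  (tIS4, 1, FOr (fafter tIS3 0) (name_step tIS4));
  (tDBL, 2, fDBL); (tBIT, 2, fBIT); (tSING, 2, fSING); (tID, 1, fID);
  (tTOP, 1, fTOP); (tNOT, 2, fNOT); (tAND, 3, fAND); (tNM, 2, fNM); (tRL, 3, fRL);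
  (tSN, 2, fSN); (tEX, 2, fEX); (tSR, 2, fSR);
  (tC1, 1, fC tIS1); (tC2, 1, fC tIS3); (tR1, 1, fR tIS2); (tR2, 1, fR tIS4);
  (tINC1, 2, fINC tIT1); (tINC2, 2, fINC tIT2); (tOC, 2, fOC);
  (tK, 2, fK); (tIC, 1, fIC); (tBAD, 1, fBAD); (tRT, 3, fRT)].

Definition fvalid := FEx (FAnd (fafter tIS4 0) (fend 0)).

Definition fhorn := FAnd
  (FNot (FEx (FEx (FEx (FAnd (fzero 0) (FAnd (tab tOC [:: 2; 0]) (tab tNOT [:: 2; 1])))))))
  (FNot (FEx (FEx (FEx (FEx (FAnd (fone 0) (FAnd (tab tOC [:: 3; 0])
     (FAnd (tab tEX [:: 3; 2]) (tab tNOT [:: 2; 1]))))))))).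

Definition fparent := FEx (FEx (FEx (FEx (FEx (FEx (
  FAnd (fTok 0) (FAnd (tab tSING [:: 1; 0]) (FAnd (tab tRT [:: 5; 4; 1])
  (FAnd (tab tEX [:: 3; 2]) (FAnd (tab tBIT [:: 4; 3]) (FAnd (fCompat 3 5 7) (fIncl 3 6 4)))))))))))).

Definition ffinal := FEx (FEx (FAnd (tab tRT [:: 1; 0; 0]) (FOr (FNot (fzero 0)) fparent))).

Definition fmain := FAnd fvalid (FAnd fhorn (FNot ffinal)).

Lemma wf_all_blocks : wf_blocks [:: 0] all_blocks.
Proof. by vm_compute. Qed.

Lemma closed_fmain : closed_form 0 fmain.
Proof. by vm_compute. Qed.

Arguments override : simpl never.

Definition letter (w : seq bool) i := nth None (map Some w) i.

Definition rd w i (s : seq bool) j :=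
  (forall k, k < size s -> letter w (i + k) = letter s k) /\ j = i + size s.

Lemma letter_lt w i b : letter w i = Some b -> i < size w.
Proof.
by move=> H; rewrite ltnNge; apply/negP => le; move: H; rewrite /letter nth_default ?size_map.
Qed.

Lemma letterE w i : i < size w -> letter w i = Some (nth false w i).
Proof. by move=> H; rewrite /letter (nth_map false). Qed.

Lemma rd_nil w i j : rd w i [::] j <-> j = i.
Proof. by split=> [[_ ->]|->]; [rewrite addn0|split; rewrite ?addn0]. Qed.

Lemma rd_cons w i b s j : rd w i (b :: s) j <-> letter w i = Some b /\ rd w i.+1 s j.
Proof.
split=> [[H ->]|[H [H' ->]]].
  split; first by have := H 0 isT; rewrite addn0.
  by split=> [k ks|]; [rewrite addSnnS H | rewrite addSnnS].
split=> [[|k] ks|]; [by rewrite addn0 | by rewrite -addSnnS H' | by rewrite addSnnS].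
Qed.

Lemma rd_cat w i s s' j : rd w i (s ++ s') j <-> exists k, rd w i s k /\ rd w k s' j.
Proof.
elim: s i => [|b s IH] i /=.
  split=> [H|[k [/rd_nil -> //]]]; by exists i; split=> //; apply/rd_nil.
rewrite rd_cons IH; split=> [[H [k [H1 H2]]]|[k [/rd_cons[H H1] H2]]].
  by exists k; split=> //; apply/rd_cons.
by split=> //; exists k.
Qed.

Lemma rd_drop w i s j : rd w i s j -> drop i w = s ++ drop j w.
Proof.
elim: s i => [|b s IH] i; first by move/rd_nil => ->.
move/rd_cons => [/[dup] /letter_lt iw H /IH E].
by rewrite (drop_nth false iw) E; move: H; rewrite letterE // => -[->].
Qed.

Lemma rd_le w i s j : rd w i s j -> i <= size w -> j <= size w.
Proof.
elim: s i => [|b s IH] i; first by move/rd_nil => ->.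
by move/rd_cons => [/letter_lt iw /IH H] _; exact: H.
Qed.

Lemma rd_code w (X : Type) (e : X -> seq bool) i x y j j' : prefix_code e ->
  rd w i (e x) j -> rd w i (e y) j' -> x = y /\ j = j'.
Proof.
move=> pe H H'; have E := rd_drop H; rewrite (rd_drop H') in E.
have [xy _] := pe _ _ _ _ E; split=> //.
by case: H => _ ->; case: H' => _ ->; rewrite xy.
Qed.

Lemma enc_name_cons b A : enc_name (b :: A) = [:: true; b] ++ enc_name A.
Proof. by []. Qed.

Lemma wf_member seen bs r k phi : wf_blocks seen bs -> List.In (r, k, phi) bs ->
  closed_form k phi /\ signed r k true phi.
Proof.
elim: bs seen => [|[[r' k'] phi'] bs IH] seen //= /and5P[_ cl sg _ /andP[_ wf]].
by case=> [[<- <- <-]|/(IH _ wf)].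
Qed.

Section Tables.
Variable w : seq bool.
Local Notation B := (domain_size w).
Definition J := final_reads all_blocks w.

Lemma size_lt_B : (size w).+2 < B.
Proof. exact: ltn_expl. Qed.

Lemma Jclosed r k phi e : List.In (r, k, phi) all_blocks -> in_box B k e ->
  holds J B e phi -> J r true e.
Proof.
move=> H eb He; apply/(final_reads_least wf_all_blocks H eb) => X HX; apply: (HX) => //.
have [cl sg] := wf_member wf_all_blocks H; have /andP[/eqP se eB] := eb.
apply: (holds_mono (sg := true) (r := r) (k := k) (J := J) _ _ cl se eB) He => //.
- by move=> r' b args rr; rewrite /override (negbTE rr) /=.
move=> args ab Ha; rewrite /override eqxx /=.
by move/(final_reads_least wf_all_blocks H ab): Ha; apply.
Qed.

Lemma Jind r k phi : List.In (r, k, phi) all_blocks -> forall X : seq nat -> Prop,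
  (forall e, in_box B k e -> holds (override J r X) B e phi -> X e) ->
  forall e, in_box B k e -> J r true e -> X e.
Proof. by move=> H X HX e eb /(final_reads_least wf_all_blocks H eb); apply. Qed.

Lemma Jeq r k phi e : List.In (r, k, phi) all_blocks -> tables_in (predC1 r) phi ->
  in_box B k e -> J r true e <-> holds J B e phi.
Proof.
move=> H tp eb; split; last exact: Jclosed H eb.
apply: (Jind H (X := fun e => holds J B e phi)) => // e' _.
by apply (holds_ext _ _ tp) => r' b args /= rr; rewrite /override (negbTE rr) /=.
Qed.

Lemma box1 i : i < B -> in_box B 1 [:: i].
Proof. by move=> iB; rewrite /in_box /= iB. Qed.

Lemma box2 i j : i < B -> j < B -> in_box B 2 [:: i; j].
Proof. by move=> iB jB; rewrite /in_box /= iB jB. Qed.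

Lemma box3 i j k : i < B -> j < B -> k < B -> in_box B 3 [:: i; j; k].
Proof. by move=> iB jB kB; rewrite /in_box /= iB jB kB. Qed.

Lemma Jind1 r phi (X : nat -> Prop) : List.In (r, 1, phi) all_blocks ->
  (forall i, i < B -> holds (override J r (fun e => X (nth 0 e 0))) B [:: i] phi -> X i) ->
  forall i, i < B -> J r true [:: i] -> X i.
Proof.
move=> H HX i iB; apply: (Jind H (X := fun e => X (nth 0 e 0))) (box1 iB).
move=> [|a [|? ?]] //=; rewrite /in_box /= andbT => aB; exact: HX.
Qed.

Lemma Jind2 r phi (X : nat -> nat -> Prop) : List.In (r, 2, phi) all_blocks ->
  (forall i j, i < B -> j < B ->
     holds (override J r (fun e => X (nth 0 e 0) (nth 0 e 1))) B [:: i; j] phi -> X i j) ->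
  forall i j, i < B -> j < B -> J r true [:: i; j] -> X i j.
Proof.
move=> H HX i j iB jB.
apply: (Jind H (X := fun e => X (nth 0 e 0) (nth 0 e 1))) (box2 iB jB).
move=> [|a [|b [|? ?]]] //=; rewrite /in_box /= andbT => /andP[aB bB]; exact: HX.
Qed.

Lemma Jind3 r phi (X : nat -> nat -> nat -> Prop) : List.In (r, 3, phi) all_blocks ->
  (forall i j k, i < B -> j < B -> k < B ->
     holds (override J r (fun e => X (nth 0 e 0) (nth 0 e 1) (nth 0 e 2))) B [:: i; j; k] phi ->
     X i j k) ->
  forall i j k, i < B -> j < B -> k < B -> J r true [:: i; j; k] -> X i j k.
Proof.
move=> H HX i j k iB jB kB.
apply: (Jind H (X := fun e => X (nth 0 e 0) (nth 0 e 1) (nth 0 e 2))) (box3 iB jB kB).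
move=> [|a [|b [|c [|? ?]]]] //=; rewrite /in_box /= andbT => /and3P[aB bB cB]; exact: HX.
Qed.

Definition inputs (J' : interpretation) := forall b x, J' 0 b [:: x] <-> letter w x = Some b.

Lemma inputs_J : inputs J.
Proof. by move=> b x; apply: final_reads_input wf_all_blocks. Qed.

Lemma inputs_override r X : r != 0 -> inputs (override J r X).
Proof. by move=> r0 b x; rewrite /override eq_sym (negbTE r0) /=; apply: inputs_J. Qed.

Lemma fsuccP J' e i j : nth 0 e j < B ->
  holds J' B e (fsucc i j) <-> nth 0 e j = (nth 0 e i).+1.
Proof.
move=> jB; rewrite /fsucc /=; split=> [[/negP lt H]|E].
  by have [||] := H (nth 0 e i).+1; lia.
by split=> [|z zB]; [apply/negP; lia | lia].
Qed.

Lemma fzeroP J' e i : holds J' B e (fzero i) <-> nth 0 e i = 0.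
Proof.
rewrite /fzero /=; split=> [H|-> //].
by have := H 0; have := size_lt_B; lia.
Qed.

Lemma feqP J' e i j : holds J' B e (feq i j) <-> nth 0 e i = nth 0 e j.
Proof. by rewrite /feq /=; split=> [[]|->]; [lia|]. Qed.

Local Opaque fsucc fbit feq.

Lemma fstrP J' e i s j : inputs J' ->
  holds J' B e (fstr i s j) <-> rd w (nth 0 e i) s (nth 0 e j).
Proof.
move=> HJ; elim: s e i j => [|b s IH] e i j.
  by rewrite rd_nil; split=> [/feqP ->|E] //; apply/feqP.
rewrite rd_cons -[holds _ _ _ _]/(holds J' B e (FAnd (fbit b i)
   (FEx (FAnd (fsucc i.+1 0) (fstr 0 s j.+1))))) /=.
split=> [[/HJ H [k [kB [/fsuccP-/(_ kB) /= E /IH /=]]]]|[H H']].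
  by rewrite E.
split; first exact/HJ.
have kB : (nth 0 e i).+1 < B by have := letter_lt H; have := size_lt_B; lia.
by exists (nth 0 e i).+1; split=> //; split; [exact/fsuccP | exact/IH].
Qed.

Lemma fendP J' e i : inputs J' -> nth 0 e i < B ->
  holds J' B e (fend i) <-> nth 0 e i = size w.
Proof.
move=> HJ iB; rewrite /fend /=; split=> [[H1 H2]|E0].
  case: (ltngtP (nth 0 e i) (size w)) => // lt.
    case: H1; case E: (nth false w (nth 0 e i)); [left|right];
      by apply/HJ; rewrite letterE // E.
  have nle : ~ nth 0 e i <= size w by apply/negP; lia.
  have szB : size w < B by have := size_lt_B; lia.
  by case: (H2 _ szB nle) => /HJ/letter_lt /=; lia.
split=> [[/HJ|/HJ] /letter_lt|z zB /negP lt]; [lia|lia|].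
have zw : z < size w by lia.
by case E: (nth false w z); [left|right]; apply/HJ; rewrite letterE // E.
Qed.

Local Opaque fzero fend fstr.

Lemma rd_lt_B i s j : rd w i s j -> i <= size w -> j < B.
Proof. by move=> H iw; have := rd_le H iw; have := size_lt_B; lia. Qed.

Lemma rd_lt_B' i b s j : rd w i (b :: s) j -> [/\ i < B, j < B & i < size w].
Proof.
move=> H; have /rd_cons[/letter_lt iw _] := H; split=> //.
  by have := size_lt_B; lia.
by apply: rd_lt_B H _; lia.
Qed.

Ltac inb := by rewrite /=; tauto.

Lemma T_NE i j : i < B -> j < B -> J tNE true [:: i; j] <-> exists A, rd w i (enc_name A) j.
Proof.
have Hin : List.In (tNE, 2, fNE) all_blocks by inb.
have HX X : inputs (override J tNE X) by apply: inputs_override.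
move=> iB jB; split.
  apply: (Jind2 (X := fun i j => exists A, rd w i (enc_name A) j) Hin) iB jB.
  move=> {}i {}j iB jB /= [/(fstrP _ _ _ _ (HX _)) /= H|]; first by exists [::].
  move=> [k [kB [H [A HA]]]].
  case: H => /(fstrP _ _ _ _ (HX _)) /= H; [exists (false :: A)|exists (true :: A)];
    by rewrite enc_name_cons; apply/rd_cat; exists k.
move=> [A HA]; elim: A i iB HA => [|b A IH] i iB HA; apply: (Jclosed Hin (box2 iB jB)) => /=.
  by left; apply/fstrP; first exact: inputs_J.
right; move: HA; rewrite enc_name_cons => /rd_cat[k [Hk HA]].
have [_ kB _] := rd_lt_B' Hk; exists k; split=> //; split; last exact: IH.
by case: b Hk => Hk; [right|left]; apply/fstrP => //; exact: inputs_J.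
Qed.

Lemma T_CE i j : i < B -> j < B -> J tCE true [:: i; j] <-> exists C, rd w i (enc_concept C) j.
Proof.
have Hin : List.In (tCE, 2, fCE) all_blocks by inb.
have HX X : inputs (override J tCE X) by apply: inputs_override.
move=> iB jB; split.
  apply: (Jind2 (X := fun i j => exists C, rd w i (enc_concept C) j) Hin) iB jB.
  move=> {}i {}j iB jB /=.
  case=> [[k [kB [/(fstrP _ _ _ _ (HX _)) /= H /(T_NE kB jB) [A HA]]]]|].
    by exists (CName A); apply/rd_cat; exists k.
  case=> [/(fstrP _ _ _ _ (HX _)) /= H|]; first by exists CTop.
  case=> [[k [kB [/(fstrP _ _ _ _ (HX _)) /= H [C HC]]]]|].
    by exists (CNot C); apply/rd_cat; exists k.
  case=> [[k [kB [l [lB [/(fstrP _ _ _ _ (HX _)) /= H [[C HC] [D HD]]]]]]]|].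
    exists (CAnd C D); apply/rd_cat; exists k; split=> //.
    by apply/rd_cat; exists l.
  move=> [k [kB [l [lB [/(fstrP _ _ _ _ (HX _)) /= H [/(T_NE kB lB) [R HR] [D HD]]]]]]].
  exists (CEx R D); apply/rd_cat; exists k; split=> //.
  by apply/rd_cat; exists l.
move=> [C]; elim: C i j iB jB => [A||C IH|C IHC D IHD|R C IH] i j iB jB HC;
  apply: (Jclosed Hin (box2 iB jB)) => /=.
- move/rd_cat: HC => [k [Hk HA]]; have [_ kB _] := rd_lt_B' Hk.
  left; exists k; split=> //; split; first by apply/fstrP; first exact: inputs_J.
  by apply/T_NE => //; exists A.
- by right; left; apply/fstrP; first exact: inputs_J.
- move/rd_cat: HC => [k [Hk HA]]; have [_ kB _] := rd_lt_B' Hk.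
  right; right; left; exists k; split=> //; split; first by apply/fstrP; first exact: inputs_J.
  exact: IH.
- move/rd_cat: HC => [k [Hk /rd_cat[l [HC HD]]]]; have [_ kB kw] := rd_lt_B' Hk.
  have lB : l < B by apply: rd_lt_B HC _; apply: rd_le Hk (ltnW kw).
  do 3 right; left; exists k; split=> //; exists l; split=> //.
  split; first by apply/fstrP; first exact: inputs_J.
  by split; [exact: IHC | exact: IHD].
- move/rd_cat: HC => [k [Hk /rd_cat[l [HC HD]]]]; have [_ kB kw] := rd_lt_B' Hk.
  have lB : l < B by apply: rd_lt_B HC _; apply: rd_le Hk (ltnW kw).
  do 4 right; exists k; split=> //; exists l; split=> //.
  split; first by apply/fstrP; first exact: inputs_J.
  by split; [apply/T_NE => //; exists R | exact: IH].
Qed.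

Lemma T_NEQ i j : i < B -> j < B -> J tNEQ true [:: i; j] <->
  exists A k l, rd w i (enc_name A) k /\ rd w j (enc_name A) l.
Proof.
have Hin : List.In (tNEQ, 2, fNEQ) all_blocks by inb.
have HX X : inputs (override J tNEQ X) by apply: inputs_override.
move=> iB jB; split.
  apply: (Jind2 (X := fun i j => exists A k l, rd w i (enc_name A) k /\ rd w j (enc_name A) l) Hin) iB jB.
  move=> {}i {}j iB jB /=.
  case=> [[H H']|].
    have {}H := (HX xpredT _ _).1 H; have {}H' := (HX xpredT _ _).1 H'.
    exists [::], i.+1, j.+1; split; apply/rd_cons; (split; last exact/rd_nil).
      exact: H.
    exact: H'.
  case=> -[k [kB [l [lB [/(fstrP _ _ _ _ (HX _)) /= H [/(fstrP _ _ _ _ (HX _)) /= H' [A [k' [l' [Hk Hl]]]]]]]]]];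
    [exists (false :: A), k', l'|exists (true :: A), k', l'];
    by rewrite enc_name_cons; split; apply/rd_cat; [exists k|exists l].
move=> [A [k' [l' [HA HA']]]]; elim: A i j iB jB HA HA' => [|b A IH] i j iB jB HA HA';
  apply: (Jclosed Hin (box2 iB jB)) => /=.
  by left; move: HA HA' => /rd_cons[H _] /rd_cons[H' _]; split; apply/inputs_J.
right; move: HA HA'; rewrite enc_name_cons => /rd_cat[k [Hk HA]] /rd_cat[l [Hl HA']].
have [_ kB _] := rd_lt_B' Hk; have [_ lB _] := rd_lt_B' Hl.
by case: b Hk Hl => Hk Hl; [right|left]; exists k; split=> //; exists l; split=> //;
  do 2 (split; first by apply/fstrP; first exact: inputs_J); exact: IH.
Qed.

Definition agree r (J' : interpretation) :=
  forall r' b args, r' != r -> J' r' b args <-> J r' b args.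

Lemma agree_J r : agree r J. Proof. by []. Qed.

Lemma agree_override r X : agree r (override J r X).
Proof. by move=> r' b args rr; rewrite /override (negbTE rr). Qed.

Arguments agree_J : clear implicits.
Arguments agree_override : clear implicits.

Lemma agree_inputs r J' : r != 0 -> agree r J' -> inputs J'.
Proof. by move=> r0 H b x; rewrite H ?inputs_J // eq_sym. Qed.

Definition after r i := exists z, z < B /\ J r true [:: z] /\ rd w z [:: false] i.

Lemma fafterP r r' J' e i : r != 0 -> agree r J' -> r' != r ->
  holds J' B e (fafter r' i) <-> after r' (nth 0 e i).
Proof.
move=> r0 ag rr; have inp := agree_inputs r0 ag; rewrite /fafter /=.
split=> [[z [zB [/(ag _ _ _ rr) H /(fstrP _ _ _ _ inp) /= H']]]|[z [zB [H H']]]].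
  by exists z.
by exists z; split=> //; split; [exact/ag | exact/fstrP].
Qed.

Definition body (X : Type) (e : X -> seq bool) (xs : seq X) : seq bool :=
  flatten [seq true :: e x | x <- xs].

Lemma enc_seq_body (X : Type) (e : X -> seq bool) xs :
  enc_seq e xs = body e xs ++ [:: false].
Proof. by elim: xs => //= x xs ->; rewrite /body /= catA. Qed.

Lemma body_rcons (X : Type) (e : X -> seq bool) xs x :
  body e (rcons xs x) = body e xs ++ true :: e x.
Proof. by rewrite /body map_rcons flatten_rcons. Qed.

Lemma items_table (X : Type) (e : X -> seq bool) r phi0 fstep (P : nat -> Prop) :
  r != 0 -> List.In (r, 1, FOr phi0 fstep) all_blocks ->
  (forall J' i, agree r J' -> i < B -> holds J' B [:: i] phi0 <-> P i) ->
  (forall J' i, agree r J' -> i < B -> holds J' B [:: i] fstep <->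
     exists z, z < B /\ J' r true [:: z] /\ exists x, rd w z (true :: e x) i) ->
  forall i, i < B ->
  J r true [:: i] <-> exists p xs, p < B /\ P p /\ rd w p (body e xs) i.
Proof.
move=> r0 Hin H0 Hs i iB; split.
  apply: (Jind1 (X := fun i => exists p xs, p < B /\ P p /\ rd w p (body e xs) i) Hin) iB.
  move=> {}i iB [/(H0 _ _ (agree_override _ _) iB) Pi|].
    by exists i, [::]; do 2 split=> //; apply/rd_nil.
  move=> /(Hs _ _ (agree_override _ _) iB)[z [zB [Xz [x Hx]]]].
  rewrite /override eqxx /= in Xz; have [p [xs [pB [Pp Hp]]]] := Xz.
  by exists p, (rcons xs x); do 2 split=> //; rewrite body_rcons; apply/rd_cat; exists z.
move=> [p [xs [pB [Pp]]]]; elim/last_ind: xs i iB => [|xs x IH] i iB.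
  move/rd_nil => ->; apply: (Jclosed Hin (box1 pB)); left; exact/(H0 _ _ (agree_J _) pB).
rewrite body_rcons => /rd_cat[z [Hz Hx]].
have [zB _ _] := rd_lt_B' Hx.
apply: (Jclosed Hin (box1 iB)); right; apply/(Hs _ _ (agree_J _) iB).
by exists z; split=> //; split; [exact: IH | exists x].
Qed.

Lemma inclusion_stepP r J' i : r != tCE -> r != 0 -> agree r J' -> i < B ->
  holds J' B [:: i] (inclusion_step r) <->
  exists z, z < B /\ J' r true [:: z] /\ exists x, rd w z (true :: enc_inclusion x) i.
Proof.
move=> rCE r0 ag iB; have inp := agree_inputs r0 ag.
have ag' : forall a b, J' tCE true [:: a; b] <-> J tCE true [:: a; b].
  by move=> a b; apply: ag; rewrite eq_sym.
rewrite /inclusion_step /=; split.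
  move=> [z [zB [Jz [a [aB [/(fstrP _ _ _ _ inp) /= Ha [b [bB [/ag'/(T_CE aB bB)[C HC] /ag'/(T_CE bB iB)[D HD]]]]]]]]]].
  exists z; do 2 split=> //; exists (Incl C D).
  rewrite -[true :: _]/([:: true] ++ (enc_concept C ++ enc_concept D)).
  by apply/rd_cat; exists a; split=> //; apply/rd_cat; exists b.
move=> [z [zB [Jz [[C D]]]]].
rewrite -[true :: _]/([:: true] ++ (enc_concept C ++ enc_concept D)) => /rd_cat[a [Ha /rd_cat[b [HC HD]]]].
have [_ aB zw] := rd_lt_B' Ha.
have bB : b < B by apply: rd_lt_B HC _; apply: rd_le Ha (ltnW zw).
exists z; do 2 split=> //; exists a; split=> //; split; first exact/fstrP.
exists b; split=> //; split; apply/ag'.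
  by apply/(T_CE aB bB); exists C.
by apply/(T_CE bB iB); exists D.
Qed.

Lemma name_stepP r J' i : r != tNE -> r != 0 -> agree r J' -> i < B ->
  holds J' B [:: i] (name_step r) <->
  exists z, z < B /\ J' r true [:: z] /\ exists x, rd w z (true :: enc_name x) i.
Proof.
move=> rNE r0 ag iB; have inp := agree_inputs r0 ag.
have ag' : forall a b, J' tNE true [:: a; b] <-> J tNE true [:: a; b].
  by move=> a b; apply: ag; rewrite eq_sym.
rewrite /name_step /=; split.
  move=> [z [zB [Jz [a [aB [/(fstrP _ _ _ _ inp) /= Ha /ag'/(T_NE aB iB)[A HA]]]]]]].
  exists z; do 2 split=> //; exists A; rewrite -[true :: _]/([:: true] ++ enc_name A).
  by apply/rd_cat; exists a.
move=> [z [zB [Jz [A]]]]; rewrite -[true :: _]/([:: true] ++ enc_name A) => /rd_cat[a [Ha HA]].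
have [_ aB zw] := rd_lt_B' Ha.
exists z; do 2 split=> //; exists a; split=> //; split; first exact/fstrP.
by apply/ag'/(T_NE aB iB); exists A.
Qed.

Lemma T_IT1 i : i < B -> J tIT1 true [:: i] <->
  exists p xs, p < B /\ p = 0 /\ rd w p (body enc_inclusion xs) i.
Proof.
apply: items_table => //; first by inb.
  by move=> J' j _ jB; rewrite fzeroP.
by move=> J' j ag jB; apply: inclusion_stepP.
Qed.

Lemma T_IT2 i : i < B -> J tIT2 true [:: i] <->
  exists p xs, p < B /\ after tIT1 p /\ rd w p (body enc_inclusion xs) i.
Proof.
apply: items_table => //; first by inb.
  by move=> J' j ag jB; rewrite (fafterP _ _ _ ag).
by move=> J' j ag jB; apply: inclusion_stepP.
Qed.

Lemma T_names r r' : r != tNE -> r != 0 -> r' != r ->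
  List.In (r, 1, FOr (fafter r' 0) (name_step r)) all_blocks ->
  forall i, i < B -> J r true [:: i] <->
  exists p xs, p < B /\ after r' p /\ rd w p (body enc_name xs) i.
Proof.
move=> rNE r0 rr Hin; apply: items_table => //; first exact: Hin.
  by move=> J' j ag jB; rewrite (fafterP _ _ r0 ag rr).
by move=> J' j ag jB; apply: name_stepP.
Qed.

Lemma after_enc_seq (X : Type) (e : X -> seq bool) r (P : nat -> Prop) :
  (forall i, i < B -> J r true [:: i] <->
     exists p xs, p < B /\ P p /\ rd w p (body e xs) i) ->
  forall i, after r i <-> exists p xs, p < B /\ P p /\ rd w p (enc_seq e xs) i.
Proof.
move=> H i; split.
  move=> [z [zB [/(H z zB)[p [xs [pB [Pp Hp]]]] Hz]]]; exists p, xs; do 2 split=> //.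
  by rewrite enc_seq_body; apply/rd_cat; exists z.
move=> [p [xs [pB [Pp]]]]; rewrite enc_seq_body => /rd_cat[z [Hp Hz]].
have [zB _ _] := rd_lt_B' Hz; exists z; do 2 split=> //.
by apply/(H z zB); exists p, xs.
Qed.

Definition after1 := after_enc_seq T_IT1.
Definition after2 := after_enc_seq T_IT2.
Definition after3 := after_enc_seq (@T_names tIS1 tIT2 isT isT isT ltac:(inb)).
Definition after4 := after_enc_seq (@T_names tIS2 tIS1 isT isT isT ltac:(inb)).
Definition after5 := after_enc_seq (@T_names tIS3 tIS2 isT isT isT ltac:(inb)).
Definition after6 := after_enc_seq (@T_names tIS4 tIS3 isT isT isT ltac:(inb)).

Lemma rd_full s : rd w 0 s (size w) -> w = s.
Proof. by move/rd_drop; rewrite drop0 drop_size cats0. Qed.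

Lemma fvalidP : holds J B [::] fvalid <->
  exists T1 T2 S1 S2, w = enc_instance T1 T2 S1 S2.
Proof.
have inp := inputs_J; rewrite /fvalid /=.
have -> : (exists x, x < B /\ holds J B [:: x] (fafter tIS4 0) /\ holds J B [:: x] (fend 0)) <->
    after tIS4 (size w).
  split=> [[x [xB [/(@fafterP 1 tIS4 J _ _ isT (agree_J 1) isT) H /(@fendP J [:: x] 0 inp xB) <-]]]|H] //.
  have sB : size w < B by have := size_lt_B; lia.
  by exists (size w); split=> //; split; [exact/(@fafterP 1 tIS4 J _ _ isT (agree_J 1) isT) | exact/fendP].
split.
  move/after6=> [p5 [n4 [_ [/after5[p4 [n3 [_ [/after4[p3 [n2 [_ [/after3[p2 [n1 [_ [/after2[p1 [l2 [_ [/after1[p0 [l1 [_ [-> H1]]]] H2]]]] H3]]]] H4]]]] H5]]]] H6]]]].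
  exists l1, l2, (n1, n2), (n3, n4); apply: rd_full.
  rewrite /enc_instance /enc_signature -!catA.
  by apply/rd_cat; exists p1; split=> //; apply/rd_cat; exists p2; split=> //;
    apply/rd_cat; exists p3; split=> //; apply/rd_cat; exists p4; split=> //;
    apply/rd_cat; exists p5.
move=> [T1 [T2 [[n1 n2] [[n3 n4] E]]]].
have : rd w 0 w (size w) by split.
rewrite {2}E /enc_instance /enc_signature -!catA => /rd_cat[p1 [H1 /rd_cat[p2 [H2
  /rd_cat[p3 [H3 /rd_cat[p4 [H4 /rd_cat[p5 [H5 H6]]]]]]]]]].
have L1 := rd_le H1 (leq0n _); have L2 := rd_le H2 L1; have L3 := rd_le H3 L2.
have L4 := rd_le H4 L3; have L5 := rd_le H5 L4; have sB := size_lt_B.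
apply/after6; exists p5, n4; split; [lia|split=> //].
apply/after5; exists p4, n3; split; [lia|split=> //].
apply/after4; exists p3, n2; split; [lia|split=> //].
apply/after3; exists p2, n1; split; [lia|split=> //].
apply/after2; exists p1, T2; split; [lia|split=> //].
by apply/after1; exists 0, T1; split; [lia|split].
Qed.

Lemma T_DBL x y : x < B -> y < B -> J tDBL true [:: x; y] <-> y = x.*2.
Proof.
have Hin : List.In (tDBL, 2, fDBL) all_blocks by inb.
move=> xB yB; split.
  apply: (Jind2 (X := fun x y => y = x.*2) Hin) xB yB.
  move=> {}x {}y xB yB /= [[/fzeroP /= -> /fzeroP /= -> //]|].
  move=> [x' [x'B [y' [y'B [m [mB [H0 [H1 [H2 H3]]]]]]]]].
  have {}H0 : y' = x'.*2 by exact: H0.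
  have /= E1 := (@fsuccP _ [:: m; y'; x'; x; y] 2 3 xB).1 H1.
  have /= E2 := (@fsuccP _ [:: m; y'; x'; x; y] 1 0 mB).1 H2.
  have /= E3 := (@fsuccP _ [:: m; y'; x'; x; y] 0 4 yB).1 H3.
  by rewrite E3 E2 E1 H0 doubleS.
move=> E; move: yB; rewrite {}E {y}; elim: x xB => [|x IH] xB yB; apply: (Jclosed Hin (box2 _ _)) => //=.
  by left; split; apply/fzeroP.
have x2 : x.*2.+1 < B by move: yB; rewrite doubleS; lia.
right; exists x; split; first lia; exists x.*2; split; first lia.
exists x.*2.+1; split; first lia; split; first by apply: IH; lia.
by split; [|split]; apply/fsuccP.
Qed.

Lemma foddP e s h : nth 0 e s < B -> nth 0 e h < B ->
  holds J B e (fodd s h) <-> nth 0 e s = (nth 0 e h).*2.+1.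
Proof.
move=> sB hB; rewrite /fodd /=; split.
  move=> [d [dB [/(T_DBL hB dB) -> H]]].
  exact: ((@fsuccP J ((nth 0 e h).*2 :: e) 0 s.+1 sB).1 H).
move=> E; exists (nth 0 e h).*2; split; first lia.
have dB : (nth 0 e h).*2 < B by lia.
by split; [apply/T_DBL | apply/fsuccP].
Qed.

Local Opaque fodd.

Lemma bitS s i : bit s i.+1 = bit s./2 i.
Proof. by rewrite /bit expnS divnMA divn2. Qed.

Lemma agree_ext r J' (phi : form) e : agree r J' -> tables_in (predC1 r) phi ->
  holds J' B e phi <-> holds J B e phi.
Proof. by move=> ag tp; apply (holds_ext _ _ tp) => r' b args rr; apply: ag. Qed.

Lemma T_BIT s i : s < B -> i < B -> J tBIT true [:: s; i] <-> bit s i.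
Proof.
have Hin : List.In (tBIT, 2, fBIT) all_blocks by inb.
move=> sB iB; split.
  apply: (Jind2 (X := fun s i => bit s i) Hin) sB iB.
  move=> {}s {}i sB iB /= [[/fzeroP /= -> [h [hB H]]]|[i' [i'B [h [hB [Hi [H Hb]]]]]]].
    have {}H := (@agree_ext tBIT _ (fodd 1 0) _ (agree_override _ _) isT).1 H.
    have {}H : s = h.*2.+1 by exact: (@foddP [:: h; s; 0] 1 0 sB hB).1 H.
    by rewrite H /bit expn0 divn1 /= odd_double.
  have {}Hb : bit h i' by exact: Hb.
  have /= -> := (@fsuccP _ [:: h; i'; s; i] 1 3 iB).1 Hi.
  rewrite bitS; case: H => H.
    have {}H : s = h.*2 by apply/(T_DBL hB sB); exact: H.
    by rewrite H doubleK.
  have {}H := (@agree_ext tBIT _ (fodd 2 0) _ (agree_override _ _) isT).1 H.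
  have {}H : s = h.*2.+1 by exact: (@foddP [:: h; i'; s; i] 2 0 sB hB).1 H.
  by rewrite H /= uphalf_double.
elim: i s sB iB => [|i IH] s sB iB Hb; apply: (Jclosed Hin (box2 sB iB)).
  left; split; first exact/fzeroP.
  have hB : s./2 < B by lia.
  exists s./2; split=> //; apply/foddP => //=.
  by rewrite -[LHS]odd_double_half; move: Hb; rewrite /bit expn0 divn1 => ->.
rewrite bitS in Hb; right; exists i; split; first lia.
have hB : s./2 < B by lia.
exists s./2; split=> //; split; first exact/fsuccP.
split; last by apply: IH => //; lia.
case Eo: (odd s); [right|left].
  by apply/foddP => //=; rewrite -[LHS]odd_double_half Eo.
by apply/T_DBL => //=; rewrite -[LHS]odd_double_half Eo.
Qed.

Lemma bit_ext s s' : s < B -> s' < B -> (forall i, i < (size w).+2 -> bit s i = bit s' i) -> s = s'.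
Proof.
rewrite /domain_size; elim: (size w).+2 s s' => [|k IH] s s'; first by case: s; case: s'.
rewrite expnS => sB s'B H.
have E : s./2 = s'./2.
  apply: IH; [lia|lia|move=> i ik; rewrite -!bitS; apply: H; lia].
have := H 0 isT; rewrite /bit expn0 !divn1 => Eo.
by rewrite -[s]odd_double_half -[s']odd_double_half E Eo.
Qed.

Lemma T_SING s b : s < B -> b < B -> J tSING true [:: s; b] <-> s = 2 ^ b.
Proof.
have Hin : List.In (tSING, 2, fSING) all_blocks by inb.
move=> sB bB; rewrite (Jeq Hin) ?box2 // /fSING /=; split=> [H|E j jB].
  have nB : (size w).+2 < B := size_lt_B.
  have H' j : j < B -> bit s j = (j == b).
    move=> jB; have [H1 H2] := H j jB; apply/idP/eqP => [/(T_BIT sB jB)/H1 /feqP //|E].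
    by apply/(T_BIT sB jB)/H2; apply/feqP.
  have bn : b < (size w).+2.
    rewrite ltnNge; apply/negP => nb; have := H' b bB; rewrite eqxx bit_small //.
    by apply: leq_trans sB _; apply: leq_pexp2l.
  apply: bit_ext => //; first by rewrite ltn_exp2l.
  by move=> i ik; rewrite H' ?bit_pow //; lia.
split=> [/(T_BIT sB jB)|/feqP /= ->]; first by rewrite E bit_pow => /eqP ->; apply/feqP.
by apply/(T_BIT sB bB); rewrite E bit_pow eqxx.
Qed.

Lemma body_prefix (X : Type) (e : X -> seq bool) : prefix_code e ->
  forall xs l t t', enc_seq e l ++ t = body e xs ++ t' -> exists ys, l = xs ++ ys.
Proof.
move=> pe; elim=> [|x xs IH] [|y l] t t' //=; first by exists [::].
  by exists (y :: l).
rewrite /body /= -!catA; case=> /pe[-> /IH[ys ->]]; by exists ys.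
Qed.

Lemma enc_seq_cat (X : Type) (e : X -> seq bool) xs ys :
  enc_seq e (xs ++ ys) = body e xs ++ enc_seq e ys.
Proof. by elim: xs => //= x xs ->; rewrite /body /= -catA. Qed.

Section List.
Variables (X : Type) (e : X -> seq bool) (r p q : nat) (l : seq X).
Hypothesis pe : prefix_code e.
Hypothesis rdl : rd w p (enc_seq e l) q.
Hypothesis Hr : forall i, i < B -> J r true [:: i] <->
  exists p' xs, p' < B /\ p' = p /\ rd w p' (body e xs) i.

Lemma item_split i : i < B -> J r true [:: i] ->
  exists xs ys, l = xs ++ ys /\ rd w p (body e xs) i /\ rd w i (enc_seq e ys) q.
Proof.
move=> iB /(Hr iB)[p' [xs [_ [-> H]]]].
have E := rd_drop rdl; rewrite (rd_drop H) in E.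
have [ys El] := body_prefix pe (esym E); exists xs, ys; do 2 split=> //.
move: rdl; rewrite El enc_seq_cat => /rd_cat[k [Hk]].
by case: H => _ ->; case: Hk => _ ->.
Qed.

Lemma item_range i : i < B -> J r true [:: i] -> p <= i < q.
Proof.
move=> iB /(item_split iB)[xs [ys [_ [[_ ->] [_ ->]]]]].
by case: ys => [|y ys] /=; rewrite ?size_cat /=; lia.
Qed.

Lemma item_at i : i < B -> J r true [:: i] -> letter w i = Some true ->
  exists x j, List.In x l /\ rd w i (true :: e x) j.
Proof.
move=> iB /(item_split iB)[xs [[|x ys] [El [H H']]]] Hi.
  by move: H' => /rd_cons[]; rewrite Hi.
move: H'; rewrite /= -cat_cons => /rd_cat[j [Hj _]]; exists x, j; split=> //.
by rewrite El; apply: List.in_or_app; right; left.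
Qed.

Lemma item_of x : p < B -> List.In x l ->
  exists i j, [/\ i < B, J r true [:: i] & rd w i (true :: e x) j].
Proof.
move=> pB /(@List.in_split _ _ _)[xs [ys El]]; move: (rdl).
rewrite El enc_seq_cat => /rd_cat[i [Hi]]; rewrite /= -cat_cons => /rd_cat[j [Hj _]].
have [iB _ _] := rd_lt_B' Hj; exists i, j; split=> //.
by apply/Hr => //; exists p, xs.
Qed.

Lemma after_list : p < B -> forall i, after r i <-> i = q.
Proof.
move=> pB i; rewrite (after_enc_seq Hr); split.
  move=> [p' [xs [_ [-> H]]]]; symmetry.
  by have [_ ->] := rd_code (enc_seq_prefix pe) rdl H.
by move=> ->; exists p, l.
Qed.
End List.

Section Valid.
Variables (T1 T2 : tbox) (S1 S2 : signature).
Hypothesis Hw : w = enc_instance T1 T2 S1 S2.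

Definition p1 := size (enc_tbox T1).
Definition sg := p1 + size (enc_tbox T2).
Definition p3 := sg + size (enc_seq enc_name S1.1).
Definition p4 := p3 + size (enc_seq enc_name S1.2).
Definition p5 := p4 + size (enc_seq enc_name S2.1).

Lemma segments : [/\ rd w 0 (enc_tbox T1) p1, rd w p1 (enc_tbox T2) sg
    & rd w sg (enc_seq enc_name S1.1) p3] /\
  [/\ rd w p3 (enc_seq enc_name S1.2) p4, rd w p4 (enc_seq enc_name S2.1) p5
    & rd w p5 (enc_seq enc_name S2.2) (size w)].
Proof.
have : rd w 0 w (size w) by split.
rewrite {2}Hw /enc_instance /enc_signature -!catA => /rd_cat[q1 [H1 /rd_cat[q2 [H2
  /rd_cat[q3 [H3 /rd_cat[q4 [H4 /rd_cat[q5 [H5 H6]]]]]]]]]].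
have E1 : q1 = p1 by case: H1.
have E2 : q2 = sg by case: H2 => _ ->; rewrite E1.
have E3 : q3 = p3 by case: H3 => _ ->; rewrite E2.
have E4 : q4 = p4 by case: H4 => _ ->; rewrite E3.
have E5 : q5 = p5 by case: H5 => _ ->; rewrite E4.
by subst q1 q2 q3 q4 q5.
Qed.

Lemma bounds : [/\ p1 <= size w, sg <= size w, p3 <= size w, p4 <= size w & p5 <= size w].
Proof.
have [[H1 H2 H3] [H4 H5 H6]] := segments.
have L1 := rd_le H1 (leq0n _); have L2 := rd_le H2 L1; have L3 := rd_le H3 L2.
have L4 := rd_le H4 L3; have L5 := rd_le H5 L4; by split.
Qed.

Lemma le_lt_B i : i <= size w -> i < B.
Proof. by move=> H; have := size_lt_B; lia. Qed.

Lemma inclusion_prefix : prefix_code enc_inclusion.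
Proof.
move=> [C D] [C' D'] s t; rewrite /enc_inclusion /= -!catA.
by move=> /enc_concept_prefix[-> /enc_concept_prefix[-> ->]].
Qed.

Definition items1 := T_IT1.

Lemma items2 i : i < B -> J tIT2 true [:: i] <->
  exists p xs, p < B /\ p = p1 /\ rd w p (body enc_inclusion xs) i.
Proof.
have [[H1 _ _] _] := segments.
have A := after_list inclusion_prefix H1 items1 (le_lt_B (leq0n _)).
move=> iB; rewrite (T_IT2 iB).
by split=> -[p [xs [pB [/A Pp H]]]]; exists p, xs.
Qed.

Lemma after_IT2 i : after tIT2 i <-> i = sg.
Proof.
have [[_ H2 _] _] := segments; have [L1 _ _ _ _] := bounds.
exact: after_list inclusion_prefix H2 items2 (le_lt_B L1) i.
Qed.

Lemma items_names r r' p0 : r != tNE -> r != 0 -> r' != r ->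
  List.In (r, 1, FOr (fafter r' 0) (name_step r)) all_blocks ->
  (forall i, after r' i <-> i = p0) ->
  forall i, i < B -> J r true [:: i] <->
    exists p xs, p < B /\ p = p0 /\ rd w p (body enc_name xs) i.
Proof.
move=> r1 r0 rr Hin A i iB; rewrite (T_names r1 r0 rr Hin iB).
by split=> -[p [xs [pB [/A Pp H]]]]; exists p, xs.
Qed.

Lemma items3 i : i < B -> J tIS1 true [:: i] <->
  exists p xs, p < B /\ p = sg /\ rd w p (body enc_name xs) i.
Proof. by apply: items_names after_IT2 _ => //; inb. Qed.

Lemma items4 i : i < B -> J tIS2 true [:: i] <->
  exists p xs, p < B /\ p = p3 /\ rd w p (body enc_name xs) i.
Proof.
apply: (items_names (r' := tIS1)) => //; first by inb.
have [[_ _ H3] _] := segments; have [_ L _ _ _] := bounds.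
exact: after_list enc_name_prefix H3 items3 (le_lt_B L).
Qed.

Lemma items5 i : i < B -> J tIS3 true [:: i] <->
  exists p xs, p < B /\ p = p4 /\ rd w p (body enc_name xs) i.
Proof.
apply: (items_names (r' := tIS2)) => //; first by inb.
have [_ [H4 _ _]] := segments; have [_ _ L _ _] := bounds.
exact: after_list enc_name_prefix H4 items4 (le_lt_B L).
Qed.

Lemma items6 i : i < B -> J tIS4 true [:: i] <->
  exists p xs, p < B /\ p = p5 /\ rd w p (body enc_name xs) i.
Proof.
apply: (items_names (r' := tIS3)) => //; first by inb.
have [_ [_ H5 _]] := segments; have [_ _ _ L _] := bounds.
exact: after_list enc_name_prefix H5 items5 (le_lt_B L).
Qed.

Definition cid i C := exists j, rd w i (enc_concept C) j /\ j <= sg.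

Lemma enc_concept_size C : 0 < size (enc_concept C).
Proof. by case: C. Qed.

Lemma cid_lt i C : cid i C -> i < sg.
Proof. by move=> [j [[_ ->]]]; have := enc_concept_size C; lia. Qed.

Lemma sg_le : sg <= size w. Proof. by case: bounds. Qed.

Lemma cid_inj i C D : cid i C -> cid i D -> C = D.
Proof. by move=> [j [H _]] [j' [H' _]]; case: (rd_code enc_concept_prefix H H'). Qed.

Lemma T_ID i : i < B -> J tID true [:: i] <-> exists C, cid i C.
Proof.
have Hin : List.In (tID, 1, fID) all_blocks by inb.
move=> iB; rewrite (Jeq Hin) ?box1 // /fID; split.
  move=> [j [jB [/(T_CE iB jB)[C HC] [z [zB [Hz /= le]]]]]]; exists C, j; split=> //.
  by move/(@fafterP 1 tIT2 J _ _ isT (agree_J 1) isT)/after_IT2: Hz => /= <-.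
move=> [C [j [HC le]]]; have sL := sg_le.
have jB : j < B by apply: le_lt_B; lia.
exists j; split=> //; split; first by apply/(T_CE iB jB); exists C.
exists sg; split; first by apply: le_lt_B.
by split=> //; apply/(@fafterP 1 tIT2 J _ _ isT (agree_J 1) isT)/after_IT2.
Qed.

Definition sel (T : Type) (P : T -> Prop) : option T :=
  if EM (exists x, P x) is left H
  then Some (proj1_sig (constructive_indefinite_description _ H)) else None.

Lemma selP (T : Type) (P : T -> Prop) x : (forall y, P y -> y = x) -> P x -> sel P = Some x.
Proof.
move=> U Px; rewrite /sel; case: EM => [H|[]]; last by exists x.
by case: constructive_indefinite_description => y /= /U ->.
Qed.

Lemma sel_some (T : Type) (P : T -> Prop) x : sel P = Some x -> P x.
Proof.
rewrite /sel; case: EM => // H [<-].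
by case: constructive_indefinite_description.
Qed.

Lemma sel_none (T : Type) (P : T -> Prop) : (forall x, ~ P x) -> sel P = None.
Proof. by move=> N; case E: (sel P) => [x|] //; case: (N x); apply: sel_some. Qed.

Definition item_name r i A := J r true [:: i] /\ exists j, rd w i (true :: enc_name A) j.

Lemma item_name_inj r i A A' : item_name r i A -> item_name r i A' -> A = A'.
Proof.
move=> [_ [j /rd_cons[_ H]]] [_ [j' /rd_cons[_ H']]].
by case: (rd_code enc_name_prefix H H').
Qed.

Lemma item_name_lt r i A : item_name r i A -> i < size w.
Proof. by move=> [_ [j /rd_cons[/letter_lt]]]. Qed.

Definition node_at (i : nat) : option node :=
  match sel (cid i) with
  | Some (CName A) => Some (NName A)
  | Some CTop => Some NTop
  | Some (CNot _) => Some (NNot (i + 3))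
  | Some (CAnd C _) => Some (NAnd (i + 2) (i + 2 + size (enc_concept C)))
  | Some (CEx R _) => Some (NEx R (i + 2 + size (enc_name R)))
  | None =>
      if sel (item_name tIS1 i) is Some A then Some (NName A)
      else if sel (item_name tIS2 i) is Some R then Some (NEx R (size w))
      else if i == size w then Some NTop else None
  end.

Definition concept_at (i : nat) : concept :=
  if sel (cid i) is Some C then C
  else match node_at i with
       | Some (NName A) => CName A
       | Some (NEx R _) => CEx R CTop
       | _ => CTop
       end.

Lemma sel_cid i C : cid i C -> sel (cid i) = Some C.
Proof. by move=> H; apply: selP => // D HD; apply: cid_inj HD H. Qed.

Lemma concept_at_cid i C : cid i C -> concept_at i = C.
Proof. by move=> /sel_cid H; rewrite /concept_at H. Qed.

Lemma no_cid i : sg <= i -> sel (cid i) = None.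
Proof. by move=> H; apply: sel_none => C /cid_lt; lia. Qed.

Lemma name1_range i A : item_name tIS1 i A -> sg <= i < p3.
Proof.
move=> H; have iw := item_name_lt H; have [[_ _ H3] _] := segments; case: H => H _.
by apply: (item_range enc_name_prefix H3 items3) H; apply: le_lt_B; lia.
Qed.

Lemma role1_range i A : item_name tIS2 i A -> p3 <= i < p4.
Proof.
move=> H; have iw := item_name_lt H; have [_ [H4 _ _]] := segments; case: H => H _.
by apply: (item_range enc_name_prefix H4 items4) H; apply: le_lt_B; lia.
Qed.

Lemma node_at_name1 i A : item_name tIS1 i A -> node_at i = Some (NName A).
Proof.
move=> H; rewrite /node_at no_cid; last by have := name1_range H; lia.
by rewrite (selP (x := A)) // => A' H'; apply: item_name_inj H' H.
Qed.

Lemma node_at_role1 i R : item_name tIS2 i R -> node_at i = Some (NEx R (size w)).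
Proof.
move=> H; have ir := role1_range H; rewrite /node_at no_cid; last by move: ir; rewrite /p3; lia.
rewrite sel_none; last by move=> A /name1_range; lia.
by rewrite (selP (x := R)) // => R' H'; apply: item_name_inj H' H.
Qed.

Lemma node_at_end : node_at (size w) = Some NTop.
Proof.
rewrite /node_at no_cid; last exact: sg_le.
rewrite sel_none; last by move=> A /item_name_lt; lia.
rewrite sel_none; last by move=> A /item_name_lt; lia.
by rewrite eqxx.
Qed.

Lemma concept_at_end : concept_at (size w) = CTop.
Proof. by rewrite /concept_at node_at_end no_cid // sg_le. Qed.

Lemma cid_not i C : cid i (CNot C) -> rd w i [:: false; true; true] (i + 3) /\ cid (i + 3) C.
Proof.
move=> [j [/(@rd_cat _ _ [:: false; true; true])[k [H H']] le]].
have -> : i + 3 = k by case: H.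
by split=> //; exists j.
Qed.

Lemma cid_and i C D : cid i (CAnd C D) ->
  [/\ rd w i [:: true; false] (i + 2), rd w (i + 2) (enc_concept C) (i + 2 + size (enc_concept C)),
   cid (i + 2) C & cid (i + 2 + size (enc_concept C)) D].
Proof.
move=> [j [/(@rd_cat _ _ [:: true; false])[k [H /rd_cat[l [HC HD]]]] le]].
have Ek : i + 2 = k by case: H.
have El : i + 2 + size (enc_concept C) = l by rewrite Ek; case: HC.
rewrite El Ek; split=> //; last by exists j.
by exists l; split=> //; case: HD => _; lia.
Qed.

Lemma cid_ex i R C : cid i (CEx R C) ->
  [/\ rd w i [:: true; true] (i + 2), rd w (i + 2) (enc_name R) (i + 2 + size (enc_name R))
   & cid (i + 2 + size (enc_name R)) C].
Proof.
move=> [j [/(@rd_cat _ _ [:: true; true])[k [H /rd_cat[l [HC HD]]]] le]].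
have Ek : i + 2 = k by case: H.
have El : i + 2 + size (enc_name R) = l by rewrite Ek; case: HC.
by rewrite El Ek; split=> //; exists j.
Qed.

Lemma node_atP i v : node_at i = Some v ->
  (exists C, cid i C /\ match C, v with
     | CName A, NName A' => A = A'
     | CTop, NTop => True
     | CNot D, NNot j => j = i + 3 /\ cid j D
     | CAnd D E, NAnd j k => [/\ j = i + 2, k = j + size (enc_concept D), cid j D & cid k E]
     | CEx R D, NEx R' j => [/\ R = R', j = i + 2 + size (enc_name R) & cid j D]
     | _, _ => False
     end) \/
  (exists A, item_name tIS1 i A /\ v = NName A) \/
  (exists R, item_name tIS2 i R /\ v = NEx R (size w)) \/
  (i = size w /\ v = NTop).
Proof.
rewrite /node_at; case E: (sel (cid i)) => [C|].
  have H := sel_some E => H'; left; exists C; split=> //; clear E.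
  case: C H H' => [A||D|D E|R D] H [<-] //.
  - by have [_ ?] := cid_not H.
  - by have [] := cid_and H.
  - by have [] := cid_ex H.
case E1: (sel (item_name tIS1 i)) => [A|].
  by move=> [<-]; right; left; exists A; split=> //; apply: sel_some.
case E2: (sel (item_name tIS2 i)) => [R|].
  by move=> [<-]; do 2 right; left; exists R; split=> //; apply: sel_some.
by case: eqP => // -> [<-]; do 3 right.
Qed.

Lemma node_at_cid i C : cid i C -> node_at i <> None.
Proof. by move=> H; rewrite /node_at (sel_cid H); case: C {H}. Qed.

Definition inc r i j := [/\ i < B, j < B & J r true [:: i; j]].

Lemma inc_describes r rl p q T : rd w p (enc_tbox T) q -> p < B -> q <= sg ->
  (forall i, i < B -> J r true [:: i] <->
     exists p' xs, p' < B /\ p' = p /\ rd w p' (body enc_inclusion xs) i) ->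
  List.In (rl, 2, fINC r) all_blocks -> tables_in (predC1 rl) (fINC r) ->
  describes node_at concept_at T (inc rl).
Proof.
move=> H pB qsg Hr Hin tp; split.
  move=> [C D] /(item_of H Hr pB)[z [j [zB Jz]]].
  rewrite -[true :: _]/([:: true] ++ (enc_concept C ++ enc_concept D)).
  move=> /rd_cat[a [Ha /rd_cat[b [HC HD]]]].
  have zz := item_range inclusion_prefix H Hr zB Jz.
  have sL := sg_le.
  have [xs [ys [_ [_ Hys]]]] := item_split inclusion_prefix H Hr zB Jz.
  have jq : j <= q.
    have zt : letter w z = Some true by have /rd_cons[] := Ha.
    case: ys Hys => [|[C' D'] ys] /=; first by move=> /rd_cons[]; rewrite zt.
    move=> /rd_cons[_]; rewrite /enc_inclusion /= -!catA => /rd_cat[b' [HC' /rd_cat[j' [HD' Hq]]]].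
    have /rd_cons[_ /rd_nil Ea] := Ha; rewrite Ea in HC.
    have [_ Eb] := rd_code enc_concept_prefix HC HC'; rewrite Eb in HD.
    have [_ Ej] := rd_code enc_concept_prefix HD HD'.
    by case: Hq => _ ->; lia.
  have Db := enc_concept_size D; have bj : b < j by case: HD => _ ->; lia.
  have cC : cid a C by exists b; split=> //; lia.
  have cD : cid b D by exists j; split=> //; lia.
  have aL := cid_lt cC; have bL := cid_lt cD.
  exists a, b; split; last by rewrite (concept_at_cid cC) (concept_at_cid cD).
  have aB : a < B by apply: le_lt_B; lia.
  have bB : b < B by apply: le_lt_B; lia.
  have jB : j < B by apply: le_lt_B; lia.
  split=> //; apply/(Jeq Hin tp (box2 aB bB)); exists z; split=> //; split; first exact: Jz.
  split; first by apply/(@fstrP J [:: z; a; b] 0 [:: true] 1 inputs_J).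
  split; first by apply/(T_CE aB bB); exists C.
  by exists j; split=> //; apply/(T_CE bB jB); exists D.
move=> i j [iB jB /(Jeq Hin tp (box2 iB jB)) /=].
move=> [z [zB [Jz [/(fstrP _ _ _ _ inputs_J) /= Hz [HC [k [kB HD]]]]]]].
move: HC => /(T_CE iB jB)[C HC]; move: HD => /(T_CE jB kB)[D HD].
have zt : letter w z = Some true by have /rd_cons[] := Hz.
have [[C' D'] [m [xT]]] := item_at inclusion_prefix H Hr zB Jz zt.
rewrite -[true :: _]/([:: true] ++ (enc_concept C' ++ enc_concept D')).
move=> Hm; have := Hm => /rd_cat[a [Ha /rd_cat[b [HC' HD']]]].
have Ei : a = i by case: Ha => _ ->; case: Hz.
rewrite Ei in HC'; have [EC Eb] := rd_code enc_concept_prefix HC' HC; subst C' b.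
have [ED Em] := rd_code enc_concept_prefix HD' HD; subst D' m.
have kq : k <= q.
  have [xs [ys [_ [_ Hys]]]] := item_split inclusion_prefix H Hr zB Jz.
  case: ys Hys => [|[C' D'] ys] /=; first by move=> /rd_cons[]; rewrite zt.
  move=> /rd_cons[_]; rewrite /enc_inclusion /= -!catA => /rd_cat[b' [HC1 /rd_cat[j' [HD1 Hq]]]].
  have /rd_cons[_ /rd_nil Ei'] := Hz; rewrite -Ei' in HC1.
  have [_ Eb] := rd_code enc_concept_prefix HC1 HC; subst b'.
  have [_ Ej] := rd_code enc_concept_prefix HD1 HD; subst j'.
  by case: Hq => _ ->; lia.
have Db := enc_concept_size D; have jk : j < k by case: HD => _ ->; lia.
have cC : cid i C by exists j; split=> //; lia.
have cD : cid j D by exists k; split=> //; lia.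
split; [exact: node_at_cid cC | exact: node_at_cid cD|].
by rewrite (concept_at_cid cC) (concept_at_cid cD).
Qed.

Lemma mem_In (T : eqType) (x : T) l : x \in l -> List.In x l.
Proof. by elim: l => //= y l IH; rewrite inE => /orP[/eqP->|/IH]; [left|right]. Qed.

Lemma coherent_word :
  coherent node_at concept_at (size w).+1 T1 T2 S1 (inc tINC1) (inc tINC2).
Proof.
have [[H1 H2 H3] [H4 H5 H6]] := segments; have [L1 L2 L3 L4 L5] := bounds.
split.
- move=> i; case E: (node_at i) => [v|] // _.
  case/node_atP: E => [[C [/cid_lt ? _]]|[[A [/item_name_lt ? _]]|[[R [/item_name_lt ? _]]|[-> _]]]] //; lia.
- move=> i v E; have := node_atP E => -[[C [HC Hv]]|[[A [HA Ev]]|[[R [HR Ev]]|[Ei Ev]]]].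
  + rewrite (concept_at_cid HC); clear E; case: C v HC Hv => [A||C|C D|R C] [A'||j|j k|R' j] HC //=.
    * by move=> ->.
    * by move=> [_ /concept_at_cid ->].
    * by move=> [_ _ /concept_at_cid -> /concept_at_cid ->].
    * by move=> [-> _ /concept_at_cid ->].
  + by rewrite /concept_at E Ev no_cid //; have := name1_range HA; lia.
  + rewrite [concept_at i]/concept_at E Ev no_cid; last by have := role1_range HR; rewrite /p3; lia.
    by rewrite /denotes concept_at_end.
  + by rewrite Ei Ev concept_at_end.
- move=> i v j E; have := node_atP E => -[[C [HC Hv]]|[[A [HA ->]]|[[R [HR ->]]|[Ei ->]]]] //=.
  + clear E; case: C v HC Hv => [A||C|C D|R C] [A'||k|k l|R' k] HC //=.
    * by move=> [_ Hk]; rewrite inE => /eqP ->; apply: node_at_cid Hk.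
    * by move=> [_ _ Hk Hl]; rewrite !inE => /orP[] /eqP ->; [apply: node_at_cid Hk|apply: node_at_cid Hl].
    * by move=> [_ _ Hk]; rewrite inE => /eqP ->; apply: node_at_cid Hk.
  + by rewrite inE => /eqP ->; rewrite node_at_end.
- apply: (inc_describes H1 _ _ items1) => //; [exact: le_lt_B|by rewrite /sg; lia|by inb].
- apply: (inc_describes H2 _ _ items2) => //; [exact: le_lt_B|by inb].
- move=> A /mem_In AS; have [i [j [iB Ji Hj]]] := item_of H3 items3 (le_lt_B L2) AS.
  by exists i; apply: node_at_name1; split=> //; exists j.
- move=> R /mem_In RS; have [i [j [iB Ji Hj]]] := item_of H4 items4 (le_lt_B L3) RS.
  exists i, (size w); split; last exact: node_at_end.
  by apply: node_at_role1; split=> //; exists j.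
Qed.

Definition tag (C : concept) : seq bool :=
  match C with
  | CName _ => [:: false; false]
  | CTop => [:: false; true; false]
  | CNot _ => [:: false; true; true]
  | CAnd _ _ => [:: true; false]
  | CEx _ _ => [:: true; true]
  end.

Lemma cid_tag i C : cid i C -> rd w i (tag C) (i + size (tag C)).
Proof.
have tg : exists s, enc_concept C = tag C ++ s.
  by case: C => [A||C|C D|R C] /=; eexists; try reflexivity; rewrite cats0.
move=> [j [H _]]; have [s E] := tg; move: H; rewrite E => /rd_cat[k [Hk _]].
by have [_ Ek] := Hk; rewrite -Ek.
Qed.

Lemma tag_inj i C C' j : cid i C -> rd w i (tag C') j -> tag C = tag C'.
Proof.
move=> /cid_tag/rd_drop E /rd_drop; rewrite E; move: (drop _ _) (drop _ _) => s t.
by case: C {E} => [?||?|? ?|? ?]; case: C' => [?||?|? ?|? ?].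
Qed.

Local Notation nd := node_at.
Local Notation tok := (size w).+1.

Lemma nd_le i : nd i <> None -> i <= size w.
Proof. by move/(nd_lt coherent_word). Qed.

Lemma nd_B i v : nd i = Some v -> i < B.
Proof. by move=> E; apply: le_lt_B; apply: nd_le; rewrite E. Qed.

Lemma child_B i v j : nd i = Some v -> j \in children v -> j < B.
Proof. by move=> E jv; apply: le_lt_B; apply: nd_le; apply: (nd_children coherent_word E). Qed.

Lemma sz_B : size w < B. Proof. exact: le_lt_B. Qed.

Lemma T_TOP i : i < B -> J tTOP true [:: i] <-> nd i = Some NTop.
Proof.
move=> iB; rewrite (@Jeq tTOP 1 fTOP _ ltac:(inb) isT (box1 iB)).
rewrite /fTOP /=; split.
  case=> [[/(T_ID iB)[C HC] [j [jB /(fstrP _ _ _ _ inputs_J) /= H]]]|/(@fendP J [:: i] 0 inputs_J iB) /= ->];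
    last exact: node_at_end.
  have := @tag_inj i C CTop j HC H; case: C HC => //= HC _.
  by rewrite /node_at (sel_cid HC).
case/node_atP=> [[C [HC Hv]]|[[A [_ //]]|[[R [_ //]]|[-> _]]]]; last first.
  by right; apply/(@fendP J [:: size w] 0 inputs_J sz_B).
left; split; first by apply/(T_ID iB); exists C.
have H := cid_tag HC; case: C HC Hv H => //= HC _ H.
have [_ jB _] := rd_lt_B' H; exists (i + 3); split=> //.
exact/(@fstrP J [:: i + 3; i] 1 _ 0 inputs_J).
Qed.

Lemma T_NOT i j : i < B -> j < B -> J tNOT true [:: i; j] <-> nd i = Some (NNot j).
Proof.
move=> iB jB; rewrite (@Jeq tNOT 2 fNOT _ ltac:(inb) isT (box2 iB jB)).
rewrite /fNOT /=; split.
  move=> [/(T_ID iB)[C HC] /(fstrP _ _ _ _ inputs_J) /= H].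
  have := @tag_inj i C (CNot C) j HC H; case: C HC => //= C HC _.
  by rewrite /node_at (sel_cid HC); case: H => _ ->.
case/node_atP=> [[C [HC Hv]]|[[A [_ //]]|[[R [_ //]]|[_ //]]]].
split; first by apply/(T_ID iB); exists C.
case: C HC Hv => //= C HC [-> _]; have [H _] := cid_not HC.
exact/(@fstrP J [:: i; i + 3] 0 _ 1 inputs_J).
Qed.

Lemma T_AND i j k : i < B -> j < B -> k < B ->
  J tAND true [:: i; j; k] <-> nd i = Some (NAnd j k).
Proof.
move=> iB jB kB; rewrite (@Jeq tAND 3 fAND _ ltac:(inb) isT (box3 iB jB kB)).
rewrite /fAND /=; split.
  move=> [/(T_ID iB)[C HC] [/(fstrP _ _ _ _ inputs_J) /= H /(T_CE jB kB)[D HD]]].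
  have := @tag_inj i C (CAnd C C) j HC H; case: C HC => //= C C' HC _.
  have [H1 H2 _ _] := cid_and HC.
  have Ej : i + 2 = j by case: H => _ ->.
  rewrite Ej in H2; have [_ Ek] := rd_code enc_concept_prefix H2 HD.
  by rewrite /node_at (sel_cid HC) Ej Ek.
case/node_atP=> [[C [HC Hv]]|[[A [_ //]]|[[R [_ //]]|[_ //]]]].
split; first by apply/(T_ID iB); exists C.
case: C HC Hv => //= C D HC [Ej Ek _ _]; have [H1 H2 _ _] := cid_and HC.
split; first by apply/(@fstrP J [:: i; j; k] 0 _ 1 inputs_J); rewrite /= Ej.
by apply/(T_CE jB kB); exists C; rewrite Ek Ej.
Qed.

Definition name_at p A := exists q, rd w p (enc_name A) q.

Lemma name_at_inj p A A' : name_at p A -> name_at p A' -> A = A'.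
Proof. by move=> [q H] [q' H']; case: (rd_code enc_name_prefix H H'). Qed.

Lemma NEQ_iff p p' A : p < B -> p' < B -> name_at p A ->
  J tNEQ true [:: p; p'] <-> name_at p' A.
Proof.
move=> pB pB' HA; rewrite T_NEQ //; split.
  move=> [A' [k [l [H1 H2]]]]; have -> : A = A' by apply: name_at_inj HA _; exists k.
  by exists l.
by case: HA => k Hk [l Hl]; exists A, k, l.
Qed.

Lemma NM_fwd i p : i < B -> p < B -> J tNM true [:: i; p] ->
  exists A, nd i = Some (NName A) /\ name_at p A.
Proof.
move=> iB pB; rewrite (@Jeq tNM 2 fNM _ ltac:(inb) isT (box2 iB pB)).
rewrite /fNM /= => -[[/(T_ID iB)[C HC] /(fstrP _ _ _ _ inputs_J) /= H]|
  [Ji /(fstrP _ _ _ _ inputs_J) /= H]].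
  have := @tag_inj i C (CName [::]) p HC H; case: C HC => //= A HC _.
  exists A; rewrite /node_at (sel_cid HC); split=> //.
  have [j [/(@rd_cat _ _ [:: false; false])[k [Hk HA]] _]] := HC.
  by exists j; have -> : p = k; [case: H => _ ->; case: Hk|].
have [[_ _ H3] _] := segments.
have zt : letter w i = Some true by have /rd_cons[] := H.
have [A [j [_ Hj]]] := item_at enc_name_prefix H3 items3 iB Ji zt.
exists A; split; first by apply: node_at_name1; split=> //; exists j.
by move: Hj => /rd_cons[_ Hj]; exists j; have -> : p = i.+1; [case: H => _ ->; rewrite addn1|].
Qed.

Lemma NM_bwd i A : nd i = Some (NName A) ->
  exists p, [/\ p < B, J tNM true [:: i; p] & name_at p A].
Proof.
move=> E; have iB := nd_B E; case/node_atP: E => [[C [HC Hv]]|[[A' [HA [EA]]]|[[R [_ //]]|[_ //]]]].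
  case: C HC Hv => // A' HC EA; subst A'.
  have [j [/(@rd_cat _ _ [:: false; false])[k [Hk HA]] _]] := HC.
  have kB : k < B by have [] := rd_lt_B' Hk.
  exists k; split=> //; last by exists j.
  rewrite (@Jeq tNM 2 fNM _ ltac:(inb) isT (box2 iB kB)).
  by left; split; [apply/(T_ID iB); exists (CName A) | apply/(@fstrP J [:: i; k] 0 _ 1 inputs_J)].
subst A'; have [Ji [j Hj]] := HA; have /rd_cons[l Hj'] := Hj.
have kB : i.+1 < B by have := letter_lt l; have := size_lt_B; lia.
exists i.+1; split=> //; last by exists j.
rewrite (@Jeq tNM 2 fNM _ ltac:(inb) isT (box2 iB kB)).
right; split; first exact: Ji.
by apply/(@fstrP J [:: i; i.+1] 0 _ 1 inputs_J)/rd_cons; split=> //; apply/rd_nil.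
Qed.

Lemma RL_fwd i p j : i < B -> p < B -> j < B -> J tRL true [:: i; p; j] ->
  exists R, nd i = Some (NEx R j) /\ name_at p R.
Proof.
move=> iB pB jB; rewrite (@Jeq tRL 3 fRL _ ltac:(inb) isT (box3 iB pB jB)).
rewrite /fRL /= => -[[/(T_ID iB)[C HC] [/(fstrP _ _ _ _ inputs_J) /= H /(T_NE pB jB)[R HR]]]|
  [Ji [/(fstrP _ _ _ _ inputs_J) /= H /(@fendP J [:: i; p; j] 2 inputs_J jB) /= ->]]].
  have := @tag_inj i C (CEx [::] CTop) p HC H; case: C HC => //= R' C HC _.
  have [H1 H2 _] := cid_ex HC.
  have Ep : i + 2 = p by case: H => _ ->.
  rewrite Ep in H2; have [ER Ej] := rd_code enc_name_prefix H2 HR; subst R'.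
  exists R; split; last by exists j.
  by rewrite /node_at (sel_cid HC) Ep Ej.
have [_ [H4 _ _]] := segments.
have zt : letter w i = Some true by have /rd_cons[] := H.
have [R [k [_ Hk]]] := item_at enc_name_prefix H4 items4 iB Ji zt.
exists R; split; first by apply: node_at_role1; split=> //; exists k.
by move: Hk => /rd_cons[_ Hk]; exists k; have -> : p = i.+1; [case: H => _ ->; rewrite addn1|].
Qed.

Lemma RL_bwd i R j : nd i = Some (NEx R j) ->
  exists p, [/\ p < B, J tRL true [:: i; p; j] & name_at p R].
Proof.
move=> E; have iB := nd_B E.
have jB : j < B by apply: (child_B E); rewrite inE eqxx.
case/node_atP: E => [[C [HC Hv]]|[[A' [_ //]]|[[R' [HR [ER Ej]]]|[_ //]]]].
  case: C HC Hv => // R' C HC [ER Ej _]; subst R'.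
  have [H1 H2 _] := cid_ex HC; rewrite -Ej in H2.
  have kB : i + 2 < B by have [] := rd_lt_B' H1.
  exists (i + 2); split=> //; last by exists j.
  rewrite (@Jeq tRL 3 fRL _ ltac:(inb) isT (box3 iB kB jB)).
  left; split; first by apply/(T_ID iB); exists (CEx R C).
  split; first exact/(@fstrP J [:: i; i + 2; j] 0 _ 1 inputs_J).
  by apply/(T_NE kB jB); exists R.
subst R' j; have [Ji [k Hk]] := HR; have /rd_cons[l Hk'] := Hk.
have kB : i.+1 < B by have := letter_lt l; have := size_lt_B; lia.
exists i.+1; split=> //; last by exists k.
rewrite (@Jeq tRL 3 fRL _ ltac:(inb) isT (box3 iB kB jB)).
right; split; first exact: Ji.
split; last exact/(@fendP J [:: i; i.+1; size w] 2 inputs_J jB).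
by apply/(@fstrP J [:: i; i.+1; size w] 0 _ 1 inputs_J)/rd_cons; split=> //; apply/rd_nil.
Qed.

Lemma T_SN i i' : i < B -> i' < B -> J tSN true [:: i; i'] <->
  exists A, nd i = Some (NName A) /\ nd i' = Some (NName A).
Proof.
move=> iB iB'; rewrite (@Jeq tSN 2 fSN _ ltac:(inb) isT (box2 iB iB')).
rewrite /fSN /=; split.
  move=> [p [pB [p' [pB' [/(NM_fwd iB pB)[A [E HA]] [/(NM_fwd iB' pB')[A' [E' HA']]]]]]]].
  move=> /(NEQ_iff pB pB' HA) H; exists A; rewrite E E'.
  by rewrite (name_at_inj HA' H).
move=> [A [/NM_bwd[p [pB H HA]] /NM_bwd[p' [pB' H' HA']]]].
exists p; split=> //; exists p'; split=> //; split; first exact: H.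
by split; [exact: H' | apply/(NEQ_iff pB pB' HA)].
Qed.

Lemma T_EX i j : i < B -> j < B -> J tEX true [:: i; j] <-> exists R, nd i = Some (NEx R j).
Proof.
move=> iB jB; rewrite (@Jeq tEX 2 fEX _ ltac:(inb) isT (box2 iB jB)).
rewrite /fEX /=; split.
  by move=> [p [pB /(RL_fwd iB pB jB)[R [E _]]]]; exists R.
by move=> [R /RL_bwd[p [pB H _]]]; exists p.
Qed.

Lemma T_SR i i' : i < B -> i' < B -> J tSR true [:: i; i'] <->
  exists R j j', nd i = Some (NEx R j) /\ nd i' = Some (NEx R j').
Proof.
move=> iB iB'; rewrite (@Jeq tSR 2 fSR _ ltac:(inb) isT (box2 iB iB')).
rewrite /fSR /=; split.
  move=> [p [pB [p' [pB' [[j [jB /(RL_fwd iB pB jB)[R [E HR]]]] [[j' [jB' /(RL_fwd iB' pB' jB')[R' [E' HR']]]]]]]]]].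
  move=> /(NEQ_iff pB pB' HR) H; exists R, j, j'; rewrite E E'.
  by rewrite (name_at_inj HR' H).
move=> [R [j [j' [E E']]]].
have [p [pB H HR]] := RL_bwd E; have [p' [pB' H' HR']] := RL_bwd E'.
have jB : j < B by apply: (child_B E); rewrite inE eqxx.
have jB' : j' < B by apply: (child_B E'); rewrite inE eqxx.
exists p; split=> //; exists p'; split=> //; split; first by exists j.
by split; [exists j' | apply/(NEQ_iff pB pB' HR)].
Qed.

Lemma In_mem (T : eqType) (x : T) l : List.In x l -> x \in l.
Proof. by elim: l => //= y l IH [->|/IH H]; rewrite inE ?eqxx ?H ?orbT. Qed.

Lemma listedP e p r p0 q l A : rd w p0 (enc_seq enc_name l) q -> p0 < B ->
  (forall i, i < B -> J r true [:: i] <->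
     exists p' xs, p' < B /\ p' = p0 /\ rd w p' (body enc_name xs) i) ->
  nth 0 e p < B -> name_at (nth 0 e p) A ->
  holds J B e (flisted r p) <-> A \in l.
Proof.
move=> H p0B Hr pB HA; rewrite /flisted /=; split.
  move=> [z [zB [a [aB [Jz [/(fstrP _ _ _ _ inputs_J) /= Hz /(NEQ_iff pB aB HA) HA']]]]]].
  have zt : letter w z = Some true by have /rd_cons[] := Hz.
  have [A' [k [Hin Hk]]] := item_at enc_name_prefix H Hr zB Jz zt.
  have -> : A = A'.
    apply: name_at_inj HA' _; exists k; move: Hk => /rd_cons[_].
    by have -> : a = z.+1; [case: Hz => _ ->; rewrite addn1|].
  exact: In_mem.
move=> /mem_In Hin; have [z [k [zB Jz Hk]]] := item_of H Hr p0B Hin.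
have /rd_cons[zt Hk'] := Hk.
have aB : z.+1 < B by have := letter_lt zt; have := size_lt_B; lia.
exists z; split=> //; exists z.+1; split=> //; split; first exact: Jz.
split; last by apply/(NEQ_iff pB aB HA); exists k.
by apply/(@fstrP J (z.+1 :: z :: e) 1 _ 0 inputs_J)/rd_cons; split=> //; apply/rd_nil.
Qed.

Lemma T_C rt r p0 q l : List.In (rt, 1, fC r) all_blocks -> tables_in (predC1 rt) (fC r) ->
  rd w p0 (enc_seq enc_name l) q -> p0 < B ->
  (forall i, i < B -> J r true [:: i] <->
     exists p' xs, p' < B /\ p' = p0 /\ rd w p' (body enc_name xs) i) ->
  forall i, i < B -> J rt true [:: i] <-> exists A, nd i = Some (NName A) /\ A \in l.
Proof.
move=> Hin tp H p0B Hr i iB; rewrite (Jeq Hin tp (box1 iB)) /fC /=; split.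
  move=> [p [pB [/(NM_fwd iB pB)[A [E HA]] Hl]]]; exists A; split=> //.
  exact: (@listedP [:: p; i] 0 r p0 q l A H p0B Hr pB HA).1 Hl.
move=> [A [/NM_bwd[p [pB Hp HA]] Al]]; exists p; split=> //; split; first exact: Hp.
exact: (@listedP [:: p; i] 0 r p0 q l A H p0B Hr pB HA).2 Al.
Qed.

Lemma T_R rt r p0 q l : List.In (rt, 1, fR r) all_blocks -> tables_in (predC1 rt) (fR r) ->
  rd w p0 (enc_seq enc_name l) q -> p0 < B ->
  (forall i, i < B -> J r true [:: i] <->
     exists p' xs, p' < B /\ p' = p0 /\ rd w p' (body enc_name xs) i) ->
  forall i, i < B -> J rt true [:: i] <-> exists R j, nd i = Some (NEx R j) /\ R \in l.
Proof.
move=> Hin tp H p0B Hr i iB; rewrite (Jeq Hin tp (box1 iB)) /fR /=; split.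
  move=> [p [pB [[j [jB /(RL_fwd iB pB jB)[A [E HA]]]] Hl]]]; exists A, j; split=> //.
  exact: (@listedP [:: p; i] 0 r p0 q l A H p0B Hr pB HA).1 Hl.
move=> [A [j [E Al]]]; have [p [pB Hp HA]] := RL_bwd E; exists p; split=> //.
split; last exact: (@listedP [:: p; i] 0 r p0 q l A H p0B Hr pB HA).2 Al.
by exists j; split=> //; apply: (child_B E); rewrite inE eqxx.
Qed.

Lemma T_C1 i : i < B -> J tC1 true [:: i] <-> exists A, nd i = Some (NName A) /\ A \in S1.1.
Proof.
have [[_ _ H3] _] := segments; have [_ L2 _ _ _] := bounds.
by apply: (T_C _ _ H3 (le_lt_B L2) items3) => //; inb.
Qed.

Lemma T_R1 i : i < B -> J tR1 true [:: i] <-> exists R j, nd i = Some (NEx R j) /\ R \in S1.2.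
Proof.
have [_ [H4 _ _]] := segments; have [_ _ L3 _ _] := bounds.
by apply: (T_R _ _ H4 (le_lt_B L3) items4) => //; inb.
Qed.

Lemma T_C2 i : i < B -> J tC2 true [:: i] <-> exists A, nd i = Some (NName A) /\ A \in S2.1.
Proof.
have [_ [_ H5 _]] := segments; have [_ _ _ L4 _] := bounds.
by apply: (T_C _ _ H5 (le_lt_B L4) items5) => //; inb.
Qed.

Lemma T_R2 i : i < B -> J tR2 true [:: i] <-> exists R j, nd i = Some (NEx R j) /\ R \in S2.2.
Proof.
have [_ [_ _ H6]] := segments; have [_ _ _ _ L5] := bounds.
by apply: (T_R _ _ H6 (le_lt_B L5) items6) => //; inb.
Qed.

Lemma occurs_trans s s' X C D : occurs s X C -> occurs s' D X -> occurs (s == s') D C.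
Proof.
elim: C s s' => [A||C IH|C IHC E IHE|R C IH] s s' /=.
- by move=> [[-> ->]|//] /= [[-> ->]|//]; left.
- by move=> [[-> ->]|//] /= [[-> ->]|//]; left.
- move=> [[-> ->]|H] H'; first by case: s' H'.
  by right; have := IH _ _ H H'; case: (s); case: (s').
- move=> [[-> ->]|H] H'; first by case: s' H'.
  by right; case: H => H; [left; exact: IHC H H'|right; exact: IHE H H'].
- move=> [[-> ->]|H] H'; first by case: s' H'.
  by right; exact: IH H H'.
Qed.

Lemma occurs_in_tbox_trans s s' X D T :
  occurs_in_tbox s X T -> occurs s' D X -> occurs_in_tbox (s == s') D T.
Proof.
move=> [x Hx H] H'; exists x => //; case: H => H; [left|right]; last exact: occurs_trans H H'.
by have := occurs_trans H H'; case: (s); case: (s').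
Qed.

Lemma occurs_self D : occurs true D D.
Proof. by case: D => *; left. Qed.

Lemma foneP J' e s : nth 0 e s < B -> holds J' B e (fone s) <-> nth 0 e s = 1.
Proof.
move=> sB; rewrite /fone /=; split.
  by move=> [z [zB [/fzeroP /= Ez /(@fsuccP J' (z :: e) 0 s.+1 sB) /= ->]]]; rewrite Ez.
move=> E; exists 0; split; first by have := size_lt_B; lia.
by split; [exact/fzeroP | exact/(@fsuccP J' (0 :: e) 0 s.+1 sB)].
Qed.

Lemma one_B : 1 < B. Proof. by have := size_lt_B; lia. Qed.
Lemma zero_B : 0 < B. Proof. by have := size_lt_B; lia. Qed.

Lemma fone1 J' e s : nth 0 e s = 1 -> holds J' B e (fone s).
Proof. by move=> E; apply/foneP; rewrite E //; exact: one_B. Qed.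

Local Opaque fone.

Lemma denotes_at i v : nd i = Some v -> concept_at i = denotes concept_at v.
Proof. exact: nd_den coherent_word i v. Qed.

Lemma INC2_in i j : inc tINC2 i j ->
  [/\ nd i <> None, nd j <> None & List.In (Incl (concept_at i) (concept_at j)) T2].
Proof. exact: (inc2P coherent_word).2. Qed.

Definition signed_occurrence (i s : nat) :=
  nd i <> None /\ exists b : bool, s = b /\ occurs_in_tbox b (concept_at i) T2.

Lemma child_some i v j : nd i = Some v -> j \in children v -> nd j <> None.
Proof. exact: (nd_children coherent_word). Qed.

Lemma OC_fwd i s : i < B -> s < B -> J tOC true [:: i; s] -> signed_occurrence i s.
Proof.
have Hin : List.In (tOC, 2, fOC) all_blocks by inb.
apply: (Jind2 (X := signed_occurrence) Hin) => {}i {}s iB sB /=.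
case=> [[H [x [xB Hx]]]|].
  have /= -> := (foneP _ _).1 H => //.
  have [_ Ni Hi] : [/\ nd x <> None, nd i <> None & List.In (Incl (concept_at x) (concept_at i)) T2].
    by apply: INC2_in; split.
  by split=> //; exists true; split=> //; eexists; [exact: Hi|right; exact: occurs_self].
case=> [[/fzeroP /= -> [x [xB Hx]]]|].
  have [Ni _ Hi] : [/\ nd i <> None, nd x <> None & List.In (Incl (concept_at i) (concept_at x)) T2].
    by apply: INC2_in; split.
  by split=> //; exists false; split=> //; eexists; [exact: Hi|left; exact: occurs_self].
case=> [[j [jB [s' [s'B [Hn [[Nj [b [Eb Hb]]] Hs]]]]]]|].
  have {}Hn : nd j = Some (NNot i) by exact/(T_NOT jB iB).
  split; first by apply: (child_some Hn); rewrite inE.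
  rewrite /= in Eb Hb; rewrite (denotes_at Hn) /= in Hb.
  exists (b == false); split.
    case: Hs => [[/fzeroP /= E0 /(@foneP _ [:: s'; j; i; s] 3 sB) /= ->]|
                 [/(@foneP _ [:: s'; j; i; s] 0 s'B) /= E1 /fzeroP /= ->]].
      by move: Eb; rewrite E0; case: (b).
    by move: Eb; rewrite E1; case: (b).
  by apply: occurs_in_tbox_trans Hb _; right; exact: occurs_self.
case=> [[j [jB [k [kB [Hn [Nj [b [Eb Hb]]]]]]]]|].
  rewrite /= in Eb Hb; have [v [Hv iv Ho]] : exists v, [/\ nd j = Some v, i \in children v
      & occurs true (concept_at i) (denotes concept_at v)].
    case: Hn => Hn; [exists (NAnd i k)|exists (NAnd k i)].
      split; [exact/(T_AND jB iB kB)|by rewrite inE eqxx|].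
      by right; left; exact: occurs_self.
    split; [exact/(T_AND jB kB iB)|by rewrite !inE eqxx orbT|].
    by right; right; exact: occurs_self.
  split; first exact: child_some Hv iv.
  rewrite (denotes_at Hv) in Hb; exists b; split=> //.
  by have := occurs_in_tbox_trans Hb Ho; rewrite eqb_id.
move=> [j [jB [Hn [Nj [b [Eb Hb]]]]]].
have {Hn} [R Hn] : exists R, nd j = Some (NEx R i) by exact/(T_EX jB iB).
rewrite /= in Eb Hb; split; first by apply: (child_some Hn); rewrite inE.
rewrite (denotes_at Hn) in Hb; exists b; split=> //.
have : occurs true (concept_at i) (CEx R (concept_at i)) by right; exact: occurs_self.
by move/(occurs_in_tbox_trans Hb); rewrite eqb_id.
Qed.

Lemma bool_B (b : bool) : b < B.
Proof. by have := one_B; case: b => //; lia. Qed.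

Lemma OC_closed i s : i < B -> s < B -> holds J B [:: i; s] fOC -> J tOC true [:: i; s].
Proof. by move=> iB sB; apply: (@Jclosed tOC 2 fOC _ _ (box2 iB sB)); inb. Qed.

Lemma some_B i : nd i <> None -> i < B.
Proof. by case E: (nd i) => [v|] // _; apply: nd_B E. Qed.

Lemma OC_bwd C : forall i (b s : bool) D, nd i <> None -> concept_at i = C ->
  J tOC true [:: i; nat_of_bool b] -> occurs s D C ->
  exists i', [/\ nd i' <> None, concept_at i' = D & J tOC true [:: i'; nat_of_bool (b == s)]].
Proof.
have nodes i : nd i <> None -> exists v, nd i = Some v by case: (nd i) => [v|] // _; exists v.
elim: C => [A||C IH|C IHC E IHE|R C IH] i b s D Ni Ei Ji /=.
- by move=> [[-> ->]|//]; exists i; rewrite eqb_id.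
- by move=> [[-> ->]|//]; exists i; rewrite eqb_id.
- move=> [[-> ->]|H]; first by exists i; rewrite eqb_id.
  have [v Hv] := nodes _ Ni; have iB := nd_B Hv.
  move: Ei; rewrite (denotes_at Hv); case: v Hv => // j Hj [Ej].
  have Nj : nd j <> None by apply: (child_some Hj); rewrite inE.
  have jB := some_B Nj.
  have Jj : J tOC true [:: j; nat_of_bool (~~ b)].
    apply: OC_closed => //; first exact: bool_B.
    do 2 right; left; exists i; split=> //; exists (nat_of_bool b); split; first exact: bool_B.
    split; first exact/(T_NOT iB jB).
    split; first exact: Ji.
    case: (b); [right|left]; split; (try exact/fzeroP); exact: fone1.
  have [i' [? ? ?]] := IH j (~~ b) (~~ s) D Nj Ej Jj H; exists i'; split=> //.
  by have -> : (b == s) = (~~ b == ~~ s) by case: (b); case: (s).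
- move=> [[-> ->]|H]; first by exists i; rewrite eqb_id.
  have [v Hv] := nodes _ Ni; have iB := nd_B Hv.
  move: Ei; rewrite (denotes_at Hv); case: v Hv => // j k Hj [Ej Ek].
  have Nj : nd j <> None by apply: (child_some Hj); rewrite inE eqxx.
  have Nk : nd k <> None by apply: (child_some Hj); rewrite !inE eqxx orbT.
  have jB := some_B Nj; have kB := some_B Nk; have HA := (T_AND iB jB kB).2 Hj.
  case: H => H; [apply: (IHC j b s D Nj Ej _ H)|apply: (IHE k b s D Nk Ek _ H)];
    apply: OC_closed => //; try exact: bool_B; do 3 right; left; exists i; split=> //.
    by exists k; split=> //; split; [left; exact: HA|exact: Ji].
  by exists j; split=> //; split; [right; exact: HA|exact: Ji].
- move=> [[-> ->]|H]; first by exists i; rewrite eqb_id.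
  have [v Hv] := nodes _ Ni; have iB := nd_B Hv.
  move: Ei; rewrite (denotes_at Hv); case: v Hv => // R' j Hj [_ Ej].
  have Nj : nd j <> None by apply: (child_some Hj); rewrite inE.
  have jB := some_B Nj.
  apply: (IH j b s D Nj Ej _ H); apply: OC_closed => //; first exact: bool_B.
  do 4 right; exists i; split=> //; split; last exact: Ji.
  by apply/(T_EX iB jB); exists R'.
Qed.

Lemma OC_all (b : bool) D : occurs_in_tbox b D T2 ->
  exists i, [/\ nd i <> None, concept_at i = D & J tOC true [:: i; nat_of_bool b]].
Proof.
move=> [x /((inc2P coherent_word).1)[i [j [Hij ->]]]] /=.
have [Ni Nj _] := INC2_in Hij; have [iB jB Jij] := Hij; case=> H.
  have Ji : J tOC true [:: i; nat_of_bool false].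
    apply: OC_closed => //; first exact: bool_B.
    by right; left; split; [exact/fzeroP|exists j].
  have [i' [? ? ?]] := OC_bwd Ni erefl Ji H; exists i'; split=> //.
  by have -> : b = (false == ~~ b) by case: (b).
have Jj : J tOC true [:: j; nat_of_bool true].
  apply: OC_closed => //; first exact: bool_B.
  by left; split; [exact: fone1|exists i].
by have [i' [? ? ?]] := OC_bwd Nj erefl Jj H; exists i'.
Qed.

Lemma fhornP : holds J B [::] fhorn <-> horn T2.
Proof.
rewrite /fhorn /=; split=> [[H1 H2]|[H1 H2]].
  split=> [C|R C] H.
    have [i [Ni Ei Ji]] := OC_all H; apply: H1.
    case Ev: (nd i) Ni => [v|] // _; have iB := nd_B Ev.
    move: Ei; rewrite (denotes_at Ev); case: v Ev => // j Ev _.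
    have jB : j < B by apply: (child_B Ev); rewrite inE.
    exists i; split=> //; exists j; split=> //; exists 0; split; first exact: zero_B.
    by split; [exact/fzeroP|split; [exact: Ji|exact/(T_NOT iB jB)]].
  have [i [Ni Ei Ji]] := OC_all H; apply: H2.
  case Ev: (nd i) Ni => [v|] // _; have iB := nd_B Ev.
  move: Ei; rewrite (denotes_at Ev); case: v Ev => // R' j Ev [_ Ej].
  have Nj : nd j <> None by apply: (child_some Ev); rewrite inE.
  case Ev': (nd j) Nj => [v|] // _; have jB := nd_B Ev'.
  move: Ej; rewrite (denotes_at Ev'); case: v Ev' => // k Ev' _.
  have kB : k < B by apply: (child_B Ev'); rewrite inE.
  exists i; split=> //; exists j; split=> //; exists k; split=> //; exists 1; split; first exact: one_B.
  split; first by exact: fone1.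
  by split; [exact: Ji|split; [apply/(T_EX iB jB); exists R'|exact/(T_NOT jB kB)]].
split.
  move=> [i [iB [j [jB [z [zB [/fzeroP /= -> [/(OC_fwd iB zero_B)[_ [b [Eb Hb]]] /(T_NOT iB jB) Hn]]]]]]]].
  by case: b Eb Hb => // _; rewrite (denotes_at Hn); apply: H1.
move=> [i [iB [j [jB [k [kB [z [zB [/(@foneP J [:: z; k; j; i] 0 zB) /= -> [/(OC_fwd iB one_B)[_ [b [Eb Hb]]]]]]]]]]]]].
move=> [/(T_EX iB jB)[R Hn] /(T_NOT jB kB) Hn'].
by case: b Eb Hb => // _; rewrite (denotes_at Hn) /= (denotes_at Hn'); apply: H2.
Qed.

Local Notation i2 := (inc tINC2).
Local Notation i1 := (inc tINC1).

Lemma T_K s i : s < B -> i < B -> J tK true [:: s; i] <-> K nd tok i2 s i.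
Proof.
have Hin : List.In (tK, 2, fK) all_blocks by inb.
move=> sB iB; split.
  apply: (Jind2 (X := K nd tok i2) Hin) sB iB => {}s {}i sB iB /=.
  move=> H; apply: K_closed => //; case: H => [H|].
    by left; apply/(T_BIT sB iB); exact: H.
  case=> [H|]; first by right; left; apply/(T_TOP iB); exact: H.
  case=> [[j [jB [k [kB [H [Kj Kk]]]]]]|].
    by do 2 right; left; exists j, k; split; [apply/(T_AND iB jB kB); exact: H|].
  case=> [[a [aB [k [kB [Ka H]]]]]|].
    by do 3 right; left; exists a, k; split=> //; apply/(T_AND aB iB kB); exact: H.
  case=> [[a [aB [k [kB [Ka H]]]]]|].
    by do 4 right; left; exists a, k; split=> //; apply/(T_AND aB kB iB); exact: H.
  case=> [[a [aB [Ka H]]]|].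
    by do 5 right; left; exists a; split=> //; split.
  case=> [[a [aB [Ka H]]]|].
    have [A [E E']] := (T_SN aB iB).1 H.
    by do 6 right; left; exists a, A.
  move=> [a [aB [b [bB [c [cB [t [tB [Ka [H [Et [Kc [H' H'']]]]]]]]]]]]].
  have {}H := (T_EX aB bB).1 H; have {}H' := (T_EX iB cB).1 H'.
  have {}H'' := (T_SR aB iB).1 H''; have {}Et := (T_SING tB bB).1 Et.
  move: H H' H'' => [R E] [R' E'] [R0 [j [j' [E1 E2]]]].
  do 7 right; exists a, R, b, c; rewrite -Et; split=> //; split=> //; split=> //.
  by move: E1 E2; rewrite E E' => -[-> _] [<- _].
move=> H; have [_ []] // : s < B /\ i < B /\ J tK true [:: s; i].
apply: (H (fun s i => s < B /\ i < B /\ J tK true [:: s; i])) => {H sB iB s i} s i sB iB H; do 2 split=> //; apply: (Jclosed Hin (box2 sB iB)).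
case: H => [H|]; first by left; exact/(T_BIT sB iB).
case=> [H|]; first by right; left; exact/(T_TOP iB).
case=> [[j [k [H [[_ [jB Jj]] [_ [kB Jk]]]]]]|].
  do 2 right; left; exists j; split=> //; exists k; split=> //.
  by split; [exact/(T_AND iB jB kB)|split; [exact: Jj|exact: Jk]].
case=> [[a [k [[_ [aB Ja]] H]]]|].
  have kB : k < B by apply: (child_B H); rewrite !inE eqxx orbT.
  do 3 right; left; exists a; split=> //; exists k; split=> //.
  by split; [exact: Ja|exact/(T_AND aB iB kB)].
case=> [[a [k [[_ [aB Ja]] H]]]|].
  have kB : k < B by apply: (child_B H); rewrite !inE eqxx.
  do 4 right; left; exists a; split=> //; exists k; split=> //.
  by split; [exact: Ja|exact/(T_AND aB kB iB)].
case=> [[a [[_ [aB Ja]] [_ _ H]]]|].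
  by do 5 right; left; exists a.
case=> [[a [A [[_ [aB Ja]] [E E']]]]|].
  do 6 right; left; exists a; split=> //; split; first exact: Ja.
  by apply/(T_SN aB iB); exists A.
move=> [a [R [b [c [[_ [aB Ja]] [E [[tB [cB Jc]] E']]]]]]].
have bB : b < B by apply: (child_B E); rewrite inE.
do 7 right; exists a; split=> //; exists b; split=> //; exists c; split=> //; exists (2 ^ b); split=> //.
split; first exact: Ja.
split; first by apply/(T_EX aB bB); exists R.
split; first exact/(T_SING tB bB).
split; first exact: Jc.
split; first by apply/(T_EX iB cB); exists R.
by apply/(T_SR aB iB); exists R, b, c.
Qed.

Lemma K_bounds s i (H : K nd tok i2 s i) : s < B /\ i < B.
Proof. by apply: (H (fun s i => s < B /\ i < B)). Qed.

Lemma ex_B i R j : nd i = Some (NEx R j) -> i < B /\ j < B.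
Proof. by move=> E; split; [exact: nd_B E | apply: (child_B E); rewrite inE]. Qed.

Lemma T_IC s : s < B -> J tIC true [:: s] <-> Incons nd tok i2 s.
Proof.
have Hin : List.In (tIC, 1, fIC) all_blocks by inb.
move=> sB; split.
  apply: (Jind1 (X := Incons nd tok i2) Hin) sB => {}s sB /= H.
  apply: Incons_closed => //; case: H => [[i [iB [j [jB [H1 [H2 H3]]]]]]|].
    left; exists i, j; split; first exact/(T_K sB iB).
    by split; [exact/(T_NOT iB jB)|exact/(T_K sB jB)].
  move=> [i [iB [b [bB [t [tB [H1 [H2 [H3 H4]]]]]]]]].
  have [R ER] := (T_EX iB bB).1 H2; have Et := (T_SING tB bB).1 H3.
  right; exists i, R, b; rewrite -Et; split=> //; exact/(T_K sB iB).
move=> H; have [] // : s < B /\ J tIC true [:: s].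
apply: (H (fun s => s < B /\ J tIC true [:: s])) => {H sB s} s sB H; split=> //.
apply: (Jclosed Hin (box1 sB)); case: H => [[i [j [K1 [E K2]]]]|[i [R [b [K1 [E [tB Jt]]]]]]].
  have [_ iB] := K_bounds K1; have [_ jB] := K_bounds K2.
  left; exists i; split=> //; exists j; split=> //.
  by split; [exact/(T_K sB iB)|split; [exact/(T_NOT iB jB)|exact/(T_K sB jB)]].
have [iB bB] := ex_B E.
right; exists i; split=> //; exists b; split=> //; exists (2 ^ b); split=> //.
split; first exact/(T_K sB iB).
by split; [apply/(T_EX iB bB); exists R|split; [exact/(T_SING tB bB)|exact: Jt]].
Qed.

Lemma LocP e t : nth 0 e t < B -> holds J B e (fLoc t) <-> Loc nd i1 (nth 0 e t).
Proof.
move=> tB; rewrite /fLoc /fiff /Loc /=; split.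
  move=> [H1 [H2 [H3 [H4 H5]]]]; split.
    move=> i E; have iB := nd_B E.
    by apply/(T_BIT tB iB); apply: (H1 i iB); apply/(T_TOP iB).
  split.
    move=> i j E; have iB := nd_B E; have jB : j < B by apply: (child_B E); rewrite inE.
    have [H6 H7] := H2 i iB j jB ((T_NOT iB jB).2 E); split=> [/(T_BIT tB iB)/H6 H /(T_BIT tB jB) //|H].
    by apply/(T_BIT tB iB)/H7 => /(T_BIT tB jB).
  split.
    move=> i j k E; have iB := nd_B E; have jB : j < B by apply: (child_B E); rewrite !inE eqxx.
    have kB : k < B by apply: (child_B E); rewrite !inE eqxx orbT.
    have [H6 H7] := H3 i iB j jB k kB ((T_AND iB jB kB).2 E).
    split=> [/(T_BIT tB iB)/H6[/(T_BIT tB jB) Hj /(T_BIT tB kB)]//|[Hj Hk]].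
    by apply/(T_BIT tB iB)/H7; split; [exact/(T_BIT tB jB)|exact/(T_BIT tB kB)].
  split.
    move=> i j A E E'; have iB := nd_B E; have jB := nd_B E' => /(T_BIT tB iB) H.
    by apply/(T_BIT tB jB)/(H4 i iB j jB) => //; apply/(T_SN iB jB); exists A.
  move=> i j [iB jB E] /(T_BIT tB iB) H.
  by apply/(T_BIT tB jB)/(H5 i iB j jB).
move=> [H1 [H2 [H3 [H4 H5]]]]; split.
  by move=> i iB /(T_TOP iB)/H1 H; apply/(T_BIT tB iB).
split.
  move=> i iB j jB /(T_NOT iB jB)/H2 H; split=> [/(T_BIT tB iB)/H H' /(T_BIT tB jB)//|H'].
  by apply/(T_BIT tB iB)/H => /(T_BIT tB jB).
split.
  move=> i iB j jB k kB /(T_AND iB jB kB)/H3 H; split.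
    by move=> /(T_BIT tB iB)/H[Hj Hk]; split; [exact/(T_BIT tB jB)|exact/(T_BIT tB kB)].
  by move=> [/(T_BIT tB jB) Hj /(T_BIT tB kB) Hk]; apply/(T_BIT tB iB)/H.
split.
  move=> i iB j jB /(T_SN iB jB)[A [E E']] /(T_BIT tB iB) H.
  by apply/(T_BIT tB jB); apply: H4 E E' H.
move=> i iB j jB E /(T_BIT tB iB) H; apply/(T_BIT tB jB); apply: H5 H; by split.
Qed.

Lemma CompatP e i t t' R b : nth 0 e t < B -> nth 0 e t' < B -> nd (nth 0 e i) = Some (NEx R b) ->
  holds J B e (fCompat i t t') <-> Compat nd R (nth 0 e t) (nth 0 e t').
Proof.
move=> tB t'B E; have iB := nd_B E; rewrite /fCompat /=; split=> H.
  move=> x y Ex /(T_BIT t'B); have [xB yB] := ex_B Ex => /(_ yB) Hy.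
  apply/(T_BIT tB xB); apply: (H x xB y yB) => //; first by apply/(T_EX xB yB); exists R.
  by apply/(T_SR iB xB); exists R, b, y.
move=> x xB y yB /(T_EX xB yB)[R' Ex] /(T_SR iB xB)[R0 [j [j' [E1 E2]]]] /(T_BIT t'B yB) Hy.
apply/(T_BIT tB xB); apply: (H x y) => //.
by move: E1 E2; rewrite E Ex => -[-> _] [-> _].
Qed.

Lemma InclP e i s' s R b : nth 0 e s' < B -> nth 0 e s < B -> nd (nth 0 e i) = Some (NEx R b) ->
  holds J B e (fIncl i s' s) <-> Incl_succ nd tok i2 R (nth 0 e s') (nth 0 e s).
Proof.
move=> s'B sB E; have iB := nd_B E; rewrite /fIncl /=; split=> H.
  move=> c x /(T_K s'B) Kc Ex; have [xB cB] := ex_B Ex.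
  apply/(T_BIT sB xB); apply: (H c cB x xB); first exact: Kc cB.
    by apply/(T_EX xB cB); exists R.
  by apply/(T_SR iB xB); exists R, b, c.
move=> c cB x xB /(T_K s'B cB) Kc /(T_EX xB cB)[R' Ex] /(T_SR iB xB)[R0 [j [j' [E1 E2]]]].
apply/(T_BIT sB xB); apply: (H c x) => //.
by move: E1 E2; rewrite E Ex => -[-> _] [-> _].
Qed.

Lemma TokP e i : nth 0 e i < B -> holds J B e (fTok i) <-> nth 0 e i = tok.
Proof.
move=> iB; rewrite /fTok /=; split.
  by move=> [z [zB [/(@fendP J (z :: e) 0 inputs_J zB) /= -> /(@fsuccP J (size w :: e) 0 i.+1 iB)]]].
move=> E; exists (size w); split; first exact: sz_B.
split; first exact/(@fendP J (size w :: e) 0 inputs_J sz_B).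
exact/(@fsuccP J (size w :: e) 0 i.+1 iB).
Qed.

Lemma tok_B : tok < B. Proof. by have := size_lt_B; lia. Qed.

Lemma bitB s i : s < B -> bit s i -> i < B.
Proof. exact: bit_lt_B. Qed.

Lemma SokP e t s : nth 0 e t < B -> nth 0 e s < B ->
  holds J B e (fSok t s) <-> Sok nd S1 (nth 0 e t) (nth 0 e s).
Proof.
move=> tB sB; rewrite /fSok /=; split=> H.
  move=> i Hi; have iB := bitB sB Hi.
  case: (H i iB ((T_BIT sB iB).2 Hi)) => [[/(T_C1 iB)[A [E AS]] /(T_BIT tB iB) Ht]|/(T_R1 iB)[R [j [E RS]]]].
    by left; exists A.
  by right; exists R, j.
move=> i iB /(T_BIT sB iB)/H[[A [E [AS Ht]]]|[R [b [E RS]]]].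
  by left; split; [apply/(T_C1 iB); exists A|exact/(T_BIT tB iB)].
by right; apply/(T_R1 iB); exists R, b.
Qed.

Lemma TrivP e t u : nth 0 e t < B -> nth 0 e u < B ->
  holds J B e (fTriv t u) <-> Triv nd tok S2 i2 (nth 0 e t) (nth 0 e u).
Proof.
move=> tB uB; rewrite /fTriv /=; split.
  case=> [[z [zB [/(@TokP (z :: e) 0 zB) /= -> /(T_BIT uB tok_B) H]]]|]; first by left.
  move=> [i [iB [/(T_K uB iB) Ki [/(T_C2 iB)[A [E AS]] Ht]]]].
  by right; exists i, A; do 3 split=> //; move=> /(T_BIT tB iB).
case=> [H|[i [A [Ki [E [AS Ht]]]]]].
  left; exists tok; split; first exact: tok_B.
  by split; [exact/(@TokP (tok :: e) 0 tok_B)|exact/(T_BIT uB tok_B)].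
have [_ iB] := K_bounds Ki; right; exists i; split=> //; split; first exact/(T_K uB iB).
by split; [apply/(T_C2 iB); exists A|move/(T_BIT tB iB)].
Qed.

Lemma low_Loc t : tables_in (predC1 tBAD) (fLoc t). Proof. by []. Qed.
Lemma low_Compat_B i t t' : tables_in (predC1 tBAD) (fCompat i t t'). Proof. by []. Qed.
Lemma low_Compat i t t' : tables_in (predC1 tRT) (fCompat i t t'). Proof. by []. Qed.
Lemma low_Incl i t t' : tables_in (predC1 tRT) (fIncl i t t'). Proof. by []. Qed.
Lemma low_Sok t s : tables_in (predC1 tRT) (fSok t s). Proof. by []. Qed.
Lemma low_Triv t s : tables_in (predC1 tRT) (fTriv t s). Proof. by []. Qed.

Local Opaque fCompat fIncl fTok fSok fTriv fLoc.

Lemma T_BAD t : t < B -> J tBAD true [:: t] <-> Bad nd tok i1 t.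
Proof.
have Hin : List.In (tBAD, 1, fBAD) all_blocks by inb.
move=> tB; split.
  apply: (Jind1 (X := Bad nd tok i1) Hin) tB => {}t tB /= H.
  apply: Bad_closed => //; case: H => [H|[i [iB [j [jB [/(T_EX iB jB)[R E] [/(T_BIT tB iB) Hi H]]]]]]].
    by left=> HL; apply: H; apply: (@agree_ext tBAD _ (fLoc 0) _ (agree_override _ _) (low_Loc 0)).2; apply/LocP.
  right; exists i, R, j; do 2 split=> //; move=> t' t'B Hj HC.
  apply: (H t' t'B); first exact/(T_BIT t'B jB).
  by apply: (@agree_ext tBAD _ (fCompat 2 3 0) _ (agree_override _ _) (low_Compat_B 2 3 0)).2; apply/(@CompatP [:: t'; j; i; t] 2 3 0 R j).
move=> H; have [] // : t < B /\ J tBAD true [:: t].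
apply: (H (fun s => s < B /\ J tBAD true [:: s])) => {H tB t} t tB H; split=> //.
apply: (Jclosed Hin (box1 tB)); case: H => [H|[i [R [j [E [Hi H]]]]]].
  by left=> /(@LocP [:: t] 0 tB).
have [iB jB] := ex_B E; right; exists i; split=> //; exists j; split=> //.
split; first by apply/(T_EX iB jB); exists R.
split; first exact/(T_BIT tB iB).
move=> t' t'B /(T_BIT t'B jB) Hj /(@CompatP [:: t'; j; i; t] 2 3 0 R j tB t'B E) HC.
by case: (H t' t'B Hj HC).
Qed.

Lemma KidsP (J' : interpretation) X o g free e t s : agree tRT J' ->
  (forall t s u, t < B -> s < B -> u < B -> J' tRT true [:: t; s; u] <-> X t s u) ->
  nth 0 e t < B -> nth 0 e s < B ->
  (forall x0 x1 x2 x3 i R b, x0 < B -> x1 < B -> nd i = Some (NEx R b) ->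
     (holds J' B [:: x0, x1, x2, x3, i & e] (g 4 0) <-> o R x0) /\
     (holds J' B [:: x0, x1, x2, x3, i & e] (g 4 1) <-> o R x1)) ->
  (forall x0 x1 i R b, nd i = Some (NEx R b) ->
     holds J' B [:: x0, x1, i & e] (free 2) <-> forall u, o R u) ->
  holds J' B e (fKids g free t s) <-> Kids nd tok i1 i2 X o (nth 0 e t) (nth 0 e s).
Proof.
move=> ag HX tB sB Hg Hf.
have aEX i j : J' tEX true [:: i; j] <-> J tEX true [:: i; j] by apply: ag.
have aBIT i j : J' tBIT true [:: i; j] <-> J tBIT true [:: i; j] by apply: ag.
have aK i j : J' tK true [:: i; j] <-> J tK true [:: i; j] by apply: ag.
have aBAD i : J' tBAD true [:: i] <-> J tBAD true [:: i] by apply: ag.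
rewrite /fKids /=; split.
  move=> [H1 H2]; split.
    move=> i R b E Hi; have [iB bB] := ex_B E.
    have [||t' [t'B [s' [s'B [u' [u'B [HR [HC [HK [HI Ho]]]]]]]]]] := H1 i iB b bB.
    - by apply/aEX/(T_EX iB bB); exists R.
    - exact/aBIT/(T_BIT sB iB).
    exists t', s', u'; do 3 split=> //; split; first exact/HX.
    have {}HC := (agree_ext _ ag (low_Compat _ _ _)).1 HC; have {}HI := (agree_ext _ ag (low_Incl _ _ _)).1 HI.
    split; first exact: ((@CompatP [:: u', s', t', b, i & e] 4 t.+1.+4 2 R b tB t'B E).1 HC).
    split; first exact/(T_K s'B bB)/aK.
    split; first exact: ((@InclP [:: u', s', t', b, i & e] 4 1 s.+1.+4 R b s'B sB E).1 HI).
    exact: ((Hg u' s' t' b i R b u'B s'B E).1.1 Ho).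
  move=> i R c E Hi; have [iB cB] := ex_B E.
  have [||t' [t'B [HB [Hc [HC Ho]]]]] := H2 i iB c cB.
  - by apply/aEX/(T_EX iB cB); exists R.
  - exact/aBIT/(T_BIT tB iB).
  have {}HC := (agree_ext _ ag (low_Compat _ _ _)).1 HC.
  exists t'; split=> //; split; first by move=> /(T_BAD t'B)/aBAD.
  split; first exact/(T_BIT t'B cB)/aBIT.
  split; first exact: ((@CompatP [:: t', c, i & e] 2 t.+3 0 R c tB t'B E).1 HC).
  case: Ho => [/(Hf _ _ _ _ _ E) H|[u' [u'B [z [zB [/fzeroP /= Ez [Ho HR]]]]]]]; first by left.
  right; exists u'; split=> //; split; first exact: ((Hg z u' t' c i R c zB u'B E).2.1 Ho).
  by rewrite Ez in HR; exact: (HX t' 0 u' t'B zero_B u'B).1 HR.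
move=> [H1 H2]; split.
  move=> i iB b bB /aEX/(T_EX iB bB)[R E] /aBIT/(T_BIT sB iB) Hi.
  have [t' [s' [u' [t'B [s'B [u'B [HR [HC [HK [HI Ho]]]]]]]]]] := H1 i R b E Hi.
  exists t'; split=> //; exists s'; split=> //; exists u'; split=> //; split; first exact/HX.
  split; first exact/(agree_ext _ ag (low_Compat _ _ _))/(@CompatP [:: u', s', t', b, i & e] 4 t.+1.+4 2 R b tB t'B E).
  split; first exact/aK/(T_K s'B bB).
  split; first exact/(agree_ext _ ag (low_Incl _ _ _))/(@InclP [:: u', s', t', b, i & e] 4 1 s.+1.+4 R b s'B sB E).
  exact: ((Hg u' s' t' b i R b u'B s'B E).1.2 Ho).
move=> i iB c cB /aEX/(T_EX iB cB)[R E] /aBIT/(T_BIT tB iB) Hi.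
have [t' [t'B [HB [Hc [HC Ho]]]]] := H2 i R c E Hi.
exists t'; split=> //; split; first by move/aBAD/(T_BAD t'B).
split; first exact/aBIT/(T_BIT t'B cB).
split; first exact/(agree_ext _ ag (low_Compat _ _ _))/(@CompatP [:: t', c, i & e] 2 t.+3 0 R c tB t'B E).
case: Ho => [H|[u' [u'B [Ho HR]]]]; first by left; apply/(Hf t' c i R c E).
right; exists u'; split=> //; exists 0; split; first exact: zero_B.
split; first exact/fzeroP.
split; first exact: ((Hg 0 u' t' c i R c zero_B u'B E).2.2 Ho).
exact: (HX t' 0 u' t'B zero_B u'B).2 HR.
Qed.

Lemma fgoalP J' e i0 b0 d i u R0 R b j : agree tRT J' ->
  nth 0 e u < B -> nd (nth 0 e i) = Some (NEx R j) -> nth 0 e (b0 + d) = b ->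
  nd (nth 0 e (i0 + d)) = Some (NEx R0 b) ->
  holds J' B e (fgoal i0 b0 d i u) <-> goal R0 b R (nth 0 e u).
Proof.
move=> ag uB E Eb E0; have [iB _] := ex_B E; have [i0B bB] := ex_B E0.
have aSR a c : J' tSR true [:: a; c] <-> J tSR true [:: a; c] by apply: ag.
have aSING a c : J' tSING true [:: a; c] <-> J tSING true [:: a; c] by apply: ag.
rewrite /fgoal /= Eb /goal; split=> H.
  move=> ER; apply/(T_SING uB bB)/aSING/H/aSR/(T_SR iB i0B); exists R, j, b.
  by rewrite E E0 ER.
move=> /aSR/(T_SR iB i0B)[R' [j' [j'' [E1 E2]]]]; apply/aSING/(T_SING uB bB)/H.
by move: E1 E2; rewrite E E0 => -[-> _] [-> _].
Qed.

Local Opaque fKids.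

Definition RTX X := forall J' e, agree tRT J' ->
  (forall t s u, t < B -> s < B -> u < B -> J' tRT true [:: t; s; u] <-> X t s u) ->
  forall t s u, e = [:: t; s; u] -> t < B -> s < B -> u < B ->
  holds J' B e fRT <-> PhiR nd tok S1 S2 i1 i2 X t s u.

Lemma fRTP X : RTX X.
Proof.
move=> J' e ag HX t s u -> tB sB uB.
have aEX i j : J' tEX true [:: i; j] <-> J tEX true [:: i; j] by apply: ag.
have aK i j : J' tK true [:: i; j] <-> J tK true [:: i; j] by apply: ag.
have aBAD i : J' tBAD true [:: i] <-> J tBAD true [:: i] by apply: ag.
have aIC i : J' tIC true [:: i] <-> J tIC true [:: i] by apply: ag.
have aR2 i : J' tR2 true [:: i] <-> J tR2 true [:: i] by apply: ag.
have aSR i j : J' tSR true [:: i; j] <-> J tSR true [:: i; j] by apply: ag.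
have HK0 : holds J' B [:: t; s; u] (fKids (fun _ _ => ftrue) (fun _ => ftrue) 0 1) <->
    Kids nd tok i1 i2 X no_goal t s.
  have ft e' : holds J' B e' ftrue by move=> x _ /=; exact: leqnn.
  apply: (@KidsP J' X no_goal _ _ [:: t; s; u] 0 1 ag HX tB sB).
    by move=> *; split; split=> // _; exact: ft.
  by move=> *; split=> // _; exact: ft.
have HK1 b i R : nd i = Some (NEx R b) ->
    holds J' B [:: b; i; t; s; u]
      (fKids (fun i u => fgoal 1 0 5 i u) (fun i => FNot (tab tSR [:: i; 4])) 2 3) <->
    Kids nd tok i1 i2 X (goal R b) t s.
  move=> E; have [iB bB] := ex_B E.
  apply: (@KidsP J' X (goal R b) _ _ [:: b; i; t; s; u] 2 3 ag HX tB sB) => //.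
    move=> x0 x1 x2 x3 i' R' b' x0B x1B E'; split.
      exact: (@fgoalP J' [:: x0, x1, x2, x3, i' & [:: b; i; t; s; u]] 1 0 5 4 0 R R' b b' ag x0B E' erefl E).
    exact: (@fgoalP J' [:: x0, x1, x2, x3, i' & [:: b; i; t; s; u]] 1 0 5 4 1 R R' b b' ag x1B E' erefl E).
  move=> x0 x1 i' R' b' E' /=; have [iB' _] := ex_B E'; split.
    move=> H u' ER; case: H; apply/aSR/(T_SR iB' iB); exists R, b', b.
    by rewrite E' E ER.
  move=> H /aSR/(T_SR iB' iB)[R0 [j [j' [E1 E2]]]].
  apply: (@goal_unsat R b) => u' _; apply: H.
  by move: E1 E2; rewrite E E' => -[-> _] [-> _].
rewrite /fRT /PhiR /=; split.
  move=> [HB [HS [HI H]]]; split; first by move/(T_BAD tB)/aBAD.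
  split.
    have {}HS := (agree_ext _ ag (low_Sok _ _)).1 HS.
    exact: ((@SokP [:: t; s; u] 0 1 tB sB).1 HS).
  split; first by move/(T_IC sB)/aIC.
  case: H => [[HT /HK0 H]|[i [iB [b [bB [/aK/(T_K uB iB) HK [/aEX/(T_EX iB bB)[R E] [/aR2/(T_R2 iB)[R' [j [E' RS]]] /(HK1 _ _ _ E) H]]]]]]]].
    have {}HT := (agree_ext _ ag (low_Triv _ _)).1 HT.
    by left; split=> //; exact: ((@TrivP [:: t; s; u] 0 2 tB uB).1 HT).
  right; exists i, R, b; do 3 split=> //.
  by move: E'; rewrite E => -[-> _].
move=> [HB [HS [HI H]]]; split; first by move/aBAD/(T_BAD tB).
split; first exact/(agree_ext _ ag (low_Sok _ _))/(@SokP [:: t; s; u] 0 1 tB sB).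
split; first by move/aIC/(T_IC sB).
case: H => [[HT /HK0 H]|[i [R [b [HK [E [RS /(HK1 _ _ _ E) H]]]]]]].
  left; split; last exact: H.
  exact/(agree_ext _ ag (low_Triv _ _))/(@TrivP [:: t; s; u] 0 2 tB uB).
have [iB bB] := ex_B E; right; exists i; split=> //; exists b; split=> //.
split; first exact/aK/(T_K uB iB).
split; first by apply/aEX/(T_EX iB bB); exists R.
by split; [apply/aR2/(T_R2 iB); exists R, b|exact: H].
Qed.

Lemma T_RT t s u : t < B -> s < B -> u < B ->
  J tRT true [:: t; s; u] <-> RT nd tok S1 S2 i1 i2 t s u.
Proof.
have Hin : List.In (tRT, 3, fRT) all_blocks by inb.
move=> tB sB uB; split.
  apply: (Jind3 (X := RT nd tok S1 S2 i1 i2) Hin) tB sB uB => {}t {}s {}u tB sB uB H.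
  apply: RT_closed => //; move: H; apply: (fRTP _ _ erefl tB sB uB).1; last by [].
  exact: agree_override.
move=> H; have [_ [_ []]] // : t < B /\ s < B /\ u < B /\ J tRT true [:: t; s; u].
apply: (H (fun t s u => t < B /\ s < B /\ u < B /\ J tRT true [:: t; s; u])).
move=> {H tB sB uB t s u} t s u tB sB uB H; do 3 split=> //.
apply: (Jclosed Hin (box3 tB sB uB)).
apply: (fRTP (agree_J _) _ erefl tB sB uB).2 H => t' s' u' tB' sB' uB'.
by split=> [H|[_ [_ [_ H]]]].
Qed.

Lemma ffinalP : holds J B [::] ffinal <-> Final nd tok S1 S2 i1 i2.
Proof.
rewrite /ffinal /fparent /Final /=; split.
  move=> [t [tB [s [sB [/(T_RT tB sB sB) H Hs]]]]]; exists t, s; do 3 split=> //.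
  case: Hs => [Hs|]; first by left=> Es; apply: Hs; apply/fzeroP.
  move=> [t0 [t0B [s0 [s0B [i [iB [b [bB [u [uB [k [kB H']]]]]]]]]]]].
  move: H' => [/(@TokP [:: k; u; b; i; s0; t0; s; t] 0 kB) /= Ek [Hu [HR [HE [Hb [HC HI]]]]]].
  have Eu := (T_SING uB kB).1 Hu; have {}HR := (T_RT t0B s0B uB).1 HR.
  have [R E] := (T_EX iB bB).1 HE; have {}Hb := (T_BIT s0B iB).1 Hb.
  right; exists t0, s0, i, R, b; split; first exact: t0B.
  split; first exact: s0B.
  split; first by have -> : 2 ^ tok = u by rewrite Eu Ek.
  split; first exact: E.
  split; first exact: Hb.
  split; first exact: ((@CompatP [:: k; u; b; i; s0; t0; s; t] 3 5 7 R b t0B tB E).1 HC).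
  exact: ((@InclP [:: k; u; b; i; s0; t0; s; t] 3 6 4 R b sB s0B E).1 HI).
move=> [t [s [tB [sB [H Hs]]]]]; exists t; split=> //; exists s; split=> //.
split; first exact/(T_RT tB sB sB).
case: Hs => [Hs|[t0 [s0 [i [R [b [t0B [s0B [HR [E [Hb [HC HI]]]]]]]]]]]].
  by left=> /fzeroP.
have [iB bB] := ex_B E; have tb : 2 ^ tok < B by rewrite ltn_exp2l.
right; exists t0; split=> //; exists s0; split=> //; exists i; split=> //; exists b; split=> //.
exists (2 ^ tok); split=> //; exists tok; split; first exact: tok_B.
split; first exact/(@TokP [:: tok; 2 ^ tok; b; i; s0; t0; s; t] 0 tok_B).
split; first exact/(T_SING tb tok_B).
split; first exact/(T_RT t0B s0B tb).
split; first by apply/(T_EX iB bB); exists R.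
split; first exact/(T_BIT s0B iB).
split; first exact/(@CompatP [:: tok; 2 ^ tok; b; i; s0; t0; s; t] 3 5 7 R b t0B tB E).
exact/(@InclP [:: tok; 2 ^ tok; b; i; s0; t0; s; t] 3 6 4 R b sB s0B E).
Qed.

Lemma fmain_valid : holds J B [::] fmain <-> horn T2 /\ rCQ_entails S1 S2 T1 T2.
Proof.
rewrite /fmain /=; split.
  move=> [_ [/fhornP H HF]]; split=> //; apply: (not_final_entails coherent_word) => //.
  by move/ffinalP.
move=> [H HE]; split; first by apply/fvalidP; exists T1, T2, S1, S2.
split; first exact/fhornP.
by move/ffinalP/(final_not_entails coherent_word H).
Qed.
End Valid.

Lemma fmainP : holds J B [::] fmain <->
  exists T1 T2 S1 S2, [/\ w = enc_instance T1 T2 S1 S2, horn T2 & rCQ_entails S1 S2 T1 T2].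
Proof.
split=> [H|[T1 [T2 [S1 [S2 [E H1 H2]]]]]]; last exact/(fmain_valid E).
have [HV _] : holds J B [::] fvalid /\ True by case: H.
have [T1 [T2 [S1 [S2 E]]]] := fvalidP.1 HV.
by have [? ?] := (fmain_valid E).1 H; exists T1, T2, S1, S2.
Qed.
End Tables.

Lemma in_ExpTime_ext (L L' : language) : (forall w, L w <-> L' w) -> in_ExpTime L -> in_ExpTime L'.
Proof.
move=> E [M [k H]]; exists M, k => w; have [h a] := H w; split=> //.
by rewrite a.
Qed.

Theorem entailment_in_ExpTime : in_ExpTime (fun w : seq bool =>
    exists (T1 T2 : tbox) (S1 S2 : signature),
      [/\ w = enc_instance T1 T2 S1 S2, horn T2 & rCQ_entails S1 S2 T1 T2]).
Proof.
apply: in_ExpTime_ext fmainP _; apply: definable_in_ExpTime; [exact: wf_all_blocks|exact: closed_fmain].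
Qed.

(** * Printing words in polynomial time *)

Notation regI := 2.

(* Variables are de Bruijn indices; [PFor i p] lets a fresh variable run
   downwards below the value of [i], and [PIn i p q] tests the letter of the
   input at [i]. *)
Inductive printer :=
| PStr of seq bool
| PCat of printer & printer
| PRep of nat & seq bool
| PFor of nat & printer
| PIn of nat & printer & printer.

Fixpoint printed (w : seq bool) (p : printer) (e : seq nat) : seq bool :=
  match p with
  | PStr s => s
  | PCat p q => printed w p e ++ printed w q e
  | PRep i s => flatten (nseq (nth 0 e i) s)
  | PFor i p => flatten [seq printed w p (x :: e) | x <- rev (iota 0 (nth 0 e i))]
  | PIn i p q => if nth false w (nth 0 e i) then printed w p e else printed w q e
  end.

Fixpoint closed_printer d p : bool :=
  match p with
  | PStr s => true
  | PCat p q => closed_printer d p && closed_printer d q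
  | PRep i s => i < d
  | PFor i p => (i < d) && closed_printer d.+1 p
  | PIn i p q => [&& i < d, closed_printer d p & closed_printer d q]
  end.

Definition print_cmd s := foldr (fun b c => Seq (Put 0 (Some b)) (Seq (Rt 0) c)) Skip s.

(* The register of a variable holds the successor of its value. *)
Fixpoint pcomp p d : cmd :=
  match p with
  | PStr s => print_cmd s
  | PCat p q => Seq (pcomp p d) (pcomp q d)
  | PRep i s => Seq (add (var_reg d i) regU) (Seq (Lt regU) (down regU (print_cmd s)))
  | PFor i p => Seq (add (var_reg d i) (regV d)) (Seq (Lt (regV d))
                  (down (regV d) (pcomp p d.+1)))
  | PIn i p q => Seq (add (var_reg d i) regI) (If regI (is_bit true)
                   (Seq (clear regI) (pcomp p d)) (Seq (clear regI) (pcomp q d)))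
  end.

Definition emit (out : seq bool) s : store :=
  Store (fun i => if i == 0 then pos s 0 + size out else pos s i)
    (fun i x => if (i == 0) && (pos s 0 <= x < pos s 0 + size out)
                then Some (nth false out (x - pos s 0)) else arr s i x).

Lemma emit0 s : emit [::] s = s.
Proof.
apply: store_ext; apply: functional_extensionality => i /=; first by case: eqP => // ->; lia.
by apply: functional_extensionality => x; rewrite addn0; case: ifP => // /andP[_]; lia.
Qed.

Lemma emit_cat a b s : emit (a ++ b) s = emit b (emit a s).
Proof.
apply: store_ext; apply: functional_extensionality => i /=.
  by case: eqP => //; rewrite size_cat; lia.
apply: functional_extensionality => x; rewrite size_cat; case: (i == 0) => //=.
rewrite nth_cat; case: (ltnP x (pos s 0)) => H1; first by have -> : (pos s 0 + size a <= x) = false by lia.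
case: (ltnP x (pos s 0 + size a)) => H2.
  have -> : (x < pos s 0 + (size a + size b)) = true by lia.
  by have -> : (x - pos s 0 < size a) = true by lia.
have -> : (x - pos s 0 < size a) = false by lia.
rewrite addnA; case: ltnP => //= _; congr (Some (nth _ _ _)); lia.
Qed.

Lemma emit_goto out s i v : i != 0 -> emit out (goto s i v) = goto (emit out s) i v.
Proof.
move=> i0; have z : (0 == i) = false by rewrite eq_sym (negbTE i0).
apply: store_ext; apply: functional_extensionality => j; rewrite /= z //.
by case: (j =P 0) => // ->; rewrite z.
Qed.

Lemma runs_print_cmd out s : runs (print_cmd out) s (2 * size out) (emit out s).
Proof.
elim: out s => [|b out IH] s; first by rewrite emit0; apply: runs_skip.
rewrite -cat1s emit_cat.
have -> : emit [:: b] s = goto (put s 0 (Some b)) 0 (pos (put s 0 (Some b)) 0).+1.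
  apply: store_ext; apply: functional_extensionality => i /=; first by case: eqP => //; lia.
  apply: functional_extensionality => x; case: (i == 0) => //=.
  case: (x =P pos s 0) => [->|ne]; first by rewrite ifT ?subnn //; lia.
  by rewrite ifF //; lia.
apply: runs_le (runs_seq (runs_put _ _ _) (runs_seq (runs_rt _ _) (IH _))) _ => /=; lia.
Qed.

Record printing V (w : seq bool) s d (e : seq nat) : Prop := Printing {
  pr_U : pos s regU = 0;
  pr_Z : pos s regZ = 0;
  pr_I : pos s regI = 0;
  pr_size : size e = d;
  pr_env : forall i, i < d -> pos s (var_reg d i) = (nth 0 e i).+1;
  pr_free : forall j, d <= j -> pos s (regV j) = 0;
  pr_le : all (fun x => x <= V) e;
  pr_in : forall x, arr s regI x.+1 = nth None (map Some w) x
}.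

Lemma printing_emit V w s d e out : printing V w s d e -> printing V w (emit out s) d e.
Proof.
case=> U Z I S E F L H; split=> //= [i id|j dj]; last by rewrite ifF ?F //; apply/eqP; rewrite /regV; lia.
by rewrite -(E i id); case: eqP => //; rewrite /var_reg /regV; lia.
Qed.

Lemma printing_push V w s d e k : printing V w s d e -> k <= V ->
  printing V w (goto s (regV d) k.+1) d.+1 (k :: e).
Proof.
case=> U Z I S E F L H kV; split=> //=; rewrite ?S ?kV ?L //.
1-3: by case: eqP => //; rewrite /regV; lia.
- move=> [|i] id; first by rewrite /var_reg subn1 eqxx.
  rewrite -(E i id) /var_reg subSS; case: eqP => //; rewrite /regV; lia.
- by move=> j dj; rewrite F; [case: eqP => //; rewrite /regV; lia|lia].
Qed.

Fixpoint print_cost p V : nat :=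
  match p with
  | PStr s => 2 * size s
  | PCat p q => print_cost p V + print_cost q V
  | PRep i s => 9 * V + (V * (2 * size s + 3) + 20)
  | PFor i p => 9 * V + (V * (print_cost p V + 3) + 20)
  | PIn i p q => 12 * V + (print_cost p V + print_cost q V + 40)
  end.

Lemma flatten_nseqSr (T : Type) n (s : seq T) :
  flatten (nseq n.+1 s) = flatten (nseq n s) ++ s.
Proof. by elim: n => [|n IH]; rewrite /= ?cats0 // -catA -IH. Qed.

Lemma nth_le V (e : seq nat) i : all (fun x => x <= V) e -> nth 0 e i <= V.
Proof.
move=> /allP H; case: (ltnP i (size e)) => ie; last by rewrite nth_default.
by apply: H; apply: mem_nth.
Qed.

Lemma runs_printer V w p : forall d s e, closed_printer d p -> printing V w s d e ->
  runs (pcomp p d) s (print_cost p V) (emit (printed w p e) s).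
Proof.
elim: p => [out|p IHp q IHq|i out|i p IH|i p IHp q IHq] d s e /=.
- by move=> _ _; apply: runs_print_cmd.
- move=> /andP[cp cq] R; rewrite emit_cat.
  exact: runs_seq (IHp _ _ _ cp R) (IHq _ _ _ cq (printing_emit _ R)).
- move=> id R; have xV := nth_le i (pr_le R); set x := nth 0 e i in xV *.
  have [_ _ n3 _ n5] := var_reg_neq d i.
  have H1 := @runs_add (var_reg d i) regU s n3 n5 isT (pr_Z R).
  rewrite (pr_U R) (pr_env R id) -/x in H1.
  have H2 := runs_lt regU (goto s regU (0 + x.+1)); rewrite /= goto_goto in H2.
  pose f k := goto (emit (flatten (nseq (x - k) out)) s) regU k.
  have H3 : runs (down regU (print_cmd out)) (f x) (x * (2 * size out + 3) + 1) (f 0).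
    apply: runs_down => [//|k kx].
    exists (emit out (f k.+1)); first exact: runs_print_cmd.
    rewrite /f emit_goto //= goto_goto -emit_cat -flatten_nseqSr.
    by rewrite (_ : (x - k.+1).+1 = x - k) //; lia.
  have E : f x = goto s regU x by rewrite /f subnn emit0.
  rewrite E in H3.
  have -> : emit (flatten (nseq x out)) s = f 0.
    rewrite /f subn0; have U := pr_U (printing_emit (flatten (nseq x out)) R).
    by rewrite -{1}(goto_id (emit _ s) regU) U.
  apply: runs_le (runs_seq H1 (runs_seq H2 H3)) _; nia.
- move=> /andP[id cp] R; have xV := nth_le i (pr_le R); set v := nth 0 e i in xV *.
  have [_ _ _ _ n5] := var_reg_neq d i.
  have n6 : var_reg d i != regV d by rewrite /var_reg /regV; lia.
  have n7 : regV d != regZ by rewrite /regV; lia.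
  have n8 : regV d != 0 by rewrite /regV; lia.
  have H1 := @runs_add (var_reg d i) (regV d) s n6 n5 n7 (pr_Z R).
  rewrite (pr_free R (leqnn d)) (pr_env R id) -/v in H1.
  have H2 := runs_lt (regV d) (goto s (regV d) (0 + v.+1)); rewrite /= eqxx goto_goto in H2.
  pose out k := flatten [seq printed w p (x :: e) | x <- rev (iota k (v - k))].
  pose f k := goto (emit (out k) s) (regV d) k.
  have H3 : runs (down (regV d) (pcomp p d.+1)) (f v) (v * (print_cost p V + 3) + 1) (f 0).
    apply: runs_down => [k _|k kv]; first by rewrite /f /= eqxx.
    exists (emit (printed w p (k :: e)) (f k.+1)).
      apply: IH cp _; apply: printing_push; last lia.
      exact: printing_emit.
    rewrite /f emit_goto // goto_goto -emit_cat /= eqxx.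
    suff -> : out k = out k.+1 ++ printed w p (k :: e) by [].
    rewrite /out (_ : v - k = (v - k.+1).+1); last lia.
    by rewrite /= rev_cons map_rcons flatten_rcons.
  have E : f v = goto s (regV d) v by rewrite /f /out subnn /= emit0.
  rewrite E in H3.
  have -> : emit (flatten [seq printed w p (x :: e) | x <- rev (iota 0 v)]) s = f 0.
    rewrite /f /out subn0.
    have F := pr_free (printing_emit (flatten [seq printed w p (x :: e) | x <- rev (iota 0 v)]) R) (leqnn d).
    by rewrite -{1}(goto_id (emit _ s) (regV d)) F.
  apply: runs_le (runs_seq H1 (runs_seq H2 H3)) _; nia.
- move=> /and3P[id cp cq] R; have xV := nth_le i (pr_le R); set x := nth 0 e i in xV *.
  have [_ _ _ _ n5] := var_reg_neq d i.
  have n6 : var_reg d i != regI by rewrite /var_reg /regV; lia.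
  have H1 := @runs_add (var_reg d i) regI s n6 n5 isT (pr_Z R).
  rewrite (pr_I R) (pr_env R id) -/x add0n in H1.
  set s1 := goto s regI x.+1 in H1.
  have E2 : goto s1 regI 0 = s by rewrite /s1 goto_goto; have := goto_id s regI; rewrite (pr_I R).
  have H2 := runs_clear regI s1; rewrite E2 /= in H2.
  have L : is_bit true (look s1 regI) = nth false w x.
    rewrite /look /= (pr_in R) /is_bit; case: (ltnP x (size w)) => xw.
      by rewrite (nth_map false) //; case: (nth false w x).
    by rewrite !nth_default ?size_map.
  have H3 : runs (If regI (is_bit true) (Seq (clear regI) (pcomp p d))
      (Seq (clear regI) (pcomp q d))) s1 (3 * x.+1 + 1 + (print_cost p V + print_cost q V)).+2
      (emit (if nth false w x then printed w p e else printed w q e) s).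
    apply: runs_if; rewrite L; case: (nth false w x).
      apply: runs_le (runs_seq H2 (IHp _ _ _ cp R)) _; lia.
    apply: runs_le (runs_seq H2 (IHq _ _ _ cq R)) _; lia.
  apply: runs_le (runs_seq H1 H3) _; nia.
Qed.

Definition load_cmd :=
  Seq (If 0 (is_bit true) (Put regI (Some true)) (Put regI (Some false)))
    (Seq (Put 0 None) (Seq (Rt 0) (Seq (Rt regI) (Seq (Rt regN) (Rt (regV 1)))))).

Definition loaded (w : seq bool) j : store :=
  Store (fun t => if t == 0 then j.+1 else if t == regI then j.+1
                  else if t == regN then j else if t == regV 1 then j.+1 else 0)
    (fun i x => if i == 0 then (if 0 < x <= j then None else nth None (map Some w) x.-1)
                else if i == regI then (if 0 < x <= j then nth None (map Some w) x.-1 else None)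
                else None).

Lemma runs_load w j : j < size w -> runs load_cmd (loaded w j) 8 (loaded w j.+1).
Proof.
move=> jw; set b := nth false w j.
have Eb : nth None (map Some w) j = Some b by rewrite (nth_map false).
have H1 : runs (If 0 (is_bit true) (Put regI (Some true)) (Put regI (Some false)))
    (loaded w j) 3 (put (loaded w j) regI (Some b)).
  apply: runs_if; rewrite /look /= ltnn /= Eb /is_bit; case: (b); exact: runs_put.
have H2 := runs_seq H1 (runs_seq (runs_put 0 None _) (runs_seq (runs_rt 0 _) (runs_seq
  (runs_rt regI _) (runs_seq (runs_rt regN _) (runs_rt (regV 1) _))))).
move: H2; set s' := goto _ _ _; suff -> : s' = loaded w j.+1 by [].
rewrite /s'; apply: store_ext; apply: functional_extensionality => t /=.
  by rewrite /regV; nat_cases; try subst; lia.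
apply: functional_extensionality => x.
case: (t =P 0) => [->|_] /=.
  case: (x =P j.+1) => [->|ne]; first by rewrite ltnS leqnn.
  have -> : (0 < x <= j.+1) = (0 < x <= j) by lia.
  by [].
case: (t =P 2) => //= _; case: (x =P j.+1) => [->|ne]; first by rewrite ltnS leqnn -Eb.
by have -> : (0 < x <= j.+1) = (0 < x <= j) by lia.
Qed.

Definition power_cmd k := iter k (fun c => Seq c (addr_step (regV 0) regW)) (Rt (regV 0)).

Lemma iter_rt r k s : runs (iter k (Seq (Rt r)) Skip) s k (goto s r (pos s r + k)).
Proof.
elim: k s => [|k IH] s; first by rewrite addn0 goto_id; apply: runs_skip.
apply: runs_le (runs_seq (runs_rt r s) _) _; last exact: leqnn.
have := IH (goto s r (pos s r).+1); rewrite goto_goto /= eqxx.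
by rewrite addSnnS.
Qed.

Lemma runs_power k s n B : pos s regN = n -> pos s regU = 0 -> pos s regZ = 0 ->
  pos s regW = 0 -> pos s (regV 0) = 0 -> n < B ->
  runs (power_cmd k) s (k * (B ^ k * (21 * B + 5) + 10) + 1) (goto s (regV 0) (n ^ k)).
Proof.
move=> N U Z W V nB.
suff H j : j <= k ->
    runs (power_cmd j) s (j * (B ^ k * (21 * B + 5) + 10) + 1) (goto s (regV 0) (n ^ j)) by apply: H.
elim: j => [|j IH] jk; first by have := runs_rt (regV 0) s; rewrite V.
have H := @runs_addr_step (regV 0) regW (goto s (regV 0) (n ^ j)) n N U Z isT isT isT isT isT isT.
rewrite goto_goto /= W addn0 -expnSr in H; apply: runs_le (runs_seq (IH (ltnW jk)) H) _.
have : n ^ j <= B ^ k.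
  apply: leq_trans (_ : B ^ j <= _); last by apply: leq_pexp2l; lia.
  by case: (j) => // i; rewrite leq_exp2r //; lia.
rewrite expnSr; move: (n ^ j) (B ^ k) => x y xy.
have : x * (9 * n + 5) + 12 * (x * n) <= y * (21 * B + 5) by nia.
by rewrite (mulSn j); lia.
Qed.

Definition prepare k :=
  Seq (Seq (Rt 0) (Seq (Rt regI) (Rt (regV 1))))
    (Seq (While 0 nonblank load_cmd)
      (Seq (Seq (clear 0) (Seq (Rt 0) (clear regI)))
        (Seq (power_cmd k) (iter k.+2 (Seq (Rt (regV 0))) Skip)))).

Definition prepared (w : seq bool) k : store :=
  Store (fun t => if t == 0 then 1 else if t == regN then size w else if t == regV 1 then (size w).+1
                  else if t == regV 0 then size w ^ k + k.+2 else 0)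
    (arr (loaded w (size w))).

Definition prepare_cost k B := 20 * B + (k * (B ^ k * (21 * B + 5) + 10) + k + 30).

Lemma runs_prepare w k : runs (prepare k) (store0 w) (prepare_cost k (size w).+2) (prepared w k).
Proof.
set n := size w.
have L j : j <= n -> runs (While 0 nonblank load_cmd) (loaded w (n - j)) (j * 10 + 1) (loaded w n).
  elim: j => [|j IH] jn.
    rewrite subn0; exists 1; first lia; apply: XWhF.
    by rewrite /look /= /nonblank ltnn /= nth_default ?size_map.
  have [a aj Ea] := IH (ltnW jn).
  have E : n - j = (n - j.+1).+1 by lia.
  have [b bj Eb] := @runs_load w (n - j.+1) ltac:(lia).
  exists (b + a).+2; first lia; rewrite E in Ea; apply: XWhT Eb Ea.
  by rewrite /look /= /nonblank ltnn /= (nth_map false) //; lia.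
have H4 := L n (leqnn n); rewrite subnn in H4.
have H1 := runs_seq (runs_rt 0 (store0 w)) (runs_seq (runs_rt regI _) (runs_rt (regV 1) _)).
set s1 := goto _ _ _ in H1.
have E1 : s1 = loaded w 0.
  rewrite /s1; apply: store_ext; apply: functional_extensionality => t /=.
    by rewrite /regV; nat_cases; try subst; lia.
  apply: functional_extensionality => x; case: (t =P 0) => [_|_] /=.
    by rewrite ifN //; lia.
  by case: ifP => // _; rewrite ifN //; lia.
have H5 := runs_seq (runs_clear 0 (loaded w n)) (runs_seq (runs_rt 0 _) (runs_clear regI _)).
set s2 := goto (goto (goto _ _ _) _ _) _ _ in H5.
have H6 := @runs_power k s2 n n.+2 erefl erefl erefl erefl erefl ltac:(lia).
have H7 := iter_rt (regV 0) k.+2 (goto s2 (regV 0) (n ^ k)).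
have E7 : goto (goto s2 (regV 0) (n ^ k)) (regV 0) (pos (goto s2 (regV 0) (n ^ k)) (regV 0) + k.+2)
    = prepared w k.
  apply: store_ext => //; apply: functional_extensionality => t.
  by rewrite /s2 /prepared -/n /regV /=; nat_cases; try subst; lia.
rewrite E7 in H7.
rewrite E1 in H1.
apply: runs_le (runs_seq H1 (runs_seq H4 (runs_seq H5 (runs_seq H6 H7)))) _.
rewrite /prepare_cost /=; move: (k * _) => c; lia.
Qed.

Lemma printing_prepared w k : printing (size w + (size w ^ k + k.+1)) w (prepared w k) 2
  [:: size w; size w ^ k + k.+1].
Proof.
split=> //=.
- by case=> [|[|i]] //= _; rewrite addnS.
- by move=> j dj; rewrite !ifF //; apply/eqP; rewrite /regV; lia.
- by rewrite leq_addr leq_addl.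
- move=> x; case: ltnP => // xw; by rewrite nth_default ?size_map.
Qed.

Lemma size_printed V w p : forall e, all (fun x => x <= V) e -> closed_printer (size e) p ->
  size (printed w p e) <= print_cost p V.
Proof.
have L n (s : seq bool) : size (flatten (nseq n s)) = n * size s.
  by elim: n => //= n IH; rewrite size_cat IH mulSn.
elim: p => [out|p IHp q IHq|i out|i p IH|i p IHp q IHq] e eV /=; first lia.
- by move=> /andP[/(IHp _ eV) Hp /(IHq _ eV) Hq]; rewrite size_cat; lia.
- by move=> _; rewrite L; have := nth_le i eV; nia.
- move=> /andP[_ cp]; have := nth_le i eV; set v := nth 0 e i => vV.
  apply: leq_trans (_ : v * print_cost p V <= _); last nia.
  have : forall l, all (fun x => x < v) l ->
      size (flatten [seq printed w p (x :: e) | x <- l]) <= size l * print_cost p V.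
    elim=> //= x l IHl /andP[xv lv]; rewrite size_cat mulSn leq_add ?IHl //.
    by apply: IH; rewrite //= eV andbT; lia.
  move/(_ (rev (iota 0 v))); rewrite size_rev size_iota; apply.
  by apply/allP => x; rewrite mem_rev mem_iota.
- move=> /and3P[_ /(IHp _ eV) Hp /(IHq _ eV) Hq]; case: ifP => _; lia.
Qed.

Lemma poly_bounded_print_cost p f : poly_bounded f -> poly_bounded (fun B => print_cost p (f B)).
Proof. by move=> H; elim: p => * /=; poly. Qed.

Lemma print_cost_mono p V V' : V <= V' -> print_cost p V <= print_cost p V'.
Proof. by move=> le; elim: p => * /=; nia. Qed.

Lemma poly_time_bound c n : n.+2 ^ c <= n ^ (2 * c + 3 ^ c) + (2 * c + 3 ^ c).
Proof.
case: n => [|[|n]].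
- apply: leq_trans (_ : 3 ^ c <= _); last lia.
  by case: c => // c; rewrite leq_exp2r.
- by rewrite exp1n; lia.
apply: leq_trans (leq_addr _ _); rewrite expnD expnM.
apply: leq_trans (_ : (n.+2 ^ 2) ^ c <= _); last by rewrite leq_pmulr // expn_gt0.
case: c => // c; rewrite leq_exp2r // expnS expn1; nia.
Qed.

Theorem printer_polytime p k : closed_printer 2 p ->
  polytime (fun w => printed w p [:: size w; size w ^ k + k.+1]).
Proof.
move=> cl; pose V B := B + (B ^ k + k.+1).
pose cost B := prepare_cost k B + (print_cost p (V B) + (3 * print_cost p (V B) + 20)).
have [c Hc] : poly_bounded cost.
  have PV : poly_bounded V by rewrite /V; poly.
  by rewrite /cost /prepare_cost; poly; exact: poly_bounded_print_cost.
pose prog := Seq (prepare k) (Seq (pcomp p 2) (Seq (clear 0) (Rt 0))).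
exists (compiled prog 0), (2 * c + 3 ^ c); apply: compiled_computes => w.
set n := size w; set e := [:: n; n ^ k + k.+1]; set out := printed w p e.
have PR := printing_prepared w k; rewrite -/n -/e in PR.
have H := runs_seq (runs_prepare w k) (runs_seq (runs_printer cl PR)
  (runs_seq (runs_clear 0 _) (runs_rt 0 _))).
rewrite -/out in H; have [a aL X] := H; eexists a, _; split; first exact: X.
- apply: leq_trans (poly_time_bound c n); apply: leq_trans (Hc n.+2 isT).
  have SL : size out <= print_cost p (n + (n ^ k + k.+1)).
    exact: (size_printed w (pr_le PR) cl).
  have M : print_cost p (n + (n ^ k + k.+1)) <= print_cost p (V n.+2).
    apply: print_cost_mono; rewrite /V.
    have : n ^ k <= n.+2 ^ k by case: (k) => // j; rewrite leq_exp2r //; lia.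
    lia.
  rewrite /cost; move: aL SL M; rewrite /= -/n /=.
  move: (prepare_cost _ _) (print_cost p _) (print_cost p _) (size out) => x y z t; lia.
- by [].
- move=> x xs; rewrite /= add1n ltnS subn1 /=.
  case: ltnP => [xl|lx]; first by rewrite (nth_map false).
  rewrite [RHS]nth_default ?size_map //; case: ltnP => // nx.
  by rewrite nth_default ?size_map.
Qed.

(** * Concepts with indexed names *)

(* [TName t o v] is the name with tag [t] whose unary index is [o] plus the
   value of the variable [v]. *)
Inductive template :=
| TName of seq bool & nat & option nat
| TTop
| TNot of template
| TAnd of template & template
| TEx of seq bool & template.

Definition shift (e : seq nat) (v : option nat) := if v is Some i then nth 0 e i else 0.

Definition indexed t i : name := t ++ nseq i true.

Fixpoint inst (e : seq nat) (C : template) : concept :=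
  match C with
  | TName t o v => CName (indexed t (o + shift e v))
  | TTop => CTop
  | TNot C => CNot (inst e C)
  | TAnd C D => CAnd (inst e C) (inst e D)
  | TEx R C => CEx R (inst e C)
  end.

Fixpoint print_template (C : template) : printer :=
  match C with
  | TName t o v =>
      PCat (PStr ([:: false; false] ++ body (fun b => [:: b]) (indexed t o)))
        (PCat (if v is Some i then PRep i [:: true; true] else PStr [::]) (PStr [:: false]))
  | TTop => PStr [:: false; true; false]
  | TNot C => PCat (PStr [:: false; true; true]) (print_template C)
  | TAnd C D => PCat (PStr [:: true; false]) (PCat (print_template C) (print_template D))
  | TEx R C => PCat (PStr ([:: true; true] ++ enc_name R)) (print_template C)
  end.

Fixpoint closed_template d (C : template) : bool :=
  match C with
  | TName _ _ v => if v is Some i then i < d else true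
  | TTop => true
  | TNot C => closed_template d C
  | TAnd C D => closed_template d C && closed_template d D
  | TEx _ C => closed_template d C
  end.

Lemma body_cat (X : Type) (e : X -> seq bool) s s' : body e (s ++ s') = body e s ++ body e s'.
Proof. by rewrite /body map_cat flatten_cat. Qed.

Lemma body_true n : body (fun b : bool => [:: b]) (nseq n true) = flatten (nseq n [:: true; true]).
Proof. by elim: n => //= n <-. Qed.

Lemma printed_template w e C : printed w (print_template C) e = enc_concept (inst e C).
Proof.
elim: C => //= [t o v|C ->|C -> D ->|R C ->] //.
have -> : indexed t (o + shift e v) = indexed t o ++ nseq (shift e v) true.
  by rewrite /indexed nseqD catA.
rewrite /enc_name enc_seq_body body_cat -catA body_true.
by case: v.
Qed.

Lemma closed_print_template d C : closed_template d C -> closed_printer d (print_template C).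
Proof. elim: C d => //= [t o [i|] d|C IHC D IHD d /andP[/IHC -> /IHD ->]] //.
by rewrite andbT. Qed.

(* [IFor v Cs] ranges over the numbers below the variable [v], and [IIn Cs Ds]
   over the positions of the input, with a choice depending on the letter. *)
Inductive item :=
| IOne of template
| IFor of nat & seq template
| IIn of seq template & seq template.

Definition inst_below (e : seq nat) v (f : nat -> seq template) : seq concept :=
  flatten [seq [seq inst (x :: e) C | C <- f x] | x <- rev (iota 0 (nth 0 e v))].

Definition inst_item w e it : seq concept :=
  match it with
  | IOne C => [:: inst e C]
  | IFor v Cs => inst_below e v (fun _ => Cs)
  | IIn Cs Ds => inst_below e 0 (fun x => if nth false w x then Cs else Ds)
  end.

Definition print_axioms Cs :=
  foldr (fun C p => PCat (PStr (true :: enc_concept CTop)) (PCat (print_template C) p)) (PStr [::]) Cs.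

Definition print_item it : printer :=
  match it with
  | IOne C => print_axioms [:: C]
  | IFor v Cs => PFor v (print_axioms Cs)
  | IIn Cs Ds => PFor 0 (PIn 0 (print_axioms Cs) (print_axioms Ds))
  end.

Definition closed_item d it : bool :=
  match it with
  | IOne C => closed_template d C
  | IFor v Cs => (v < d) && all (closed_template d.+1) Cs
  | IIn Cs Ds => [&& 0 < d, all (closed_template d.+1) Cs & all (closed_template d.+1) Ds]
  end.

Lemma closed_print_axioms d Cs : all (closed_template d) Cs -> closed_printer d (print_axioms Cs).
Proof. by elim: Cs => //= C Cs IH /andP[/closed_print_template -> /IH]. Qed.

Lemma closed_print_item d it : closed_item d it -> closed_printer d (print_item it).
Proof.
case: it => [C|v Cs|Cs Ds] /=; first by move/closed_print_template => ->.
  by move=> /andP[-> /closed_print_axioms].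
by move=> /and3P[-> /closed_print_axioms -> /closed_print_axioms ->].
Qed.

Definition valid_tbox (Cs : seq concept) : tbox := [seq Incl CTop C | C <- Cs].

Lemma printed_axioms w e Cs :
  printed w (print_axioms Cs) e = body enc_inclusion (valid_tbox [seq inst e C | C <- Cs]).
Proof. by elim: Cs => //= C Cs ->; rewrite printed_template. Qed.

Lemma valid_tbox_cat Cs Ds : valid_tbox (Cs ++ Ds) = valid_tbox Cs ++ valid_tbox Ds.
Proof. exact: map_cat. Qed.

Lemma printed_item w e it :
  printed w (print_item it) e = body enc_inclusion (valid_tbox (inst_item w e it)).
Proof.
have L (f : nat -> seq template) p : (forall x, printed w p (x :: e) =
      body enc_inclusion (valid_tbox [seq inst (x :: e) C | C <- f x])) ->
    forall v, printed w (PFor v p) e = body enc_inclusion (valid_tbox (inst_below e v f)).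
  move=> H v; rewrite /= /inst_below; elim: (rev _) => //= x l ->.
  by rewrite valid_tbox_cat body_cat H.
case: it => [C|v Cs|Cs Ds]; first exact: printed_axioms.
  by apply: L => x; apply: printed_axioms.
apply: (L (fun x => if nth false w x then Cs else Ds)) => x /=.
by case: ifP => _; apply: printed_axioms.
Qed.

Definition inst_items w e its := flatten [seq inst_item w e it | it <- its].

Definition print_items its := foldr (fun it p => PCat (print_item it) p) (PStr [::]) its.

Lemma printed_items w e its :
  printed w (print_items its) e = body enc_inclusion (valid_tbox (inst_items w e its)).
Proof.
elim: its => //= it its ->; rewrite printed_item /inst_items /=.
by rewrite valid_tbox_cat body_cat.
Qed.

Lemma closed_print_items d its : all (closed_item d) its -> closed_printer d (print_items its).
Proof. by elim: its => //= it its IH /andP[/closed_print_item -> /IH]. Qed.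

Lemma instance_polytime k its T2 S1 S2 : all (closed_item 2) its ->
  polytime (fun w => enc_instance
    (valid_tbox (inst_items w [:: size w; size w ^ k + k.+1] its)) T2 S1 S2).
Proof.
move=> cl; set tail := [:: false] ++ enc_tbox T2 ++ enc_signature S1 ++ enc_signature S2.
have [|M [c H]] := @printer_polytime (PCat (print_items its) (PStr tail)) k.
  by rewrite /= closed_print_items.
exists M, c => w; have := H w.
suff -> : printed w (PCat (print_items its) (PStr tail)) [:: size w; size w ^ k + k.+1] =
  enc_instance (valid_tbox (inst_items w [:: size w; size w ^ k + k.+1] its)) T2 S1 S2 by [].
rewrite -[LHS]/(printed w (print_items its) _ ++ tail) printed_items /enc_instance.
by rewrite [enc_tbox (valid_tbox _)](enc_seq_body enc_inclusion) -catA.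
Qed.

Definition satisfies I Cs := forall C, List.In C Cs -> forall d : dom I, ext C d.

Lemma satisfies_cat I Cs Ds : satisfies I (Cs ++ Ds) <-> satisfies I Cs /\ satisfies I Ds.
Proof.
split=> [H|[H H'] C HC].
  by split=> C HC; apply: H; apply: List.in_or_app; [left|right].
by case: (List.in_app_or _ _ _ HC) => {}HC; [exact: H|exact: H'].
Qed.

Lemma satisfies_below I e v f : satisfies I (inst_below e v f) <->
  forall x, x < nth 0 e v -> satisfies I [seq inst (x :: e) C | C <- f x].
Proof.
rewrite /inst_below; have H x : x < nth 0 e v <-> x \in rev (iota 0 (nth 0 e v)).
  by rewrite mem_rev mem_iota.
have -> : (forall x, x < nth 0 e v -> satisfies I [seq inst (x :: e) C | C <- f x]) <->
    (forall x, x \in rev (iota 0 (nth 0 e v)) -> satisfies I [seq inst (x :: e) C | C <- f x]).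
  by split=> G x /H; apply: G.
elim: (rev _) => [|x l IH] /=; first by split=> // _ C [].
rewrite satisfies_cat IH; split=> [[H1 H2] y|G].
  by rewrite inE => /orP[/eqP->|/H2].
by split=> [|y yl]; apply: G; rewrite inE ?eqxx // yl orbT.
Qed.

Lemma satisfies_cons I C Cs : satisfies I (C :: Cs) <-> (forall d : dom I, ext C d) /\ satisfies I Cs.
Proof.
split=> [H|[H H'] D]; first by split=> [|D DC]; apply: H; [left|right].
by case=> [<-|DC]; [exact: H|exact: H'].
Qed.

Lemma valid_tbox_sat I Cs :
  (forall x, List.In x (valid_tbox Cs) -> sat_inclusion I x) <-> satisfies I Cs.
Proof.
split=> [H C HC d|H x /List.in_map_iff[C [<- HC]] d _]; last exact: H.
by have := H (Incl CTop C) (List.in_map _ _ _ HC) d; apply.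
Qed.

Definition tOr C D := TNot (TAnd (TNot C) (TNot D)).
Definition tImp C D := TNot (TAnd C (TNot D)).
Definition tIff C D := TAnd (tImp C D) (tImp D C).
Definition tAll R C := TNot (TEx R (TNot C)).
Definition tBot := TNot TTop.

(* The successors satisfy [Q] iff exactly one of [C] and [Q] holds here. *)
Definition tFlip C Q R :=
  TAnd (tImp (tIff C Q) (tAll R (TNot Q))) (tImp (TNot (tIff C Q)) (tAll R Q)).

Section Connectives.
Variables (I : interp) (e : seq nat).
Notation holds C d := (ext (inst e C) (d : dom I)).

Lemma ext_imp C D d : holds (tImp C D) d <-> (holds C d -> holds D d).
Proof. by rewrite /=; tauto. Qed.

Lemma ext_iff C D d : holds (tIff C D) d <-> (holds C d <-> holds D d).
Proof. by rewrite /=; tauto. Qed.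

Lemma ext_all R C d : holds (tAll R C) d <-> forall d', role_int R d d' -> holds C d'.
Proof.
rewrite /=; split=> [H d' r|H [d' r]]; last by apply; apply: H.
by apply: NNPP => N; apply: H; exists d'.
Qed.

Lemma ext_flip C Q R d (c q : bool) : (holds C d <-> c) -> (holds Q d <-> q) ->
  holds (tFlip C Q R) d <-> forall d', role_int R d d' -> (holds Q d' <-> c (+) q).
Proof.
move=> Hc Hq; have E : holds (tIff C Q) d <-> ~~ (c (+) q).
  by rewrite ext_iff Hc Hq; case: c q {Hc Hq} => -[]; intuition.
rewrite -[holds (tFlip C Q R) d]/(holds (tImp (tIff C Q) (tAll R (TNot Q))) d /\
  holds (tImp (TNot (tIff C Q)) (tAll R Q)) d) 
  (ext_imp (tIff C Q)) (ext_imp (TNot (tIff C Q))) !ext_all.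
rewrite -[holds (TNot (tIff C Q)) d]/(~ holds (tIff C Q) d) E.
case: (c (+) q) => /=; split.
- by move=> [_ H] d' r; split=> // _; apply: H => //.
- by move=> H; split=> // _ d' /H [_]; apply.
- by move=> [H _] d' r; split=> // Q'; case: (H isT d' r).
- by move=> H; split=> [_ d' /H[Q' _] /Q' //|[]].
Qed.
End Connectives.

Local Opaque tOr tImp tIff tAll tFlip tBot.

(** * Binary counters *)

Definition low (q : pred nat) i := all q (iota 0 i).

Lemma lowS q i : low q i.+1 = low q i && q i.
Proof. by rewrite /low -addn1 iotaD all_cat /= andbT. Qed.

Lemma lowS' q i : low q i.+1 = q 0 && low (fun k => q k.+1) i.
Proof. by rewrite /low /= (iotaDl 1 0) all_map. Qed.

Lemma eq_low q q' i : q =1 q' -> low q i = low q' i.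
Proof. by move=> E; apply: eq_all. Qed.

Lemma bit_odd s : bit s 0 = odd s.
Proof. by rewrite /bit expn0 divn1. Qed.

Lemma bit_incr e i : bit e.+1 i = low (bit e) i (+) bit e i.
Proof.
elim: i e => [|i IH] e; first by rewrite !bit_odd /=.
rewrite lowS' bit_odd !bitS (eq_low (q' := bit e./2)); last by move=> k; rewrite bitS.
case Eo: (odd e) => /=; last by rewrite uphalf_half Eo.
by rewrite uphalf_half Eo add1n IH.
Qed.

Lemma bit_decr j i : 0 < j -> bit j.-1 i = low (predC (bit j)) i (+) bit j i.
Proof.
elim: i j => [|i IH] j j0; first by rewrite !bit_odd /= -{2}(prednK j0) /= negbK.
rewrite lowS' /= bit_odd !bitS (eq_low (q' := predC (bit j./2))); last by move=> k /=; rewrite bitS.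
have E := prednK j0; case Eo: (odd j) => /=.
  by congr (bit _ i); move: Eo; rewrite -E /= uphalf_half => /negbTE ->.
have h0 : 0 < j./2 by rewrite half_gt0; move: Eo j0; case: (j) => [|[]].
rewrite -IH //; congr (bit _ i).
by move: Eo; rewrite -E /= => /negbFE Eo; rewrite uphalf_half Eo add1n.
Qed.

Lemma low_full m e : e < 2 ^ m -> low (bit e) m = (e == (2 ^ m).-1).
Proof.
move=> em; have p : 0 < 2 ^ m by rewrite expn_gt0.
have F : low (bit (2 ^ m).-1) m.
  apply/allP => i; rewrite mem_iota add0n => /= im; rewrite bit_decr //.
  have -> : low (predC (bit (2 ^ m))) i = true.
    by apply/allP => k; rewrite mem_iota /= bit_pow => /= ki; rewrite neq_ltn; lia.
  by rewrite bit_pow; case: eqP => //; lia.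
apply/idP/eqP => [H|-> //]; apply/eqP/contraT => ne.
have : e.+1 = 0.
  apply: (@bits_eq0 e.+1 m) => [|i im]; first lia.
  rewrite bit_incr; have -> : bit e i by apply: (allP H); rewrite mem_iota.
  have -> // : low (bit e) i.
  by apply/allP => k; rewrite mem_iota => ki; apply: (allP H); rewrite mem_iota; lia.
by [].
Qed.

Lemma low_zero m j : j < 2 ^ m -> low (predC (bit j)) m = (j == 0).
Proof.
move=> jm; apply/idP/eqP => [H|->].
  apply: (@bits_eq0 j m) => // i im; apply/negbTE.
  by apply: (allP H); rewrite mem_iota.
by apply/allP => k _ /=; rewrite bit0.
Qed.

Lemma carryP m (Cn Qn : nat -> Prop) (q : pred nat) : Cn 0 ->
  (forall i, i < m -> Cn i.+1 <-> Cn i /\ Qn i) -> (forall i, i < m -> Qn i <-> q i) ->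
  forall i, i <= m -> Cn i <-> low q i.
Proof.
move=> C0 CS Q; elim=> [|i IH] im; first by split.
by rewrite CS // IH ?Q ?lowS; [split=> [[-> ->]|/andP[]]|lia|lia].
Qed.

(** * The computation tree of a cellular automaton *)

Section Automaton.
Variables (L : finType) (F : L -> L -> L -> L -> L) (init : option bool -> bool -> L).
Variable (acc : pred L).

Definition nB := [:: false; false; false].
Definition nP := [:: false; false; true].
Definition nC := [:: false; true; false].
Definition nD := [:: false; true; true].
Definition nZ := [:: true; false; false].
Definition nE := [:: true; false; true].
Definition nL := [:: true; true; false].
Definition nX := [:: true; true; true].

Definition role k : name := nseq k true.
Definition at_label (a : L) := TName nL (pickle a) None.
Definition at_root := TName nX 0 None.

(* [nB] and [nP] are the bits of the elapsed time and of the position; [nC],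
   [nD] and [nZ] at [i] say that the bits below [i] of the time, of the position,
   and of the complement of the position are all one. *)
Definition bit_axioms :=
  let B := TName nB 0 (Some 0) in let P := TName nP 0 (Some 0) in
  let C := TName nC 0 (Some 0) in let D := TName nD 0 (Some 0) in
  let Z := TName nZ 0 (Some 0) in
  let full := TName nC 0 (Some 2) in let zero := TName nZ 0 (Some 2) in
  [:: tIff (TName nC 1 (Some 0)) (TAnd C B); tIff (TName nD 1 (Some 0)) (TAnd D P);
      tIff (TName nZ 1 (Some 0)) (TAnd Z (TNot P));
      tImp at_root (TAnd (TNot B) (TNot P));
      tFlip (TAnd (TNot full) C) B (role 0); tFlip (TAnd (TNot full) C) B (role 1);
      tFlip (TAnd (TNot full) C) B (role 2); tFlip (TAnd (TNot full) C) B (role 3);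
      tFlip P P (role 0); tFlip (TAnd (TNot zero) Z) P (role 1);
      tFlip (TNot TTop) P (role 2); tFlip D P (role 3)].

(* [nE] at [i] gives the minimum of the position and of the input length. *)
Definition leaf_axioms i m o :=
  let leaf := TAnd (TName nC 0 (Some m)) (TName nE 0 (Some i)) in let zero := TName nZ 0 (Some m) in
  [:: tImp (TAnd leaf zero) (at_label (init o true));
      tImp (TAnd leaf (TNot zero)) (at_label (init o false))].

Definition rule (x : L * L * L * L) :=
  let: (a, b, c, d) := x in
  tImp (TAnd (TEx (role 0) (at_label a)) (TAnd (TEx (role 1) (at_label b))
         (TAnd (TEx (role 2) (at_label c)) (TEx (role 3) (at_label d))))) (at_label (F a b c d)).

Definition tree_items : seq item :=
  let full := TName nC 0 (Some 1) in let zero := TName nZ 0 (Some 1) in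
  let En := TName nE 0 (Some 0) in
  [:: IOne (TName nC 0 None); IOne (TName nD 0 None); IOne (TName nZ 0 None);
      IOne (TEx (role 1) TTop);
      IOne (tImp (TNot full) (TAnd (TEx (role 0) TTop) (TAnd (TEx (role 2) TTop) (TEx (role 3) TTop))));
      IOne (tImp zero (TName nE 0 None));
      IOne (tImp (TAnd (TNot zero) (TEx (role 1) En)) En);
      IFor 1 bit_axioms;
      IFor 0 [:: tImp (TAnd (TNot (TName nZ 0 (Some 2))) (TEx (role 1) (TName nE 0 (Some 0))))
                      (TName nE 1 (Some 0))];
      IIn (leaf_axioms 0 2 (Some true)) (leaf_axioms 0 2 (Some false))]
  ++ [seq IOne C | C <- leaf_axioms 0 1 None ++ [seq rule x | x <- enum {: L * L * L * L}]
       ++ [seq tImp at_root (TNot (at_label a)) | a <- enum L & acc a]].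

Lemma closed_tree_items : all (closed_item 2) tree_items.
Proof.
have H (T : Type) (f : T -> template) s : (forall x, closed_template 2 (f x)) ->
    all (preim IOne (closed_item 2)) [seq f x | x <- s].
  by move=> H; elim: s => //= x s ->; rewrite H.
rewrite /tree_items all_cat all_map !all_cat; apply/and4P; split; try by vm_compute.
  by apply: H => -[[[a b] c] d]; vm_compute.
by apply: H => a; vm_compute.
Qed.

Variables (w : seq bool) (m : nat).
Local Notation n := (size w).
Definition letter_at j := nth None (map Some w) j.

Variable lab : nat -> nat -> L.
Hypothesis lab0 : forall j, lab 0 j = init (letter_at j) (j == 0).
Hypothesis labS : forall t j, lab t.+1 j = F (lab t 0) (lab t j.-1) (lab t j) (lab t j.+1).

Definition last_time := (2 ^ m).-1.
Definition tree_axioms := inst_items w [:: n; m] tree_items.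

Section Spec.
Variable I : interp.
Definition N t i (d : dom I) := conc_int (indexed t i) d.
Definition edge_of r (d d' : dom I) := role_int (role r) d d'.

Lemma inst_ones e (its : seq template) :
  inst_items w e [seq IOne C | C <- its] = [seq inst e C | C <- its].
Proof. by elim: its => //= C its <-. Qed.

Lemma satisfies_map e (T : eqType) (f : T -> template) s :
  satisfies I [seq inst e C | C <- [seq f x | x <- s]] <->
  forall x, x \in s -> forall d : dom I, ext (inst e (f x)) d.
Proof.
elim: s => [|x s IH]; first by split=> // _ C [].
rewrite /= satisfies_cons IH; split=> [[H H'] y|H].
  by rewrite inE => /orP[/eqP->|/H'].
by split=> [|y ys]; apply: H; rewrite inE ?eqxx // ys orbT.
Qed.

Lemma satisfies_one e C its : satisfies I (inst_items w e (IOne C :: its)) <->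
  (forall d : dom I, ext (inst e C) d) /\ satisfies I (inst_items w e its).
Proof. exact: satisfies_cons. Qed.

Lemma satisfies_item e it its : satisfies I (inst_items w e (it :: its)) <->
  satisfies I (inst_item w e it) /\ satisfies I (inst_items w e its).
Proof. exact: satisfies_cat. Qed.

Lemma inst_items_cat e its its' : inst_items w e (its ++ its') = inst_items w e its ++ inst_items w e its'.
Proof. by rewrite /inst_items map_cat flatten_cat. Qed.

Record spec : Prop := Spec {
  sp_C0 : forall d, N nC 0 d; sp_D0 : forall d, N nD 0 d; sp_Z0 : forall d, N nZ 0 d;
  sp_r1 : forall d, exists d', edge_of 1 d d';
  sp_r : forall d, ~ N nC m d ->
    (exists d', edge_of 0 d d') /\ (exists d', edge_of 2 d d') /\ (exists d', edge_of 3 d d');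
  sp_E0 : forall d, N nZ m d -> N nE 0 d;
  sp_En : forall d d', ~ N nZ m d -> edge_of 1 d d' -> N nE n d' -> N nE n d;
  sp_bits : forall i, i < m -> satisfies I [seq inst [:: i; n; m] C | C <- bit_axioms];
  sp_E : forall i, i < n -> forall d d', ~ N nZ m d -> edge_of 1 d d' -> N nE i d' -> N nE i.+1 d;
  sp_leaf : forall i, i <= n -> forall d, N nC m d -> N nE i d ->
    (N nZ m d -> N nL (pickle (init (letter_at i) true)) d) /\
    (~ N nZ m d -> N nL (pickle (init (letter_at i) false)) d);
  sp_rule : forall x0 x1 x2 x3 d d0 d1 d2 d3, edge_of 0 d d0 -> edge_of 1 d d1 ->
    edge_of 2 d d2 -> edge_of 3 d d3 -> N nL (pickle x0) d0 -> N nL (pickle x1) d1 ->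
    N nL (pickle x2) d2 -> N nL (pickle x3) d3 -> N nL (pickle (F x0 x1 x2 x3)) d;
  sp_acc : forall a d, acc a -> N nX 0 d -> ~ N nL (pickle a) d
}.

Lemma leafP i e m' o k : nth 0 e i = k -> nth 0 e m' = m ->
  satisfies I [seq inst e C | C <- leaf_axioms i m' o] <->
  forall d, N nC m d -> N nE k d ->
    (N nZ m d -> N nL (pickle (init o true)) d) /\ (~ N nZ m d -> N nL (pickle (init o false)) d).
Proof.
move=> Ek Em; rewrite /leaf_axioms -/(map _ _) ![map _ _]/= !satisfies_cons.
split=> [[H1 [H2 _]] d HC HE|H].
  have := H2 d; have := H1 d; rewrite !ext_imp /= Ek Em !addn0 => {}H1 {}H2.
  by split=> HZ; [apply: H1|apply: H2].
split=> [d|]; first by rewrite ext_imp /= Ek Em !addn0 => -[[HC HE] HZ]; apply H.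
by split=> // d; rewrite ext_imp /= Ek Em !addn0 => -[[HC HE] HZ]; apply H.
Qed.

Lemma tree_axiomsP : satisfies I tree_axioms <-> spec.
Proof.
rewrite /tree_axioms /tree_items inst_items_cat satisfies_cat inst_ones !map_cat.
do 7 rewrite satisfies_one; do 3 rewrite satisfies_item.
rewrite (satisfies_cat I [seq inst [:: n; m] i | i <- leaf_axioms 0 1 None]) satisfies_cat.
rewrite !satisfies_map (@leafP 0 [:: n; m] 1 None n erefl erefl).
rewrite [inst_item _ _ (IFor 1 _)]/= [inst_item _ _ (IFor 0 _)]/= [inst_item _ _ (IIn _ _)]/=.
rewrite !satisfies_below.
have En x : x < n -> letter_at x = Some (nth false w x) by move=> xn; rewrite /letter_at (nth_map false).
have E0 : letter_at n = None by rewrite /letter_at nth_default ?size_map.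
split.
  move=> [[H1 [H2 [H3 [H4 [H5 [H6 [H7 [H8 [H9 [H10 _]]]]]]]]]] [H11 [H12 H13]]]; split.
  - exact: H1.
  - exact: H2.
  - exact: H3.
  - by move=> d; have [d' r _] := H4 d; exists d'.
  - move=> d HC; have := H5 d; rewrite ext_imp /= => /(_ HC)[[a ra _] [[b rb _] [c rc _]]].
    by split; [exists a|split; [exists b|exists c]].
  - by move=> d HZ; have := H6 d; rewrite ext_imp /=; apply.
  - by move=> d d' HZ r HE; have := H7 d; rewrite ext_imp /=; apply; split=> //; exists d'.
  - by move=> i im; apply: H8.
  - move=> i iN d d' HZ r HE; have := H9 i iN; rewrite /= satisfies_cons => -[/(_ d) H _].
    by move: H; rewrite ext_imp /=; apply; split=> //; exists d'.
  - move=> i; rewrite leq_eqVlt => /orP[/eqP->|iN]; first by rewrite E0; exact: H11.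
    rewrite (En i iN); have := H10 i iN.
    by case: (nth false w i) => H; apply/(@leafP 0 [:: i; n; m] 2 _ i erefl erefl).
  - move=> x0 x1 x2 x3 d d0 d1 d2 d3 r0 r1 r2 r3 L0 L1 L2 L3.
    have := H12 (x0, x1, x2, x3); rewrite mem_enum => /(_ isT d); rewrite ext_imp /= !addn0.
    apply; split; first by exists d0.
    by split; [exists d1|split; [exists d2|exists d3]].
  - move=> a d aa HX; have := H13 a; rewrite mem_filter mem_enum aa => /(_ isT d).
    by rewrite ext_imp /= !addn0 => H; exact: (H HX).
case=> H1 H2 H3 H4 H5 H6 H7 H8 H9 H10 H11 H12; split; last first.
  split; first by have := H10 n (leqnn n); rewrite E0.
  split=> [[[[x0 x1] x2] x3] _ d|a]; rewrite ?ext_imp /= ?addn0.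
    move=> [[d0 r0 L0] [[d1 r1 L1] [[d2 r2 L2] [d3 r3 L3]]]].
    exact: H11 r0 r1 r2 r3 L0 L1 L2 L3.
  rewrite mem_filter => /andP[aa _] d; rewrite ext_imp /= !addn0; exact: (H12 a d aa).
split; first exact: H1.
split; first exact: H2.
split; first exact: H3.
split; first by move=> d; have [d' r] := H4 d; exists d'.
split.
  move=> d; rewrite ext_imp /= => HC; have [[a ra] [[b rb] [c rc]]] := H5 d HC.
  by split; [exists a|split; [exists b|exists c]].
split; first by move=> d; rewrite ext_imp /=; exact: H6.
split; first by move=> d; rewrite ext_imp /= => -[HZ [d' r HE]]; exact: H7 HZ r HE.
split; first exact: H8.
split.
  move=> i iN; rewrite /= satisfies_cons; split=> // d.
  by rewrite ext_imp /= => -[HZ [d' r HE]]; exact: H9 iN _ _ HZ r HE.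
split=> // i iN; have := H10 i (ltnW iN); rewrite (En i iN).
by case: (nth false w i) => H; apply/(@leafP 0 [:: i; n; m] 2 _ i erefl erefl).
Qed.

Definition flip_at i C Q r (d : dom I) := ext (inst [:: i; n; m] (tFlip C Q (role r))) d.

Lemma bit_axiomsP i : satisfies I [seq inst [:: i; n; m] C | C <- bit_axioms] <-> forall d,
  let B := TName nB 0 (Some 0) in let P := TName nP 0 (Some 0) in
  let full := TName nC 0 (Some 2) in let zero := TName nZ 0 (Some 2) in
  [/\ N nC i.+1 d <-> N nC i d /\ N nB i d, N nD i.+1 d <-> N nD i d /\ N nP i d,
      N nZ i.+1 d <-> N nZ i d /\ ~ N nP i d & N nX 0 d -> ~ N nB i d /\ ~ N nP i d] /\
  (forall r, r < 4 -> flip_at i (TAnd (TNot full) (TName nC 0 (Some 0))) B r d) /\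
  [/\ flip_at i P P 0 d, flip_at i (TAnd (TNot zero) (TName nZ 0 (Some 0))) P 1 d,
      flip_at i (TNot TTop) P 2 d & flip_at i (TName nD 0 (Some 0)) P 3 d].
Proof.
rewrite /bit_axioms ![map _ _]/= !satisfies_cons.
split=> [[H1 [H2 [H3 [H4 [H5 [H6 [H7 [H8 [H9 [H10 [H11 [H12 _]]]]]]]]]]]] d|H].
  split; last first.
    split; last by split; [exact: H9|exact: H10|exact: H11|exact: H12].
    by case=> [|[|[|[|]]]] // _; [exact: H5|exact: H6|exact: H7|exact: H8].
  have := H1 d; have := H2 d; have := H3 d; have := H4 d.
  by rewrite !ext_iff ext_imp.
do ![apply: conj] => // d; have [[? ? ? ?] [G [? ? ? ?]]] := H d;
  rewrite ?ext_iff ?ext_imp //; first [exact: (G 0)|exact: (G 1)|exact: (G 2)|exact: (G 3)].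
Qed.

Hypothesis S : spec.
Local Notation T := last_time.

Definition reads_bits t (d : dom I) e := forall i, i < m -> N t i d <-> bit e i.

Lemma pow_gt0 : 0 < 2 ^ m. Proof. by rewrite expn_gt0. Qed.

Definition bits_at i (im : i < m) d := (bit_axiomsP i).1 (sp_bits S im) d.

Lemma reads_C d e i : reads_bits nB d e -> i <= m -> N nC i d <-> low (bit e) i.
Proof.
move=> R; apply: (@carryP m (fun i => N nC i d) (fun i => N nB i d)); [exact: sp_C0| |exact: R].
by move=> k km; have [[H _ _ _] _] := bits_at km d.
Qed.

Lemma reads_D d j i : reads_bits nP d j -> i <= m -> N nD i d <-> low (bit j) i.
Proof.
move=> R; apply: (@carryP m (fun i => N nD i d) (fun i => N nP i d)); [exact: sp_D0| |exact: R].
by move=> k km; have [[_ H _ _] _] := bits_at km d.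
Qed.

Lemma reads_Z d j i : reads_bits nP d j -> i <= m -> N nZ i d <-> low (predC (bit j)) i.
Proof.
move=> R; apply: (@carryP m (fun i => N nZ i d) (fun i => ~ N nP i d)); [exact: sp_Z0| |].
  by move=> k km; have [[_ _ H _] _] := bits_at km d.
by move=> k km; rewrite (R k km) /=; split=> [/negP|/negP].
Qed.

Lemma reads_full d e : reads_bits nB d e -> e <= T -> N nC m d <-> e = T.
Proof.
move=> R eT; rewrite (reads_C R) // low_full; first by split=> [/eqP|->].
by move: eT; rewrite /last_time; have := pow_gt0; lia.
Qed.

Lemma reads_zero d j : reads_bits nP d j -> j < 2 ^ m -> N nZ m d <-> j = 0.
Proof. by move=> R jm; rewrite (reads_Z R) // low_zero //; split=> [/eqP|->]. Qed.

Lemma child_time d d' e r : r < 4 -> reads_bits nB d e -> e <= T -> edge_of r d d' ->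
  reads_bits nB d' (minn e.+1 T).
Proof.
move=> r4 R eT rd i im; have [_ [/(_ r r4) H _]] := bits_at im d.
have full := reads_full R eT.
have HC : ext (inst [:: i; n; m] (TAnd (TNot (TName nC 0 (Some 2))) (TName nC 0 (Some 0)))) d <->
    (e != T) && low (bit e) i.
  rewrite /= -/(N nC m d) full -/(N nC i d) (reads_C R (ltnW im)).
  by split=> [[/eqP -> ->]|/andP[/eqP]].
have HB : ext (inst [:: i; n; m] (TName nB 0 (Some 0))) d <-> bit e i by exact: R.
have := (ext_flip (role r) HC HB).1 H d' rd => {}H; apply: (iff_trans H).
case: (e =P T) => [->|ne] /=; first by rewrite (minn_idPr _).
by rewrite (minn_idPl _) ?bit_incr //; lia.
Qed.

Lemma child_position d d' j r : r < 4 -> reads_bits nP d j -> j < 2 ^ m -> edge_of r d d' ->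
  reads_bits nP d' (nth 0 [:: 0; j.-1; j; j.+1] r).
Proof.
move=> r4 R jm rd i im; have [_ [_ [H0 H1 H2 H3]]] := bits_at im d.
have HP : ext (inst [:: i; n; m] (TName nP 0 (Some 0))) d <-> bit j i by exact: R.
case: r r4 rd => [|[|[|[|//]]]] _ rd.
- by have := (ext_flip (role 0) HP HP).1 H0 d' rd; rewrite addbb /= bit0.
- have HC : ext (inst [:: i; n; m] (TAnd (TNot (TName nZ 0 (Some 2))) (TName nZ 0 (Some 0)))) d <->
      (j != 0) && low (predC (bit j)) i.
    rewrite /= -/(N nZ m d) (reads_zero R jm) -/(N nZ i d) (reads_Z R (ltnW im)).
    by split=> [[/eqP -> ->]|/andP[/eqP]].
  have := (ext_flip (role 1) HC HP).1 H1 d' rd => H; apply: (iff_trans H).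
  by case: (posnP j) => [->|j0] //=; rewrite bit_decr.
- have HC : ext (inst [:: i; n; m] (TNot TTop)) d <-> false by split=> // H; case: H.
  exact: ((ext_flip (role 2) HC HP).1 H2 d' rd).
- have HC : ext (inst [:: i; n; m] (TName nD 0 (Some 0))) d <-> low (bit j) i.
    exact: (reads_D R (ltnW im)).
  by have := (ext_flip (role 3) HC HP).1 H3 d' rd; rewrite -bit_incr.
Qed.

Lemma time_lt e : e <= T -> e < 2 ^ m.
Proof. by rewrite /last_time; have := pow_gt0; lia. Qed.

Lemma leaf_position j d : j < 2 ^ m -> reads_bits nB d T -> reads_bits nP d j ->
  N nE (minn j n) d.
Proof.
elim: j d => [|j IH] d jm RB RP.
  by rewrite min0n; apply: (sp_E0 S); apply/(reads_zero RP).
have nz : ~ N nZ m d by move/(reads_zero RP jm).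
have [d' r] := sp_r1 S d.
have RB' := child_time (isT : 1 < 4) RB (leqnn T) r; rewrite (minn_idPr (leqnSn T)) in RB'.
have RP' := child_position (isT : 1 < 4) RP jm r; rewrite /= in RP'.
have H := IH d' (ltnW jm) RB' RP'.
move: H; case: (ltnP j n) => jn.
  by rewrite (minn_idPl jn); exact: (sp_E S jn nz r).
by rewrite (minn_idPr (leqW jn)); exact: (sp_En S nz r).
Qed.

Lemma letter_min j : letter_at (minn j n) = letter_at j.
Proof.
case: (ltnP j n) => jn //.
by rewrite /letter_at !nth_default ?size_map.
Qed.

Lemma tree_label t e j d : e + t = T -> j <= e -> reads_bits nB d e -> reads_bits nP d j ->
  N nL (pickle (lab t j)) d.
Proof.
elim: t e j d => [|t IH] e j d Et je RB RP; have eT : e <= T by lia.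
  have Ee : e = T by lia.
  have jm : j < 2 ^ m by apply: time_lt; lia.
  subst e; have HC := (reads_full RB (leqnn _)).2 erefl.
  have [H1 H2] := sp_leaf S (geq_minr j n) HC (leaf_position jm RB RP).
  have Z := reads_zero RP jm; rewrite letter_min in H1 H2; rewrite lab0.
  by case: (j =P 0) => [/Z|N0]; [apply: H1 | apply: H2 => /Z].
have lt : e < T by lia.
have nf : ~ N nC m d by move/(reads_full RB eT); lia.
have jm : j < 2 ^ m by apply: time_lt; lia.
have [[d0 r0] [[d2 r2] [d3 r3]]] := sp_r S nf; have [d1 r1] := sp_r1 S d.
have E : minn e.+1 T = e.+1 by rewrite (minn_idPl lt).
have B r d' : r < 4 -> edge_of r d d' -> reads_bits nB d' e.+1.
  by move=> r4 rd; rewrite -E; apply: child_time rd.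
rewrite labS; apply: (sp_rule S r0 r1 r2 r3); apply: (IH e.+1); rewrite ?addSnnS //; try lia.
- exact: B r0.
- exact: (child_position (r := 0) isT RP jm r0).
- exact: B r1.
- exact: (child_position (r := 1) isT RP jm r1).
- exact: B r2.
- exact: (child_position (r := 2) isT RP jm r2).
- exact: B r3.
- exact: (child_position (r := 3) isT RP jm r3).
Qed.

Lemma root_unsat d : acc (lab T 0) -> ~ N nX 0 d.
Proof.
move=> a HX; apply: (sp_acc S a HX).
have R i (im : i < m) : ~ N nB i d /\ ~ N nP i d by have [[_ _ _ H] _] := bits_at im d; apply: H.
apply: (tree_label (e := 0)) => // i im; rewrite bit0; split=> // H; by have [] := R i im.
Qed.
End Spec.

Section Tree.
Hypothesis rejects : ~~ acc (lab last_time 0).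
Local Notation T := last_time.

Definition tree_node := {x : nat * nat | (x.2 <= x.1) && (x.1 <= T)}.

Definition tree_value (d : name + tree_node) : nat * nat := if d is inr x then sval x else (0, 0).

Definition tree_name t i (d : name + tree_node) : bool :=
  let: (e, j) := tree_value d in
  if t == nB then bit e i else if t == nP then bit j i else
  if t == nC then low (bit e) i else if t == nD then low (bit j) i else
  if t == nZ then low (predC (bit j)) i else if t == nE then i == minn j n else
  if t == nL then i == pickle (lab (T - e) j) else
  (t == nX) && (i == 0) && (if d is inl _ then true else false).

Definition tree_step r (x y : nat * nat) :=
  [/\ y.1 = minn x.1.+1 T, y.2 = nth 0 [:: 0; x.2.-1; x.2; x.2.+1] r & r = 1 \/ x.1 < T].

Definition counter_model : interp := @Interp tree_node
  (fun A d => tree_name (take 3 A) (size A - 3) d)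
  (fun R d d' => (exists y, d' = inr y) /\ tree_step (size R) (tree_value d) (tree_value d')).

Implicit Types d : dom counter_model.

Lemma tree_nameE t i d : size t = 3 -> N t i d <-> tree_name t i d.
Proof.
by move=> t3; rewrite /N /= /indexed -t3 take_size_cat // size_cat size_nseq addKn.
Qed.

Lemma tree_edge r d d' : edge_of r d d' -> tree_step r (tree_value d) (tree_value d').
Proof. by move=> [_]; rewrite size_nseq. Qed.

Lemma tree_ok d : (tree_value d).2 <= (tree_value d).1 <= T.
Proof. by case: d => [a|[x H]] //=. Qed.

Lemma tree_child r d : r < 4 -> r = 1 \/ (tree_value d).1 < T -> exists d', edge_of r d d'.
Proof.
move=> r4 H; have := tree_ok d; set x := tree_value d in H * => xT.
pose y := (minn x.1.+1 T, nth 0 [:: 0; x.2.-1; x.2; x.2.+1] r).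
have yT : (y.2 <= y.1) && (y.1 <= T).
  rewrite /y /=; apply/andP; split; last exact: geq_minr.
  by case: r r4 H {y} => [|[|[|[|]]]] //= _ [] // H; lia.
by exists (inr (exist _ y yT)); split; [exists (exist _ y yT)|rewrite size_nseq].
Qed.

Lemma tree_lt d : (tree_value d).1 < 2 ^ m /\ (tree_value d).2 < 2 ^ m.
Proof. have := tree_ok d; rewrite /last_time; have : 0 < 2 ^ m by rewrite expn_gt0. lia. Qed.

Lemma tree_full d : N nC m d <-> (tree_value d).1 = T.
Proof.
rewrite tree_nameE // /tree_name; have [eT _] := tree_lt d.
case E: (tree_value d) eT => [e j] /= eT; rewrite low_full //; by split=> /eqP.
Qed.

Lemma tree_zero d : N nZ m d <-> (tree_value d).2 = 0.
Proof.
rewrite tree_nameE // /tree_name; have [_ jT] := tree_lt d.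
case E: (tree_value d) jT => [e j] /= jT; rewrite low_zero //; by split=> /eqP.
Qed.

Lemma tree_position i d : N nE i d <-> i = minn (tree_value d).2 n.
Proof. by rewrite tree_nameE // /tree_name; case: (tree_value d) => e j; split=> /eqP. Qed.

Lemma tree_labelE a d :
  N nL (pickle a) d <-> a = lab (T - (tree_value d).1) (tree_value d).2.
Proof.
rewrite tree_nameE // /tree_name; case: (tree_value d) => e j /=.
by split=> [/eqP/(pcan_inj pickleK)|->].
Qed.

Lemma tree_root d : N nX 0 d -> tree_value d = (0, 0).
Proof. by rewrite tree_nameE // /tree_name; case: d => [a|[[e j] H]]. Qed.

Lemma tree_bits i : i < m -> satisfies counter_model [seq inst [:: i; n; m] C | C <- bit_axioms].
Proof.
move=> im; apply/bit_axiomsP => d; cbv zeta.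
have HB d' : N nB i d' <-> bit (tree_value d').1 i.
  by rewrite tree_nameE // /tree_name; case: (tree_value d').
have HP d' : N nP i d' <-> bit (tree_value d').2 i.
  by rewrite tree_nameE // /tree_name; case: (tree_value d').
have HC k : N nC k d <-> low (bit (tree_value d).1) k.
  by rewrite tree_nameE // /tree_name; case: (tree_value d).
have HD k : N nD k d <-> low (bit (tree_value d).2) k.
  by rewrite tree_nameE // /tree_name; case: (tree_value d).
have HZ k : N nZ k d <-> low (predC (bit (tree_value d).2)) k.
  by rewrite tree_nameE // /tree_name; case: (tree_value d).
have ok := tree_ok d.
split; [split|split=> [r r4|]].
- by rewrite !HC HB lowS; split=> [/andP[]|[-> ->]].
- by rewrite !HD HP lowS; split=> [/andP[]|[-> ->]].
- by rewrite !HZ HP lowS /=; split=> [/andP[-> /negP]|[-> /negP]].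
- by move/tree_root => E; rewrite HB HP E !bit0.
- have Hc : ext (inst [:: i; n; m] (TAnd (TNot (TName nC 0 (Some 2))) (TName nC 0 (Some 0)))) d <->
      ((tree_value d).1 != T) && low (bit (tree_value d).1) i.
    rewrite -[ext _ _]/(~ N nC m d /\ N nC i d) tree_full HC.
    by split=> [[/eqP -> ->]|/andP[/eqP]].
  have Hb : ext (inst [:: i; n; m] (TName nB 0 (Some 0))) d <-> bit (tree_value d).1 i by exact: HB.
  apply/(ext_flip (role r) Hc Hb) => d' /tree_edge[E _ _]; apply: (iff_trans (HB d')); rewrite E.
  case: ((tree_value d).1 =P T) => [->|ne] /=; first by rewrite (minn_idPr _).
  by rewrite (minn_idPl _) ?bit_incr //; lia.
have Hp : ext (inst [:: i; n; m] (TName nP 0 (Some 0))) d <-> bit (tree_value d).2 i by exact: HP.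
split.
- apply/(ext_flip (role 0) Hp Hp) => d' /tree_edge[_ E _]; apply: (iff_trans (HP d')).
  by rewrite E addbb /= bit0.
- have Hz : ext (inst [:: i; n; m] (TAnd (TNot (TName nZ 0 (Some 2))) (TName nZ 0 (Some 0)))) d <->
      ((tree_value d).2 != 0) && low (predC (bit (tree_value d).2)) i.
    rewrite -[ext _ _]/(~ N nZ m d /\ N nZ i d) tree_zero HZ.
    by split=> [[/eqP -> ->]|/andP[/eqP]].
  apply/(ext_flip (role 1) Hz Hp) => d' /tree_edge[_ E _]; apply: (iff_trans (HP d')); rewrite E /=.
  by case: (posnP (tree_value d).2) => [->|j0] //=; rewrite bit_decr.
- have Hf : ext (inst [:: i; n; m] (TNot TTop)) d <-> false by split=> // H; case: H.
  by apply/(ext_flip (role 2) Hf Hp) => d' /tree_edge[_ E _]; apply: (iff_trans (HP d')); rewrite E.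
- have Hd : ext (inst [:: i; n; m] (TName nD 0 (Some 0))) d <-> low (bit (tree_value d).2) i.
    exact: HD.
  apply/(ext_flip (role 3) Hd Hp) => d' /tree_edge[_ E _]; apply: (iff_trans (HP d')).
  by rewrite E /= bit_incr.
Qed.

Lemma tree_spec : spec counter_model.
Proof.
split.
- by move=> d; rewrite tree_nameE // /tree_name; case: (tree_value d).
- by move=> d; rewrite tree_nameE // /tree_name; case: (tree_value d).
- by move=> d; rewrite tree_nameE // /tree_name; case: (tree_value d).
- by move=> d; apply: tree_child => //; left.
- move=> d nf; have lt : (tree_value d).1 < T.
    by have := tree_ok d; move: nf; rewrite tree_full; lia.
  by split; [|split]; apply: tree_child => //; right.
- by move=> d /tree_zero E; rewrite tree_position E min0n.
- move=> d d' /tree_zero nz /tree_edge[_ E _] /tree_position; rewrite E [nth _ _ _]/= => H.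
  by apply/tree_position; lia.
- exact: tree_bits.
- move=> i iN d d' /tree_zero nz /tree_edge[_ E _] /tree_position; rewrite E [nth _ _ _]/= => H.
  by apply/tree_position; lia.
- move=> i iN d /tree_full E /tree_position ->; rewrite letter_min.
  split=> [/tree_zero Z|/tree_zero/eqP/negbTE Z]; apply/tree_labelE; rewrite E subnn lab0.
    by rewrite Z.
  by rewrite Z.
- move=> x0 x1 x2 x3 d d0 d1 d2 d3 /tree_edge[A0 B0 C0] /tree_edge[A1 B1 _]
    /tree_edge[A2 B2 _] /tree_edge[A3 B3 _].
  have lt : (tree_value d).1 < T by case: C0.
  have E : minn (tree_value d).1.+1 T = (tree_value d).1.+1 by rewrite (minn_idPl lt).
  move=> /tree_labelE -> /tree_labelE -> /tree_labelE -> /tree_labelE ->.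
  rewrite A0 A1 A2 A3 B0 B1 B2 B3 E /= -labS; apply/tree_labelE.
  by congr (lab _ _); lia.
- move=> a d aa /tree_root E /tree_labelE; rewrite E /= subn0 => Ea.
  by move: rejects; rewrite -Ea aa.
Qed.
End Tree.

(** * Reduction to rCQ entailment *)

Definition root_name : name := indexed nX 0.
Definition goal_name : name := indexed nX 1.
Definition goal_tbox : tbox := [:: Incl (CName root_name) (CName goal_name)].

Lemma goal_tbox_horn : horn goal_tbox.
Proof.
by split=> [C|R C] [x [<-|//]] /=; case=> -[] // [_] //; case.
Qed.

Lemma entails_iff_accepts :
  rCQ_entails ([:: root_name], [::]) ([:: goal_name], [::]) (valid_tbox tree_axioms) goal_tbox <->
  acc (lab last_time 0).
Proof.
split=> [H|Ha].
  apply/negPn/negP => rej; pose A := [:: AConcept root_name [::]].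
  have sat := (tree_axiomsP (counter_model)).2 (tree_spec rej).
  have M1 : model (valid_tbox tree_axioms) A counter_model.
    split; first exact/valid_tbox_sat.
    by move=> x [<-|//].
  have c2 : consistent goal_tbox A.
    by exists (@Interp unit (fun _ _ => True) (fun _ _ _ => True)); split=> [x [<-|//]|x [<-|//]].
  pose q := Query [:: 0] [::] [:: QConcept goal_name 0].
  have Q : is_rCQ q by split=> // y.
  have O : query_over ([:: goal_name], [::]) q by [].
  have sub : {subset [:: [::]] <= ind A} by [].
  have cert : certain_answer goal_tbox A q [:: [::]].
    move=> I [MI1 MI2]; exists (fun _ => indiv I [::]); split=> // t [<-|//] /=.
    apply: (MI1 _ (or_introl erefl)) => /=.
    exact: (MI2 _ (or_introl erefl)).
  have [h [[E] /(_ _ (or_introl erefl))]] :=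
    H A isT (ex_intro _ _ M1) c2 q Q O [:: [::]] erefl sub cert _ M1.
  by rewrite /= E.
move=> A overA [I1 M1] [I2 M2] q [/andP[uq vq] rq] oq a sa ia _ I [MI1 MI2].
have spI := (tree_axiomsP I).1 ((valid_tbox_sat I tree_axioms).1 MI1).
have A0 : A = [::].
  case: A overA MI2 {M1 M2 ia} => [|[B b|R b c] A] //= /andP[oB _] MI2.
  have := MI2 _ (or_introl erefl); rewrite inE in oB; rewrite (eqP oB) /= => HX.
  by case: (root_unsat spI Ha HX).
have a0 : a = [::].
  by case: a sa ia => [|x a] // _ /(_ x); rewrite A0 inE eqxx => /(_ isT).
have av0 : answer_vars q = [::] by move: sa; rewrite a0; case: (answer_vars q).
have qv0 : quant_vars q = [::].
  case E: (quant_vars q) => [|y l] //; have := rq y; rewrite E inE eqxx => /(_ isT)[x [p []]].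
  by rewrite av0.
exists (fun _ => indiv I [::]); rewrite av0 a0; split=> // t Ht.
by have := all_In vq Ht; rewrite av0 qv0; case: t {Ht}.
Qed.
End Automaton.

Section Machine.
Variable M : machine.

(* The state, and the contents of all tapes [j] cells to the right and [j] cells
   to the left of the heads; the first component tells whether [j] is zero. *)
Definition label : finType :=
  (bool * state M * {ffun 'I_(extra_tapes M).+1 -> symbol (work M)}
    * {ffun 'I_(extra_tapes M).+1 -> symbol (work M)})%type.

Definition here (a : label) := a.1.1.1.
Definition lstate (a : label) := a.1.1.2.
Definition right_of (a : label) := a.1.2.
Definition left_of (a : label) := a.2.

Definition label_at (w : seq bool) (t j : nat) : label :=
  let c := run M w t in
  (j == 0, cstate c, [ffun i => nth None (tape_right (ctape c i)) j],
   [ffun i => nth None (tape_left (ctape c i)) j]).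

Definition next (a0 a b c : label) : label :=
  if halting (lstate a0) then b else
  let r := delta (lstate a0) (right_of a0) in
  (here b, r.1,
   [ffun i => match (r.2 i).2 with
              | MoveLeft => if here b then left_of a0 i else
                            if here a then (r.2 i).1 else right_of a i
              | MoveStay => if here b then (r.2 i).1 else right_of b i
              | MoveRight => right_of c i
              end],
   [ffun i => match (r.2 i).2 with
              | MoveLeft => left_of c i
              | MoveStay => left_of b i
              | MoveRight => if here b then (r.2 i).1 else left_of a i
              end]).

Definition initial (o : option bool) (z : bool) : label :=
  (z, start M, [ffun i => if i == ord0 then omap inl o else None], [ffun=> None]).

Lemma label_at0 w j : label_at w 0 j = initial (letter_at w j) (j == 0).
Proof.
rewrite /label_at /initial /run /= /letter_at; congr (_, _, _, _); apply/ffunP => i; rewrite !ffunE.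
  case: (i == ord0); last by rewrite nth_nil.
  case: (ltnP j (size w)) => jw; first by rewrite !(nth_map false).
  by rewrite !nth_default ?size_map.
by rewrite nth_nil.
Qed.

Lemma label_atS w t j : label_at w t.+1 j =
  next (label_at w t 0) (label_at w t j.-1) (label_at w t j) (label_at w t j.+1).
Proof.
have E : run M w t.+1 = step (run M w t) by rewrite /run iterS.
rewrite /label_at E; set c := run M w t; rewrite /next /lstate /= /step.
case: ifP => // _.
have -> : [ffun i => scan (ctape c i)] = right_of (label_at w t 0).
  by apply/ffunP => i; rewrite !ffunE.
set r := delta _ _; congr (_, _, _, _); apply/ffunP => i; rewrite !ffunE /here /right_of /left_of /=;
  case: (r.2 i) => s []; rewrite /= ?ffunE.
- by case: j => [|[|j]] //=; rewrite ?nth0 ?nth_behead.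
- by case: j => [|j] //=; rewrite nth_behead.
- by rewrite nth_behead.
- by rewrite nth_behead.
- by [].
- by case: j.
Qed.

Lemma run_halted w t t' : halting (cstate (run M w t)) -> t <= t' -> run M w t' = run M w t.
Proof.
move=> H; elim: t' => [|t' IH]; first by rewrite leqn0 => /eqP ->.
rewrite leq_eqVlt => /orP[/eqP -> //|/IH E].
by rewrite {1}/run iterS -/(run M w t') E /step H.
Qed.
End Machine.

Theorem entailment_ExpTime_hard : ExpTime_hard (fun w : seq bool =>
    exists (T1 T2 : tbox) (S1 S2 : signature),
      [/\ w = enc_instance T1 T2 S1 S2, horn T2 & rCQ_entails S1 S2 T1 T2]).
Proof.
move=> L' [M [k D]].
pose acc (a : label M) := accepting (lstate a).
pose axioms w := tree_axioms (@next M) (@initial M) acc w (size w ^ k + k.+1).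
exists (fun w => enc_instance (valid_tbox (axioms w)) goal_tbox
    ([:: root_name], [::]) ([:: goal_name], [::])).
  exact: (instance_polytime k _ _ _ (closed_tree_items (@next M) (@initial M) acc)).
move=> w; have := D w; set t := 2 ^ _; move=> [h a].
set m := size w ^ k + k.+1.
have E : run M w (last_time m) = run M w t.
  apply: run_halted => //; rewrite /last_time /t /m addnS expnS.
  have : 0 < 2 ^ (size w ^ k + k) by rewrite expn_gt0.
  by lia.
have {a} a : L' w <-> acc (label_at M w (last_time m) 0) by rewrite /acc /lstate /= E; apply: iff_sym.
have R := entails_iff_accepts acc m (label_at0 M w) (label_atS M w).
rewrite a -R; split=> [H|[T1 [T2 [S1 [S2 [/enc_instance_inj[<- <- <- <-] _ H]]]]]] //.
by exists (valid_tbox (axioms w)), goal_tbox, ([:: root_name], [::]), ([:: goal_name], [::]);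
  split=> //; exact: goal_tbox_horn.
Qed.

Theorem theorem11 :
  ExpTime_complete (fun w : seq bool =>
    exists (T1 T2 : tbox) (S1 S2 : signature),
      [/\ w = enc_instance T1 T2 S1 S2, horn T2 & rCQ_entails S1 S2 T1 T2]).
Proof. by split; [exact: entailment_in_ExpTime | exact: entailment_ExpTime_hard]. Qed.
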